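(* Let $T$ be a vertical double monad on a monoidal double category $\mathbb D$ and assume that the vertical transformations $\alpha,\lambda,\rho$ of $\mathbb D$ and $\mu,\eta$ of $T$ are invertible and liftable. A liftable left vertical strength $t$ on $T$ that is invertible as a vertical transformation induces a horizontal extension of the canonical action of $\mathbb D$ on itself (for the horizontal double monad $\hat T$), where the action is the horizontal action obtained by companion-lifting $(\triangleright,\tilde\alpha,\tilde\lambda,\tilde p,\tilde l,\tilde m)$ with $f\triangleright g^K=[f\otimes g\,|\,\hat t_{A',B'}]$, $\sigma\triangleright\delta^K=[\sigma\otimes\delta\,|\,\hat t^{v,v'}]$, $\tilde\alpha_{f,g,h^K}=[\alpha_{f,g,h}|y^*_{A',B',C'}]$, $\tilde\lambda_{h^K}=[\lambda_h|x^*_{A'}]$, $\tilde p=K(p),\tilde l=K(l),\tilde m=K(m)$, and the icon $\theta:-\triangleright K(-)\Rightarrow K(-\otimes-)$ is given by $\theta_{f,g}=[\mathrm{Id}_{f\otimes g}\,|\,\hat z_{A',B'}]$ for 1h-cells $f:A\to A',g:B\to B'$ and $\theta^{u,v}=\mathrm{Id}$ for 1v-cells $u,v$.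
   Context: Double categories are strict: objects, 1h-cells (horizontal), 1v-cells (vertical), squares (2-cells). $[a|b|\cdots]$: horizontal composition (left to right), also for 1h-cells; $a/b$: vertical composition ($a$ on top), also for 1v-cells and transformations. Pseudodouble functors preserve vertical structure strictly and horizontal composition up to coherent natural invertible compositors/unitors. A horizontal pseudonatural transformation $\alpha:F\Rightarrow G$ has 1h-components $\alpha(A)$, squares $\alpha^u$ (top $\alpha(A)$, bottom $\alpha(\tilde A)$, left $F(u)$, right $G(u)$) and invertible horizontally globular 2-cells $\alpha_f:\alpha(B)F(f)\Rightarrow G(f)\alpha(A)$, coherent and natural; horizontal equivalence: components are equivalences; a horizontal icon is a horizontal transformation with identity 1h-components. Horizontal modification: horizontally globular 2-cells compatible with structure cells. A vertical strict transformation has 1v-components natural in 1v-cells and squares $\alpha_f$ (top $F(f)$, bottom $G(f)$) compatible with compositors, unitors, 2-cells; invertible if all $\alpha_f$ are vertically invertible. Companion of $u:A\to B$ (vertical): 1h-cell $\hat u:A\to B$ with 2-cells $\varepsilon_u$ (top $\hat u$, left $u$, other sides identities), $\iota_u$ (bottom $\hat u$, right $u$, other sides identities), $[\iota_u|\varepsilon_u]=\mathrm{Id}$, $\iota_u/\varepsilon_u=\mathrm{Id}$. Liftable: all 1v-components have companions. Companion-lift $\hat\alpha$ of an invertible liftable vertical strict $\alpha$: horizontal equivalence with components $\hat\alpha(A)$, $[\iota_{\alpha(A)}|\alpha_f|\varepsilon_{\alpha(B)}]$, $\hat\alpha^u=[\mathrm{Id}^{F(u)}/\iota_{\alpha(\tilde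 A)}|\varepsilon_{\alpha(A)}/\mathrm{Id}^{G(u)}]$. An equality $u=v$ of 1v-composites, viewed as a vertically globular 2-cell from $u$ to $v$, lifts to $[\iota_u|\mathrm{Id}|\varepsilon_v]:\hat v\Rightarrow\hat u$; an equality $u/v=v'/u'$ lifts to the square $[\mathrm{Id}^u/\iota_v|\varepsilon_{v'}/\mathrm{Id}^{u'}]$ with top $\hat v'$, bottom $\hat v$, left $u$, right $u'$. Monoidal double category: pseudodouble functors $\otimes,I$ and invertible vertical strict $\alpha:(AB)C\to A(BC)$, $\lambda:IA\to A$, $\rho:AI\to A$ satisfying strictly the pentagon and unit triangles, the identities $p$ ($\alpha_{AB,C,D}/\alpha_{A,B,CD}=\alpha_{A,B,C}D/\alpha_{A,BC,D}/A\alpha_{B,C,D}$), $m$ ($\rho_AB=\alpha_{A,I,B}/A\lambda_B$), $l$ ($\alpha_{I,A,B}/\lambda_{AB}=\lambda_AB$), $r$. When $\alpha,\lambda,\rho$ are liftable, $(\mathbb D,\otimes,\hat\alpha,\hat\lambda,\hat\rho;\hat p,\hat l,\hat m,\hat r)$ is horizontally monoidal (horizontal equivalences and horizontal modifications satisfying the monoidal bicategory axioms). Vertical double monad: pseudodouble functor $T$ with vertical strict $\mu:TT\Rightarrow T$, $\eta:\mathrm{Id}\Rightarrow T$ satisfying the monad laws strictly; $\hat T=(T,\hat\mu,\hat\eta)$ is then a horizontal double monad (monad laws up to coherent invertible horizontal modifications). Left vertical strength: vertical strict $t_{A,B}:A\otimes T(B)\to T(A\otimes B)$ with $x:\lambda_{T(A)}=t_{I,A}/T\lambda_A$;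 $y:\alpha_{A,B,T(C)}/(At_{B,C})/t_{A,BC}=t_{AB,C}/T(\alpha_{A,B,C})$; $w:(A\mu_B)/t_{A,B}=t_{A,T(B)}/T(t_{A,B})/\mu_{AB}$; $z:\eta_{AB}=(A\eta_B)/t_{A,B}$. $y^*$ has top $\hat t_{AB,C}$, bottom $[A\hat t_{B,C}|\hat t_{A,BC}]$, left $\alpha_{A,B,T(C)}$, right $T(\alpha_{A,B,C})$; $x^*_A$ has top $\hat t_{I,A}$, bottom identity, left $\lambda_{T(A)}$, right $T(\lambda_A)$; $\hat z_{A,B}:[A\hat\eta_B|\hat t_{A,B}]\Rightarrow\hat\eta_{AB}$. Kleisli pseudodouble category $\mathbb{K}l(S)$ of a horizontal double monad $(S,\mu,\eta)$: objects and 1v-cells of $\mathbb D$; 1h-cells $f^K:A\to B$ are 1h-cells $f:A\to S(B)$; 2-cells with right side $v$ are 2-cells of $\mathbb D$ with right side $S(v)$; horizontal composition $[f|S(g)|\mu_C]$, $[\phi|S(\psi)|\mu^w]$; identities $\eta_A,\eta^u$. $K:\mathbb D\to\mathbb{K}l(S)$: identity on objects and 1v-cells, $K(f)=[f|\eta_B]$, $K(\phi)=[\phi|\eta^v]$. Horizontal action of a horizontally monoidal $\mathbb D$ on $\mathbb E$: pseudodouble functor $\triangleright:\mathbb D\times\mathbb E\to\mathbb E$, horizontal equivalences $\tilde\lambda_E:I\triangleright E\to E$, $\tilde\alpha_{A,B,E}:(A\otimes B)\triangleright E\to A\triangleright(B\triangleright E)$, horizontal modifications $\tilde p,\tilde l,\tilde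 m$ satisfying the analogues of the tricategory axioms (TA1), (TA2) of Gordon–Power–Street. Horizontal extension of the canonical action of a horizontally monoidal $(\mathbb D,\otimes,\alpha,\lambda,\rho;p,l,m)$ on itself, for a horizontal double monad $S$: a pair $(\triangleright,\theta)$ of a horizontal action $\triangleright:\mathbb D\times\mathbb{K}l(S)\to\mathbb{K}l(S)$ (structure $\tilde\alpha,\tilde\lambda,\tilde p,\tilde m,\tilde l$) and a horizontal icon $\theta:-\triangleright K(-)\Rightarrow K(-\otimes-)$ such that $K(\lambda_A)=\tilde\lambda_A$, $K(\alpha_{A,B,C})=\tilde\alpha_{A,B,C}$, $\theta_{1_A,1_B}$ is the unitor of $\triangleright$ at $(A,B)$, and $\theta_{\lambda_A,B}/K(l_{AB})=\tilde l_{AB}$; $[\mathrm{Id}_{K(\alpha_{A,I,B})}|\theta_{A,\lambda_B}]/K(m_{AB})/(\theta_{\rho_A,B})^{-1}=\tilde m_{AB}$; $[\theta_{\alpha_{A,B,C},D}|K(\alpha_{A,BC,D})|\theta_{A,\alpha_{B,C,D}}]/K(p_{ABCD})=\tilde p_{ABCD}$; $[\theta_{1_I,f}|\mathrm{Id}_{K(\lambda_{A'})}]/K(\lambda_f)=\tilde\lambda_{K(f)}$; $[\theta_{fg,h}|\mathrm{Id}_{K(\alpha_{A',B',C'})}]/K(\alpha_{f,g,h})=\tilde\alpha_{f,g,K(h)}/[\mathrm{Id}_{\alpha_{A,B,C}}|f\triangleright\theta_{g,h}]/[\mathrm{Id}_{\alpha_{A,B,C}}|\theta_{f,gh}]$.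 In the theorem this is applied with $\hat T$ and $(\mathbb D,\otimes,\hat\alpha,\hat\lambda,\hat\rho;\hat p,\hat l,\hat m)$.
   Formalization: The formal theorem also assumes that the inverses of the 1v-components of α, λ, ρ have companions; without this the companion-lifts α̂, λ̂, ρ̂ need not be horizontal equivalences, so the claim fails as stated. *)

(* Defs.v *)
From Stdlib Require Import ClassicalEpsilon.

Set Implicit Arguments.
Unset Strict Implicit.
Unset Printing Implicit Defensive.
Set Primitive Projections.

(** * Double categories

    1h-cells and 1v-cells are typed by their end objects.  Squares are "raw":
    they are typed by their four corner objects only (top left, top right,
    bottom left, bottom right) and carry a well-formedness predicate [wf] and
    boundary functions; the squares of the double category are those satisfying
    [wf].  The two compositions are total operations on raw squares about which
    something is assumed only on composable well-formed squares.  Because of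
    this, squares whose boundaries agree only up to a provable equality of
    1-cells can be composed and compared with plain equality, without
    transports.

    [hc f g] is [f | g], i.e. first f and then g; [vc u v] is u/v, u on top. *)

Record dbl_data := DblData {
  ob : Type;
  hor : ob -> ob -> Type;
  ver : ob -> ob -> Type;
  sq : ob -> ob -> ob -> ob -> Type;
  wf : forall A B C D, sq A B C D -> Prop;
  top : forall A B C D, sq A B C D -> hor A B;
  bot : forall A B C D, sq A B C D -> hor C D;
  lft : forall A B C D, sq A B C D -> ver A C;
  rgt : forall A B C D, sq A B C D -> ver B D;
  hid : forall A, hor A A;
  hc : forall A B C, hor A B -> hor B C -> hor A C;
  vid : forall A, ver A A;
  vc : forall A B C, ver A B -> ver B C -> ver A C;
  (* Id_f : from f to f, with identity vertical sides *)
  sid : forall A B, hor A B -> sq A B A B;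
  (* Id^u : from u to u, with identity horizontal sides *)
  sidv : forall A B, ver A B -> sq A A B B;
  sh : forall A B C D E F, sq A B C D -> sq B E D F -> sq A E C F;
  sv : forall A B C D E F, sq A B C D -> sq C D E F -> sq A B E F;
  (* associator [[f|g]|h] => [f|[g|h]] and unitors [1|f] => f, [f|1] => f *)
  asc : forall A B C D, hor A B -> hor B C -> hor C D -> sq A D A D;
  lun : forall A B, hor A B -> sq A B A B;
  run : forall A B, hor A B -> sq A B A B
}.

Arguments hid {d} A.
Arguments vid {d} A.

Declare Scope dbl_scope.
Delimit Scope dbl_scope with dbl.
Notation "f *h g" := (hc f g) (at level 40, left associativity) : dbl_scope.
Notation "u *v v" := (vc u v) (at level 40, left associativity) : dbl_scope.
Notation "a || b" := (sh a b) (at level 50, left associativity) : dbl_scope.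
Notation "a // b" := (sv a b) (at level 55, left associativity) : dbl_scope.
Local Open Scope dbl_scope.

Definition is_sq (X : dbl_data) (A B C D : ob X) (a : sq A B C D)
    (f : hor A B) (g : hor C D) (u : ver A C) (v : ver B D) : Prop :=
  wf a /\ top a = f /\ bot a = g /\ lft a = u /\ rgt a = v.

(* Horizontally globular 2-cell f => g. *)
Definition is_glob (X : dbl_data) (A B : ob X) (a : sq A B A B)
    (f g : hor A B) : Prop :=
  is_sq a f g (vid A) (vid B).

Definition inv_glob (X : dbl_data) (A B : ob X) (a b : sq A B A B)
    (f g : hor A B) : Prop :=
  is_glob a f g /\ is_glob b g f /\ a // b = sid f /\ b // a = sid g.

Definition is_giso (X : dbl_data) (A B : ob X) (a : sq A B A B)
    (f g : hor A B) : Prop :=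
  exists b, inv_glob a b f g.

(* The vertical inverse of an invertible globular 2-cell (junk otherwise). *)
Definition ginv (X : dbl_data) (A B : ob X) (a : sq A B A B) : sq A B A B :=
  epsilon (inhabits a) (fun b => exists f g, inv_glob a b f g).

Definition is_viso (X : dbl_data) (A B C D : ob X) (a : sq A B C D) : Prop :=
  wf a /\ exists b : sq C D A B,
    wf b /\ top b = bot a /\ bot b = top a /\
    a // b = sid (top a) /\ b // a = sid (bot a).

Definition is_hequiv (X : dbl_data) (A B : ob X) (f : hor A B) : Prop :=
  exists (g : hor B A) (a : sq A A A A) (b : sq B B B B),
    is_giso a (f *h g) (hid A) /\ is_giso b (g *h f) (hid B).

(* Pseudodouble categories: strict vertically, weak horizontally. *)
Record is_pseudodouble (X : dbl_data) : Prop := {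
  vc_assoc : forall (A B C D : ob X) (u : ver A B) (v : ver B C) (w : ver C D),
    (u *v v) *v w = u *v (v *v w);
  vc_idl : forall (A B : ob X) (u : ver A B), vid A *v u = u;
  vc_idr : forall (A B : ob X) (u : ver A B), u *v vid B = u;
  sid_ty : forall (A B : ob X) (f : hor A B), is_glob (sid f) f f;
  sidv_ty : forall (A B : ob X) (u : ver A B),
    is_sq (sidv u) (hid A) (hid B) u u;
  sh_ty : forall (A B C D E F : ob X) (a : sq A B C D) (b : sq B E D F)
      f g f' g' u v w,
    is_sq a f g u v -> is_sq b f' g' v w ->
    is_sq (a || b) (f *h f') (g *h g') u w;
  sv_ty : forall (A B C D E F : ob X) (a : sq A B C D) (b : sq C D E F)
      f g h u v u' v',
    is_sq a f g u v -> is_sq b g h u' v' ->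
    is_sq (a // b) f h (u *v u') (v *v v');
  sv_assoc : forall (A B C D E F G H : ob X) (a : sq A B C D) (b : sq C D E F)
      (c : sq E F G H),
    wf a -> wf b -> wf c -> bot a = top b -> bot b = top c ->
    (a // b) // c = a // (b // c);
  sv_idl : forall (A B C D : ob X) (a : sq A B C D),
    wf a -> sid (top a) // a = a;
  sv_idr : forall (A B C D : ob X) (a : sq A B C D),
    wf a -> a // sid (bot a) = a;
  interchange : forall (A B C D E F G H K : ob X)
      (a : sq A B D E) (b : sq B C E F) (c : sq D E G H) (d : sq E F H K),
    wf a -> wf b -> wf c -> wf d -> rgt a = lft b -> rgt c = lft d ->
    bot a = top c -> bot b = top d ->
    (a || b) // (c || d) = (a // c) || (b // d);
  sid_hc : forall (A B C : ob X) (f : hor A B) (g : hor B C),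
    sid (f *h g) = sid f || sid g;
  sidv_vc : forall (A B C : ob X) (u : ver A B) (v : ver B C),
    sidv (u *v v) = sidv u // sidv v;
  sidv_id : forall A : ob X, sidv (vid A) = sid (hid A);
  asc_ty : forall (A B C D : ob X) (f : hor A B) (g : hor B C) (h : hor C D),
    is_giso (asc f g h) ((f *h g) *h h) (f *h (g *h h));
  lun_ty : forall (A B : ob X) (f : hor A B), is_giso (lun f) (hid A *h f) f;
  run_ty : forall (A B : ob X) (f : hor A B), is_giso (run f) (f *h hid B) f;
  asc_nat : forall (A B C D A' B' C' D' : ob X)
      (a : sq A B A' B') (b : sq B C B' C') (c : sq C D C' D'),
    wf a -> wf b -> wf c -> rgt a = lft b -> rgt b = lft c ->
    ((a || b) || c) // asc (bot a) (bot b) (bot c)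
      = asc (top a) (top b) (top c) // (a || (b || c));
  lun_nat : forall (A B A' B' : ob X) (a : sq A B A' B'),
    wf a -> (sidv (lft a) || a) // lun (bot a) = lun (top a) // a;
  run_nat : forall (A B A' B' : ob X) (a : sq A B A' B'),
    wf a -> (a || sidv (rgt a)) // run (bot a) = run (top a) // a;
  pentagon : forall (A B C D E : ob X)
      (f : hor A B) (g : hor B C) (h : hor C D) (k : hor D E),
    asc (f *h g) h k // asc f g (h *h k)
      = (asc f g h || sid k) // asc f (g *h h) k // (sid f || asc g h k);
  triangle : forall (A B C : ob X) (f : hor A B) (g : hor B C),
    asc f (hid B) g // (sid f || lun g) = run f || sid g
}.

Record is_strict (X : dbl_data) : Prop := {
  hc_assoc : forall (A B C D : ob X) (f : hor A B) (g : hor B C) (h : hor C D),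
    (f *h g) *h h = f *h (g *h h);
  hc_idl : forall (A B : ob X) (f : hor A B), hid A *h f = f;
  hc_idr : forall (A B : ob X) (f : hor A B), f *h hid B = f;
  asc_id : forall (A B C D : ob X) (f : hor A B) (g : hor B C) (h : hor C D),
    asc f g h = sid (f *h g *h h);
  lun_id : forall (A B : ob X) (f : hor A B), lun f = sid f;
  run_id : forall (A B : ob X) (f : hor A B), run f = sid f
}.

Record double_category := DoubleCategory {
  dc_data :> dbl_data;
  dc_pseudo : is_pseudodouble dc_data;
  dc_strict : is_strict dc_data
}.

Definition dbl_unit : dbl_data := {|
  ob := unit; hor _ _ := unit; ver _ _ := unit; sq _ _ _ _ := unit;
  wf _ _ _ _ _ := True;
  top _ _ _ _ _ := tt; bot _ _ _ _ _ := tt;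
  lft _ _ _ _ _ := tt; rgt _ _ _ _ _ := tt;
  hid _ := tt; hc _ _ _ _ _ := tt; vid _ := tt; vc _ _ _ _ _ := tt;
  sid _ _ _ := tt; sidv _ _ _ := tt;
  sh _ _ _ _ _ _ _ _ := tt; sv _ _ _ _ _ _ _ _ := tt;
  asc _ _ _ _ _ _ _ := tt; lun _ _ _ := tt; run _ _ _ := tt
|}.

Definition dbl_prod (X Y : dbl_data) : dbl_data := {|
  ob := ob X * ob Y;
  hor A B := (hor (fst A) (fst B) * hor (snd A) (snd B))%type;
  ver A B := (ver (fst A) (fst B) * ver (snd A) (snd B))%type;
  sq A B C D := (sq (fst A) (fst B) (fst C) (fst D)
                 * sq (snd A) (snd B) (snd C) (snd D))%type;
  wf _ _ _ _ a := wf (fst a) /\ wf (snd a);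
  top _ _ _ _ a := (top (fst a), top (snd a));
  bot _ _ _ _ a := (bot (fst a), bot (snd a));
  lft _ _ _ _ a := (lft (fst a), lft (snd a));
  rgt _ _ _ _ a := (rgt (fst a), rgt (snd a));
  hid A := (hid (fst A), hid (snd A));
  hc _ _ _ f g := (fst f *h fst g, snd f *h snd g);
  vid A := (vid (fst A), vid (snd A));
  vc _ _ _ u v := (fst u *v fst v, snd u *v snd v);
  sid _ _ f := (sid (fst f), sid (snd f));
  sidv _ _ u := (sidv (fst u), sidv (snd u));
  sh _ _ _ _ _ _ a b := (fst a || fst b, snd a || snd b);
  sv _ _ _ _ _ _ a b := (fst a // fst b, snd a // snd b);
  asc _ _ _ _ f g h :=
    (asc (fst f) (fst g) (fst h), asc (snd f) (snd g) (snd h));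
  lun _ _ f := (lun (fst f), lun (snd f));
  run _ _ f := (run (fst f), run (snd f))
|}.

(** * Pseudodouble functors, indexed by their action on objects *)

Record functor (X Y : dbl_data) (F : ob X -> ob Y) := Functor {
  fh : forall A B, hor A B -> hor (F A) (F B);
  fv : forall A B, ver A B -> ver (F A) (F B);
  fs : forall A B C D, sq A B C D -> sq (F A) (F B) (F C) (F D);
  (* compositor [F f | F g] => F [f | g] and unitor 1_{F A} => F 1_A *)
  fc : forall A B C, hor A B -> hor B C -> sq (F A) (F C) (F A) (F C);
  fu : forall A, sq (F A) (F A) (F A) (F A)
}.

Record is_functor (X Y : dbl_data) (F0 : ob X -> ob Y) (F : functor F0) : Prop := {
  fv_vid : forall A, fv F (vid A) = vid (F0 A);
  fv_vc : forall A B C (u : ver A B) (v : ver B C),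
    fv F (u *v v) = fv F u *v fv F v;
  fs_ty : forall A B C D (a : sq A B C D) f g u v,
    is_sq a f g u v -> is_sq (fs F a) (fh F f) (fh F g) (fv F u) (fv F v);
  fs_sid : forall A B (f : hor A B), fs F (sid f) = sid (fh F f);
  fs_sv : forall A B C D E G (a : sq A B C D) (b : sq C D E G),
    wf a -> wf b -> bot a = top b -> fs F (a // b) = fs F a // fs F b;
  fc_ty : forall A B C (f : hor A B) (g : hor B C),
    is_giso (fc F f g) (fh F f *h fh F g) (fh F (f *h g));
  fu_ty : forall A, is_giso (fu F A) (hid (F0 A)) (fh F (hid A));
  fc_nat : forall A B C A' B' C' (a : sq A B A' B') (b : sq B C B' C'),
    wf a -> wf b -> rgt a = lft b ->
    (fs F a || fs F b) // fc F (bot a) (bot b)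
      = fc F (top a) (top b) // fs F (a || b);
  fu_nat : forall A B (u : ver A B),
    sidv (fv F u) // fu F B = fu F A // fs F (sidv u);
  fc_asc : forall A B C D (f : hor A B) (g : hor B C) (h : hor C D),
    (fc F f g || sid (fh F h)) // fc F (f *h g) h // fs F (asc f g h)
      = asc (fh F f) (fh F g) (fh F h)
        // (sid (fh F f) || fc F g h) // fc F f (g *h h);
  fc_lun : forall A B (f : hor A B),
    (fu F A || sid (fh F f)) // fc F (hid A) f // fs F (lun f) = lun (fh F f);
  fc_run : forall A B (f : hor A B),
    (sid (fh F f) || fu F B) // fc F f (hid B) // fs F (run f) = run (fh F f)
}.

Definition f_id (X : dbl_data) : functor (fun A : ob X => A) := {|
  fh _ _ f := f; fv _ _ u := u; fs _ _ _ _ a := a;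
  fc _ _ _ f g := sid (f *h g); fu A := sid (hid A)
|}.

(* [f_comp F G] is F followed by G. *)
Definition f_comp (X Y Z : dbl_data) (F0 : ob X -> ob Y) (G0 : ob Y -> ob Z)
    (F : functor F0) (G : functor G0) : functor (fun A => G0 (F0 A)) := {|
  fh _ _ f := fh G (fh F f);
  fv _ _ u := fv G (fv F u);
  fs _ _ _ _ a := fs G (fs F a);
  fc _ _ _ f g := fc G (fh F f) (fh F g) // fs G (fc F f g);
  fu A := fu G (F0 A) // fs G (fu F A)
|}.

Definition f_bang (X : dbl_data) : @functor X dbl_unit (fun _ => tt) :=
  @Functor X dbl_unit (fun _ => tt)
    (fun _ _ _ => tt) (fun _ _ _ => tt) (fun _ _ _ _ _ => tt)
    (fun _ _ _ _ _ => tt) (fun _ => tt).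

Definition f_fst (X Y : dbl_data) : @functor (dbl_prod X Y) X fst :=
  @Functor (dbl_prod X Y) X fst
    (fun _ _ f => fst f) (fun _ _ u => fst u) (fun _ _ _ _ a => fst a)
    (fun _ _ _ f g => sid (fst f *h fst g)) (fun A => sid (hid (fst A))).

Definition f_snd (X Y : dbl_data) : @functor (dbl_prod X Y) Y snd :=
  @Functor (dbl_prod X Y) Y snd
    (fun _ _ f => snd f) (fun _ _ u => snd u) (fun _ _ _ _ a => snd a)
    (fun _ _ _ f g => sid (snd f *h snd g)) (fun A => sid (hid (snd A))).

Definition f_pair (X Y Z : dbl_data) (F0 : ob X -> ob Y) (G0 : ob X -> ob Z)
    (F : functor F0) (G : functor G0)
    : @functor X (dbl_prod Y Z) (fun A => (F0 A, G0 A)) :=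
  @Functor X (dbl_prod Y Z) (fun A => (F0 A, G0 A))
    (fun _ _ f => (fh F f, fh G f)) (fun _ _ u => (fv F u, fv G u))
    (fun _ _ _ _ a => (fs F a, fs G a))
    (fun _ _ _ f g => (fc F f g, fc G f g)) (fun A => (fu F A, fu G A)).

Definition op2 (A B C : Type) (f : A -> B -> C) (p : A * B) : C :=
  f (fst p) (snd p).

(* A ↦ B (a A, b A), for a bifunctor B. *)
Definition f_app2 (W X Y Z : dbl_data) (B0 : ob X -> ob Y -> ob Z)
    (a0 : ob W -> ob X) (b0 : ob W -> ob Y)
    (B : @functor (dbl_prod X Y) Z (op2 B0)) (a : functor a0) (b : functor b0)
    : functor (fun A => B0 (a0 A) (b0 A)) :=
  f_comp (f_pair a b) B.

Section Bifunctor.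
Variables (X Y Z : dbl_data) (B0 : ob X -> ob Y -> ob Z).
Variable B : @functor (dbl_prod X Y) Z (op2 B0).

Definition bh A A' C C' (f : hor A A') (g : hor C C') : hor (B0 A C) (B0 A' C') :=
  @fh _ _ _ B (A, C) (A', C') (f, g).
Definition bv A A' C C' (u : ver A A') (v : ver C C') : ver (B0 A C) (B0 A' C') :=
  @fv _ _ _ B (A, C) (A', C') (u, v).
Definition bs A1 A2 A3 A4 C1 C2 C3 C4 (a : sq A1 A2 A3 A4) (c : sq C1 C2 C3 C4)
    : sq (B0 A1 C1) (B0 A2 C2) (B0 A3 C3) (B0 A4 C4) :=
  @fs _ _ _ B (A1, C1) (A2, C2) (A3, C3) (A4, C4) (a, c).
(* [B(f,g) | B(f',g')] => B([f|f'],[g|g']) *)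
Definition bc A A' A'' C C' C'' (f : hor A A') (g : hor C C')
    (f' : hor A' A'') (g' : hor C' C'')
    : sq (B0 A C) (B0 A'' C'') (B0 A C) (B0 A'' C'') :=
  @fc _ _ _ B (A, C) (A', C') (A'', C'') (f, g) (f', g').
Definition bu A C : sq (B0 A C) (B0 A C) (B0 A C) (B0 A C) := fu B (A, C).
End Bifunctor.

(** * Horizontal pseudonatural transformations, icons, modifications *)

Record htrans (X Y : dbl_data) (F0 G0 : ob X -> ob Y) := HTrans {
  ht1 : forall A, hor (F0 A) (G0 A);
  (* α^u : top α(A), bottom α(A'), left F u, right G u *)
  htv : forall A A', ver A A' -> sq (F0 A) (G0 A) (F0 A') (G0 A');
  (* α_f : [F f | α(B)] => [α(A) | G f] *)
  hth : forall A B, hor A B -> sq (F0 A) (G0 B) (F0 A) (G0 B)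
}.

Record is_htrans (X Y : dbl_data) (F0 G0 : ob X -> ob Y) (F : functor F0)
    (G : functor G0) (a : htrans F0 G0) : Prop := {
  htv_ty : forall A A' (u : ver A A'),
    is_sq (htv a u) (ht1 a A) (ht1 a A') (fv F u) (fv G u);
  hth_ty : forall A B (f : hor A B),
    is_giso (hth a f) (fh F f *h ht1 a B) (ht1 a A *h fh G f);
  htv_vid : forall A, htv a (vid A) = sid (ht1 a A);
  htv_vc : forall A B C (u : ver A B) (v : ver B C),
    htv a (u *v v) = htv a u // htv a v;
  hth_nat : forall A B A' B' (s : sq A B A' B'), wf s ->
    (fs F s || htv a (rgt s)) // hth a (bot s)
      = hth a (top s) // (htv a (lft s) || fs G s);
  hth_hc : forall A B C (f : hor A B) (g : hor B C),
    (fc F f g || sid (ht1 a C)) // hth a (f *h g)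
      = asc (fh F f) (fh F g) (ht1 a C)
        // (sid (fh F f) || hth a g)
        // ginv (asc (fh F f) (ht1 a B) (fh G g))
        // (hth a f || sid (fh G g))
        // asc (ht1 a A) (fh G f) (fh G g)
        // (sid (ht1 a A) || fc G f g);
  hth_hid : forall A,
    (fu F A || sid (ht1 a A)) // hth a (hid A)
      = lun (ht1 a A) // ginv (run (ht1 a A)) // (sid (ht1 a A) || fu G A)
}.

Definition is_htrans_equiv (X Y : dbl_data) (F0 G0 : ob X -> ob Y)
    (F : functor F0) (G : functor G0) (a : htrans F0 G0) : Prop :=
  is_htrans F G a /\ forall A, is_hequiv (ht1 a A).

Definition ht_id (X Y : dbl_data) (F0 : ob X -> ob Y) (F : functor F0)
    : htrans F0 F0 := {|
  ht1 A := hid (F0 A);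
  htv _ _ u := sidv (fv F u);
  hth _ _ f := run (fh F f) // ginv (lun (fh F f))
|}.

(* Composite F => G => K. *)
Definition ht_comp (X Y : dbl_data) (F0 G0 K0 : ob X -> ob Y) (F : functor F0)
    (G : functor G0) (K : functor K0) (a : htrans F0 G0) (b : htrans G0 K0)
    : htrans F0 K0 := {|
  ht1 A := ht1 a A *h ht1 b A;
  htv _ _ u := htv a u || htv b u;
  hth A B f :=
    ginv (asc (fh F f) (ht1 a B) (ht1 b B))
    // (hth a f || sid (ht1 b B))
    // asc (ht1 a A) (fh G f) (ht1 b B)
    // (sid (ht1 a A) || hth b f)
    // ginv (asc (ht1 a A) (ht1 b A) (fh K f))
|}.

(* α_{H(-)} *)
Definition ht_pre (W X Y : dbl_data) (H0 : ob W -> ob X) (F0 G0 : ob X -> ob Y)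
    (H : functor H0) (a : htrans F0 G0)
    : htrans (fun A => F0 (H0 A)) (fun A => G0 (H0 A)) := {|
  ht1 A := ht1 a (H0 A);
  htv _ _ u := htv a (fv H u);
  hth _ _ f := hth a (fh H f)
|}.

(* K(α), for α : F => G *)
Definition ht_post (X Y Z : dbl_data) (F0 G0 : ob X -> ob Y) (K0 : ob Y -> ob Z)
    (K : functor K0) (F : functor F0) (G : functor G0) (a : htrans F0 G0)
    : htrans (fun A => K0 (F0 A)) (fun A => K0 (G0 A)) := {|
  ht1 A := fh K (ht1 a A);
  htv _ _ u := fs K (htv a u);
  hth A B f := fc K (fh F f) (ht1 a B) // fs K (hth a f)
               // ginv (fc K (ht1 a A) (fh G f))
|}.

Definition ht_pair (X Y Z : dbl_data) (F0 G0 : ob X -> ob Y)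
    (F0' G0' : ob X -> ob Z) (a : htrans F0 G0) (b : htrans F0' G0')
    : @htrans X (dbl_prod Y Z) (fun A => (F0 A, F0' A)) (fun A => (G0 A, G0' A)) :=
  @HTrans X (dbl_prod Y Z) (fun A => (F0 A, F0' A)) (fun A => (G0 A, G0' A))
    (fun A => (ht1 a A, ht1 b A))
    (fun _ _ u => (htv a u, htv b u))
    (fun _ _ f => (hth a f, hth b f)).

(* A horizontal icon: a horizontal transformation with identity 1h-components,
   presented by globular cells θ_f : F f => G f instead of
   [F f | 1] => [1 | G f]. *)
Record icon (X Y : dbl_data) (F0 : ob X -> ob Y) := Icon {
  icv : forall A A', ver A A' -> sq (F0 A) (F0 A) (F0 A') (F0 A');
  ich : forall A B, hor A B -> sq (F0 A) (F0 B) (F0 A) (F0 B)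
}.

Definition htrans_of_icon (X Y : dbl_data) (F0 : ob X -> ob Y)
    (F G : functor F0) (t : icon F0) : htrans F0 F0 := {|
  ht1 A := hid (F0 A);
  htv _ _ u := icv t u;
  hth _ _ f := run (fh F f) // ich t f // ginv (lun (fh G f))
|}.

Record is_icon (X Y : dbl_data) (F0 : ob X -> ob Y) (F G : functor F0)
    (t : icon F0) : Prop := {
  ich_ty : forall A B (f : hor A B), is_giso (ich t f) (fh F f) (fh G f);
  icon_htrans : is_htrans F G (htrans_of_icon F G t)
}.

(* Invertible horizontal modification between α, β : F => G. *)
Record is_imod (X Y : dbl_data) (F0 G0 : ob X -> ob Y) (F : functor F0)
    (G : functor G0) (a b : htrans F0 G0)
    (m : forall A, sq (F0 A) (G0 A) (F0 A) (G0 A)) : Prop := {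
  mod_ty : forall A, is_giso (m A) (ht1 a A) (ht1 b A);
  mod_h : forall A B (f : hor A B),
    (sid (fh F f) || m B) // hth b f = hth a f // (m A || sid (fh G f));
  mod_v : forall A A' (u : ver A A'), htv a u // m A' = m A // htv b u
}.

(** * Vertical strict transformations *)

Record vtrans (X Y : dbl_data) (F0 G0 : ob X -> ob Y) := VTrans {
  vt1 : forall A, ver (F0 A) (G0 A);
  (* top F f, bottom G f, left α(A), right α(B) *)
  vts : forall A B, hor A B -> sq (F0 A) (F0 B) (G0 A) (G0 B)
}.

Record is_vtrans (X Y : dbl_data) (F0 G0 : ob X -> ob Y) (F : functor F0)
    (G : functor G0) (a : vtrans F0 G0) : Prop := {
  vt1_nat : forall A B (u : ver A B), fv F u *v vt1 a B = vt1 a A *v fv G u;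
  vts_ty : forall A B (f : hor A B),
    is_sq (vts a f) (fh F f) (fh G f) (vt1 a A) (vt1 a B);
  vts_nat : forall A B A' B' (s : sq A B A' B'), wf s ->
    fs F s // vts a (bot s) = vts a (top s) // fs G s;
  vts_hc : forall A B C (f : hor A B) (g : hor B C),
    fc F f g // vts a (f *h g) = (vts a f || vts a g) // fc G f g;
  vts_hid : forall A,
    fu F A // vts a (hid A) = sidv (vt1 a A) // fu G A
}.

Definition invertible (X Y : dbl_data) (F0 G0 : ob X -> ob Y)
    (a : vtrans F0 G0) : Prop :=
  forall A B (f : hor A B), is_viso (vts a f).

(** * Companions and companion-lifts *)

(* ε_u : top û, left u;  ι_u : bottom û, right u;  other sides identities. *)
Record companion (X : dbl_data) (A B : ob X) (u : ver A B) := Companion {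
  ch : hor A B;
  ceps : sq A B B B;
  ciot : sq A A A B
}.

(* The unitors in the first identity only matter when X is weak. *)
Record is_companion (X : dbl_data) (A B : ob X) (u : ver A B)
    (c : companion u) : Prop := {
  ceps_ty : is_sq (ceps c) (ch c) (hid B) u (vid B);
  ciot_ty : is_sq (ciot c) (hid A) (ch c) (vid A) u;
  ciot_ceps_h : ciot c || ceps c = lun (ch c) // ginv (run (ch c));
  ciot_ceps_v : ciot c // ceps c = sidv u
}.

Record liftable (X Y : dbl_data) (F0 G0 : ob X -> ob Y) (a : vtrans F0 G0) := {
  lift_comp :> forall A, companion (vt1 a A);
  lift_ok : forall A, is_companion (lift_comp A)
}.

(* The 1v-components are invertible and their inverses have companions.  For an
   invertible u with companion û, this says exactly that û is an equivalence;
   it does not follow from u being invertible and û existing. *)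
Definition inverse_liftable (X Y : dbl_data) (F0 G0 : ob X -> ob Y)
    (a : vtrans F0 G0) : Prop :=
  forall A, exists (w : ver (G0 A) (F0 A)) (c : companion w),
    vt1 a A *v w = vid (F0 A) /\ w *v vt1 a A = vid (G0 A) /\ is_companion c.

Definition c_id (X : dbl_data) (A : ob X) : companion (vid A) :=
  @Companion X A A (vid A) (hid A) (sid (hid A)) (sid (hid A)).

Definition c_comp (X : dbl_data) (A B C : ob X) (u : ver A B) (v : ver B C)
    (c : companion u) (d : companion v) : companion (u *v v) :=
  @Companion X A C (u *v v) (ch c *h ch d)
    ((ceps c || sid (ch d)) // lun (ch d) // ceps d)
    (ciot c // ginv (run (ch c)) // (sid (ch c) || ciot d)).

Definition c_fun (X Y : dbl_data) (F0 : ob X -> ob Y) (F : functor F0)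
    (A B : ob X) (u : ver A B) (c : companion u) : companion (fv F u) :=
  @Companion Y (F0 A) (F0 B) (fv F u) (fh F (ch c))
    (fs F (ceps c) // ginv (fu F B)) (fu F A // fs F (ciot c)).

Definition c_bifun (X Y Z : dbl_data) (B0 : ob X -> ob Y -> ob Z)
    (B : @functor (dbl_prod X Y) Z (op2 B0)) (A A' : ob X) (C C' : ob Y)
    (u : ver A A') (v : ver C C') (c : companion u) (d : companion v)
    : companion (bv B u v) :=
  @c_fun (dbl_prod X Y) Z (op2 B0) B (A, C) (A', C') (u, v)
    (@Companion (dbl_prod X Y) (A, C) (A', C') (u, v)
      (ch c, ch d) (ceps c, ceps d) (ciot c, ciot d)).

(* Lift of an equality u = v: [ι_u | Id | ε_v] : v^ => u^. *)
Definition lift_eq (X : dbl_data) (A B : ob X) (u v : ver A B)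
    (cu : companion u) (cv : companion v) : sq A B A B :=
  ginv (lun (ch cv)) // (ciot cu || ceps cv) // run (ch cu).

(* Lift of an equality u/v = v'/u': [Id^u/ι_v | ε_{v'}/Id^{u'}]. *)
Definition lift_sq (X : dbl_data) (A B C D : ob X) (u : ver A C) (v : ver C D)
    (v' : ver A B) (u' : ver B D) (cv : companion v) (cv' : companion v')
    : sq A B C D :=
  ginv (lun (ch cv'))
  // ((sidv u // ciot cv) || (ceps cv' // sidv u'))
  // run (ch cv).

Definition lift (X Y : dbl_data) (F0 G0 : ob X -> ob Y) (F : functor F0)
    (G : functor G0) (a : vtrans F0 G0) (c : forall A, companion (vt1 a A))
    : htrans F0 G0 := {|
  ht1 A := ch (c A);
  htv A A' u := lift_sq (fv F u) (fv G u) (c A') (c A);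
  hth A B f :=
    ginv (lun (fh F f *h ch (c B)))
    // (ciot (c A) || (vts a f || ceps (c B)))
    // (sid (ch (c A)) || run (fh G f))
|}.

(** * Monoidal double categories *)

Section Triple.
(* The functors ((A,B),C) ↦ (A⊗B)⊳C and A⊳(B⊳C) for an action-like bifunctor. *)
Variables (X E : dbl_data) (tenO : ob X -> ob X -> ob X) (triO : ob X -> ob E -> ob E).
Variables (ten : @functor (dbl_prod X X) X (op2 tenO))
          (tri : @functor (dbl_prod X E) E (op2 triO)).

Definition pr1 := f_comp (f_fst (dbl_prod X X) E) (f_fst X X).
Definition pr2 := f_comp (f_fst (dbl_prod X X) E) (f_snd X X).
Definition pr3 := f_snd (dbl_prod X X) E.
Definition triple_l := f_app2 tri (f_app2 ten pr1 pr2) pr3.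
Definition triple_r := f_app2 tri pr1 (f_app2 tri pr2 pr3).
Definition al_src (p : ob X * ob X * ob E) : ob E :=
  triO (tenO (fst (fst p)) (snd (fst p))) (snd p).
Definition al_tgt (p : ob X * ob X * ob E) : ob E :=
  triO (fst (fst p)) (triO (snd (fst p)) (snd p)).
End Triple.

Section UnitFunctors.
Variables (X : dbl_data) (I0 : ob X) (un : @functor dbl_unit X (fun _ => I0)).
Definition f_unit (W : dbl_data) : @functor W X (fun _ => I0) :=
  f_comp (f_bang W) un.
(* The 1h-cell I(1), isomorphic to 1_I through the unitor. *)
Definition unit_h : hor I0 I0 := @fh _ _ _ un tt tt tt.
End UnitFunctors.

Record monoidal_data (X : dbl_data) := {
  tenO : ob X -> ob X -> ob X;
  ten : @functor (dbl_prod X X) X (op2 tenO);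
  I0 : ob X;
  un : @functor dbl_unit X (fun _ => I0);
  al : @vtrans (dbl_prod (dbl_prod X X) X) X (al_src tenO tenO) (al_tgt tenO);
  la : @vtrans X X (fun A => tenO I0 A) (fun A => A);
  rh : @vtrans X X (fun A => tenO A I0) (fun A => A)
}.

Section MonoidalNotations.
Variables (X : dbl_data) (M : monoidal_data X).
Definition ten_o (A B : ob X) : ob X := tenO M A B.
Definition al1 (A B C : ob X) : ver (ten_o (ten_o A B) C) (ten_o A (ten_o B C)) :=
  vt1 (al M) (A, B, C).
Definition als A A' B B' C C' (f : hor A A') (g : hor B B') (h : hor C C')
    : sq (ten_o (ten_o A B) C) (ten_o (ten_o A' B') C')
         (ten_o A (ten_o B C)) (ten_o A' (ten_o B' C')) :=
  @vts _ _ _ _ (al M) (A, B, C) (A', B', C') (f, g, h).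
End MonoidalNotations.

(* p, m, l, r are equalities of vertical transformations: each is stated on
   1v-components and on 2-cell components. *)
Record is_monoidal (X : dbl_data) (M : monoidal_data X) : Prop := {
  ten_functor : is_functor (ten M);
  un_functor : is_functor (un M);
  al_vtrans : is_vtrans (triple_l (ten M) (ten M)) (triple_r (ten M)) (al M);
  la_vtrans : is_vtrans (f_app2 (ten M) (f_unit (un M) X) (f_id X)) (f_id X) (la M);
  rh_vtrans : is_vtrans (f_app2 (ten M) (f_id X) (f_unit (un M) X)) (f_id X) (rh M);
  al_inv : invertible (al M);
  la_inv : invertible (la M);
  rh_inv : invertible (rh M);
  mon_p : forall A B C D,
    al1 M (ten_o M A B) C D *v al1 M A B (ten_o M C D)
      = bv (ten M) (al1 M A B C) (vid D) *v al1 M A (ten_o M B C) D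
        *v bv (ten M) (vid A) (al1 M B C D);
  mon_ps : forall A A' B B' C C' D D'
      (f : hor A A') (g : hor B B') (h : hor C C') (k : hor D D'),
    als M (bh (ten M) f g) h k // als M f g (bh (ten M) h k)
      = bs (ten M) (als M f g h) (sid k) // als M f (bh (ten M) g h) k
        // bs (ten M) (sid f) (als M g h k);
  mon_m : forall A B,
    bv (ten M) (vt1 (rh M) A) (vid B)
      = al1 M A (I0 M) B *v bv (ten M) (vid A) (vt1 (la M) B);
  mon_ms : forall A A' B B' (f : hor A A') (g : hor B B'),
    bs (ten M) (vts (rh M) f) (sid g)
      = als M f (unit_h (un M)) g // bs (ten M) (sid f) (vts (la M) g);
  mon_l : forall A B,
    al1 M (I0 M) A B *v vt1 (la M) (ten_o M A B)
      = bv (ten M) (vt1 (la M) A) (vid B);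
  mon_ls : forall A A' B B' (f : hor A A') (g : hor B B'),
    als M (unit_h (un M)) f g // vts (la M) (bh (ten M) f g)
      = bs (ten M) (vts (la M) f) (sid g);
  mon_r : forall A B,
    al1 M A B (I0 M) *v bv (ten M) (vid A) (vt1 (rh M) B)
      = vt1 (rh M) (ten_o M A B);
  mon_rs : forall A A' B B' (f : hor A A') (g : hor B B'),
    als M f g (unit_h (un M)) // bs (ten M) (sid f) (vts (rh M) g)
      = vts (rh M) (bh (ten M) f g)
}.

Record monoidal_double_category (X : dbl_data) := {
  mdc_data :> monoidal_data X;
  mdc_laws : is_monoidal mdc_data
}.

(** * Vertical double monads and vertical strengths *)

Record vmonad_data (X : dbl_data) := {
  tO : ob X -> ob X;
  tf : functor tO;
  vmu : @vtrans X X (fun A => tO (tO A)) tO;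
  veta : @vtrans X X (fun A => A) tO
}.

Record is_vmonad (X : dbl_data) (T : vmonad_data X) : Prop := {
  tf_functor : is_functor (tf T);
  vmu_vtrans : is_vtrans (f_comp (tf T) (tf T)) (tf T) (vmu T);
  veta_vtrans : is_vtrans (f_id X) (tf T) (veta T);
  vmu_assoc : forall A,
    vt1 (vmu T) (tO T A) *v vt1 (vmu T) A
      = fv (tf T) (vt1 (vmu T) A) *v vt1 (vmu T) A;
  vmu_assoc_s : forall A B (f : hor A B),
    vts (vmu T) (fh (tf T) f) // vts (vmu T) f
      = fs (tf T) (vts (vmu T) f) // vts (vmu T) f;
  vmu_idl : forall A, vt1 (veta T) (tO T A) *v vt1 (vmu T) A = vid (tO T A);
  vmu_idl_s : forall A B (f : hor A B),
    vts (veta T) (fh (tf T) f) // vts (vmu T) f = sid (fh (tf T) f);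
  vmu_idr : forall A, fv (tf T) (vt1 (veta T) A) *v vt1 (vmu T) A = vid (tO T A);
  vmu_idr_s : forall A B (f : hor A B),
    fs (tf T) (vts (veta T) f) // vts (vmu T) f = sid (fh (tf T) f)
}.

Record vertical_double_monad (X : dbl_data) := {
  vdm_data :> vmonad_data X;
  vdm_laws : is_vmonad vdm_data
}.

Section Strength.
Variables (X : dbl_data) (M : monoidal_data X) (T : vmonad_data X).

Definition str_src (p : ob X * ob X) : ob X := tenO M (fst p) (tO T (snd p)).
Definition str_tgt (p : ob X * ob X) : ob X := tO T (tenO M (fst p) (snd p)).
Definition f_str_src :=
  f_app2 (ten M) (f_fst X X) (f_comp (f_snd X X) (tf T)).
Definition f_str_tgt :=
  f_comp (f_app2 (ten M) (f_fst X X) (f_snd X X)) (tf T).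
Definition str_data := @vtrans (dbl_prod X X) X str_src str_tgt.

Definition st1 (t : str_data) (A B : ob X)
    : ver (ten_o M A (tO T B)) (tO T (ten_o M A B)) := vt1 t (A, B).
Definition sts (t : str_data) A A' B B' (f : hor A A') (g : hor B B')
    : sq (ten_o M A (tO T B)) (ten_o M A' (tO T B'))
         (tO T (ten_o M A B)) (tO T (ten_o M A' B')) :=
  @vts _ _ _ _ t (A, B) (A', B') (f, g).

Record is_strength (t : str_data) : Prop := {
  str_vtrans : is_vtrans f_str_src f_str_tgt t;
  str_x : forall A,
    vt1 (la M) (tO T A) = st1 t (I0 M) A *v fv (tf T) (vt1 (la M) A);
  str_xs : forall A A' (f : hor A A'),
    vts (la M) (fh (tf T) f)
      = sts t (unit_h (un M)) f // fs (tf T) (vts (la M) f);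
  str_y : forall A B C,
    al1 M A B (tO T C) *v bv (ten M) (vid A) (st1 t B C) *v st1 t A (ten_o M B C)
      = st1 t (ten_o M A B) C *v fv (tf T) (al1 M A B C);
  str_ys : forall A A' B B' C C' (f : hor A A') (g : hor B B') (h : hor C C'),
    als M f g (fh (tf T) h) // bs (ten M) (sid f) (sts t g h)
      // sts t f (bh (ten M) g h)
      = sts t (bh (ten M) f g) h // fs (tf T) (als M f g h);
  str_w : forall A B,
    bv (ten M) (vid A) (vt1 (vmu T) B) *v st1 t A B
      = st1 t A (tO T B) *v fv (tf T) (st1 t A B) *v vt1 (vmu T) (ten_o M A B);
  str_ws : forall A A' B B' (f : hor A A') (g : hor B B'),
    bs (ten M) (sid f) (vts (vmu T) g) // sts t f g
      = sts t f (fh (tf T) g) // fs (tf T) (sts t f g)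
        // vts (vmu T) (bh (ten M) f g);
  str_z : forall A B,
    vt1 (veta T) (ten_o M A B)
      = bv (ten M) (vid A) (vt1 (veta T) B) *v st1 t A B;
  str_zs : forall A A' B B' (f : hor A A') (g : hor B B'),
    vts (veta T) (bh (ten M) f g)
      = bs (ten M) (sid f) (vts (veta T) g) // sts t f g
}.

Record left_vertical_strength := {
  lvs_data :> str_data;
  lvs_laws : is_strength lvs_data
}.
End Strength.

(** * Horizontal double monads, Kleisli pseudodouble categories

    Here the underlying double category is strict, so that no associators or
    unitors are inserted. *)

Record hmonad_data (X : dbl_data) := {
  hO : ob X -> ob X;
  hf : functor hO;
  hmu : @htrans X X (fun A => hO (hO A)) hO;
  heta : @htrans X X (fun A => A) hO;
  (* [μ_{SA} | μ_A] => [S μ_A | μ_A] *)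
  hass : forall A, sq (hO (hO (hO A))) (hO A) (hO (hO (hO A))) (hO A);
  (* [η_{SA} | μ_A] => 1 *)
  hlu : forall A, sq (hO A) (hO A) (hO A) (hO A);
  (* [S η_A | μ_A] => 1 *)
  hru : forall A, sq (hO A) (hO A) (hO A) (hO A)
}.

Record is_hmonad (X : dbl_data) (S : hmonad_data X) : Prop := {
  hf_functor : is_functor (hf S);
  hmu_htrans : is_htrans (f_comp (hf S) (hf S)) (hf S) (hmu S);
  heta_htrans : is_htrans (f_id X) (hf S) (heta S);
  hass_mod :
    let SS := f_comp (hf S) (hf S) in
    let SSS := f_comp SS (hf S) in
    is_imod SSS (hf S)
      (ht_comp SSS SS (hf S) (ht_pre (hf S) (hmu S)) (hmu S))
      (ht_comp SSS SS (hf S) (ht_post (hf S) SS (hf S) (hmu S)) (hmu S))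
      (hass S);
  hlu_mod :
    let SS := f_comp (hf S) (hf S) in
    is_imod (hf S) (hf S)
      (ht_comp (hf S) SS (hf S) (ht_pre (hf S) (heta S)) (hmu S))
      (ht_id (hf S)) (hlu S);
  hru_mod :
    let SS := f_comp (hf S) (hf S) in
    is_imod (hf S) (hf S)
      (ht_comp (hf S) SS (hf S) (ht_post (hf S) (f_id X) (hf S) (heta S)) (hmu S))
      (ht_id (hf S)) (hru S);
  hmonad_pentagon : forall A,
    let mu := ht1 (hmu S) in
    (hass S (hO S A) || sid (mu A))
    // (sid (fh (hf S) (mu (hO S A))) || hass S A)
    // ((fc (hf S) (mu (hO S A)) (mu A) // fs (hf S) (hass S A)
         // ginv (fc (hf S) (fh (hf S) (mu A)) (mu A))) || sid (mu A))
    = (sid (mu (hO S (hO S A))) || hass S A)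
      // (ginv (hth (hmu S) (mu A)) || sid (mu A))
      // (sid (fh (hf S) (fh (hf S) (mu A))) || hass S A);
  hmonad_triangle : forall A,
    let mu := ht1 (hmu S) in
    let eta := ht1 (heta S) in
    hru S (hO S A) || sid (mu A)
    = (sid (fh (hf S) (eta (hO S A))) || hass S A)
      // ((fc (hf S) (eta (hO S A)) (mu A) // fs (hf S) (hlu S A)
           // ginv (fu (hf S) (hO S A))) || sid (mu A))
}.

Section Kleisli.
Variables (X : dbl_data) (S : hmonad_data X).
Let F := hf S.
Let mu := hmu S.
Let eta := heta S.

(* A 2-cell of Kl(S) is a 2-cell of X together with the 1v-cell v such that its
   right side is S(v): S need not be injective on 1v-cells. *)
Definition kl : dbl_data := {|
  ob := ob X;
  hor A B := hor A (hO S B);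
  ver A B := ver A B;
  sq A B C D := (sq A (hO S B) C (hO S D) * ver B D)%type;
  wf _ _ _ _ a := wf (fst a) /\ rgt (fst a) = fv F (snd a);
  top _ _ _ _ a := top (fst a);
  bot _ _ _ _ a := bot (fst a);
  lft _ _ _ _ a := lft (fst a);
  rgt _ _ _ _ a := snd a;
  hid A := ht1 eta A;
  hc _ _ C f g := f *h fh F g *h ht1 mu C;
  vid A := vid A;
  vc _ _ _ u v := u *v v;
  sid _ B f := (sid f, vid B);
  sidv _ _ u := (htv eta u, u);
  sh _ _ _ _ _ _ a b := (fst a || fs F (fst b) || htv mu (snd b), snd b);
  sv _ _ _ _ _ _ a b := (fst a // fst b, snd a *v snd b);
  asc _ _ _ D f g h :=
    ( (sid f || sid (fh F g) || ginv (hth mu h) || sid (ht1 mu D))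
      // (sid f || sid (fh F g) || sid (fh F (fh F h)) || hass S D)
      // (sid f || fc F g (fh F h) || sid (fh F (ht1 mu D)) || sid (ht1 mu D))
      // (sid f || fc F (g *h fh F h) (ht1 mu D) || sid (ht1 mu D)),
      vid D);
  lun _ B f := ((ginv (hth eta f) || sid (ht1 mu B)) // (sid f || hlu S B), vid B);
  run _ B f := (sid f || hru S B, vid B)
|}.

(* The compositor uses the naturality of η at [g | η_C] and [η_{SC} | μ_C] => 1. *)
Definition kl_K : @functor X kl (fun A => A) :=
  @Functor X kl (fun A => A)
    (fun _ B f => f *h ht1 eta B)
    (fun _ _ u => u)
    (fun _ _ _ _ a => (a || htv eta (rgt a), rgt a))
    (fun _ _ C f g =>
       ((sid f || ginv (hth eta (g *h ht1 eta C)) || sid (ht1 mu C))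
        // (sid f || sid g || sid (ht1 eta C) || hlu S C), vid C))
    (fun A => (sid (ht1 eta A), vid A)).
End Kleisli.

(** * Horizontal actions and horizontally monoidal double categories *)

Record hmonoidal_data (X : dbl_data) := {
  htenO : ob X -> ob X -> ob X;
  hten : @functor (dbl_prod X X) X (op2 htenO);
  hI0 : ob X;
  hun : @functor dbl_unit X (fun _ => hI0);
  hal : @htrans (dbl_prod (dbl_prod X X) X) X (al_src htenO htenO) (al_tgt htenO);
  hla : @htrans X X (fun A => htenO hI0 A) (fun A => A);
  hrh : @htrans X X (fun A => htenO A hI0) (fun A => A);
  (* [α_{A,B,C}D | α_{A,BC,D} | Aα_{B,C,D}] => [α_{AB,C,D} | α_{A,B,CD}] *)
  hp : forall A B C D,
    sq (htenO (htenO (htenO A B) C) D) (htenO A (htenO B (htenO C D)))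
       (htenO (htenO (htenO A B) C) D) (htenO A (htenO B (htenO C D)));
  (* λ_A B => [α_{I,A,B} | λ_{AB}] *)
  hl : forall A B, sq (htenO (htenO hI0 A) B) (htenO A B)
                      (htenO (htenO hI0 A) B) (htenO A B);
  (* [α_{A,I,B} | Aλ_B] => ρ_A B *)
  hm : forall A B, sq (htenO (htenO A hI0) B) (htenO A B)
                      (htenO (htenO A hI0) B) (htenO A B);
  (* ρ_{AB} => [α_{A,B,I} | Aρ_B] *)
  hr : forall A B, sq (htenO (htenO A B) hI0) (htenO A B)
                      (htenO (htenO A B) hI0) (htenO A B)
}.

Record haction_data (X : dbl_data) (M : hmonoidal_data X) (E : dbl_data)
    (triO : ob X -> ob E -> ob E) := {
  tri : @functor (dbl_prod X E) E (op2 triO);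
  ta : @htrans (dbl_prod (dbl_prod X X) E) E (al_src (htenO M) triO) (al_tgt triO);
  tl : @htrans E E (fun C => triO (hI0 M) C) (fun C => C);
  tp : forall A B C G,
    sq (triO (htenO M (htenO M A B) C) G) (triO A (triO B (triO C G)))
       (triO (htenO M (htenO M A B) C) G) (triO A (triO B (triO C G)));
  tll : forall A G, sq (triO (htenO M (hI0 M) A) G) (triO A G)
                       (triO (htenO M (hI0 M) A) G) (triO A G);
  tm : forall A G, sq (triO (htenO M A (hI0 M)) G) (triO A G)
                      (triO (htenO M A (hI0 M)) G) (triO A G)
}.

Definition hal1 (X : dbl_data) (M : hmonoidal_data X) (A B C : ob X)
    : hor (htenO M (htenO M A B) C) (htenO M A (htenO M B C)) :=
  ht1 (hal M) (A, B, C).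
Definition ta1 (X : dbl_data) (M : hmonoidal_data X) (E : dbl_data)
    (triO : ob X -> ob E -> ob E) (T : haction_data M triO) (A B : ob X) (G : ob E)
    : hor (triO (htenO M A B) G) (triO A (triO B G)) :=
  ht1 (ta T) (A, B, G).

Definition self_action (X : dbl_data) (M : hmonoidal_data X)
    : haction_data M (htenO M) := {|
  tri := hten M; ta := hal M; tl := hla M; tp := hp M; tll := hl M; tm := hm M
|}.

(* Rewriting inside right-bracketed composites [x | [y | ... ]]. *)
Section Rewriting.
Variable E : dbl_data.

(* p : [[x|y]|z] => [u|v] *)
Definition rw3 (A B C D U : ob E) (p : sq A D A D)
    (x : hor A B) (y : hor B C) (z : hor C D) (u : hor A U) (v : hor U D)
    : sq A D A D :=
  ginv (asc x y z) // p.
Definition rw3r (A B C D U R : ob E) (p : sq A D A D)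
    (x : hor A B) (y : hor B C) (z : hor C D) (u : hor A U) (v : hor U D)
    (r : hor D R) : sq A R A R :=
  ginv (asc x y (z *h r)) // ginv (asc (x *h y) z r) // (p || sid r) // asc u v r.
(* n : [x|y] => [u|v] *)
Definition rw2r (A B C U R : ob E) (n : sq A C A C)
    (x : hor A B) (y : hor B C) (u : hor A U) (v : hor U C)
    (r : hor C R) : sq A R A R :=
  ginv (asc x y r) // (n || sid r) // asc u v r.
(* m : [x|y] => u *)
Definition rw21r (A B C R : ob E) (m : sq A C A C)
    (x : hor A B) (y : hor B C) (r : hor C R) : sq A R A R :=
  ginv (asc x y r) // (m || sid r).
End Rewriting.

Section Actions.
Variables (X : dbl_data) (M : hmonoidal_data X) (E : dbl_data).
Variables (triO : ob X -> ob E -> ob E) (T : haction_data M triO).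

Local Notation "A ⊗ B" := (htenO M A B) (at level 35).
Local Notation "A ⊳ B" := (triO A B) (at level 37, right associativity).
Local Notation I := (hI0 M).
Local Notation a A B C := (hal1 M A B C).
Local Notation b A B G := (ta1 T A B G).
Local Notation rho A := (ht1 (hrh M) A).
Local Notation lam A := (ht1 (hla M) A).
Local Notation lam' G := (ht1 (tl T) G).

(* x ⊳ 1_G and 1_A ⊳ x *)
Definition actR A A' (x : hor A A') (G : ob E) := bh (tri T) x (hid G).
Definition actL (A : ob X) G G' (x : hor G G') := bh (tri T) (hid A) x.
Definition tenR A A' (x : hor A A') (B : ob X) := bh (hten M) x (hid B).
Definition tenL (A : ob X) B B' (x : hor B B') := bh (hten M) (hid A) x.

(* [x⊳1 | y⊳1] => [x|y]⊳1 and [1⊳x | 1⊳y] => 1⊳[x|y] *)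
Definition cR A A' A'' (x : hor A A') (y : hor A' A'') (G : ob E) :=
  bc (tri T) x (hid G) y (hid G) // bs (tri T) (sid (x *h y)) (lun (hid G)).
Definition cL (A : ob X) G G' G'' (x : hor G G') (y : hor G' G'') :=
  bc (tri T) (hid A) x (hid A) y // bs (tri T) (lun (hid A)) (sid (x *h y)).

(* Images of 2-cells [[x|y]|z] => [u|v], [x|y] => u and y => [u|v]. *)
Definition actR3 A B C D U (s : sq A D A D) (x : hor A B) (y : hor B C)
    (z : hor C D) (u : hor A U) (v : hor U D) (G : ob E) :=
  (cR x y G || sid (actR z G)) // cR (x *h y) z G
  // bs (tri T) s (sid (hid G)) // ginv (cR u v G).
Definition actL3 (A : ob X) G H K L U (s : sq G L G L) (x : hor G H) (y : hor H K)
    (z : hor K L) (u : hor G U) (v : hor U L) :=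
  (cL A x y || sid (actL A z)) // cL A (x *h y) z
  // bs (tri T) (sid (hid A)) s // ginv (cL A u v).
Definition actR2 A B C (s : sq A C A C) (x : hor A B) (y : hor B C) (G : ob E) :=
  cR x y G // bs (tri T) s (sid (hid G)).
Definition actL2 (A : ob X) G H K (s : sq G K G K) (x : hor G H) (y : hor H K) :=
  cL A x y // bs (tri T) (sid (hid A)) s.
Definition actL12 (A : ob X) G H U (s : sq G H G H) (u : hor G U) (v : hor U H) :=
  bs (tri T) (sid (hid A)) s // ginv (cL A u v).
Definition actR12 A B U (s : sq A B A B) (u : hor A U) (v : hor U B) (G : ob E) :=
  bs (tri T) s (sid (hid G)) // ginv (cR u v G).

(* Naturality of α~ in its third, second and first variable:
   [1⊳g | α~] => [α~ | 1⊳(1⊳g)],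
   [(1⊗h)⊳1 | α~] => [α~ | 1⊳(h⊳1)],
   [(h⊗1)⊳1 | α~] => [α~ | h⊳1]. *)
Definition tah A A' B B' G G' (f : hor A A') (g : hor B B') (h : hor G G')
    : sq ((A ⊗ B) ⊳ G) (A' ⊳ (B' ⊳ G')) ((A ⊗ B) ⊳ G) (A' ⊳ (B' ⊳ G')) :=
  @hth _ _ _ _ (ta T) (A, B, G) (A', B', G') (f, g, h).
Definition nat3 (A B : ob X) G G' (g : hor G G') :=
  (bs (tri T) (bu (hten M) A B) (sid g) || sid (b A B G'))
  // tah (hid A) (hid B) g.
Definition nat2 (A : ob X) B B' (h : hor B B') (G : ob E) :=
  tah (hid A) h (hid G).
Definition nat1 A A' (h : hor A A') (B : ob X) (G : ob E) :=
  tah h (hid B) (hid G)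
  // (sid (b A B G) || bs (tri T) (sid h) (ginv (bu (tri T) B G))).

(* (TA1): both sides are 2-cells from
   [(α_{A,B,C}D)G | α_{A,BC,D}G | (Aα_{B,C,D})G
     | α~_{A,B(CD),G} | Aα~_{B,CD,G} | A(Bα~_{C,D,G})]
   to [α~_{(AB)C,D,G} | α~_{AB,C,DG} | α~_{A,B,C(DG)}]. *)
Definition TA1_lhs (A B C D : ob X) (G : ob E) :=
  let f1 := actR (a (A ⊗ B) C D) G in
  let e4 := b A (B ⊗ (C ⊗ D)) G in
  let e5 := actL A (b B (C ⊗ D) G) in
  let e6 := actL A (actL B (b C D G)) in
  rw3r (actR3 (hp M A B C D) (tenR (a A B C) D) (a A (B ⊗ C) D)
          (tenL A (a B C D)) (a (A ⊗ B) C D) (a A B (C ⊗ D)) G)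
    (actR (tenR (a A B C) D) G) (actR (a A (B ⊗ C) D) G)
    (actR (tenL A (a B C D)) G) f1 (actR (a A B (C ⊗ D)) G)
    (e4 *h (e5 *h e6))
  // (sid f1 ||
      rw3r (tp T A B (C ⊗ D) G) (actR (a A B (C ⊗ D)) G) e4 e5
        (b (A ⊗ B) (C ⊗ D) G) (b A B ((C ⊗ D) ⊳ G)) e6)
  // (sid f1 || (sid (b (A ⊗ B) (C ⊗ D) G) || ginv (nat3 A B (b C D G))))
  // rw3r (tp T (A ⊗ B) C D G) f1 (b (A ⊗ B) (C ⊗ D) G)
       (actL (A ⊗ B) (b C D G)) (b ((A ⊗ B) ⊗ C) D G) (b (A ⊗ B) C (D ⊳ G))
       (b A B (C ⊳ (D ⊳ G))).

Definition TA1_rhs (A B C D : ob X) (G : ob E) :=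
  let e1 := actR (tenR (a A B C) D) G in
  let e2 := actR (a A (B ⊗ C) D) G in
  let e5 := actL A (b B (C ⊗ D) G) in
  let e6 := actL A (actL B (b C D G)) in
  let e4' := b A ((B ⊗ C) ⊗ D) G in
  let q1 := actL A (b (B ⊗ C) D G) in
  let q2 := actL A (b B C (D ⊳ G)) in
  let s2 := b A (B ⊗ C) (D ⊳ G) in
  (sid e1 || (sid e2 ||
     rw2r (nat2 A (a B C D) G) (actR (tenL A (a B C D)) G) (b A (B ⊗ (C ⊗ D)) G)
       e4' (actL A (actR (a B C D) G)) (e5 *h e6)))
  // (sid e1 || (sid e2 || (sid e4' ||
       rw3 (actL3 A (tp T B C D G) (actR (a B C D) G) (b B (C ⊗ D) G)
              (actL B (b C D G)) (b (B ⊗ C) D G) (b B C (D ⊳ G)))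
         (actL A (actR (a B C D) G)) e5 e6 q1 q2)))
  // (sid e1 || rw3r (tp T A (B ⊗ C) D G) e2 e4' q1 (b (A ⊗ (B ⊗ C)) D G) s2 q2)
  // rw2r (nat1 (a A B C) D G) e1 (b (A ⊗ (B ⊗ C)) D G)
       (b ((A ⊗ B) ⊗ C) D G) (actR (a A B C) (D ⊳ G)) (s2 *h q2)
  // (sid (b ((A ⊗ B) ⊗ C) D G) ||
      rw3 (tp T A B C (D ⊳ G)) (actR (a A B C) (D ⊳ G)) s2 q2
        (b (A ⊗ B) C (D ⊳ G)) (b A B (C ⊳ (D ⊳ G)))).

(* (TA2): both sides are 2-cells from
   [α_{A,I,B}G | α~_{A,IB,G} | A(λ_B G)] to [α~_{AI,B,G} | ρ_A(BG)]. *)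
Definition TA2_lhs (A B : ob X) (G : ob E) :=
  let a1 := actR (a A I B) G in
  let a2 := b A (I ⊗ B) G in
  let b1 := actL A (b I B G) in
  let b2 := actL A (lam' (B ⊳ G)) in
  (sid a1 || (sid a2 || actL12 A (tll T B G) (b I B G) (lam' (B ⊳ G))))
  // rw3r (tp T A I B G) a1 a2 b1 (b (A ⊗ I) B G) (b A I (B ⊳ G)) b2
  // (sid (b (A ⊗ I) B G) || tm T A (B ⊳ G)).

Definition TA2_rhs (A B : ob X) (G : ob E) :=
  let a1 := actR (a A I B) G in
  let c := actR (tenL A (lam B)) G in
  (sid a1 || ginv (nat2 A (lam B) G))
  // rw21r (actR2 (hm M A B) (a A I B) (tenL A (lam B)) G) a1 c (b A B G)
  // nat1 (rho A) B G.

(* The transformations underlying p~, l~, m~, between functors of a variable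
   ranging over W. *)
Section ActionTransformations.
Variable W : dbl_data.
Local Notation "x ⊗f y" := (f_app2 (hten M) x y) (at level 35).
Local Notation "x ⊳f y" := (f_app2 (tri T) x y) (at level 37, right associativity).
Local Notation If := (f_unit (hun M) W).

Definition t_al x0 y0 z0 (x : @functor W X x0) (y : @functor W X y0)
    (z : @functor W X z0)
    : htrans (fun w => (x0 w ⊗ y0 w) ⊗ z0 w) (fun w => x0 w ⊗ (y0 w ⊗ z0 w)) :=
  ht_pre (f_pair (f_pair x y) z) (hal M).
Definition t_be x0 y0 g0 (x : @functor W X x0) (y : @functor W X y0)
    (g : @functor W E g0)
    : htrans (fun w => (x0 w ⊗ y0 w) ⊳ g0 w) (fun w => x0 w ⊳ (y0 w ⊳ g0 w)) :=
  ht_pre (f_pair (f_pair x y) g) (ta T).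
Definition t_la x0 (x : @functor W X x0)
    : htrans (fun w => I ⊗ x0 w) x0 := ht_pre x (hla M).
Definition t_rh x0 (x : @functor W X x0)
    : htrans (fun w => x0 w ⊗ I) x0 := ht_pre x (hrh M).
Definition t_la' g0 (g : @functor W E g0)
    : htrans (fun w => I ⊳ g0 w) g0 := ht_pre g (tl T).
(* s ⊳ g and x ⊳ s *)
Definition t_actR x0 y0 g0 (x : @functor W X x0) (y : @functor W X y0)
    (s : htrans x0 y0) (g : @functor W E g0)
    : htrans (fun w => x0 w ⊳ g0 w) (fun w => y0 w ⊳ g0 w) :=
  ht_post (tri T) (f_pair x g) (f_pair y g) (ht_pair s (ht_id g)).
Definition t_actL x0 g0 h0 (x : @functor W X x0) (g : @functor W E g0)
    (h : @functor W E h0) (s : htrans g0 h0)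
    : htrans (fun w => x0 w ⊳ g0 w) (fun w => x0 w ⊳ h0 w) :=
  ht_post (tri T) (f_pair x g) (f_pair x h) (ht_pair (ht_id x) s).

Definition p_src x0 y0 z0 g0 (x : @functor W X x0) (y : @functor W X y0)
    (z : @functor W X z0) (g : @functor W E g0) :=
  ht_comp (((x ⊗f y) ⊗f z) ⊳f g) (x ⊳f ((y ⊗f z) ⊳f g)) (x ⊳f (y ⊳f (z ⊳f g)))
    (ht_comp (((x ⊗f y) ⊗f z) ⊳f g) ((x ⊗f (y ⊗f z)) ⊳f g) (x ⊳f ((y ⊗f z) ⊳f g))
       (t_actR ((x ⊗f y) ⊗f z) (x ⊗f (y ⊗f z)) (t_al x y z) g)
       (t_be x (y ⊗f z) g))
    (t_actL x ((y ⊗f z) ⊳f g) (y ⊳f (z ⊳f g)) (t_be y z g)).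
Definition p_tgt x0 y0 z0 g0 (x : @functor W X x0) (y : @functor W X y0)
    (z : @functor W X z0) (g : @functor W E g0) :=
  ht_comp (((x ⊗f y) ⊗f z) ⊳f g) ((x ⊗f y) ⊳f (z ⊳f g)) (x ⊳f (y ⊳f (z ⊳f g)))
    (t_be (x ⊗f y) z g) (t_be x y (z ⊳f g)).
Definition l_src x0 g0 (x : @functor W X x0) (g : @functor W E g0) :=
  t_actR (If ⊗f x) x (t_la x) g.
Definition l_tgt x0 g0 (x : @functor W X x0) (g : @functor W E g0) :=
  ht_comp ((If ⊗f x) ⊳f g) (If ⊳f (x ⊳f g)) (x ⊳f g)
    (t_be If x g) (t_la' (x ⊳f g)).
Definition m_src x0 g0 (x : @functor W X x0) (g : @functor W E g0) :=
  ht_comp ((x ⊗f If) ⊳f g) (x ⊳f (If ⊳f g)) (x ⊳f g)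
    (t_be x If g) (t_actL x (If ⊳f g) g (t_la' g)).
Definition m_tgt x0 g0 (x : @functor W X x0) (g : @functor W E g0) :=
  t_actR (x ⊗f If) x (t_rh x) g.
End ActionTransformations.

Definition w1 := f_comp (f_fst (dbl_prod (dbl_prod X X) X) E) (pr1 X X).
Definition w2 := f_comp (f_fst (dbl_prod (dbl_prod X X) X) E) (pr2 X X).
Definition w3 := f_comp (f_fst (dbl_prod (dbl_prod X X) X) E) (pr3 X X).
Definition w4 := f_snd (dbl_prod (dbl_prod X X) X) E.

Record is_haction : Prop := {
  tri_functor : is_functor (tri T);
  ta_equiv : is_htrans_equiv (triple_l (hten M) (tri T)) (triple_r (tri T)) (ta T);
  tl_equiv : is_htrans_equiv (f_app2 (tri T) (f_unit (hun M) E) (f_id E)) (f_id E)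
               (tl T);
  tp_mod :
    is_imod
      (f_app2 (tri T) (f_app2 (hten M) (f_app2 (hten M) w1 w2) w3) w4)
      (f_app2 (tri T) w1 (f_app2 (tri T) w2 (f_app2 (tri T) w3 w4)))
      (p_src w1 w2 w3 w4) (p_tgt w1 w2 w3 w4)
      (fun w => tp T (fst (fst (fst w))) (snd (fst (fst w))) (snd (fst w)) (snd w));
  tll_mod :
    is_imod
      (f_app2 (tri T) (f_app2 (hten M) (f_unit (hun M) _) (f_fst X E)) (f_snd X E))
      (f_app2 (tri T) (f_fst X E) (f_snd X E))
      (l_src (f_fst X E) (f_snd X E)) (l_tgt (f_fst X E) (f_snd X E))
      (fun w => tll T (fst w) (snd w));
  tm_mod :
    is_imod
      (f_app2 (tri T) (f_app2 (hten M) (f_fst X E) (f_unit (hun M) _)) (f_snd X E))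
      (f_app2 (tri T) (f_fst X E) (f_snd X E))
      (m_src (f_fst X E) (f_snd X E)) (m_tgt (f_fst X E) (f_snd X E))
      (fun w => tm T (fst w) (snd w));
  TA1 : forall A B C D G, TA1_lhs A B C D G = TA1_rhs A B C D G;
  TA2 : forall A B G, TA2_lhs A B G = TA2_rhs A B G
}.
End Actions.

Section HorizontallyMonoidal.
Variables (X : dbl_data) (M : hmonoidal_data X).
Let T := self_action M.

Local Notation "A ⊗ B" := (htenO M A B) (at level 35).
Local Notation I := (hI0 M).
Local Notation a A B C := (hal1 M A B C).
Local Notation rho A := (ht1 (hrh M) A).
Local Notation lam A := (ht1 (hla M) A).

(* (TA3): both sides are 2-cells from
   [α_{A,B,I}C | α_{A,BI,C} | Aα_{B,I,C} | A(Bλ_C)] to [ρ_{AB}C | α_{A,B,C}]. *)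
Definition TA3_lhs (A B C : ob X) :=
  let a1 := tenR M (a A B I) C in
  let a2 := a A (B ⊗ I) C in
  let a3 := tenL M A (a B I C) in
  let a4 := tenL M A (tenL M B (lam C)) in
  rw3r (hp M A B I C) a1 a2 a3 (a (A ⊗ B) I C) (a A B (I ⊗ C)) a4
  // (sid (a (A ⊗ B) I C) || ginv (nat3 T A B (lam C)))
  // rw21r (hm M (A ⊗ B) C) (a (A ⊗ B) I C) (tenL M (A ⊗ B) (lam C)) (a A B C).

Definition TA3_rhs (A B C : ob X) :=
  let a1 := tenR M (a A B I) C in
  let a2 := a A (B ⊗ I) C in
  (sid a1 || (sid a2 || actL2 T A (hm M B C) (a B I C) (tenL M B (lam C))))
  // (sid a1 || ginv (nat2 T A (rho B) C))
  // rw21r (ginv (actR12 T (hr M A B) (a A B I) (tenL M A (rho B)) C))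
       a1 (tenR M (tenL M A (rho B)) C) (a A B C).

Definition r_src (x := f_fst X X) (y := f_snd X X) :=
  t_rh M (f_app2 (hten M) x y).
Definition r_tgt (x := f_fst X X) (y := f_snd X X) (i := f_unit (hun M) _) :=
  ht_comp (f_app2 (hten M) (f_app2 (hten M) x y) i)
    (f_app2 (hten M) x (f_app2 (hten M) y i)) (f_app2 (hten M) x y)
    (t_al M x y i) (t_actL T x (f_app2 (hten M) y i) y (t_rh M y)).

Record is_hmonoidal : Prop := {
  hmon_action : is_haction T;
  hun_functor : is_functor (hun M);
  hrh_equiv : is_htrans_equiv (f_app2 (hten M) (f_id X) (f_unit (hun M) X)) (f_id X)
                (hrh M);
  hr_mod :
    is_imod
      (f_app2 (hten M) (f_app2 (hten M) (f_fst X X) (f_snd X X)) (f_unit (hun M) _))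
      (f_app2 (hten M) (f_fst X X) (f_snd X X))
      r_src r_tgt (fun w => hr M (fst w) (snd w));
  TA3 : forall A B C, TA3_lhs A B C = TA3_rhs A B C
}.
End HorizontallyMonoidal.

(** * Horizontal extensions of the canonical action *)

Section Extension.
Variables (X : dbl_data) (M : hmonoidal_data X) (S : hmonad_data X).
(* ⊳ agrees with ⊗ on objects, as the icon θ requires. *)
Variables (T : @haction_data X M (kl S) (htenO M))
          (th : @icon (dbl_prod X X) (kl S) (op2 (htenO M))).
Let K := kl_K S.

Local Notation "A ⊗ B" := (htenO M A B) (at level 35).
Local Notation I := (hI0 M).
Local Notation a A B C := (hal1 M A B C).
Local Notation rho A := (ht1 (hrh M) A).
Local Notation lam A := (ht1 (hla M) A).

(* - ⊳ K(-) and K(- ⊗ -) *)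
Definition ext_src := f_app2 (tri T) (f_fst X X) (f_comp (f_snd X X) K).
Definition ext_tgt := f_comp (f_app2 (hten M) (f_fst X X) (f_snd X X)) K.

(* θ_{f,g} : f ⊳ K(g) => K(f ⊗ g) *)
Definition thh A A' B B' (f : hor A A') (g : hor B B')
    : @sq (kl S) (A ⊗ B) (A' ⊗ B') (A ⊗ B) (A' ⊗ B') :=
  @ich _ _ _ th (A, B) (A', B') (f, g).
Definition halh A A' B B' C C' (f : hor A A') (g : hor B B') (h : hor C C')
    : sq ((A ⊗ B) ⊗ C) (A' ⊗ (B' ⊗ C')) ((A ⊗ B) ⊗ C) (A' ⊗ (B' ⊗ C')) :=
  @hth _ _ _ _ (hal M) (A, B, C) (A', B', C') (f, g, h).

(* The compositors of K mediate between [K(-) | K(-)] and K([- | -]); K is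
   strictly unital since X is strict. *)
Record is_horizontal_extension : Prop := {
  ext_monoidal : is_hmonoidal M;
  ext_monad : is_hmonad S;
  ext_kleisli : is_pseudodouble (kl S);
  ext_action : is_haction T;
  ext_icon : is_icon ext_src ext_tgt th;
  ext_lam : forall A, fh K (lam A) = ht1 (tl T) A;
  ext_al : forall A B C, fh K (a A B C) = ta1 T A B C;
  (* θ_{1,1} is inverse to the unitor of ⊳, modulo that of ⊗ *)
  ext_unit : forall A B : ob X,
    bu (tri T) A B // thh (hid A) (hid B) = fs K (bu (hten M) A B);
  ext_l : forall A B : ob X,
    thh (lam A) (hid B) // fs K (hl M A B) // ginv (fc K (a I A B) (lam (A ⊗ B)))
      = tll T A B;
  ext_m : forall A B : ob X,
    (sid (fh K (a A I B)) || thh (hid A) (lam B))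
    // fc K (a A I B) (tenL M A (lam B)) // fs K (hm M A B)
    // ginv (thh (rho A) (hid B))
      = tm T A B;
  ext_p : forall A B C D : ob X,
    (thh (a A B C) (hid D) || sid (fh K (a A (B ⊗ C) D)) || thh (hid A) (a B C D))
    // (fc K (tenR M (a A B C) D) (a A (B ⊗ C) D)
        || sid (fh K (tenL M A (a B C D))))
    // fc K (tenR M (a A B C) D *h a A (B ⊗ C) D) (tenL M A (a B C D))
    // fs K (hp M A B C D) // ginv (fc K (a (A ⊗ B) C D) (a A B (C ⊗ D)))
      = tp T A B C D;
  ext_lam_h : forall A A' (f : hor A A'),
    (thh (unit_h (hun M)) f || sid (fh K (lam A')))
    // fc K (bh (hten M) (unit_h (hun M)) f) (lam A')
    // fs K (hth (hla M) f) // ginv (fc K (lam A) f)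
      = hth (tl T) (fh K f);
  ext_al_h : forall A A' B B' C C' (f : hor A A') (g : hor B B') (h : hor C C'),
    (thh (bh (hten M) f g) h || sid (fh K (a A' B' C')))
    // fc K (bh (hten M) (bh (hten M) f g) h) (a A' B' C')
    // fs K (halh f g h) // ginv (fc K (a A B C) (bh (hten M) f (bh (hten M) g h)))
      = tah T f g (fh K h)
        // (sid (ta1 T A B C) || bs (tri T) (sid f) (thh g h))
        // (sid (ta1 T A B C) || thh f (bh (hten M) g h))
}.
End Extension.

(** * Companion-lifts of the structures *)

Section LiftAction.
Variables (X : dbl_data) (M : monoidal_data X) (E : dbl_data).
Variables (triO : ob X -> ob E -> ob E) (tri : @functor (dbl_prod X E) E (op2 triO)).
Variables (va : @vtrans (dbl_prod (dbl_prod X X) E) E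
                  (al_src (tenO M) triO) (al_tgt triO))
          (vl : @vtrans E E (fun C => triO (I0 M) C) (fun C => C)).
Variables (cal : forall x, companion (vt1 (al M) x))
          (cla : forall A, companion (vt1 (la M) A))
          (crh : forall A, companion (vt1 (rh M) A))
          (cva : forall x, companion (vt1 va x))
          (cvl : forall G, companion (vt1 vl G)).

(* Lifts of the equalities p, l, m of 1v-cells of E. *)
Definition lift_p A B C G
    : sq (triO (tenO M (tenO M A B) C) G) (triO A (triO B (triO C G)))
         (triO (tenO M (tenO M A B) C) G) (triO A (triO B (triO C G))) :=
  lift_eq
    (c_comp (cva (tenO M A B, C, G)) (cva (A, B, triO C G)))
    (c_comp (c_comp (c_bifun tri (cal (A, B, C)) (c_id G))
                    (cva (A, tenO M B C, G)))
            (c_bifun tri (c_id A) (cva (B, C, G)))).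
Definition lift_l A G
    : sq (triO (tenO M (I0 M) A) G) (triO A G)
         (triO (tenO M (I0 M) A) G) (triO A G) :=
  lift_eq
    (c_comp (cva (I0 M, A, G)) (cvl (triO A G)))
    (c_bifun tri (cla A) (c_id G)).
Definition lift_m A G
    : sq (triO (tenO M A (I0 M)) G) (triO A G)
         (triO (tenO M A (I0 M)) G) (triO A G) :=
  lift_eq
    (c_bifun tri (crh A) (c_id G))
    (c_comp (cva (A, I0 M, G)) (c_bifun tri (c_id A) (cvl G))).
End LiftAction.

Section LiftMonoidal.
Variables (X : dbl_data) (M : monoidal_data X).
Variables (cal : forall x, companion (vt1 (al M) x))
          (cla : forall A, companion (vt1 (la M) A))
          (crh : forall A, companion (vt1 (rh M) A)).

Definition lift_monoidal : hmonoidal_data X := {|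
  htenO := tenO M;
  hten := ten M;
  hI0 := I0 M;
  hun := un M;
  hal := lift (triple_l (ten M) (ten M)) (triple_r (ten M)) cal;
  hla := lift (f_app2 (ten M) (f_unit (un M) X) (f_id X)) (f_id X) cla;
  hrh := lift (f_app2 (ten M) (f_id X) (f_unit (un M) X)) (f_id X) crh;
  hp := lift_p (ten M) cal cal;
  hl := lift_l (ten M) cla cal cla;
  hm := lift_m (ten M) crh cal cla;
  hr A B :=
    lift_eq (c_comp (cal (A, B, I0 M)) (c_bifun (ten M) (c_id A) (crh B)))
            (crh (tenO M A B))
|}.

Definition lift_action (E : dbl_data) (triO : ob X -> ob E -> ob E)
    (tri : @functor (dbl_prod X E) E (op2 triO))
    (va : @vtrans (dbl_prod (dbl_prod X X) E) E
            (al_src (tenO M) triO) (al_tgt triO))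
    (vl : @vtrans E E (fun C => triO (I0 M) C) (fun C => C))
    (cva : forall x, companion (vt1 va x)) (cvl : forall G, companion (vt1 vl G))
    : haction_data lift_monoidal triO :=
  @Build_haction_data X lift_monoidal E triO
    tri
    (lift (triple_l (ten M) tri) (triple_r tri) cva)
    (lift (f_app2 tri (f_unit (un M) E) (f_id E)) (f_id E) cvl)
    (lift_p tri cal cva)
    (lift_l tri cla cva cvl)
    (lift_m tri crh cva cvl).
End LiftMonoidal.

Section LiftMonad.
Variables (X : dbl_data) (T : vmonad_data X).
Variables (cmu : forall A, companion (vt1 (vmu T) A))
          (ceta : forall A, companion (vt1 (veta T) A)).

Definition lift_monad : hmonad_data X := {|
  hO := tO T;
  hf := tf T;
  hmu := lift (f_comp (tf T) (tf T)) (tf T) cmu;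
  heta := lift (f_id X) (tf T) ceta;
  hass A := lift_eq (c_comp (c_fun (tf T) (cmu A)) (cmu A))
                    (c_comp (cmu (tO T A)) (cmu A));
  hlu A := lift_eq (c_id (tO T A)) (c_comp (ceta (tO T A)) (cmu A));
  hru A := lift_eq (c_id (tO T A)) (c_comp (c_fun (tf T) (ceta A)) (cmu A))
|}.
End LiftMonad.

(** * The extension induced by a strength *)

Section Induced.
Variables (X : dbl_data) (M : monoidal_data X) (T : vmonad_data X)
          (t : str_data M T).
Variables (cal : forall x, companion (vt1 (al M) x))
          (cla : forall A, companion (vt1 (la M) A))
          (crh : forall A, companion (vt1 (rh M) A))
          (cmu : forall A, companion (vt1 (vmu T) A))
          (ceta : forall A, companion (vt1 (veta T) A))
          (ct : forall x, companion (vt1 t x)).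

Let S := lift_monad cmu ceta.
Let F := tf T.
Let K := kl_K S.

Local Notation "A ⊗ B" := (tenO M A B) (at level 35).

Definition str_hat := lift (f_str_src M T) (f_str_tgt M T) ct.
Definition t1 (A B : ob X) : hor (A ⊗ tO T B) (tO T (A ⊗ B)) :=
  ht1 str_hat (A, B).
Definition tv A A' B B' (u : ver A A') (v : ver B B')
    : sq (A ⊗ tO T B) (tO T (A ⊗ B)) (A' ⊗ tO T B') (tO T (A' ⊗ B')) :=
  @htv _ _ _ _ str_hat (A, B) (A', B') (u, v).
Definition th A A' B B' (f : hor A A') (g : hor B B')
    : sq (A ⊗ tO T B) (tO T (A' ⊗ B')) (A ⊗ tO T B) (tO T (A' ⊗ B')) :=
  @hth _ _ _ _ str_hat (A, B) (A', B') (f, g).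

(* A ⊗ u^ *)
Definition c_tenL (A : ob X) B B' (u : ver B B') (c : companion u)
    : companion (bv (ten M) (vid A) u) :=
  c_bifun (ten M) (c_id A) c.

(* [t_{A,TB} | T t_{A,B} | μ_{AB}] => [Aμ_B | t_{A,B}] *)
Definition w_hat (A B : ob X)
    : sq (A ⊗ tO T (tO T B)) (tO T (A ⊗ B)) (A ⊗ tO T (tO T B)) (tO T (A ⊗ B)) :=
  lift_eq
    (c_comp (c_tenL A (cmu B)) (ct (A, B)))
    (c_comp (c_comp (ct (A, tO T B)) (c_fun F (ct (A, B)))) (cmu (A ⊗ B))).
(* [Aη_B | t_{A,B}] => η_{AB} *)
Definition z_hat (A B : ob X)
    : sq (A ⊗ B) (tO T (A ⊗ B)) (A ⊗ B) (tO T (A ⊗ B)) :=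
  lift_eq (ceta (A ⊗ B)) (c_comp (c_tenL A (ceta B)) (ct (A, B))).
(* top t_{AB,C}, bottom [At_{B,C} | t_{A,BC}] *)
Definition y_star (A B C : ob X)
    : sq ((A ⊗ B) ⊗ tO T C) (tO T ((A ⊗ B) ⊗ C))
         (A ⊗ (B ⊗ tO T C)) (tO T (A ⊗ (B ⊗ C))) :=
  lift_sq (al1 M A B (tO T C)) (fv F (al1 M A B C))
    (c_comp (c_tenL A (ct (B, C))) (ct (A, B ⊗ C))) (ct (A ⊗ B, C)).
(* top t_{I,A}, bottom 1 *)
Definition x_star (A : ob X)
    : sq (I0 M ⊗ tO T A) (tO T (I0 M ⊗ A)) (tO T A) (tO T A) :=
  lift_sq (vt1 (la M) (tO T A)) (fv F (vt1 (la M) A))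
    (c_id (tO T A)) (ct (I0 M, A)).

Definition tri_h A A' B B' (f : hor A A') (g : hor B (tO T B'))
    : hor (A ⊗ B) (tO T (A' ⊗ B')) :=
  bh (ten M) f g *h t1 A' B'.
Definition tri_s A1 A2 A3 A4 B1 B2 B3 B4 (s : sq A1 A2 A3 A4)
    (d : sq B1 (tO T B2) B3 (tO T B4)) (v' : ver B2 B4)
    : sq (A1 ⊗ B1) (tO T (A2 ⊗ B2)) (A3 ⊗ B3) (tO T (A4 ⊗ B4)) :=
  bs (ten M) s d || tv (rgt s) v'.

(* The compositor of ⊳:
     [f⊗g | t | T[f'⊗g' | t] | μ] => [f⊗g | t | T(f'⊗g') | T t | μ]
       => [f⊗g | f'⊗Tg' | t | T t | μ] => [f⊗g | f'⊗Tg' | 1⊗μ | t]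
       => [[f|f'] ⊗ [g|Tg'] | 1⊗μ | t] => [[f|f'] ⊗ [g|Tg'|μ] | t]. *)
Definition tri_c A A' A'' B B' B'' (f : hor A A') (g : hor B (tO T B'))
    (f' : hor A' A'') (g' : hor B' (tO T B''))
    : sq (A ⊗ B) (tO T (A'' ⊗ B'')) (A ⊗ B) (tO T (A'' ⊗ B'')) :=
  let fg := sid (bh (ten M) f g) in
  let mu := ch (cmu B'') in
  let muA := sid (ch (cmu (A'' ⊗ B''))) in
  (fg || sid (t1 A' B') || ginv (fc F (bh (ten M) f' g') (t1 A'' B'')) || muA)
  // (fg || ginv (th f' g') || sid (fh F (t1 A'' B'')) || muA)
  // (fg || sid (bh (ten M) f' (fh F g')) || w_hat A'' B'')
  // (bc (ten M) f g f' (fh F g') || sid (bh (ten M) (hid A'') mu)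
      || sid (t1 A'' B''))
  // (bc (ten M) (f *h f') (g *h fh F g') (hid A'') mu || sid (t1 A'' B'')).

(* The unitor is η_{AB} => [Aη_B | t_{A,B}]. *)
Definition act_tri : @functor (dbl_prod X (kl S)) (kl S) (op2 (tenO M)) :=
  @Functor (dbl_prod X (kl S)) (kl S) (op2 (tenO M))
    (fun _ _ f => tri_h (fst f) (snd f))
    (fun _ _ u => bv (ten M) (fst u) (snd u))
    (fun _ _ _ _ s => (tri_s (fst s) (fst (snd s)) (snd (snd s)),
                       bv (ten M) (rgt (fst s)) (snd (snd s))))
    (fun _ _ _ f f' => (tri_c (fst f) (snd f) (fst f') (snd f'), vid _))
    (fun A => (ginv (z_hat (fst A) (snd A)), vid _)).

(* [α_{f,g,h} | y*], followed by the compositor of ⊗ that identifies the bottom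
   [f⊗(g⊗h) | A't | t] with f ⊳ (g ⊳ h) = [f⊗[g⊗h | t] | t]. *)
Definition act_als A A' B B' C C' (f : hor A A') (g : hor B B')
    (h : hor C (tO T C'))
    : sq ((A ⊗ B) ⊗ C) (tO T ((A' ⊗ B') ⊗ C'))
         (A ⊗ (B ⊗ C)) (tO T (A' ⊗ (B' ⊗ C'))) :=
  (als M f g h || y_star A' B' C')
  // (bc (ten M) f (bh (ten M) g h) (hid A') (t1 B' C') || sid (t1 A' (B' ⊗ C'))).

Definition act_al
    : @vtrans (dbl_prod (dbl_prod X X) (kl S)) (kl S)
        (al_src (tenO M) (tenO M)) (al_tgt (tenO M)) :=
  @VTrans (dbl_prod (dbl_prod X X) (kl S)) (kl S)
    (al_src (tenO M) (tenO M)) (al_tgt (tenO M))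
    (fun x => al1 M (fst (fst x)) (snd (fst x)) (snd x))
    (fun _ y f => (act_als (fst (fst f)) (snd (fst f)) (snd f),
                   al1 M (fst (fst y)) (snd (fst y)) (snd y))).

(* [λ_h | x*] *)
Definition act_la : @vtrans (kl S) (kl S) (fun C => tenO M (I0 M) C) (fun C => C) :=
  @VTrans (kl S) (kl S) (fun C => tenO M (I0 M) C) (fun C => C)
    (fun C => vt1 (la M) C)
    (fun _ C' h => (vts (la M) h || x_star C', vt1 (la M) C')).

Definition act_cal (x : ob (dbl_prod (dbl_prod X X) (kl S)))
    : companion (vt1 act_al x) :=
  c_fun K (cal (fst (fst x), snd (fst x), snd x)).
Definition act_cla (C : ob (kl S)) : companion (vt1 act_la C) :=
  c_fun K (cla C).

(* p~, l~, m~ are the lifts of K(p), K(l), K(m), i.e. of the equalities p, l, m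
   of 1v-cells seen in Kl. *)
Definition induced_action
    : @haction_data X (lift_monoidal cal cla crh) (kl S) (tenO M) :=
  lift_action cal cla crh act_tri act_cal act_cla.

(* θ_{f,g} = [Id | z^], preceded by the compositor of ⊗ that identifies
   f ⊳ K(g) = [f⊗[g | η] | t] with [f⊗g | A'η | t];  θ^{u,v} = Id^{u⊗v}. *)
Definition ind_th A A' B B' (f : hor A A') (g : hor B B')
    : sq (A ⊗ B) (tO T (A' ⊗ B')) (A ⊗ B) (tO T (A' ⊗ B')) :=
  (ginv (bc (ten M) f g (hid A') (ch (ceta B'))) || sid (t1 A' B'))
  // (sid (bh (ten M) f g) || z_hat A' B').

Definition induced_icon
    : @icon (dbl_prod X X) (kl S) (op2 (tenO M)) :=
  @Icon (dbl_prod X X) (kl S) (op2 (tenO M))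
    (fun _ _ u => @sidv (kl S) _ _ (bv (ten M) (fst u) (snd u)))
    (fun _ _ f => (ind_th (fst f) (snd f), vid _)).
End Induced.

(* Main.v *)
(* Between companions of equal 1v-cells there is exactly one globular cell compatible with
   the counits.  All canonical cells (structure cells of pseudodouble functors, components of
   companion-lifted transformations, lifted equalities of 1v-cells) are of this kind, and so
   are their composites; hence every axiom relating such cells, in particular TA1 and TA2, the
   monad laws of the lifted monad and the formulas for the lifted modifications, holds by
   uniqueness.

   For [u] with companion [û] and counit-unit [ε], [ι], the cells [kap p = Id_p | ι], with top
   [p] and bottom [p | û], are epic for vertical composition.  The coherence cells of the
   Kleisli double category, of the action and of the icon are each characterised by what they
   become after precomposition with such a cell, where only the strict naturality and the
   strict vertical equations of the monad and its strength remain to be used. *)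

From Stdlib Require Import ClassicalEpsilon.
Require Import Defs.

Set Implicit Arguments.
Unset Strict Implicit.
Unset Printing Implicit Defensive.
Local Open Scope dbl_scope.

(** The overview names two methods; the need for both comes from the Kleisli double category. Its
    associators and unitors, and the compositor of the action, are taken at arbitrary 1h-cells,
    which need not be companions, so uniqueness of lifts cannot decide their coherence. After
    precomposition with cells of the kind [kap] the weak data disappear: an inverse such as
    [ginv (hth mu h)] meets the vertical component it came from, and only the strict 2-cell
    components of [mu], [eta] and [t] remain. Moreover [kl] is not strict even over a strict base.
    Companions, lifts, lifted transformations and lifted actions are therefore treated over
    arbitrary pseudodouble categories, with unitors written out; the result on lifted actions is
    then used once for the base acting on itself and once for its action on [kl]. Since squares are
    raw, every step owes boundary conditions; [bd] discharges them by inferring a typing of each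
    pasting. *)

Lemma is_sq_cast (X : dbl_data) (A B C D : ob X) (a : sq A B C D)
    f g u v f' g' u' v' :
  is_sq a f g u v -> f = f' -> g = g' -> u = u' -> v = v' -> is_sq a f' g' u' v'.
Proof. now intros; subst. Qed.

(** * Boundaries of raw squares and inverses of globular cells *)

Section Boundaries.
Variables (X : dbl_data) (A B C D : ob X) (a : sq A B C D).
Variables (f : hor A B) (g : hor C D) (u : ver A C) (v : ver B D).
Hypothesis a_ty : is_sq a f g u v.
Lemma wf_of : wf a. Proof. apply a_ty. Qed.
Lemma top_of : top a = f. Proof. apply a_ty. Qed.
Lemma bot_of : bot a = g. Proof. apply a_ty. Qed.
Lemma lft_of : lft a = u. Proof. apply a_ty. Qed.
Lemma rgt_of : rgt a = v. Proof. apply a_ty. Qed.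
End Boundaries.

Lemma sh_ty2 (X : dbl_data) (A B C D E F : ob X) (a : sq A B C D) (b : sq B E D F)
    f g f' g' u v v' w :
  is_pseudodouble X -> is_sq a f g u v -> is_sq b f' g' v' w -> v = v' ->
  is_sq (a || b) (f *h f') (g *h g') u w.
Proof. intros HX Ha Hb <-. exact (sh_ty HX Ha Hb). Qed.

Lemma sv_ty2 (X : dbl_data) (A B C D E F : ob X) (a : sq A B C D) (b : sq C D E F)
    f g g' h u v u' v' :
  is_pseudodouble X -> is_sq a f g u v -> is_sq b g' h u' v' -> g = g' ->
  is_sq (a // b) f h (u *v u') (v *v v').
Proof. intros HX Ha Hb <-. exact (sv_ty HX Ha Hb). Qed.

(** [ginv] picks an inverse for some pair of boundaries. That pair agrees with [f] and [g], since
    both are the [top] and [bot] of the same cell [a], so the choice is an inverse of the stated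
    type. *)
Lemma ginv_spec (X : dbl_data) (A B : ob X) (a : sq A B A B) f g :
  is_giso a f g -> inv_glob a (ginv a) f g.
Proof.
  intros [b Hb].
  destruct (epsilon_spec (inhabits a) (fun b => exists f g, inv_glob a b f g))
    as (f' & g' & H); [now exists b, f, g|].
  fold (ginv a) in H.
  assert (f' = f) as -> by (transitivity (top a); [symmetry|]; [apply H|apply Hb]).
  assert (g' = g) as -> by (transitivity (bot a); [symmetry|]; [apply H|apply Hb]).
  exact H.
Qed.

Section Giso.
Variables (X : dbl_data) (A B : ob X) (a : sq A B A B) (f g : hor A B).
Hypothesis Ha : is_giso a f g.
Lemma giso_glob : is_glob a f g. Proof. apply (ginv_spec Ha). Qed.
Lemma ginv_glob : is_glob (ginv a) g f. Proof. apply (ginv_spec Ha). Qed.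
Lemma giso_r : a // ginv a = sid f. Proof. apply (ginv_spec Ha). Qed.
Lemma giso_l : ginv a // a = sid g. Proof. apply (ginv_spec Ha). Qed.
End Giso.

Lemma giso_cast (X : dbl_data) (A B : ob X) (a : sq A B A B) f g f' g' :
  is_giso a f g -> f = f' -> g = g' -> is_giso a f' g'.
Proof. now intros; subst. Qed.

(* Automation of boundary conditions *)
Create HintDb psd.
Create HintDb sqty.
Create HintDb giso.
Create HintDb cells.
#[global] Hint Constants Opaque : psd sqty giso.
Ltac psd := solve [eauto 4 with psd].

Lemma vc_idl' (X : dbl_data) (A B : ob X) (u : ver A B) :
  is_pseudodouble X -> vid A *v u = u.
Proof. intros HX; apply (vc_idl HX). Qed.
Lemma vc_idr' (X : dbl_data) (A B : ob X) (u : ver A B) :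
  is_pseudodouble X -> u *v vid B = u.
Proof. intros HX; apply (vc_idr HX). Qed.
Lemma vc_assoc' (X : dbl_data) (A B C D : ob X) (u : ver A B) (v : ver B C)
    (w : ver C D) :
  is_pseudodouble X -> (u *v v) *v w = u *v (v *v w).
Proof. intros HX; apply (vc_assoc HX). Qed.
Lemma hc_assoc' (X : dbl_data) (A B C D : ob X) (f : hor A B) (g : hor B C)
    (h : hor C D) :
  is_strict X -> (f *h g) *h h = f *h (g *h h).
Proof. intros HX; apply (hc_assoc HX). Qed.
Lemma hc_idl' (X : dbl_data) (A B : ob X) (f : hor A B) :
  is_strict X -> hid A *h f = f.
Proof. intros HX; apply (hc_idl HX). Qed.
Lemma hc_idr' (X : dbl_data) (A B : ob X) (f : hor A B) :
  is_strict X -> f *h hid B = f.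
Proof. intros HX; apply (hc_idr HX). Qed.
Lemma fv_vc' (X Y : dbl_data) (F0 : ob X -> ob Y) (F : functor F0) (A B C : ob X)
    (u : ver A B) (v : ver B C) :
  is_functor F -> fv F (u *v v) = fv F u *v fv F v.
Proof. intros HF; apply (fv_vc HF). Qed.
Lemma fv_vid' (X Y : dbl_data) (F0 : ob X -> ob Y) (F : functor F0) (A : ob X) :
  is_functor F -> fv F (vid A) = vid (F0 A).
Proof. intros HF; apply (fv_vid HF). Qed.

Lemma bv_vid' (X Y Z : dbl_data) (B0 : ob X -> ob Y -> ob Z)
    (B : @functor (dbl_prod X Y) Z (op2 B0)) (A : ob X) (C : ob Y) :
  is_functor B -> bv B (vid A) (vid C) = vid (B0 A C).
Proof. intros HB. exact (fv_vid HB (A, C)). Qed.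

Ltac cells1 :=
  match goal with
  | |- context [bv ?B (vid ?A) (vid ?C)] => rewrite (@bv_vid' _ _ _ _ B A C) by psd
  | |- context [vc (vid ?A) ?u] => rewrite (@vc_idl' _ _ _ u) by psd
  | |- context [vc ?u (vid ?A)] => rewrite (@vc_idr' _ _ _ u) by psd
  | |- context [fv ?F (vid ?A)] => rewrite (@fv_vid' _ _ _ F A) by psd
  | |- context [fv ?F (vc ?u ?v)] => rewrite (@fv_vc' _ _ _ F _ _ _ u v) by psd
  | |- context [hc (hid ?A) ?f] => rewrite (@hc_idl' _ _ _ f) by psd
  | |- context [hc ?f (hid ?A)] => rewrite (@hc_idr' _ _ _ f) by psd
  | |- context [vc (vc ?u ?v) ?w] => rewrite (@vc_assoc' _ _ _ _ _ u v w) by psd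
  | |- context [hc (hc ?u ?v) ?w] => rewrite (@hc_assoc' _ _ _ _ _ u v w) by psd
  end.
Ltac cells := first [reflexivity | eassumption |
  solve [repeat cells1; first [reflexivity | eassumption | solve [eauto 3 with cells] | congruence]]].

(* [ty] infers the boundary of a pasting composite, structurally. *)
Ltac ty_leaf := solve [eassumption | eapply giso_glob; eassumption | eauto 6 with sqty].
Ltac ty :=
  lazymatch goal with
  | |- is_sq (sh _ _) _ _ _ _ => eapply sh_ty2; [psd | ty | ty | cells]
  | |- is_sq (sv _ _) _ _ _ _ => eapply sv_ty2; [psd | ty | ty | cells]
  | |- is_sq (sid _) _ _ _ _ => eapply sid_ty; psd
  | |- is_sq (sidv _) _ _ _ _ => eapply sidv_ty; psd
  | |- is_sq (fs _ _) _ _ _ _ => first [ty_leaf | eapply fs_ty; [psd | ty]]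
  | |- is_sq (ginv _) _ _ _ _ => eapply ginv_glob; gi
  | |- is_sq (asc _ _ _) _ _ _ _ => eapply giso_glob; gi
  | |- is_sq (lun _) _ _ _ _ => eapply giso_glob; gi
  | |- is_sq (run _) _ _ _ _ => eapply giso_glob; gi
  | |- is_sq (fc _ _ _) _ _ _ _ => eapply giso_glob; gi
  | |- is_sq (fu _ _) _ _ _ _ => eapply giso_glob; gi
  | |- _ => ty_leaf
  end
with gi :=
  lazymatch goal with
  | |- is_giso (asc _ _ _) _ _ => eapply asc_ty; psd
  | |- is_giso (lun _) _ _ => eapply lun_ty; psd
  | |- is_giso (run _) _ _ => eapply run_ty; psd
  | |- is_giso (fc _ _ _) _ _ => eapply fc_ty; psd
  | |- is_giso (fu _ _) _ _ => eapply fu_ty; psd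
  | |- _ => solve [eassumption | eauto 6 with giso]
  end.
(** A boundary function applied to a square is evaluated by typing the square with unknown
    boundaries and reading off the one in question. *)
Ltac compute_bd :=
  match goal with
  | |- context [@top ?X ?A ?B ?C ?D ?a] => let H := fresh in
      eassert (H : @is_sq X A B C D a _ _ _ _) by ty; rewrite (top_of H); clear H
  | |- context [@bot ?X ?A ?B ?C ?D ?a] => let H := fresh in
      eassert (H : @is_sq X A B C D a _ _ _ _) by ty; rewrite (bot_of H); clear H
  | |- context [@lft ?X ?A ?B ?C ?D ?a] => let H := fresh in
      eassert (H : @is_sq X A B C D a _ _ _ _) by ty; rewrite (lft_of H); clear H
  | |- context [@rgt ?X ?A ?B ?C ?D ?a] => let H := fresh in
      eassert (H : @is_sq X A B C D a _ _ _ _) by ty; rewrite (rgt_of H); clear H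
  end.
Ltac bd :=
  lazymatch goal with
  | |- is_pseudodouble _ => psd
  | |- is_functor _ => psd
  | |- is_strict _ => psd
  | |- wf _ => eapply wf_of; ty
  | |- is_sq _ _ _ _ _ => eapply is_sq_cast; [ty | cells | cells | cells | cells]
  | |- is_glob _ _ _ => eapply is_sq_cast; [ty | cells | cells | cells | cells]
  | |- is_giso _ _ _ => eapply giso_cast; [gi | cells | cells]
  | |- ?x = ?y => first [reflexivity | repeat compute_bd; cells]
  | |- _ => psd
  end.

(** * Invertible globular cells *)

Section Basics.
Variables (X : dbl_data) (HX : is_pseudodouble X).

Lemma sid_sv (A B C D : ob X) (a : sq A B C D) f :
  wf a -> top a = f -> sid f // a = a.
Proof. intros Ha <-. exact (sv_idl HX Ha). Qed.
Lemma sv_sid (A B C D : ob X) (a : sq A B C D) f :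
  wf a -> bot a = f -> a // sid f = a.
Proof. intros Ha <-. exact (sv_idr HX Ha). Qed.
Lemma giso_inv (A B : ob X) (a : sq A B A B) f g : is_giso a f g -> is_giso (ginv a) g f.
Proof. intros [? H]%ginv_spec. exists a. unfold inv_glob in *; intuition. Qed.
Lemma ginv_unique (A B : ob X) (a b : sq A B A B) f g :
  inv_glob a b f g -> ginv a = b.
Proof.
  intros H. assert (Ha : is_giso a f g) by now exists b.
  destruct H as (H1 & H2 & H3 & H4).
  assert (Hi := ginv_glob Ha).
  rewrite <- (sid_sv (a := ginv a) (f := g)) by bd. rewrite <- H4.
  rewrite (sv_assoc HX) by bd. rewrite (giso_r Ha). apply sv_sid; bd.
Qed.
Lemma ginv_ginv (A B : ob X) (a : sq A B A B) f g : is_giso a f g -> ginv (ginv a) = a.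
Proof.
  intros Ha. apply ginv_unique with g f. apply ginv_spec in Ha.
  unfold inv_glob in *; intuition.
Qed.
(** A one-sided inverse is enough once the other cell is known to be invertible. This identifies
    explicit pastings as inverses of the Kleisli unitors from a single equation each. *)
Lemma ginv_of_l (A B : ob X) (a b : sq A B A B) f g v :
  is_giso b g f -> is_sq a f g (vid A) v -> a // b = sid f -> a = ginv b.
Proof.
  intros Hb Ha E. assert (H1 := giso_glob Hb). assert (H2 := ginv_glob Hb).
  rewrite <- (sv_sid (a := a) (f := g)), <- (giso_r Hb), <- (sv_assoc HX), E by bd.
  apply sid_sv; bd.
Qed.
Lemma giso_sid (A B : ob X) (f : hor A B) : is_giso (sid f) f f.
Proof.
  exists (sid f). repeat split; try bd; apply sid_sv; bd.
Qed.
Lemma giso_sv (A B : ob X) (a b : sq A B A B) f g h :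
  is_giso a f g -> is_giso b g h -> is_giso (a // b) f h.
Proof.
  intros Ha Hb. exists (ginv b // ginv a).
  assert (H1 := giso_glob Ha). assert (H2 := ginv_glob Ha).
  assert (H3 := giso_glob Hb). assert (H4 := ginv_glob Hb).
  split; [|split; [|split]]; try bd.
  - rewrite (sv_assoc HX), <- (sv_assoc HX (a := b)), (giso_r Hb), sid_sv by bd.
    apply (giso_r Ha).
  - rewrite (sv_assoc HX), <- (sv_assoc HX (a := ginv a)), (giso_l Ha), sid_sv by bd.
    apply (giso_l Hb).
Qed.
Lemma giso_sh (A B C : ob X) (a : sq A B A B) (b : sq B C B C) f g f' g' :
  is_giso a f g -> is_giso b f' g' -> is_giso (a || b) (f *h f') (g *h g').
Proof.
  intros Ha Hb. exists (ginv a || ginv b).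
  assert (H1 := giso_glob Ha). assert (H2 := ginv_glob Ha).
  assert (H3 := giso_glob Hb). assert (H4 := ginv_glob Hb).
  split; [|split; [|split]]; try bd; rewrite (interchange HX) by bd.
  - now rewrite (giso_r Ha), (giso_r Hb), (sid_hc HX).
  - now rewrite (giso_l Ha), (giso_l Hb), (sid_hc HX).
Qed.
Lemma giso_epi (A B C D : ob X) (a : sq A B A B) f g (s s' : sq A B C D) :
  is_giso a f g -> wf s -> wf s' -> top s = g -> top s' = g ->
  a // s = a // s' -> s = s'.
Proof.
  intros Ha Hs Hs' Ht Ht' E. assert (H1 := giso_glob Ha). assert (H2 := ginv_glob Ha).
  assert (is_sq s g (bot s) (lft s) (rgt s)) by (repeat split; trivial).
  assert (is_sq s' g (bot s') (lft s') (rgt s')) by (repeat split; trivial).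
  rewrite <- (sid_sv Hs Ht), <- (sid_sv Hs' Ht'), <- (giso_l Ha), !(sv_assoc HX) by bd.
  now rewrite E.
Qed.
Lemma giso_mono (A B C D : ob X) (a : sq C D C D) f g (s s' : sq A B C D) :
  is_giso a f g -> wf s -> wf s' -> bot s = f -> bot s' = f ->
  s // a = s' // a -> s = s'.
Proof.
  intros Ha Hs Hs' Ht Ht' E. assert (H1 := giso_glob Ha). assert (H2 := ginv_glob Ha).
  assert (is_sq s (top s) f (lft s) (rgt s)) by (repeat split; trivial).
  assert (is_sq s' (top s') f (lft s') (rgt s')) by (repeat split; trivial).
  rewrite <- (sv_sid Hs Ht), <- (sv_sid Hs' Ht'), <- (giso_r Ha), <- !(sv_assoc HX) by bd.
  now rewrite E.
Qed.
End Basics.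

Lemma giso_sv2 (X : dbl_data) (A B : ob X) (a b : sq A B A B) f g g' h :
  is_pseudodouble X -> is_giso a f g -> is_giso b g' h -> g = g' -> is_giso (a // b) f h.
Proof. intros HX Ha Hb <-. exact (giso_sv HX Ha Hb). Qed.
#[global] Hint Resolve giso_sid : giso.
#[global] Hint Extern 1 (is_giso (ginv _) _ _) =>
  eapply giso_inv; gi : giso.
#[global] Hint Extern 2 (is_giso (sv _ _) _ _) =>
  eapply giso_sv2; [psd | gi | gi | cells] : giso.
#[global] Hint Extern 2 (is_giso (sh _ _) _ _) =>
  eapply giso_sh; [psd | gi | gi] : giso.
#[global] Hint Extern 5 (is_pseudodouble _) => psd : giso.

Lemma sv_assoc' (X : dbl_data) (A B C D E F G H : ob X) (a : sq A B C D)
    (b : sq C D E F) (c : sq E F G H) :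
  is_pseudodouble X ->
  wf a -> wf b -> wf c -> bot a = top b -> bot b = top c ->
  (a // b) // c = a // (b // c).
Proof. intros HX; apply (sv_assoc HX). Qed.

Lemma sv_rew2 (X : dbl_data) (A B C D E F G H : ob X) (a : sq A B C D)
    (b : sq C D E F) (r : sq E F G H) c :
  is_pseudodouble X -> a // b = c ->
  wf a -> wf b -> wf r -> bot a = top b -> bot b = top r -> a // (b // r) = c // r.
Proof. intros HX <- ? ? ? ? ?. symmetry. now apply (sv_assoc HX). Qed.

Ltac asr := repeat match goal with
  | |- context [sv (sv ?a ?b) ?c] =>
      rewrite (@sv_assoc' _ _ _ _ _ _ _ _ _ a b c) by bd end.

Lemma sv_rew3 (X : dbl_data) (A B C D E F G H I J : ob X) (a : sq A B C D)
    (b : sq C D E F) (c : sq E F G H) (r : sq G H I J) d :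
  is_pseudodouble X -> a // (b // c) = d ->
  wf a -> wf b -> wf c -> wf r -> bot a = top b -> bot b = top c -> bot c = top r ->
  wf (b // c) -> bot (b // c) = bot c -> top (b // c) = top b ->
  a // (b // (c // r)) = d // r.
Proof.
  intros HX <- ? ? ? ? ? ? ? ? ? ?. symmetry.
  rewrite (sv_assoc HX) by congruence. now rewrite (sv_assoc HX) by congruence.
Qed.

(* [vr H] rewrites with [H : a // b = c] inside a right-nested vertical composite,
   [vrl H] with [H : c = a // b]. *)
Ltac vr_with a b e :=
  first [ rewrite e
        | match goal with |- context [sv a (sv b ?r)] =>
            rewrite (@sv_rew2 _ _ _ _ _ _ _ _ _ a b r _ ltac:(psd) e) by bd end ];
  clear e; asr.
Ltac vr H :=
  match goal with
  | |- context [sv ?a ?b] => let e := fresh in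
      eassert (e : sv a b = _) by (eapply H; bd); vr_with a b e
  | |- context [sv ?a (sv ?b ?r)] => let e := fresh in
      eassert (e : sv a b = _) by (eapply H; bd); vr_with a b e
  end.
Ltac vrl H :=
  match goal with
  | |- context [sv ?a ?b] => let e := fresh in
      eassert (e : sv a b = _) by (symmetry; eapply H; bd); vr_with a b e
  | |- context [sv ?a (sv ?b ?r)] => let e := fresh in
      eassert (e : sv a b = _) by (symmetry; eapply H; bd); vr_with a b e
  end.

(** * Naturality and unit coherence in a pseudodouble category *)

Section Laws.
Variables (X : dbl_data) (HX : is_pseudodouble X).

Lemma ich (A B C D E F G H K : ob X)
    (a : sq A B D E) (b : sq B C E F) (c : sq D E G H) (d : sq E F H K) :
  wf a -> wf b -> wf c -> wf d -> rgt a = lft b -> rgt c = lft d ->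
  bot a = top c -> bot b = top d ->
  (a || b) // (c || d) = (a // c) || (b // d).
Proof. apply (interchange HX). Qed.

Lemma lun_sq (A B A' B' : ob X) (a : sq A B A' B') f g u v :
  is_sq a f g u v -> (sidv u || a) // lun g = lun f // a.
Proof. intros H. rewrite <- (bot_of H), <- (top_of H), <- (lft_of H). apply (lun_nat HX), H. Qed.
Lemma run_sq (A B A' B' : ob X) (a : sq A B A' B') f g u v :
  is_sq a f g u v -> (a || sidv v) // run g = run f // a.
Proof. intros H. rewrite <- (bot_of H), <- (top_of H), <- (rgt_of H). apply (run_nat HX), H. Qed.
Lemma lun_glob (A B B' : ob X) (a : sq A B A B') f g v :
  is_sq a f g (vid A) v -> (sid (hid A) || a) // lun g = lun f // a.
Proof. intros H. rewrite <- (sidv_id HX). eapply lun_sq; bd. Qed.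
Lemma run_glob (A B A' : ob X) (a : sq A B A' B) f g u :
  is_sq a f g u (vid B) -> (a || sid (hid B)) // run g = run f // a.
Proof. intros H. rewrite <- (sidv_id HX). eapply run_sq; bd. Qed.
Lemma asc_sq (A B C D A' B' C' D' : ob X)
    (a : sq A B A' B') (b : sq B C B' C') (c : sq C D C' D')
    f f' g g' h h' u v w x :
  is_sq a f f' u v -> is_sq b g g' v w -> is_sq c h h' w x ->
  ((a || b) || c) // asc f' g' h' = asc f g h // (a || (b || c)).
Proof.
  intros H1 H2 H3. rewrite <- (bot_of H1), <- (bot_of H2), <- (bot_of H3),
    <- (top_of H1), <- (top_of H2), <- (top_of H3).
  apply (asc_nat HX); bd.
Qed.
Lemma ginv_nat (A B A' B' : ob X) (a : sq A B A' B') (i : sq A B A B) (j : sq A' B' A' B')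
    (b : sq A B A' B') f f' g g' u v :
  is_giso i f f' -> is_giso j g g' -> is_sq a f g u v -> is_sq b f' g' u v ->
  a // j = i // b -> b // ginv j = ginv i // a.
Proof.
  intros Hi Hj Ha Hb E. assert (H1 := giso_glob Hi). assert (H2 := giso_glob Hj).
  assert (H3 := ginv_glob Hi). assert (H4 := ginv_glob Hj).
  apply (giso_mono HX Hj); try bd. asr. rewrite E, (giso_l Hj).
  rewrite (sv_sid HX) by bd. rewrite <- (sv_assoc HX), (giso_l Hi), (sid_sv HX); bd.
Qed.
Lemma asc_sq_inv (A B C D A' B' C' D' : ob X)
    (a : sq A B A' B') (b : sq B C B' C') (c : sq C D C' D')
    f f' g g' h h' u v w x :
  is_sq a f f' u v -> is_sq b g g' v w -> is_sq c h h' w x ->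
  (a || (b || c)) // ginv (asc f' g' h') = ginv (asc f g h) // ((a || b) || c).
Proof.
  intros H1 H2 H3.
  apply ginv_nat with (1 := asc_ty HX f g h) (2 := asc_ty HX f' g' h') (u := u) (v := x);
    try bd. eapply asc_sq; bd.
Qed.

(** Naturality of the left unitor turns whiskering by [hid A] into conjugation with invertible
    cells. *)
Lemma sh_hid_faithful (A B B' : ob X) (s s' : sq A B A B') f g v v' :
  is_sq s f g (vid A) v -> is_sq s' f g (vid A) v' ->
  sid (hid A) || s = sid (hid A) || s' -> s = s'.
Proof.
  intros H H' E. apply (giso_epi HX (lun_ty HX f)); try bd.
  rewrite <- (lun_glob H), <- (lun_glob H'), E. reflexivity.
Qed.
Lemma hid_sh_faithful (A A' B : ob X) (s s' : sq A B A' B) f g u u' :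
  is_sq s f g u (vid B) -> is_sq s' f g u' (vid B) ->
  s || sid (hid B) = s' || sid (hid B) -> s = s'.
Proof.
  intros H H' E. apply (giso_epi HX (run_ty HX f)); try bd.
  rewrite <- (run_glob H), <- (run_glob H'), E. reflexivity.
Qed.

(** Kelly's argument that this unit law follows from pentagon and triangle. Whiskering by [hid A] is
    faithful, and after whiskering the pentagon at [hid A], [hid A], [f], [g] and two instances of
    the triangle give the equation. *)
Lemma asc_hid_lun (A B C : ob X) (f : hor A B) (g : hor B C) :
  asc (hid A) f g // lun (f *h g) = lun f || sid g.
Proof.
  eapply sh_hid_faithful; [bd|bd|].
  assert (Ha : is_giso ((asc (hid A) (hid A) f || sid g) // asc (hid A) (hid A *h f) g)
    (((hid A *h hid A) *h f) *h g) (hid A *h ((hid A *h f) *h g))).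
  { bd. }
  apply (giso_epi HX Ha); try bd.
  transitivity (((asc (hid A) (hid A) f || sid g) // asc (hid A) (hid A *h f) g
     // (sid (hid A) || asc (hid A) f g)) // (sid (hid A) || lun (f *h g))).
  { asr. rewrite (interchange HX) by bd. now rewrite (sid_sv HX) by bd. }
  rewrite <- (pentagon HX). asr. rewrite (triangle HX), (sid_hc HX).
  erewrite <- asc_sq by bd.
  erewrite <- asc_sq by bd. rewrite <- (sv_assoc HX) by bd. f_equal.
  rewrite (ich) by bd. rewrite (triangle HX), (sid_sv HX) by bd. reflexivity.
Qed.
Lemma asc_hid_run (A B C : ob X) (f : hor A B) (g : hor B C) :
  asc f g (hid C) // (sid f || run g) = run (f *h g).
Proof.
  eapply hid_sh_faithful; [bd|bd|].
  apply (giso_mono HX (asc_ty HX f g (hid C))); try bd.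
  transitivity ((asc f g (hid C) || sid (hid C)) //
    (asc f (g *h hid C) (hid C) // (sid f || (run g || sid (hid C))))).
  { erewrite <- asc_sq by bd. asr. rewrite <- (sv_assoc HX) by bd.
    rewrite ich by bd. now rewrite (sid_sv HX) by bd. }
  rewrite <- (triangle HX). rewrite <- (sid_sv HX (a := sid f) (f := f)) at 1 by bd.
  rewrite <- ich by bd. rewrite <- !(sv_assoc HX) by bd.
  rewrite <- (pentagon HX). asr.
  rewrite <- (triangle HX), (sid_hc HX). asr. f_equal. erewrite <- asc_sq by bd. reflexivity.
Qed.
(** Whiskered by [hid A] on the right, the two sides are [asc] followed by [lun (hid A *h hid A)]
    and by [sid (hid A) || lun (hid A)]. These agree by naturality of the left unitor at itself. *)
Lemma lun_hid_run (A : ob X) : lun (hid A) = run (hid A).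
Proof.
  eapply hid_sh_faithful; [bd|bd|].
  rewrite <- (triangle HX), <- asc_hid_lun. f_equal.
  apply (giso_mono HX (lun_ty HX (hid A))); try bd.
  erewrite <- lun_glob by bd. reflexivity.
Qed.
Lemma asc_hid_lun_inv (A B C : ob X) (f : hor A B) (g : hor B C) :
  ginv (asc (hid A) f g) // (lun f || sid g) = lun (f *h g).
Proof.
  rewrite <- asc_hid_lun, <- (sv_assoc HX) by bd. erewrite giso_l by gi.
  now rewrite (sid_sv HX) by bd.
Qed.
Lemma triangle_inv (A B C : ob X) (f : hor A B) (g : hor B C) :
  ginv (asc f (hid B) g) // (run f || sid g) = sid f || lun g.
Proof.
  rewrite <- (triangle HX), <- (sv_assoc HX) by bd. erewrite giso_l by gi.
  now rewrite (sid_sv HX) by bd.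
Qed.
End Laws.

Lemma ceps_sq (X : dbl_data) (A B : ob X) (u : ver A B) (c : companion u) :
  is_companion c -> is_sq (ceps c) (ch c) (hid B) u (vid B).
Proof. apply ceps_ty. Qed.
Lemma ciot_sq (X : dbl_data) (A B : ob X) (u : ver A B) (c : companion u) :
  is_companion c -> is_sq (ciot c) (hid A) (ch c) (vid A) u.
Proof. apply ciot_ty. Qed.
#[global] Hint Resolve ceps_sq ciot_sq : sqty.

(** * Companions *)

Section Companions.
Variables (X : dbl_data) (HX : is_pseudodouble X).

(** The horizontal triangle identity recovers [s]: pasting [ciot c] on the left turns
    [s // (ceps c || sid g)] into [s] between invertible cells. The left sides must agree because
    the pasting involves [sidv l]; the right sides may differ. *)
Lemma ceps_mono_sh (A B C A' B' : ob X) (u : ver A B) (c : companion u) (g : hor B C)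
    (s s' : sq A' B' A C) f l r r' :
  is_companion c ->
  is_sq s f (ch c *h g) l r -> is_sq s' f (ch c *h g) l r' ->
  s // (ceps c || sid g) = s' // (ceps c || sid g) -> s = s'.
Proof.
  intros Hc Hs Hs' E.
  pose (G := ginv (lun (ch c *h g)) // (ginv (asc (hid A) (ch c) g)
    // (((lun (ch c) // ginv (run (ch c))) || sid g) // asc (ch c) (hid B) g))).
  assert (HG : is_giso G (ch c *h g) (ch c *h (hid B *h g))) by (unfold G; bd).
  assert (R : forall s r, is_sq s f (ch c *h g) l r ->
    (sidv l // ciot c) || (s // (ceps c || sid g)) = lun f // (s // G)).
  { clear s s' r r' Hs Hs' E. intros s r Hs. rewrite <- (ich HX) by bd.
    assert (E : ciot c || (ceps c || sid g)
      = ginv (asc (hid A) (ch c) g)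
        // (((lun (ch c) // ginv (run (ch c))) || sid g) // asc (ch c) (hid B) g)).
    { rewrite <- (ciot_ceps_h Hc). erewrite (asc_sq HX) by bd.
      rewrite <- (sv_assoc HX) by bd. erewrite giso_l by gi. now rewrite (sid_sv HX) by bd. }
    rewrite E. unfold G.
    assert (E0 : sidv l || s = lun f // (s // ginv (lun (ch c *h g)))).
    { rewrite <- (sv_assoc HX) by bd. erewrite <- (lun_sq HX) by bd. asr.
      erewrite giso_r by gi. now rewrite (sv_sid HX) by bd. }
    rewrite E0. asr. reflexivity. }
  assert (E' := R _ _ Hs). rewrite E, (R _ _ Hs') in E'.
  apply (giso_epi HX (lun_ty HX f)) in E'; try bd.
  apply (giso_mono HX HG) in E'; try bd.
Qed.

Lemma ceps_mono (A B A' B' : ob X) (u : ver A B) (c : companion u)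
    (s s' : sq A' B' A B) f l r r' :
  is_companion c ->
  is_sq s f (ch c) l r -> is_sq s' f (ch c) l r' ->
  s // ceps c = s' // ceps c -> s = s'.
Proof.
  intros Hc Hs Hs' E.
  apply (giso_mono HX (giso_inv (run_ty HX (ch c)))); try bd.
  eapply ceps_mono_sh with (g := hid B) (l := l); [exact Hc | bd | bd |].
  apply (giso_mono HX (run_ty HX (hid B))); try bd.
  asr.
  assert (E' : (ceps c || sid (hid B)) // run (hid B) = run (ch c) // ceps c)
   by (eapply run_glob; bd).
  rewrite E'. rewrite <- !(sv_assoc HX (a := ginv _)) by bd.
  erewrite giso_l by gi. now rewrite (sid_sv HX) by bd.
Qed.

(** Mirror image for the unit: pasting the counit on the right recovers [s], so the right sides must
    agree and the left ones may differ. This is the source of the epic cells of the Kleisli part. *)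
Lemma ciot_epi_sh (A B D C E : ob X) (u : ver A B) (c : companion u) (f : hor D A)
    (s s' : sq D B C E) g l l' w :
  is_companion c ->
  is_sq s (f *h ch c) g l w -> is_sq s' (f *h ch c) g l' w ->
  (sid f || ciot c) // s = (sid f || ciot c) // s' -> s = s'.
Proof.
  intros Hc Hs Hs' E0.
  pose (G := asc f (hid A) (ch c) // (sid f || (lun (ch c) // ginv (run (ch c))))
    // ginv (asc f (ch c) (hid B))).
  assert (HG : is_giso G ((f *h hid A) *h ch c) ((f *h ch c) *h hid B)) by (unfold G; bd).
  assert (R : forall s l, is_sq s (f *h ch c) g l w ->
    ((sid f || ciot c) // s) || (ceps c // sidv w) = G // (run (f *h ch c) // s // ginv (run g))).
  { clear s s' l l' Hs Hs' E0. intros s l Hs. rewrite <- (ich HX) by bd.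
    assert (E0 : (sid f || ciot c) || ceps c = G).
    { unfold G. rewrite <- (ciot_ceps_h Hc). erewrite <- (asc_sq HX) by bd.
      asr. erewrite giso_r by gi. now rewrite (sv_sid HX) by bd. }
    rewrite E0. f_equal. erewrite <- (run_sq HX) by bd. asr.
    erewrite giso_r by gi. now rewrite (sv_sid HX) by bd. }
  assert (E' := R _ _ Hs). rewrite E0, (R _ _ Hs') in E'.
  apply (giso_epi HX HG) in E'; try bd.
  apply (giso_mono HX (giso_inv (run_ty HX g))) in E'; try bd.
  apply (giso_epi HX (run_ty HX _)) in E'; bd.
Qed.

Lemma c_id_ok (A : ob X) : is_companion (c_id A).
Proof.
  split; cbn; try bd.
  - rewrite <- (sid_hc HX), (lun_hid_run HX). now erewrite giso_r by gi.
  - rewrite (sid_sv HX) by bd. symmetry. apply (sidv_id HX).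
Qed.

Lemma sh_split (A B C D E : ob X) (a : sq A B D B) (b : sq B C B E) f h g k u w :
  is_sq a f h u (vid B) -> is_sq b g k (vid B) w ->
  a || b = (a || sid g) // (sid h || b).
Proof.
  intros Ha Hb. rewrite (ich HX) by bd. now rewrite (sv_sid HX), (sid_sv HX) by bd.
Qed.

(* A vertically composable pair is a companion as soon as the counit is monic. *)
Lemma companion_of_mono (A B : ob X) (u : ver A B) (c : companion u) :
  is_sq (ceps c) (ch c) (hid B) u (vid B) ->
  is_sq (ciot c) (hid A) (ch c) (vid A) u ->
  ciot c // ceps c = sidv u ->
  (forall s s' f, is_glob s f (ch c) -> is_glob s' f (ch c) ->
    s // ceps c = s' // ceps c -> s = s') ->
  is_companion c.
Proof.
  intros He Hi E M. split; trivial.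
  apply (giso_mono HX (run_ty HX (ch c))); try bd.
  rewrite (sv_assoc HX) by bd. erewrite giso_l by gi. rewrite (sv_sid HX) by bd.
  apply M with (hid A *h ch c); try bd.
  asr. erewrite <- (run_glob HX) by bd. rewrite <- (sv_assoc HX), (ich HX), E by bd.
  rewrite (sv_sid HX), <- (lun_hid_run HX) by bd. eapply lun_sq; bd.
Qed.

(** Only the vertical identity is computed. The horizontal one follows through [companion_of_mono],
    since the counit of the composite is monic when the two counits are. *)
Lemma c_comp_ok (A B C : ob X) (u : ver A B) (v : ver B C) (c : companion u)
    (d : companion v) : is_companion c -> is_companion d -> is_companion (c_comp c d).
Proof.
  intros Hc Hd. apply companion_of_mono; cbn; try bd.
  - asr. rewrite <- (sv_assoc HX (a := _ || _) (b := _ || _)) by bd.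
    rewrite (ich HX), (sid_sv HX), (sv_sid HX) by bd.
    erewrite (@sh_split _ _ _ _ _ (ceps c)) by bd. asr.
    rewrite <- (sv_assoc HX (b := lun _)) by bd.
    erewrite (lun_glob HX (a := ciot d)) by bd. rewrite (lun_hid_run HX).
    asr. rewrite <- (sv_assoc HX (b := run _)) by bd.
    erewrite (run_glob HX (a := ceps c)) by bd.
    asr. rewrite <- (sv_assoc HX (b := run _)) by bd.
    erewrite giso_l by gi. rewrite (sid_sv HX) by bd.
    rewrite (ciot_ceps_v Hd), <- (sv_assoc HX), (ciot_ceps_v Hc) by bd.
    symmetry; apply (sidv_vc HX).
  - intros s s' f Hs Hs' E. revert E. asr. intros E.
    eapply ceps_mono_sh; [exact Hc | exact Hs | exact Hs' |].
    apply (giso_mono HX (lun_ty HX (ch d))); try bd.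
    eapply ceps_mono with (1 := Hd); [bd|bd|]. asr. exact E.
Qed.
End Companions.

(** * Companions under functors, products and bifunctors *)

Section Functors.
Variables (X Y : dbl_data) (HX : is_pseudodouble X) (HY : is_pseudodouble Y).
Variables (F0 : ob X -> ob Y) (F : functor F0) (HF : is_functor F).

Lemma fc_sq (A B C A' B' C' : ob X) (a : sq A B A' B') (b : sq B C B' C')
    f f' g g' u v w :
  is_sq a f f' u v -> is_sq b g g' v w ->
  (fs F a || fs F b) // fc F f' g' = fc F f g // fs F (a || b).
Proof.
  intros Ha Hb. rewrite <- (bot_of Ha), <- (bot_of Hb), <- (top_of Ha), <- (top_of Hb).
  apply (fc_nat HF); bd.
Qed.
Lemma fs_giso (A B : ob X) (a : sq A B A B) f g :
  is_giso a f g -> is_giso (fs F a) (fh F f) (fh F g).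
Proof.
  intros Ha. assert (H1 := giso_glob Ha). assert (H2 := ginv_glob Ha).
  exists (fs F (ginv a)). split; [|split; [|split]]; try bd;
    rewrite <- (fs_sv HF) by bd; rewrite <- (fs_sid HF); f_equal.
  - apply (giso_r Ha).
  - apply (giso_l Ha).
Qed.
End Functors.
#[global] Hint Extern 2 (is_giso (fs _ _) _ _) => eapply fs_giso; [psd | gi] : giso.

Section FunctorCompanion.
Variables (X Y : dbl_data) (HX : is_pseudodouble X) (HY : is_pseudodouble Y).
Variables (F0 : ob X -> ob Y) (F : functor F0) (HF : is_functor F).

(** The unit laws [fc_lun] and [fc_run] absorb the units of [F] contained in the counit and unit of
    [c_fun]; what is left is the image under [F] of the horizontal identity of [c], carried across
    the compositor. *)
Lemma c_fun_ok (A B : ob X) (u : ver A B) (c : companion u) :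
  is_companion c -> is_companion (c_fun F c).
Proof.
  intros Hc. split; cbn; try bd.
  - apply (giso_mono HY (run_ty HY (fh F (ch c)))); try bd.
    rewrite (sv_assoc HY (b := ginv _)) by bd. erewrite giso_l by gi.
    rewrite (sv_sid HY) by bd.
    rewrite <- (fc_lun HF (ch c)), <- (fc_run HF (ch c)).
    assert (E : ((fu F A // fs F (ciot c)) || (fs F (ceps c) // ginv (fu F B)))
        // (sid (fh F (ch c)) || fu F B)
      = (fu F A || sid (fh F (ch c))) // (fs F (ciot c) || fs F (ceps c))).
    { rewrite !(ich HY) by bd. asr. erewrite giso_l by gi.
      now rewrite (sv_sid HY), (sv_sid HY), (sid_sv HY) by bd. }
    rewrite (sv_assoc HY (b := fc _ _ _)), <- (sv_assoc HY (b := sid _ || fu _ _)), E by bd.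
    asr. rewrite <- (sv_assoc HY (b := fc _ _ _)) by bd.
    erewrite (fc_sq HF) by bd. rewrite (ciot_ceps_h Hc).
    asr. rewrite <- (fs_sv HF) by bd. asr.
    erewrite giso_l by gi. now rewrite (sv_sid HX) by bd.
  - asr. rewrite <- (sv_assoc HY (b := fs F (ceps c))) by bd.
    rewrite <- (fs_sv HF), (ciot_ceps_v Hc) by bd.
    rewrite <- (sv_assoc HY) by bd. rewrite <- (fu_nat HF). asr.
    erewrite giso_r by gi. now rewrite (sv_sid HY) by bd.
Qed.
End FunctorCompanion.

Section Product.
Variables (X Y : dbl_data) (HX : is_pseudodouble X) (HY : is_pseudodouble Y).

Lemma is_sq_prod (A B C D : ob (dbl_prod X Y)) (a : sq A B C D) f g u v :
  is_sq (fst a) (fst f) (fst g) (fst u) (fst v) ->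
  is_sq (snd a) (snd f) (snd g) (snd u) (snd v) -> is_sq a f g u v.
Proof.
  intros (? & ? & ? & ? & ?) (? & ? & ? & ? & ?). destruct f, g, u, v; cbn in *.
  repeat split; cbn; trivial; congruence.
Qed.
Lemma sq_pair (A B C D : ob X) (A' B' C' D' : ob Y) (a : sq A B C D)
    (c : sq A' B' C' D') f g u v f' g' u' v' :
  is_sq a f g u v -> is_sq c f' g' u' v' ->
  @is_sq (dbl_prod X Y) (A, A') (B, B') (C, C') (D, D') (a, c)
    (f, f') (g, g') (u, u') (v, v').
Proof. intros H H'. now apply is_sq_prod. Qed.
Lemma is_sq_fst (A B C D : ob (dbl_prod X Y)) (a : sq A B C D) f g u v :
  is_sq a f g u v -> is_sq (fst a) (fst f) (fst g) (fst u) (fst v).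
Proof. intros (? & <- & <- & <- & <-). repeat split; now destruct H. Qed.
Lemma is_sq_snd (A B C D : ob (dbl_prod X Y)) (a : sq A B C D) f g u v :
  is_sq a f g u v -> is_sq (snd a) (snd f) (snd g) (snd u) (snd v).
Proof. intros (? & <- & <- & <- & <-). repeat split; now destruct H. Qed.
Lemma inv_glob_prod (A B : ob (dbl_prod X Y)) (a b : sq A B A B) f g :
  inv_glob (fst a) (fst b) (fst f) (fst g) -> inv_glob (snd a) (snd b) (snd f) (snd g) ->
  inv_glob a b f g.
Proof.
  intros (H1 & H2 & H3 & H4) (H5 & H6 & H7 & H8).
  split; [|split; [|split]]; try (now apply is_sq_prod); cbn; congruence.
Qed.
Lemma is_giso_prod (A B : ob (dbl_prod X Y)) (a : sq A B A B) f g :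
  is_giso (fst a) (fst f) (fst g) -> is_giso (snd a) (snd f) (snd g) -> is_giso a f g.
Proof.
  intros [b Hb] [b' Hb']. exists (b, b'). now apply inv_glob_prod.
Qed.
Lemma giso_pair (A B : ob X) (A' B' : ob Y) (a : sq A B A B) (c : sq A' B' A' B') f g f' g' :
  is_giso a f g -> is_giso c f' g' ->
  @is_giso (dbl_prod X Y) (A, A') (B, B') (a, c) (f, f') (g, g').
Proof. intros H H'. now apply is_giso_prod. Qed.
Lemma prod_pseudodouble : is_pseudodouble (dbl_prod X Y).
Proof.
  split; intros; repeat match goal with H : is_sq _ _ _ _ _ |- _ =>
    pose proof (is_sq_fst H); pose proof (is_sq_snd H); clear H end;
   repeat match goal with H : wf _ |- _ => destruct H end;
   repeat match goal with H : @eq (hor _ _) _ _ |- _ => cbn in H; injection H as ? ? end;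
   repeat match goal with H : @eq (ver _ _) _ _ |- _ => cbn in H; injection H as ? ? end.
  all: cbn in * |-.
  - cbn; f_equal; apply vc_assoc'; trivial.
  - destruct u; cbn; f_equal; apply vc_idl'; trivial.
  - destruct u; cbn; f_equal; apply vc_idr'; trivial.
  - apply is_sq_prod; cbn; bd.
  - apply is_sq_prod; cbn; bd.
  - apply is_sq_prod; cbn; bd.
  - apply is_sq_prod; cbn; bd.
  - cbn; f_equal; apply sv_assoc'; trivial.
  - destruct a; cbn; f_equal; apply sid_sv; trivial.
  - destruct a; cbn; f_equal; apply sv_sid; trivial.
  - cbn; f_equal; apply ich; trivial.
  - cbn; f_equal; apply sid_hc; trivial.
  - cbn; f_equal; apply sidv_vc; trivial.
  - cbn; f_equal; apply sidv_id; trivial.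
  - apply is_giso_prod; cbn; bd.
  - apply is_giso_prod; cbn; bd.
  - apply is_giso_prod; cbn; bd.
  - cbn; f_equal; apply asc_nat; trivial.
  - cbn; f_equal; apply lun_nat; trivial.
  - cbn; f_equal; apply run_nat; trivial.
  - cbn; f_equal; apply pentagon; trivial.
  - cbn; f_equal; apply triangle; trivial.
Qed.
End Product.
#[global] Hint Resolve prod_pseudodouble : psd.

Lemma ginv_pair (X Y : dbl_data) (HX : is_pseudodouble X) (HY : is_pseudodouble Y)
    (A B : ob X) (A' B' : ob Y) (a : sq A B A B) (b : sq A' B' A' B') f g f' g' :
  is_giso a f g -> is_giso b f' g' ->
  @ginv (dbl_prod X Y) (A, A') (B, B') (a, b) = (ginv a, ginv b).
Proof.
  intros Ha Hb. apply (ginv_unique (prod_pseudodouble HX HY)) with (f, f') (g, g').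
  apply inv_glob_prod; cbn; now apply ginv_spec.
Qed.

Lemma pair_ok (X Y : dbl_data) (HX : is_pseudodouble X) (HY : is_pseudodouble Y)
    (A A' : ob X) (C C' : ob Y)
    (u : ver A A') (v : ver C C') (c : companion u) (d : companion v) :
  is_companion c -> is_companion d ->
  is_companion (@Companion (dbl_prod X Y) (A, C) (A', C') (u, v)
      (ch c, ch d) (ceps c, ceps d) (ciot c, ciot d)).
Proof.
  intros Hc Hd. split; cbn.
  - apply is_sq_prod; cbn; bd.
  - apply is_sq_prod; cbn; bd.
  - erewrite ginv_pair by bd. now rewrite (ciot_ceps_h Hc), (ciot_ceps_h Hd).
  - now rewrite (ciot_ceps_v Hc), (ciot_ceps_v Hd).
Qed.

Lemma c_bifun_ok (X Y Z : dbl_data) (HX : is_pseudodouble X) (HY : is_pseudodouble Y)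
    (HZ : is_pseudodouble Z)
    (B0 : ob X -> ob Y -> ob Z) (B : @functor (dbl_prod X Y) Z (op2 B0))
    (HB : is_functor B) (A A' : ob X) (C C' : ob Y)
    (u : ver A A') (v : ver C C') (c : companion u) (d : companion v) :
  is_companion c -> is_companion d -> is_companion (c_bifun B c d).
Proof.
  intros Hc Hd. unfold c_bifun.
  exact (@c_fun_ok (dbl_prod X Y) Z (prod_pseudodouble HX HY) HZ _ B HB
    (A, C) (A', C') (u, v) _ (pair_ok HX HY Hc Hd)).
Qed.
#[global] Hint Resolve c_id_ok c_comp_ok c_fun_ok c_bifun_ok : sqty giso.
#[global] Hint Extern 5 (is_pseudodouble _) => psd : sqty.
#[global] Hint Extern 5 (is_functor _) => psd : sqty.
#[global] Hint Extern 5 (is_functor _) => psd : giso.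

Create HintDb comp.
Ltac cok :=
  lazymatch goal with
  | |- is_companion (@c_comp ?X ?A ?B ?C ?u ?v ?c ?d) =>
      refine (@c_comp_ok X _ A B C u v c d _ _); [psd | cok | cok]
  | |- is_companion (@c_bifun ?X ?Y ?Z ?B0 ?B ?A ?A' ?C ?C' ?u ?v ?c ?d) =>
      refine (@c_bifun_ok X Y Z _ _ _ B0 B _ A A' C C' u v c d _ _);
      [psd | psd | psd | psd | cok | cok]
  | |- is_companion (@c_fun ?X ?Y ?F0 ?F ?A ?B ?u ?c) =>
      refine (@c_fun_ok X Y _ _ F0 F _ A B u c _); [psd | psd | psd | cok]
  | |- is_companion (@c_id ?X ?A) => refine (@c_id_ok X _ A); psd
  | |- is_companion (_ ?x) =>
      first [eassumption | match goal with H : _ |- _ => exact (H x) end | solve [auto with comp]]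
  | |- _ => first [eassumption | solve [auto with comp]]
  end.

#[global] Hint Extern 1 (is_companion _) => cok : psd.

(** * Lifts of equalities of 1v-cells *)

(* [s] is the canonical globular cell between companions of equal 1v-cells. *)
Definition lifts (X : dbl_data) (A B : ob X) (u v : ver A B)
    (c : companion u) (d : companion v) (s : sq A B A B) : Prop :=
  is_glob s (ch d) (ch c) /\ s // ceps c = ceps d.

Section Lifts.
Variables (X : dbl_data) (HX : is_pseudodouble X).

Section Generalities.
Variables (A B : ob X).
Implicit Types (u v w : ver A B).

Lemma lifts_glob u v (c : companion u) (d : companion v) s :
  lifts c d s -> is_glob s (ch d) (ch c).
Proof. now intros [? ?]. Qed.
(** The counits have [u] and [v] as their left sides, and composing with a globular cell does not
    change a left side. *)
Lemma lifts_ver u v (c : companion u) (d : companion v) s :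
  is_companion c -> is_companion d -> lifts c d s -> u = v.
Proof.
  intros Hc Hd [Hs E]. assert (E' : lft (s // ceps c) = v) by (rewrite E; bd).
  rewrite <- E'. symmetry; bd.
Qed.
Lemma lifts_unique u v (c : companion u) (d : companion v) s s' :
  is_companion c -> lifts c d s -> lifts c d s' -> s = s'.
Proof.
  intros Hc [Hs E] [Hs' E']. eapply ceps_mono; [exact HX | exact Hc | exact Hs | exact Hs' |].
  now rewrite E, E'.
Qed.
Lemma lifts_refl u (c : companion u) : is_companion c -> lifts c c (sid (ch c)).
Proof. intros Hc. split; [bd|]. now rewrite (sid_sv HX) by bd. Qed.
Lemma lifts_trans u v w (c : companion u) (d : companion v) (e : companion w) s r :
  is_companion c -> lifts d e r -> lifts c d s -> lifts c e (r // s).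
Proof.
  intros Hc [Hs E] [Hr E']. split; [bd|]. rewrite (sv_assoc HX) by bd. now rewrite E'.
Qed.
Lemma lift_eq_lifts u v (c : companion u) (d : companion v) :
  is_companion c -> is_companion d -> u = v -> lifts c d (lift_eq c d).
Proof.
  intros Hc Hd <-. unfold lift_eq. split; [bd|].
  asr. erewrite <- (run_glob HX) by bd. rewrite <- (sv_assoc HX (a := _ || _)) by bd.
  rewrite (ich HX), (ciot_ceps_v Hc), (sv_sid HX), <- (lun_hid_run HX) by bd.
  erewrite (lun_sq HX) by bd. rewrite <- (sv_assoc HX) by bd.
  erewrite giso_l by gi. now rewrite (sid_sv HX) by bd.
Qed.
(** The inverse is the lift of the reversed equality: both composites lift a reflexive equality,
    hence are identities by uniqueness. *)
Lemma lifts_giso u v (c : companion u) (d : companion v) s :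
  is_companion c -> is_companion d -> lifts c d s -> is_giso s (ch d) (ch c).
Proof.
  intros Hc Hd H. assert (E := lifts_ver Hc Hd H).
  assert (H' := lift_eq_lifts Hd Hc (eq_sym E)).
  exists (lift_eq d c). split; [|split; [|split]].
  - apply H.
  - apply H'.
  - eapply lifts_unique with (c := d) (d := d); trivial; [|now apply lifts_refl].
    now apply lifts_trans with (d := c).
  - eapply lifts_unique with (c := c) (d := c); trivial; [|now apply lifts_refl].
    now apply lifts_trans with (d := d).
Qed.
Lemma lifts_sym u v (c : companion u) (d : companion v) s :
  is_companion c -> is_companion d -> lifts c d s -> lifts d c (ginv s).
Proof.
  intros Hc Hd H. assert (Hg := lifts_giso Hc Hd H). destruct H as [Hs E].
  split; [bd|]. rewrite <- E, <- (sv_assoc HX) by bd. rewrite (giso_l Hg).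
  now rewrite (sid_sv HX) by bd.
Qed.
End Generalities.

Lemma lifts_sh (A B C : ob X) (u v : ver A B) (u' v' : ver B C)
    (c : companion u) (d : companion v) (c' : companion u') (d' : companion v') s s' :
  is_companion c -> is_companion d -> is_companion c' -> is_companion d' ->
  lifts c d s -> lifts c' d' s' -> lifts (c_comp c c') (c_comp d d') (s || s').
Proof.
  intros Hc Hd Hc' Hd' [Hs E] [Hs' E']. split; cbn; [bd|]. asr.
  rewrite <- (sv_assoc HX (a := _ || _)), (ich HX), (sv_sid HX), E by bd.
  erewrite sh_split by bd. asr.
  rewrite <- (sv_assoc HX (a := sid _ || _)) by bd. erewrite (lun_glob HX) by bd.
  asr. now rewrite E'.
Qed.
Lemma lifts_whl (A B C : ob X) (u : ver A B) (u' v' : ver B C)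
    (c : companion u) (c' : companion u') (d' : companion v') s' :
  is_companion c -> is_companion c' -> is_companion d' ->
  lifts c' d' s' -> lifts (c_comp c c') (c_comp c d') (sid (ch c) || s').
Proof. intros Hc Hc' Hd' H. apply lifts_sh; trivial. now apply lifts_refl. Qed.
Lemma lifts_whr (A B C : ob X) (u v : ver A B) (u' : ver B C)
    (c : companion u) (d : companion v) (c' : companion u') s :
  is_companion c -> is_companion d -> is_companion c' ->
  lifts c d s -> lifts (c_comp c c') (c_comp d c') (s || sid (ch c')).
Proof. intros Hc Hd Hc' H. apply lifts_sh; trivial. now apply lifts_refl. Qed.
(** The counit of a composite contains a left unitor, and moving the associator past it is exactly
    the derived law [asc_hid_lun]. *)
Lemma lifts_asc (A B C D : ob X) (u : ver A B) (v : ver B C) (w : ver C D)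
    (c : companion u) (d : companion v) (e : companion w) :
  is_companion c -> is_companion d -> is_companion e ->
  lifts (c_comp c (c_comp d e)) (c_comp (c_comp c d) e) (asc (ch c) (ch d) (ch e)).
Proof.
  intros Hc Hd He. split; cbn; [bd|]. rewrite (sid_hc HX).
  asr. rewrite <- (sv_assoc HX (a := asc _ _ _)) by bd. erewrite <- (asc_sq HX) by bd.
  asr. rewrite <- (sv_assoc HX (b := lun (_ *h _))), (asc_hid_lun HX) by bd.
  rewrite <- (sv_assoc HX (b := lun _ || _)) by bd. rewrite (ich HX) by bd.
  rewrite <- (sv_assoc HX (b := ceps d || _)) by bd. rewrite (ich HX) by bd.
  rewrite !(sv_sid HX) by bd. asr. reflexivity.
Qed.
Lemma lifts_lun (A B : ob X) (u : ver A B) (c : companion u) :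
  is_companion c -> lifts c (c_comp (c_id A) c) (lun (ch c)).
Proof.
  intros Hc. split; cbn; [bd|]. rewrite <- (sid_hc HX), (sid_sv HX); bd.
Qed.
End Lifts.

Section FunctorLifts.
Variables (X Y : dbl_data) (HX : is_pseudodouble X) (HY : is_pseudodouble Y).
Variables (F0 : ob X -> ob Y) (F : functor F0) (HF : is_functor F).

Lemma lifts_fs (A B : ob X) (u v : ver A B) (c : companion u) (d : companion v) s :
  is_companion c -> is_companion d -> lifts c d s ->
  lifts (c_fun F c) (c_fun F d) (fs F s).
Proof.
  intros Hc Hd [Hs E]. split; cbn; [bd|].
  now rewrite <- (sv_assoc HY), <- (fs_sv HF), E by bd.
Qed.
Lemma lifts_fu (A : ob X) : lifts (c_fun F (c_id A)) (c_id (F0 A)) (fu F A).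
Proof.
  split; cbn; [bd|]. rewrite (fs_sid HF), (sid_sv HY) by bd. eapply giso_r; gi.
Qed.
(** Compositors at companions thereby join the cells governed by uniqueness. The unit inside
    [c_fun F d] is cancelled by the left unit law of [F]. *)
Lemma lifts_fc (A B C : ob X) (u : ver A B) (v : ver B C)
    (c : companion u) (d : companion v) :
  is_companion c -> is_companion d ->
  lifts (c_fun F (c_comp c d)) (c_comp (c_fun F c) (c_fun F d)) (fc F (ch c) (ch d)).
Proof.
  intros Hc Hd. split; cbn; [bd|]. rewrite !(fs_sv HF) by bd. asr.
  rewrite <- (sv_assoc HY (a := fc _ _ _)) by bd. erewrite <- (fc_sq HF) by bd.
  rewrite (fs_sid HF). asr. rewrite <- (fc_lun HF (ch d)). asr.
  rewrite <- (sv_assoc HY (b := fu _ _ || _)) by bd. rewrite (ich HY) by bd.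
  asr. erewrite giso_l by gi. rewrite (sv_sid HY), (sid_sv HY) by bd. reflexivity.
Qed.
End FunctorLifts.

Section Bifunctors.
Variables (X Y Z : dbl_data) (HX : is_pseudodouble X) (HY : is_pseudodouble Y)
  (HZ : is_pseudodouble Z).
Variables (B0 : ob X -> ob Y -> ob Z) (B : @functor (dbl_prod X Y) Z (op2 B0)).
Hypothesis HB : is_functor B.

Lemma bv_vid (A : ob X) (C : ob Y) : bv B (vid A) (vid C) = vid (B0 A C).
Proof. exact (fv_vid HB (A, C)). Qed.
Lemma bv_vc (A A' A'' : ob X) (C C' C'' : ob Y) (u : ver A A') (u' : ver A' A'')
    (v : ver C C') (v' : ver C' C'') :
  bv B (u *v u') (v *v v') = bv B u v *v bv B u' v'.
Proof. exact (@fv_vc _ _ _ _ HB (A, C) (A', C') (A'', C'') (u, v) (u', v')). Qed.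
Lemma bs_ty (A1 A2 A3 A4 : ob X) (C1 C2 C3 C4 : ob Y) (a : sq A1 A2 A3 A4)
    (c : sq C1 C2 C3 C4) f g u v f' g' u' v' :
  is_sq a f g u v -> is_sq c f' g' u' v' ->
  is_sq (bs B a c) (bh B f f') (bh B g g') (bv B u u') (bv B v v').
Proof.
  intros Ha Hc.
  exact (@fs_ty _ _ _ _ HB (A1, C1) (A2, C2) (A3, C3) (A4, C4) (a, c) (f, f') (g, g')
    (u, u') (v, v') (sq_pair Ha Hc)).
Qed.
Lemma bs_sid (A A' : ob X) (C C' : ob Y) (f : hor A A') (g : hor C C') :
  bs B (sid f) (sid g) = sid (bh B f g).
Proof. exact (@fs_sid _ _ _ _ HB (A, C) (A', C') (f, g)). Qed.
Lemma bs_sv (A B' C D E F : ob X) (A' B'' C' D' E' F' : ob Y) (a : sq A B' C D)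
    (b : sq C D E F) (a' : sq A' B'' C' D') (b' : sq C' D' E' F') :
  wf a -> wf b -> bot a = top b -> wf a' -> wf b' -> bot a' = top b' ->
  bs B (a // b) (a' // b') = bs B a a' // bs B b b'.
Proof.
  intros Ha Hb E1 Ha' Hb' E2.
  apply (@fs_sv _ _ _ _ HB (A, A') (B', B'') (C, C') (D, D') (E, E') (F, F') (a, a') (b, b'));
   cbn; try split; trivial. now rewrite E1, E2.
Qed.
Lemma bs_giso (A A' : ob X) (C C' : ob Y) (a : sq A A' A A') (c : sq C C' C C') f g f' g' :
  is_giso a f g -> is_giso c f' g' -> is_giso (bs B a c) (bh B f f') (bh B g g').
Proof.
  intros Ha Hc.
  exact (@fs_giso (dbl_prod X Y) Z _ B HB (A, C) (A', C') (a, c) (f, f') (g, g')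
    (giso_pair Ha Hc)).
Qed.
Lemma bc_ty (A A' A'' : ob X) (C C' C'' : ob Y) (f : hor A A') (g : hor C C')
    (f' : hor A' A'') (g' : hor C' C'') :
  is_giso (bc B f g f' g') (bh B f g *h bh B f' g') (bh B (f *h f') (g *h g')).
Proof. exact (@fc_ty _ _ _ _ HB (A, C) (A', C') (A'', C'') (f, g) (f', g')). Qed.
Lemma bu_ty (A : ob X) (C : ob Y) :
  is_giso (bu B A C) (hid (B0 A C)) (bh B (hid A) (hid C)).
Proof. exact (fu_ty HB (A, C)). Qed.
Lemma bc_sq (A1 A2 A3 A1' A2' A3' : ob X) (C1 C2 C3 C1' C2' C3' : ob Y)
    (a : sq A1 A2 A1' A2') (b : sq A2 A3 A2' A3')
    (c : sq C1 C2 C1' C2') (d : sq C2 C3 C2' C3') f f' g g' h h' k k' u v w u' v' w' :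
  is_sq a f f' u v -> is_sq b g g' v w -> is_sq c h h' u' v' -> is_sq d k k' v' w' ->
  (bs B a c || bs B b d) // bc B f' h' g' k' = bc B f h g k // bs B (a || b) (c || d).
Proof.
  intros Ha Hb Hc Hd.
  exact (@fc_sq (dbl_prod X Y) Z _ B HB (A1, C1) (A2, C2) (A3, C3) (A1', C1') (A2', C2')
    (A3', C3') (a, c) (b, d) (f, h) (f', h') (g, k) (g', k') (u, u') (v, v') (w, w')
    (sq_pair Ha Hc)
    (sq_pair Hb Hd)).
Qed.
Lemma bu_nat (A A' : ob X) (C C' : ob Y) (u : ver A A') (v : ver C C') :
  sidv (bv B u v) // bu B A' C' = bu B A C // bs B (sidv u) (sidv v).
Proof. exact (@fu_nat _ _ _ _ HB (A, C) (A', C') (u, v)). Qed.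
Lemma bc_asc (A1 A2 A3 A4 : ob X) (C1 C2 C3 C4 : ob Y)
    (f : hor A1 A2) (g : hor A2 A3) (h : hor A3 A4)
    (f' : hor C1 C2) (g' : hor C2 C3) (h' : hor C3 C4) :
  (bc B f f' g g' || sid (bh B h h')) // bc B (f *h g) (f' *h g') h h'
    // bs B (asc f g h) (asc f' g' h')
  = asc (bh B f f') (bh B g g') (bh B h h')
    // (sid (bh B f f') || bc B g g' h h') // bc B f f' (g *h h) (g' *h h').
Proof. exact (@fc_asc _ _ _ _ HB (A1, C1) (A2, C2) (A3, C3) (A4, C4) (f, f') (g, g') (h, h')). Qed.
Lemma bc_lun (A A' : ob X) (C C' : ob Y) (f : hor A A') (g : hor C C') :
  (bu B A C || sid (bh B f g)) // bc B (hid A) (hid C) f g // bs B (lun f) (lun g)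
  = lun (bh B f g).
Proof. exact (@fc_lun _ _ _ _ HB (A, C) (A', C') (f, g)). Qed.
Lemma bc_run (A A' : ob X) (C C' : ob Y) (f : hor A A') (g : hor C C') :
  (sid (bh B f g) || bu B A' C') // bc B f g (hid A') (hid C') // bs B (run f) (run g)
  = run (bh B f g).
Proof. exact (@fc_run _ _ _ _ HB (A, C) (A', C') (f, g)). Qed.

Lemma lifts_bs (A A' : ob X) (C C' : ob Y) (u v : ver A A') (u' v' : ver C C')
    (c : companion u) (d : companion v) (c' : companion u') (d' : companion v') s s' :
  is_companion c -> is_companion d -> is_companion c' -> is_companion d' ->
  lifts c d s -> lifts c' d' s' -> lifts (c_bifun B c c') (c_bifun B d d') (bs B s s').
Proof.
  intros Hc Hd Hc' Hd' [H1 E] [H2 E'].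
  exact (lifts_fs HZ HB
    (A := (A, C)) (B := (A', C')) (u := (u, u')) (v := (v, v')) (s := (s, s'))
    (pair_ok HX HY Hc Hc') (pair_ok HX HY Hd Hd')
    (conj (sq_pair H1 H2) (f_equal2 pair E E'))).
Qed.
Lemma lifts_bu (A : ob X) (C : ob Y) :
  lifts (c_bifun B (c_id A) (c_id C)) (c_id (B0 A C)) (bu B A C).
Proof. exact (lifts_fu HZ HB (A, C)). Qed.
Lemma lifts_bc (A A' A'' : ob X) (C C' C'' : ob Y) (u : ver A A') (v : ver C C')
    (u' : ver A' A'') (v' : ver C' C'')
    (c : companion u) (d : companion v) (c' : companion u') (d' : companion v') :
  is_companion c -> is_companion d -> is_companion c' -> is_companion d' ->
  lifts (c_bifun B (c_comp c c') (c_comp d d'))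
    (c_comp (c_bifun B c d) (c_bifun B c' d')) (bc B (ch c) (ch d) (ch c') (ch d')).
Proof.
  intros Hc Hd Hc' Hd'.
  exact (lifts_fc (prod_pseudodouble HX HY) HZ HB
    (pair_ok HX HY Hc Hd) (pair_ok HX HY Hc' Hd')).
Qed.
End Bifunctors.
#[global] Hint Extern 2 (is_giso (bs _ _ _) _ _) => eapply bs_giso; [psd | gi | gi] : giso.
#[global] Hint Extern 2 (is_giso (bc _ _ _ _ _) _ _) => eapply bc_ty; psd : giso.
#[global] Hint Extern 2 (is_giso (bu _ _ _) _ _) => eapply bu_ty; psd : giso.
#[global] Hint Extern 2 (is_sq (bs _ _ _) _ _ _ _) => eapply bs_ty; [psd | ty | ty] : sqty.
#[global] Hint Extern 2 (is_sq (bc _ _ _ _ _) _ _ _ _) => eapply giso_glob; gi : sqty.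
#[global] Hint Extern 2 (is_sq (bu _ _ _) _ _ _ _) => eapply giso_glob; gi : sqty.

(** * Closure properties of pseudodouble functors *)

Lemma wf_sq (X : dbl_data) (A B C D : ob X) (a : sq A B C D) :
  wf a -> exists f g u v, is_sq a f g u v.
Proof. intros H. now exists (top a), (bot a), (lft a), (rgt a). Qed.
Ltac wfs := repeat match goal with
  | H : wf ?a |- _ => let T := fresh "T" in
      destruct (wf_sq H) as (? & ? & ? & ? & T); clear H;
      rewrite ?(top_of T), ?(bot_of T), ?(lft_of T), ?(rgt_of T) in *
  end; subst.

Lemma f_id_ok (X : dbl_data) : is_pseudodouble X -> is_functor (f_id X).
Proof.
  intros HX. split; cbn; intros; trivial; wfs; try bd.
  - rewrite (sid_sv HX), (sv_sid HX) by bd. reflexivity.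
  - rewrite (sid_sv HX), (sv_sid HX) by bd. reflexivity.
  - rewrite <- (sid_hc HX), !(sid_sv HX), <- (sid_hc HX), !(sv_sid HX) by bd. reflexivity.
  - rewrite <- !(sid_hc HX), !(sid_sv HX) by bd. reflexivity.
  - rewrite <- !(sid_hc HX), !(sid_sv HX) by bd. reflexivity.
Qed.
Lemma f_fst_ok (X Y : dbl_data) : is_pseudodouble X -> is_functor (f_fst X Y).
Proof.
  intros HX. split; cbn; intros; trivial; wfs; try bd.
  - now apply is_sq_fst in H.
  - destruct H, H0. injection H1 as ? ?. cbn in *. wfs.
    rewrite (sid_sv HX), (sv_sid HX) by bd. reflexivity.
  - rewrite (sid_sv HX), (sv_sid HX) by bd. reflexivity.
  - rewrite <- (sid_hc HX), !(sid_sv HX), <- (sid_hc HX), !(sv_sid HX) by bd. reflexivity.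
  - rewrite <- !(sid_hc HX), !(sid_sv HX) by bd. reflexivity.
  - rewrite <- !(sid_hc HX), !(sid_sv HX) by bd. reflexivity.
Qed.
Lemma f_snd_ok (X Y : dbl_data) : is_pseudodouble Y -> is_functor (f_snd X Y).
Proof.
  intros HX. split; cbn; intros; trivial; wfs; try bd.
  - now apply is_sq_snd in H.
  - destruct H, H0. injection H1 as ? ?. cbn in *. wfs.
    rewrite (sid_sv HX), (sv_sid HX) by bd. reflexivity.
  - rewrite (sid_sv HX), (sv_sid HX) by bd. reflexivity.
  - rewrite <- (sid_hc HX), !(sid_sv HX), <- (sid_hc HX), !(sv_sid HX) by bd. reflexivity.
  - rewrite <- !(sid_hc HX), !(sid_sv HX) by bd. reflexivity.
  - rewrite <- !(sid_hc HX), !(sid_sv HX) by bd. reflexivity.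
Qed.
Lemma f_pair_ok (X Y Z : dbl_data) (F0 : ob X -> ob Y) (G0 : ob X -> ob Z)
    (F : functor F0) (G : functor G0) :
  is_functor F -> is_functor G -> is_functor (f_pair F G).
Proof.
  intros HF HG. split; cbn; intros.
  - now rewrite (fv_vid HF), (fv_vid HG).
  - now rewrite (fv_vc HF), (fv_vc HG).
  - apply is_sq_prod; cbn; bd.
  - now rewrite (fs_sid HF), (fs_sid HG).
  - now rewrite (fs_sv HF), (fs_sv HG).
  - apply is_giso_prod; cbn; bd.
  - apply is_giso_prod; cbn; bd.
  - now rewrite (fc_nat HF), (fc_nat HG).
  - now rewrite (fu_nat HF), (fu_nat HG).
  - now rewrite (fc_asc HF), (fc_asc HG).
  - now rewrite (fc_lun HF), (fc_lun HG).
  - now rewrite (fc_run HF), (fc_run HG).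
Qed.
Lemma f_comp_ok (X Y Z : dbl_data) (F0 : ob X -> ob Y) (G0 : ob Y -> ob Z)
    (F : functor F0) (G : functor G0) :
  is_pseudodouble X -> is_pseudodouble Y -> is_pseudodouble Z ->
  is_functor F -> is_functor G -> is_functor (f_comp F G).
Proof.
  intros HX HY HZ HF HG. split; cbn; intros; wfs; try bd.
  - rewrite (fs_sid HF). apply (fs_sid HG).
  - rewrite (fs_sv HF), (fs_sv HG); bd.
  - rewrite <- (sv_assoc HZ) by bd. erewrite (fc_sq HG) by bd.
    asr. rewrite <- (fs_sv HG) by bd. erewrite (fc_sq HF) by bd. rewrite (fs_sv HG) by bd. reflexivity.
  - rewrite <- (sv_assoc HZ), (fu_nat HG) by bd. asr.
    rewrite <- (fs_sv HG), (fu_nat HF), (fs_sv HG) by bd. reflexivity.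
  - rewrite <- (sv_sid HZ (a := sid (fh G (fh F h))) (f := fh G (fh F h))) by bd.
    rewrite <- (ich HZ) by bd. rewrite <- (fs_sid HG (fh F h)) at 2.
    asr. vr (fc_sq HG). rewrite <- !(fs_sv HG) by bd. rewrite <- (sv_assoc HY), (fc_asc HF) by bd.
    rewrite !(fs_sv HG) by bd.
    assert (E := fc_asc HG (fh F f) (fh F g) (fh F h)).
    rewrite !(sv_assoc HZ) in E by bd. asr. rewrite (sv_rew3 HZ E) by bd.
    asr. vrl (fc_sq HG). rewrite (fs_sid HG). vr (ich HZ). now rewrite (sid_sv HZ) by bd.
  - rewrite <- (sv_sid HZ (a := sid (fh G (fh F f))) (f := fh G (fh F f))) by bd.
    rewrite <- (ich HZ) by bd. rewrite <- (fs_sid HG (fh F f)) at 2.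
    asr. vr (fc_sq HG). rewrite <- !(fs_sv HG) by bd. rewrite <- (sv_assoc HY), (fc_lun HF) by bd.
    rewrite <- (sv_assoc HZ) by bd. apply (fc_lun HG).
  - rewrite <- (sv_sid HZ (a := sid (fh G (fh F f))) (f := fh G (fh F f))) by bd.
    rewrite <- (ich HZ) by bd. rewrite <- (fs_sid HG (fh F f)) at 2.
    asr. vr (fc_sq HG). rewrite <- !(fs_sv HG) by bd. rewrite <- (sv_assoc HY), (fc_run HF) by bd.
    rewrite <- (sv_assoc HZ) by bd. apply (fc_run HG).
Qed.
Lemma f_app2_ok (W X Y Z : dbl_data) (B0 : ob X -> ob Y -> ob Z)
    (a0 : ob W -> ob X) (b0 : ob W -> ob Y)
    (B : @functor (dbl_prod X Y) Z (op2 B0)) (a : functor a0) (b : functor b0) :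
  is_pseudodouble W -> is_pseudodouble X -> is_pseudodouble Y -> is_pseudodouble Z ->
  is_functor B -> is_functor a -> is_functor b -> is_functor (f_app2 B a b).
Proof.
  intros HW HX HY HZ HB Ha Hb.
  exact (f_comp_ok HW (prod_pseudodouble HX HY) HZ (f_pair_ok Ha Hb) HB).
Qed.
Lemma f_unit_ok (W X : dbl_data) (I : ob X) (un : @functor dbl_unit X (fun _ => I)) :
  is_pseudodouble W -> is_pseudodouble X -> is_functor un -> is_functor (f_unit un W).
Proof.
  intros HW HX Hu.
  assert (T : forall a b : unit, a = b) by (now intros [] []).
  assert (HU : is_pseudodouble dbl_unit).
  { split; intros; cbn in *; repeat split; try apply T;
      try (exists tt; repeat split; apply T). }
  apply (@f_comp_ok W dbl_unit X _ _ (f_bang W) un); trivial.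
  split; intros; cbn in *; repeat split; try apply T; exists tt; repeat split; apply T.
Qed.
Ltac fok :=
  lazymatch goal with
  | |- is_functor (@f_app2 ?W ?X ?Y ?Z ?B0 ?a0 ?b0 ?B ?a ?b) =>
      refine (@f_app2_ok W X Y Z B0 a0 b0 B a b _ _ _ _ _ _ _);
      [psd | psd | psd | psd | fok | fok | fok]
  | |- is_functor (@f_comp ?X ?Y ?Z ?F0 ?G0 ?F ?G) =>
      refine (@f_comp_ok X Y Z F0 G0 F G _ _ _ _ _); [psd | psd | psd | fok | fok]
  | |- is_functor (@f_unit ?X ?I ?un ?W) =>
      refine (@f_unit_ok W X I un _ _ _); [psd | psd | fok]
  | |- is_functor (@f_pair ?X ?Y ?Z ?F0 ?G0 ?F ?G) =>
      refine (@f_pair_ok X Y Z F0 G0 F G _ _); [fok | fok]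
  | |- is_functor (@f_fst ?X ?Y) => refine (@f_fst_ok X Y _); psd
  | |- is_functor (@f_snd ?X ?Y) => refine (@f_snd_ok X Y _); psd
  | |- is_functor (@f_id ?X) => refine (@f_id_ok X _); psd
  | |- is_functor (pr1 _ _) => unfold pr1; fok
  | |- is_functor (pr2 _ _) => unfold pr2; fok
  | |- is_functor (pr3 _ _) => unfold pr3; fok
  | |- is_functor (triple_l _ _) => unfold triple_l; fok
  | |- is_functor (triple_r _) => unfold triple_r; fok
  | |- _ => psd
  end.
#[global] Hint Resolve f_id_ok f_fst_ok f_snd_ok f_pair_ok f_comp_ok f_app2_ok : psd.

(** * Lifted squares and companion-lifted transformations *)

Section LiftSquare.
Variables (X : dbl_data) (HX : is_pseudodouble X).
Variables (A B C D : ob X) (u : ver A C) (v : ver C D) (v' : ver A B) (u' : ver B D).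
Variables (cv : companion v) (cv' : companion v').
Hypotheses (Hcv : is_companion cv) (Hcv' : is_companion cv') (E : u *v v = v' *v u').

Lemma lift_sq_ty : is_sq (lift_sq u u' cv cv') (ch cv') (ch cv) u u'.
Proof. unfold lift_sq. bd. Qed.
(** Above the counit the [ciot] part of the formula cancels by the vertical triangle identity. As
    the counit is monic, this equation pins the square down and replaces the formula in later
    arguments. *)
Lemma lift_sq_ceps : lift_sq u u' cv cv' // ceps cv = ceps cv' // sidv u'.
Proof.
  unfold lift_sq. asr. erewrite <- (run_glob HX) by bd.
  rewrite <- (sv_assoc HX (b := _ || sid _)), (ich HX) by bd. asr.
  rewrite (ciot_ceps_v Hcv), (sv_sid HX), <- (lun_hid_run HX), <- (sidv_vc HX) by bd.
  erewrite (lun_sq HX) by bd. rewrite <- (sv_assoc HX) by bd. erewrite giso_l by gi.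
  now rewrite (sid_sv HX) by bd.
Qed.
Lemma lift_sq_ciot : ciot cv' // lift_sq u u' cv cv' = sidv u // ciot cv.
Proof.
  assert (H := lift_sq_ty).
  eapply ceps_mono; [exact HX | exact Hcv | bd | bd |]. asr.
  rewrite lift_sq_ceps, (ciot_ceps_v Hcv), <- (sv_assoc HX), (ciot_ceps_v Hcv') by bd.
  now rewrite <- !(sidv_vc HX), E.
Qed.
End LiftSquare.

(* The horizontal transformation [a] is a companion-lift of [v]; only the actions
   of the two functors on 1-cells matter. *)
Record lifts_trans_of (X Y : dbl_data) (F0 G0 : ob X -> ob Y)
    (Fh : forall A B, hor A B -> hor (F0 A) (F0 B))
    (Fv : forall A B, ver A B -> ver (F0 A) (F0 B))
    (Gh : forall A B, hor A B -> hor (G0 A) (G0 B))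
    (Gv : forall A B, ver A B -> ver (G0 A) (G0 B))
    (v : vtrans F0 G0) (c : forall A, companion (vt1 v A)) (a : htrans F0 G0) : Prop := {
  lt_ht1 : forall A, ht1 a A = ch (c A);
  lt_htv_ty : forall A A' (u : ver A A'),
    is_sq (htv a u) (ch (c A)) (ch (c A')) (Fv _ _ u) (Gv _ _ u);
  lt_htv : forall A A' (u : ver A A'),
    htv a u // ceps (c A') = ceps (c A) // sidv (Gv _ _ u);
  lt_vts_ty : forall A B (f : hor A B),
    is_sq (vts v f) (Fh _ _ f) (Gh _ _ f) (vt1 v A) (vt1 v B);
  lt_hth_ty : forall A B (f : hor A B),
    is_glob (hth a f) (Fh _ _ f *h ch (c B)) (ch (c A) *h Gh _ _ f);
  lt_hth : forall A B (f : hor A B),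
    hth a f // ((ceps (c A) || sid (Gh _ _ f)) // lun (Gh _ _ f))
      = (vts v f || ceps (c B)) // run (Gh _ _ f)
}.
Notation lifts_h F G :=
  (lifts_trans_of (@fh _ _ _ F) (@fv _ _ _ F) (@fh _ _ _ G) (@fv _ _ _ G)).

Section LiftsH.
Variables (X Y : dbl_data) (HX : is_pseudodouble X) (HY : is_pseudodouble Y).
Variables (F0 G0 : ob X -> ob Y) (F : functor F0) (G : functor G0).
Variables (v : vtrans F0 G0) (c : forall A, companion (vt1 v A)).
Hypothesis Hc : forall A, is_companion (c A).

Lemma lift_lifts_h : is_vtrans F G v -> lifts_h F G c (lift F G c).
Proof.
  intros Hv. assert (Ht := vts_ty Hv). split; cbn; trivial.
  - intros. apply lift_sq_ty; auto. apply (vt1_nat Hv).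
  - intros. apply lift_sq_ceps; auto. apply (vt1_nat Hv).
  - intros. bd.
  - intros. asr. rewrite <- (sv_assoc HY (a := sid _ || _)) by bd.
    rewrite (ich HY) by bd. rewrite (sid_sv HY), (sv_sid HY) by bd.
    rewrite <- (sv_assoc HY (a := ciot _ || _)), (ich HY), (ciot_ceps_v (Hc A)) by bd.
    erewrite (lun_sq HY) by bd. rewrite <- (sv_assoc HY) by bd.
    erewrite giso_l by gi. now rewrite (sid_sv HY) by bd.
Qed.

Variable a : htrans F0 G0.
Hypothesis Ha : lifts_h F G c a.

Lemma lt_mono (B A' B' : ob Y) (C : ob X) (g : hor (G0 C) B)
    (s s' : sq A' B' (F0 C) B) f l r r' :
  is_sq s f (ch (c C) *h g) l r -> is_sq s' f (ch (c C) *h g) l r' ->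
  s // ((ceps (c C) || sid g) // lun g) = s' // ((ceps (c C) || sid g) // lun g) -> s = s'.
Proof.
  intros Hs Hs' E. eapply ceps_mono_sh; [exact HY | apply Hc | exact Hs | exact Hs' |].
  specialize (Hc C). apply (giso_mono HY (lun_ty HY g)); try bd. asr. exact E.
Qed.

Lemma lt_hth_giso (A B : ob X) (f : hor A B) : is_viso (vts v f) ->
  is_giso (hth a f) (fh F f *h ch (c B)) (ch (c A) *h fh G f).
Proof.
  intros (Hw & V & HV & E1 & E2 & E3 & E4).
  assert (T1 := lt_vts_ty Ha f). assert (T2 := lt_hth_ty Ha f). assert (E := lt_hth Ha f).
  assert (HA := Hc A). assert (HB := Hc B).
  rewrite (top_of T1) in *. rewrite (bot_of T1) in *.
  assert (T3 : is_sq V (fh G f) (fh F f) (lft V) (rgt V)) by now repeat split.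
  assert (R1 : vt1 v B *v rgt V = vid (F0 B)).
  { transitivity (rgt (vts v f // V)); [symmetry; bd | rewrite E3; bd]. }
  assert (R2 : rgt V *v vt1 v B = vid (G0 B)).
  { transitivity (rgt (V // vts v f)); [symmetry; bd | rewrite E4; bd]. }
  assert (L1 : vt1 v A *v lft V = vid (F0 A)).
  { transitivity (lft (vts v f // V)); [symmetry; bd | rewrite E3; bd]. }
  (* The inverse is the reversed stack: counit of [c A], the vertical inverse [V], unit of [c B].
     Its sides are identities because those of [V] invert [vt1 v A] and [vt1 v B]. *)
  pose (W := (ceps (c A) || sid (fh G f)) // (lun (fh G f) // (V // (ginv (run (fh F f))
    // (sid (fh F f) || ciot (c B)))))).
  assert (T4 : is_glob W (ch (c A) *h fh G f) (fh F f *h ch (c B))) by (unfold W; bd).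
  exists W. split; [bd|split; [bd|split]].
  - unfold W. rewrite <- (sv_assoc HY (b := lun _)), <- (sv_assoc HY (a := hth a f)) by bd.
    rewrite E. asr. rewrite <- (sv_assoc HY (b := V)) by bd.
    erewrite <- (run_sq HY (a := V)) by bd. asr.
    rewrite <- (sv_assoc HY (a := run _)) by bd. erewrite giso_r by gi.
    rewrite (sid_sv HY), <- (sv_assoc HY), !(ich HY), E3, (sid_sv HY), (sid_hc HY) by bd.
    f_equal. eapply ceps_mono; [exact HY | exact HB | bd | bd |]. asr.
    rewrite (ciot_ceps_v HB), <- (sidv_vc HY), R2, (sidv_id HY), (sv_sid HY), (sid_sv HY) by bd.
    reflexivity.
  - eapply lt_mono; [bd | bd |]. asr. rewrite E. unfold W. asr.
    rewrite <- (sv_assoc HY (b := vts v f || _)), (ich HY), (ciot_ceps_v HB), (sid_sv HY) by bd.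
    erewrite (run_sq HY) by bd. rewrite <- (sv_assoc HY (c := vts v f)) by bd.
    erewrite giso_l by gi. rewrite (sid_sv HY), E4, (sv_sid HY), (sid_sv HY) by bd.
    reflexivity.
Qed.

(** Each equational axiom is tested with the counit stacked below, where it turns into the matching
    axiom of the vertical transformation [v]. Invertibility of [v] serves to make the cells [hth]
    invertible. *)
Lemma lt_is_htrans : is_functor F -> is_functor G -> is_vtrans F G v -> invertible v ->
  is_htrans F G a.
Proof.
  intros HF HG Hv Hinv.
  assert (T0 := lt_htv_ty Ha). assert (T1 := lt_vts_ty Ha).
  assert (T2 := lt_hth_ty Ha). unfold is_glob in T2.
  assert (E1 := lt_ht1 Ha). assert (E2 := lt_htv Ha). assert (E3 := lt_hth Ha).
  split.
  - intros. rewrite !E1. apply T0.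
  - intros. rewrite !E1. apply lt_hth_giso. apply Hinv.
  - intros A. rewrite E1. eapply ceps_mono; [exact HY | apply Hc | bd | bd |].
    rewrite E2, (fv_vid HG), (sidv_id HY), (sv_sid HY), (sid_sv HY) by bd. reflexivity.
  - intros A B C u w. eapply ceps_mono; [exact HY | apply Hc | bd | bd |].
    rewrite E2. asr. rewrite E2, <- (sv_assoc HY), E2 by bd. asr.
    now rewrite <- (sidv_vc HY), (fv_vc HG).
  - intros A B A' B' s Hs.
    assert (Ts : is_sq s (top s) (bot s) (lft s) (rgt s)) by now repeat split.
    eapply lt_mono; [bd | bd |]. asr. rewrite E3.
    vr (ich HY). rewrite (vts_nat Hv Hs), E2. rewrite <- (ich HY) by bd. asr.
    vr (run_sq HY). vr (ich HY). rewrite E2, (sv_sid HY) by bd.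
    rewrite <- (sid_sv HY (a := fs G s) (f := fh G (top s))) at 2 by bd.
    rewrite <- (ich HY) by bd. asr. vr (lun_sq HY).
    rewrite <- !(sv_assoc HY (c := fs G s)) by bd.
    f_equal. asr. symmetry. apply E3.
  - intros A B C f g. rewrite !E1.
    eapply lt_mono; [bd | bd |]. asr. rewrite E3.
    vr (ich HY). rewrite (sid_sv HY), (vts_hc Hv) by bd.
    rewrite <- (sv_sid HY (a := ceps (c C)) (f := hid (G0 C))) at 1 by bd.
    rewrite <- (ich HY) by bd. asr. vr (run_glob HY).
    vr (ich HY). rewrite (sid_sv HY), (sv_sid HY) by bd.
    erewrite (@sh_split _ HY _ _ _ _ _ (ceps (c A)) (fc G f g)) by bd. asr.
    vr (lun_glob HY). rewrite (sid_hc HY). vrl (asc_sq HY). vr (asc_hid_lun HY).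
    vr (ich HY). vr (ich HY). asr. rewrite (sv_sid HY), E3 by bd.
    rewrite <- (sv_sid HY (a := sid (fh G g)) (f := fh G g)) at 1 by bd.
    rewrite <- (ich HY) by bd. asr. vrl (asc_sq_inv HY).
    rewrite (sv_sid HY (a := sid _)) by bd. vr (triangle_inv HY). vr (ich HY). vr (ich HY).
    rewrite (sid_sv HY), (sv_sid HY) by bd. asr. rewrite E3.
    rewrite <- (sv_sid HY (a := vts v f) (f := fh G f)) at 2 by bd.
    rewrite <- (ich HY) by bd. asr. vrl (asc_sq HY). vr (asc_hid_run HY). reflexivity.
  - intros A. rewrite E1. eapply lt_mono; [bd | bd |]. asr. rewrite E3.
    vr (ich HY). rewrite (vts_hid Hv), (sid_sv HY) by bd.
    rewrite <- (sv_sid HY (a := ceps (c A)) (f := hid (G0 A))) at 1 by bd.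
    rewrite <- (ich HY) by bd. asr. vr (run_glob HY).
    rewrite <- (lun_hid_run HY). vr (lun_sq HY).
    vr (ich HY). rewrite (sid_sv HY), (sv_sid HY) by bd.
    erewrite (@sh_split _ HY _ _ _ _ _ (ceps (c A)) (fu G A)) by bd. asr.
    vr (lun_glob HY). rewrite (lun_hid_run HY). vr (run_glob HY).
    assert (El : ginv (run (ch (c A))) // run (ch (c A)) = sid (ch (c A)))
      by (eapply giso_l; gi).
    vr El. rewrite (sid_sv HY) by bd. reflexivity.
Qed.
End LiftsH.

(** * Modifications and operations on companion-lifted transformations *)

Section Modifications.
Variables (X Y : dbl_data) (HX : is_pseudodouble X) (HY : is_pseudodouble Y).
Variables (F0 G0 : ob X -> ob Y) (F : functor F0) (G : functor G0).
Variables (v w : vtrans F0 G0).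
Variables (c : forall A, companion (vt1 v A)) (d : forall A, companion (vt1 w A)).
Hypotheses (Hc : forall A, is_companion (c A)) (Hd : forall A, is_companion (d A)).
Variables (a b : htrans F0 G0).
Hypotheses (Ha : lifts_h F G c a) (Hb : lifts_h F G d b).

(** With the counits stacked below, both transformations show the same component [vts v f], and the
    cells [m] only exchange one counit for another. *)
Lemma lt_is_imod m :
  (forall A B (f : hor A B), vts v f = vts w f) ->
  (forall A, lifts (d A) (c A) (m A)) -> is_imod F G a b m.
Proof.
  intros E Hm.
  assert (T0 := lt_htv_ty Ha). assert (T1 := lt_vts_ty Ha).
  assert (T2 := lt_hth_ty Ha). unfold is_glob in T2.
  assert (E2 := lt_htv Ha). assert (E3 := lt_hth Ha).
  assert (T0' := lt_htv_ty Hb). assert (T1' := lt_vts_ty Hb).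
  assert (T2' := lt_hth_ty Hb). unfold is_glob in T2'.
  assert (E2' := lt_htv Hb). assert (E3' := lt_hth Hb).
  assert (Gm := fun A => lifts_giso HY (Hd A) (Hc A) (Hm A)).
  assert (Em : forall A, m A // ceps (d A) = ceps (c A)) by apply Hm.
  split.
  - intros A. rewrite (lt_ht1 Ha), (lt_ht1 Hb). apply Gm.
  - intros A B f. specialize (T1' _ _ f). rewrite <- E in T1'.
    assert (G1 := Gm A). assert (G2 := Gm B).
    eapply (lt_mono HY Hd); [bd | bd |]. asr. rewrite E3', <- E. 
    vr (ich HY). vr (ich HY). rewrite (sid_sv HY), (sv_sid HY), !Em by bd. now rewrite E3.
  - intros A A' u. assert (G1 := Gm A). assert (G2 := Gm A').
    eapply ceps_mono; [exact HY | apply Hd | bd | bd |]. asr.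
    rewrite E2', Em, E2, <- (sv_assoc HY), Em by bd. reflexivity.
Qed.
End Modifications.

(** The vertical counterparts of [ht_id], [ht_comp], [ht_pre], [ht_post] and [ht_pair] start here.
    Through them every composite horizontal transformation occurring in the axioms is exhibited as a
    companion-lift. *)
Definition vt_id (X Y : dbl_data) (F0 : ob X -> ob Y) (F : functor F0) : vtrans F0 F0 := {|
  vt1 A := vid (F0 A);
  vts _ _ f := sid (fh F f)
|}.
Definition vt_comp (X Y : dbl_data) (F0 G0 K0 : ob X -> ob Y)
    (v : vtrans F0 G0) (w : vtrans G0 K0) : vtrans F0 K0 := {|
  vt1 A := vt1 v A *v vt1 w A;
  vts _ _ f := vts v f // vts w f
|}.
Definition vt_pre (W X Y : dbl_data) (H0 : ob W -> ob X) (F0 G0 : ob X -> ob Y)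
    (H : functor H0) (v : vtrans F0 G0)
    : vtrans (fun A => F0 (H0 A)) (fun A => G0 (H0 A)) := {|
  vt1 A := vt1 v (H0 A);
  vts _ _ f := vts v (fh H f)
|}.
Definition vt_post (X Y Z : dbl_data) (F0 G0 : ob X -> ob Y) (K0 : ob Y -> ob Z)
    (K : functor K0) (v : vtrans F0 G0)
    : vtrans (fun A => K0 (F0 A)) (fun A => K0 (G0 A)) := {|
  vt1 A := fv K (vt1 v A);
  vts _ _ f := fs K (vts v f)
|}.
Definition vt_pair (X Y Z : dbl_data) (F0 G0 : ob X -> ob Y)
    (F0' G0' : ob X -> ob Z) (v : vtrans F0 G0) (w : vtrans F0' G0')
    : @vtrans X (dbl_prod Y Z) (fun A => (F0 A, F0' A)) (fun A => (G0 A, G0' A)) :=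
  @VTrans X (dbl_prod Y Z) (fun A => (F0 A, F0' A)) (fun A => (G0 A, G0' A))
    (fun A => (vt1 v A, vt1 w A)) (fun _ _ f => (vts v f, vts w f)).

Section Closure.
Variables (X Y : dbl_data) (HX : is_pseudodouble X) (HY : is_pseudodouble Y).

Lemma lt_id (F0 : ob X -> ob Y) (F : functor F0) : is_functor F ->
  lifts_h F F (v := vt_id F) (fun A => c_id (F0 A)) (ht_id F).
Proof.
  intros HF. split; cbn; intros; try bd; trivial.
  - rewrite <- !(sidv_id HY), <- !(sidv_vc HY). f_equal. cells.
  - asr. rewrite <- (sid_hc HY). rewrite (sid_sv HY) by bd.
    erewrite giso_l by gi. rewrite <- (sid_hc HY), (sid_sv HY), (sv_sid HY); bd.
Qed.

Lemma lt_comp (F0 G0 K0 : ob X -> ob Y) (F : functor F0) (G : functor G0) (K : functor K0)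
    (v : vtrans F0 G0) (w : vtrans G0 K0)
    (c : forall A, companion (vt1 v A)) (d : forall A, companion (vt1 w A)) a b :
  (forall A, is_companion (c A)) -> (forall A, is_companion (d A)) ->
  lifts_h F G c a -> lifts_h G K d b ->
  lifts_h F K (v := vt_comp v w) (fun A => c_comp (c A) (d A)) (ht_comp F G K a b).
Proof.
  intros Hc Hd Ha Hb.
  assert (E1 := lt_ht1 Ha). assert (T0 := lt_htv_ty Ha). assert (T1 := lt_vts_ty Ha).
  assert (T2 := lt_hth_ty Ha). unfold is_glob in T2.
  assert (E2 := lt_htv Ha). assert (E3 := lt_hth Ha).
  assert (E1' := lt_ht1 Hb). assert (T0' := lt_htv_ty Hb). assert (T1' := lt_vts_ty Hb).
  assert (T2' := lt_hth_ty Hb). unfold is_glob in T2'.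
  assert (E2' := lt_htv Hb). assert (E3' := lt_hth Hb).
  split; cbn; intros; rewrite ?E1, ?E1'; try bd; trivial.
  - asr. vr (ich HY). rewrite (sv_sid HY), E2 by bd.
    rewrite <- (sid_sv HY (a := htv b u) (f := ch (d A))) by bd. rewrite <- (ich HY) by bd. asr.
    vr (lun_sq HY). now rewrite E2'.
  - rewrite <- (sv_sid HY (a := sid (fh K f)) (f := fh K f)) by bd.
    rewrite <- (ich HY) by bd.
    rewrite <- (sv_sid HY (a := sid (fh K f)) (f := fh K f)) at 1 by bd.
    rewrite <- (ich HY) by bd. asr.
    vrl (asc_sq_inv HY). vr (asc_hid_lun_inv HY). vr (ich HY).
    rewrite <- (sid_hc HY), (sid_sv HY), (sv_sid HY) by bd.
    erewrite (@sh_split _ HY _ _ _ _ _ (ceps (c A)) (hth b f)) by bd. asr.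
    vr (lun_glob HY). rewrite E3', (sid_hc HY). vrl (asc_sq HY). vr (asc_hid_lun HY).
    vr (ich HY). vr (ich HY). rewrite !(sv_sid HY) by bd. asr. rewrite E3.
    rewrite <- (sv_sid HY (a := sid (ch (d B))) (f := ch (d B))) at 1 by bd.
    rewrite <- (ich HY) by bd. asr. vrl (asc_sq_inv HY). vr (triangle_inv HY).
    vr (ich HY). vr (ich HY). rewrite (sid_sv HY) by bd. now asr.
Qed.

Lemma lt_pre (W : dbl_data) (H0 : ob W -> ob X) (H : functor H0) (F0 G0 : ob X -> ob Y)
    (F : functor F0) (G : functor G0) (v : vtrans F0 G0)
    (c : forall A, companion (vt1 v A)) a :
  lifts_h F G c a ->
  lifts_h (f_comp H F) (f_comp H G) (v := vt_pre H v) (fun A => c (H0 A)) (ht_pre H a).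
Proof. intros []; split; cbn; auto. Qed.
End Closure.

Section Post.
Variables (W X Y : dbl_data) (HW : is_pseudodouble W) (HX : is_pseudodouble X)
  (HY : is_pseudodouble Y).
Variables (F0 G0 : ob W -> ob X) (F : functor F0) (G : functor G0).
Variables (v : vtrans F0 G0) (c : forall A, companion (vt1 v A)) (a : htrans F0 G0).
Hypotheses (Hc : forall A, is_companion (c A)) (Ha : lifts_h F G c a).

Lemma lt_post (K0 : ob X -> ob Y) (K : functor K0) : is_functor K ->
  lifts_h (f_comp F K) (f_comp G K) (v := vt_post K v) (fun A => c_fun K (c A))
    (ht_post K F G a).
Proof.
  intros HK.
  assert (E1 := lt_ht1 Ha). assert (T0 := lt_htv_ty Ha). assert (T1 := lt_vts_ty Ha).
  assert (T2 := lt_hth_ty Ha). unfold is_glob in T2.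
  assert (E2 := lt_htv Ha). assert (E3 := lt_hth Ha).
  split; cbn; intros; rewrite ?E1; try bd; trivial.
  - rewrite <- (sv_assoc HY), <- (fs_sv HK), E2, (fs_sv HK) by bd. asr. f_equal.
    eapply (ginv_nat HY); [gi | gi | bd | bd |]. apply (fu_nat HK).
  - rewrite <- (sv_sid HY (a := sid (fh K (fh G f))) (f := fh K (fh G f))) by bd.
    rewrite <- (ich HY) by bd. asr.
    assert (El : (ginv (fu K (G0 A)) || sid (fh K (fh G f))) // lun (fh K (fh G f))
      = fc K (hid (G0 A)) (fh G f) // fs K (lun (fh G f))).
    { rewrite <- (fc_lun HK). asr. rewrite <- (sv_assoc HY), (ich HY) by bd.
      erewrite giso_l by gi.
      now rewrite (sid_sv HY), <- (sid_hc HY), (sid_sv HY) by bd. }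
    vr El. rewrite <- (fs_sid HK). vr (fc_sq HK).
    assert (El' : ginv (fc K (ch (c A)) (fh G f)) // fc K (ch (c A)) (fh G f)
      = sid (fh K (ch (c A) *h fh G f))) by (eapply giso_l; gi).
    vr El'. rewrite (sid_sv HY) by bd. rewrite <- !(fs_sv HK) by bd. rewrite E3.
    rewrite (fs_sv HK) by bd. vrl (fc_sq HK). rewrite <- (fc_run HK). asr.
    rewrite <- (sv_assoc HY (b := _ || fu _ _)), (ich HY), (sv_sid HY) by bd. asr.
    erewrite giso_l by gi. now rewrite (sv_sid HY) by bd.
Qed.
End Post.

Section Pair.
Variables (W X Y : dbl_data) (HW : is_pseudodouble W) (HX : is_pseudodouble X)
  (HY : is_pseudodouble Y).
Variables (F0 G0 : ob W -> ob X) (F : functor F0) (G : functor G0).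
Variables (v : vtrans F0 G0) (c : forall A, companion (vt1 v A)) (a : htrans F0 G0).
Variables (F0' G0' : ob W -> ob Y) (F' : functor F0') (G' : functor G0').
Variables (v' : vtrans F0' G0') (c' : forall A, companion (vt1 v' A)) (a' : htrans F0' G0').

Definition c_pair (A A' : ob X) (C C' : ob Y) (u : ver A A') (u' : ver C C')
    (c : companion u) (d : companion u') :=
  @Companion (dbl_prod X Y) (A, C) (A', C') (u, u')
    (ch c, ch d) (ceps c, ceps d) (ciot c, ciot d).

Lemma lt_pair : lifts_h F G c a -> lifts_h F' G' c' a' ->
  lifts_h (f_pair F F') (f_pair G G') (v := vt_pair v v') (fun A => c_pair (c A) (c' A))
    (ht_pair a a').
Proof.
  intros H H'. split; cbn; intros.
  - now rewrite (lt_ht1 H), (lt_ht1 H').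
  - apply is_sq_prod; cbn; [apply (lt_htv_ty H) | apply (lt_htv_ty H')].
  - now rewrite (lt_htv H), (lt_htv H').
  - apply is_sq_prod; cbn; [apply (lt_vts_ty H) | apply (lt_vts_ty H')].
  - apply is_sq_prod; cbn; [apply (lt_hth_ty H) | apply (lt_hth_ty H')].
  - now rewrite (lt_hth H), (lt_hth H').
Qed.
End Pair.

(* [cF] is [c_fun F d] up to the presentation of its counit. *)
Record image_companion (X Y : dbl_data) (F0 : ob X -> ob Y) (F : functor F0)
    (A B : ob X) (u : ver A B) (d : companion u) (u' : ver (F0 A) (F0 B))
    (cF : companion u') : Prop := {
  ic_ok : is_companion cF;
  ic_ch : ch cF = fh F (ch d);
  ic_ceps : fs F (ceps d) = ceps cF // fu F B
}.

Lemma image_c_fun (X Y : dbl_data) (HX : is_pseudodouble X) (HY : is_pseudodouble Y)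
    (F0 : ob X -> ob Y) (F : functor F0) (HF : is_functor F)
    (A B : ob X) (u : ver A B) (d : companion u) :
  is_companion d -> image_companion F d (c_fun F d).
Proof.
  intros Hd. split; [now apply c_fun_ok | reflexivity |]. cbn. asr.
  erewrite giso_l by gi. now rewrite (sv_sid HY) by bd.
Qed.

(** Naturality of [v] at the counit square of [d] shows that the pseudonaturality cell at a
    companion lifts an equality of 1v-cells, so such cells fall under uniqueness too.
    [image_companion] leaves the presentation of the images of [d] free. *)
Lemma lt_lifts_hth (X Y : dbl_data) (HX : is_pseudodouble X) (HY : is_pseudodouble Y)
    (F0 G0 : ob X -> ob Y) (F : functor F0) (G : functor G0)
    (HF : is_functor F) (HG : is_functor G)
    (v : vtrans F0 G0) (Hv : is_vtrans F G v)
    (c : forall A, companion (vt1 v A)) (Hc : forall A, is_companion (c A)) a :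
  lifts_h F G c a ->
  forall (A B : ob X) (u : ver A B) (d : companion u) (u1 : ver (F0 A) (F0 B))
    (u2 : ver (G0 A) (G0 B)) (cF : companion u1) (cG : companion u2),
  is_companion d -> image_companion F d cF -> image_companion G d cG ->
  lifts (c_comp (c A) cG) (c_comp cF (c B)) (hth a (ch d)).
Proof.
  intros Ha A B u d u1 u2 cF cG Hd [H1 E1 F1] [H2 E2 F2].
  assert (HA := Hc A). assert (HB := Hc B).
  assert (T1 := lt_vts_ty Ha).
  assert (T2 := lt_hth_ty Ha). unfold is_glob in T2. assert (E3 := lt_hth Ha (ch d)).
  split; cbn; [rewrite E1, E2; bd |]. rewrite E2. asr.
  apply (giso_mono HY (fu_ty HG B)); try bd. asr. rewrite <- F2.
  rewrite <- !(sv_assoc HY) by bd. rewrite <- (sv_assoc HY) in E3 by bd. rewrite E3. asr.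
  assert (N : fs F (ceps d) // vts v (hid B) = vts v (ch d) // fs G (ceps d)).
  { assert (N := vts_nat Hv (wf_of (ceps_ty Hd))).
    now rewrite (top_of (ceps_ty Hd)), (bot_of (ceps_ty Hd)) in N. }
  erewrite <- (run_glob HY) by bd. vr (ich HY). rewrite <- N, F1, (sv_sid HY) by bd.
  rewrite (sv_assoc HY), (vts_hid Hv) by bd.
  rewrite <- (sid_sv HY (a := ceps (c B)) (f := ch (c B))) at 1 by bd.
  rewrite <- (ich HY) by bd. asr. f_equal.
  rewrite <- (sv_sid HY (a := ceps (c B)) (f := hid (G0 B))) at 1 by bd.
  rewrite <- (ich HY) by bd. asr. vr (run_glob HY). rewrite <- (lun_hid_run HY).
  vr (lun_sq HY). reflexivity.
Qed.

Lemma lifts_giso_ch (X : dbl_data) (HX : is_pseudodouble X) (A B : ob X)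
    (u v : ver A B) (c : companion u) (d : companion v) :
  is_companion c -> is_companion d -> u = v -> exists s, is_giso s (ch c) (ch d).
Proof.
  intros Hc Hd <-. exists (lift_eq d c). apply lifts_giso; trivial.
  now apply lift_eq_lifts.
Qed.

(** The composite [c_comp c d] and [c_id A] are companions of the same 1v-cell, hence isomorphic,
    and likewise on the other side. *)
Lemma companion_hequiv (X : dbl_data) (HX : is_pseudodouble X) (A B : ob X)
    (u : ver A B) (w : ver B A) (c : companion u) (d : companion w) :
  is_companion c -> is_companion d -> u *v w = vid A -> w *v u = vid B ->
  is_hequiv (ch c).
Proof.
  intros Hc Hd E E'.
  destruct (lifts_giso_ch HX (c := c_comp c d) (d := c_id A)) as [a Ha]; auto using c_id_ok, c_comp_ok.
  destruct (lifts_giso_ch HX (c := c_comp d c) (d := c_id B)) as [b Hb]; auto using c_id_ok, c_comp_ok.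
  now exists (ch d), a, b.
Qed.
Lemma liftable_hequiv (X Y : dbl_data) (HY : is_pseudodouble Y) (F0 G0 : ob X -> ob Y)
    (v : vtrans F0 G0) (L : liftable v) :
  inverse_liftable v -> forall A, is_hequiv (ch (L A)).
Proof.
  intros H A. destruct (H A) as (w & d & E & E' & Hd).
  exact (companion_hequiv HY (lift_ok L A) Hd E E').
Qed.
Lemma functor_hequiv (X Y : dbl_data) (HX : is_pseudodouble X) (HY : is_pseudodouble Y)
    (F0 : ob X -> ob Y) (F : functor F0) (HF : is_functor F) (A B : ob X) (f : hor A B) :
  is_hequiv f -> is_hequiv (fh F f).
Proof.
  intros (g & a & b & Ha & Hb).
  exists (fh F g), (fc F f g // (fs F a // ginv (fu F A))),
    (fc F g f // (fs F b // ginv (fu F B))).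
  split; bd.
Qed.

(** * Icons as companion-lifts *)

Section Icon.
Variables (X Y : dbl_data) (HX : is_pseudodouble X) (HY : is_pseudodouble Y).
Variables (F0 : ob X -> ob Y) (F G : functor F0) (HF : is_functor F) (HG : is_functor G).
Variable t : icon F0.
Local Notation th := (Defs.ich t).
Hypotheses (Ht : forall A B (f : hor A B), is_giso (th f) (fh F f) (fh G f))
  (Hv : forall A A' (u : ver A A'), icv t u = sidv (fv F u))
  (Ev : forall A A' (u : ver A A'), fv G u = fv F u)
  (Hn : forall A B A' B' (s : sq A B A' B'), wf s ->
    fs F s // th (bot s) = th (top s) // fs G s)
  (Hc : forall A B C (f : hor A B) (g : hor B C),
    fc F f g // th (f *h g) = (th f || th g) // fc G f g)
  (Hu : forall A, fu F A // th (hid A) = fu G A).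

(* An icon is the companion-lift, along identity companions, of a vertical
   transformation with identity 1v-components. *)
Definition vt_icon : vtrans F0 F0 := VTrans (fun A => vid (F0 A)) (fun _ _ f => th f).
Lemma vt_icon_ok : is_vtrans F G vt_icon.
Proof.
  split.
  - intros A B u. cbn. rewrite Ev. cells.
  - intros A B f. exact (giso_glob (Ht f)).
  - intros. now apply Hn.
  - intros. apply Hc.
  - intros A. cbn. rewrite (sidv_id HY), (sid_sv HY) by bd. apply Hu.
Qed.
Lemma giso_viso (Z : dbl_data) (A B : ob Z) (a : sq A B A B) f g : is_giso a f g -> is_viso a.
Proof.
  intros [b (H1 & H2 & H3 & H4)]. split; [exact (wf_of H1)|]. exists b.
  rewrite (top_of H1), (bot_of H1), (top_of H2), (bot_of H2). repeat split; trivial. exact (wf_of H2).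
Qed.
Lemma lifts_htrans_of_icon :
  lifts_h F G (v := vt_icon) (fun A => c_id (F0 A)) (htrans_of_icon F G t).
Proof.
  assert (Hs : forall A B (f : hor A B), is_sq (th f) (fh F f) (fh G f) (vid _) (vid _))
    by (intros; exact (giso_glob (Ht f))).
  split; intros; cbn.
  - reflexivity.
  - rewrite Hv, Ev. bd.
  - rewrite Hv, Ev, (sid_sv HY), (sv_sid HY); bd.
  - exact (Hs _ _ f).
  - assert (H := Hs _ _ f). bd.
  - assert (H := Hs _ _ f). rewrite <- (sid_hc HY). rewrite (sid_sv HY) by bd. asr.
    erewrite giso_l by gi. rewrite (sv_sid HY) by bd.
    symmetry. eapply (run_glob HY). bd.
Qed.
Lemma is_icon_of : is_icon F G t.
Proof.
  split; [exact Ht|].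
  refine (lt_is_htrans HY _ lifts_htrans_of_icon HF HG vt_icon_ok _).
  - intros. apply c_id_ok; bd.
  - intros A B f. exact (giso_viso (Ht f)).
Qed.
(** Naturality at the counit square of [d] compares [th (ch d)] with [th (hid B)], and the unit
    condition on the icon removes the latter. *)
Lemma lifts_icon (A B : ob X) (u : ver A B) (d : companion u) (u1 u2 : ver (F0 A) (F0 B))
    (cF : companion u1) (cG : companion u2) :
  is_companion d -> image_companion F d cF -> image_companion G d cG ->
  lifts cG cF (th (ch d)).
Proof.
  intros Hd [Ho1 Hc1 He1] [Ho2 Hc2 He2]. assert (H := giso_glob (Ht (ch d))).
  assert (HdT := ceps_ty Hd).
  assert (T1 := ceps_ty Ho1). assert (T2 := ceps_ty Ho2). rewrite Hc1 in T1. rewrite Hc2 in T2.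
  split.
  - rewrite Hc1, Hc2. exact H.
  - assert (E := Hn (wf_of HdT)). rewrite (top_of HdT), (bot_of HdT), He1, He2 in E.
    assert (Hh := giso_glob (Ht (hid B))).
    rewrite (sv_assoc HY), Hu, <- (sv_assoc HY) in E by bd.
    symmetry. eapply (giso_mono HY (fu_ty HG B)); [bd .. | exact E].
Qed.
End Icon.

Section ImageBifunctor.
Variables (X Y Y' Z : dbl_data) (HX : is_pseudodouble X) (HY : is_pseudodouble Y)
  (HY' : is_pseudodouble Y') (HZ : is_pseudodouble Z).
Variables (B0 : ob X -> ob Y' -> ob Z) (B : @functor (dbl_prod X Y') Z (op2 B0)) (HB : is_functor B).
Variables (K0 : ob Y -> ob Y') (K : functor K0) (HK : is_functor K).
(** The companion [d'] may differ from [c_fun K d]. For an identity 1v-cell it will be the identity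
    companion of the Kleisli double category, as the lifted modifications of an action require. *)
Lemma image_app2_snd (A A' : ob X) (C C' : ob Y) (u : ver A A') (v : ver C C')
    (c : companion u) (d : companion v) (v' : ver (K0 C) (K0 C')) (d' : companion v') :
  is_companion c -> is_companion d -> fv K v = v' -> image_companion K d d' ->
  image_companion (f_app2 B (f_fst X Y) (f_comp (f_snd X Y) K)) (c_pair c d) (c_bifun B c d').
Proof.
  intros Hc Hd Ev [Ho Hh He]. split.
  - cok.
  - cbn. now rewrite Hh.
  - assert (T1 := ceps_ty Hc). assert (T2 := ceps_ty Ho). rewrite Hh in T2.
    change (bs B (ceps c) (fs K (ceps d)) = bs B (ceps c) (ceps d') // ginv (bu B A' (K0 C'))
      // (bu B A' (K0 C') // bs B (sid (hid A')) (fu K C' // fs K (sid (hid C'))))).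
    rewrite He, (fs_sid HK), (sv_sid HY') by bd. asr.
    rewrite <- (sv_assoc HZ (a := ginv _)) by bd. erewrite giso_l by gi.
    rewrite (sid_sv HZ), <- (bs_sv HB), (sv_sid HX) by bd. reflexivity.
Qed.
End ImageBifunctor.

Lemma image_comp (X Y Z : dbl_data) (HY : is_pseudodouble Y) (HZ : is_pseudodouble Z)
    (F0 : ob X -> ob Y) (G0 : ob Y -> ob Z) (F : functor F0) (G : functor G0)
    (HF : is_functor F) (HG : is_functor G) (A B : ob X) (u : ver A B) (d : companion u)
    (u1 : ver (F0 A) (F0 B)) (cF : companion u1) (u2 : ver (G0 (F0 A)) (G0 (F0 B)))
    (cG : companion u2) :
  image_companion F d cF -> image_companion G cF cG -> image_companion (f_comp F G) d cG.
Proof.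
  intros [H1 H2 H3] [K1 K2 K3]. split; [exact K1 | cbn; now rewrite K2, H2 |].
  assert (T1 := ceps_ty H1). assert (T2 := ceps_ty K1). rewrite K2 in T2.
  cbn. rewrite H3, (fs_sv HG), K3 by bd. apply (sv_assoc HZ); bd.
Qed.

(** Covers pseudonaturality cells at arbitrary 1h-cells. The counit equations determine [a0] and
    [a1] as lifts of [s0] and [s1], so an equation between vertical 2-cells yields one between the
    lifts. The extension axioms for the pseudonaturality of the action's unitor and associator come
    from here. *)
Lemma lifted_hth_transfer (E : dbl_data) (HE : is_pseudodouble E) (A B A1 B1 : ob E)
    (u : ver A A1) (v : ver B B1) (c : companion u) (d : companion v)
    (f0 f1 : hor A B) (g0 g1 : hor A1 B1) (th : sq A B A B) (w : sq A1 B1 A1 B1)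
    (s0 s1 : sq A B A1 B1) (a0 a1 : sq A B1 A B1) :
  is_companion c -> is_companion d ->
  is_glob th f0 f1 -> is_glob w g0 g1 -> is_sq s0 f0 g0 u v -> is_sq s1 f1 g1 u v ->
  is_glob a0 (f0 *h ch d) (ch c *h g0) -> is_glob a1 (f1 *h ch d) (ch c *h g1) ->
  a0 // ((ceps c || sid g0) // lun g0) = (s0 || ceps d) // run g0 ->
  a1 // ((ceps c || sid g1) // lun g1) = (s1 || ceps d) // run g1 ->
  th // s1 = s0 // w ->
  (th || sid (ch d)) // a1 = a0 // (sid (ch c) || w).
Proof.
  intros Hc Hd Hth Hw H0 H1 G0 G1 E0 E1 Eq.
  eapply (ceps_mono_sh HE Hc); [bd | bd |].
  eapply (giso_mono HE (lun_ty HE g1)); [bd | bd | bd | bd |].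
  asr. rewrite E1. rewrite <- (sv_assoc HE), (ich HE), Eq, (sid_sv HE) by bd.
  rewrite <- (sv_assoc HE (a := sid _ || w)), (ich HE), (sid_sv HE), (sv_sid HE) by bd.
  rewrite <- (sv_sid HE (a := ceps c) (f := hid A1)), <- (sid_sv HE (a := w) (f := g0)) by bd.
  rewrite <- (ich HE) by bd. asr. erewrite (lun_glob HE) by bd.
  rewrite <- (sv_assoc HE (a := _ || sid g0)), <- (sv_assoc HE (a := a0)), E0 by bd. asr.
  rewrite (sid_sv HE (a := w)) by bd.
  erewrite <- (run_glob HE) by bd.
  rewrite <- (sv_assoc HE (a := s0 || _)), (ich HE), (sv_sid HE) by bd. reflexivity.
Qed.

(** * Lifts through rewriting in bracketed composites *)

Section RewritingLifts.
Variables (X : dbl_data) (HX : is_pseudodouble X).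
Variables (A B C D U R : ob X) (x : ver A B) (y : ver B C) (z : ver C D)
  (u : ver A U) (v : ver U D) (r : ver D R) (v' : ver U C) (w : ver A C) (r' : ver C R).
Variables (cx : companion x) (cy : companion y) (cz : companion z)
  (cu : companion u) (cv : companion v) (cr : companion r) (cv' : companion v')
  (cw : companion w) (cr' : companion r').
Hypotheses (Hx : is_companion cx) (Hy : is_companion cy) (Hz : is_companion cz)
  (Hu : is_companion cu) (Hv : is_companion cv) (Hr : is_companion cr)
  (Hv' : is_companion cv') (Hw : is_companion cw) (Hr' : is_companion cr').

Lemma lifts_rw3 p : lifts (c_comp cu cv) (c_comp (c_comp cx cy) cz) p ->
  lifts (c_comp cu cv) (c_comp cx (c_comp cy cz))
    (rw3 p (ch cx) (ch cy) (ch cz) (ch cu) (ch cv)).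
Proof.
  intros Hp. eapply lifts_trans; [exact HX | | | exact Hp]; try cok.
  apply lifts_sym; try cok. now apply lifts_asc.
Qed.
Lemma lifts_rw3r p : lifts (c_comp cu cv) (c_comp (c_comp cx cy) cz) p ->
  lifts (c_comp cu (c_comp cv cr)) (c_comp cx (c_comp cy (c_comp cz cr)))
    (rw3r p (ch cx) (ch cy) (ch cz) (ch cu) (ch cv) (ch cr)).
Proof.
  intros Hp. unfold rw3r.
  apply (lifts_trans HX) with (d := c_comp (c_comp cu cv) cr); try cok.
  2: now apply lifts_asc.
  apply (lifts_trans HX) with (d := c_comp (c_comp (c_comp cx cy) cz) cr); try cok.
  2: { apply lifts_sh; try cok; auto using lifts_refl. }
  apply (lifts_trans HX) with (d := c_comp (c_comp cx cy) (c_comp cz cr)); try cok.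
  - apply lifts_sym; try cok.
    apply (lifts_asc HX (c := cx) (d := cy) (e := c_comp cz cr)); try cok.
  - apply lifts_sym; try cok.
    apply (lifts_asc HX (c := c_comp cx cy) (d := cz) (e := cr)); try cok.
Qed.
Lemma lifts_rw2r n : lifts (c_comp cu cv') (c_comp cx cy) n ->
  lifts (c_comp cu (c_comp cv' cr')) (c_comp cx (c_comp cy cr'))
    (rw2r n (ch cx) (ch cy) (ch cu) (ch cv') (ch cr')).
Proof.
  intros Hn. unfold rw2r.
  apply (lifts_trans HX) with (d := c_comp (c_comp cu cv') cr'); try cok.
  2: now apply lifts_asc.
  apply (lifts_trans HX) with (d := c_comp (c_comp cx cy) cr'); try cok.
  - apply lifts_sym; try cok. now apply lifts_asc.
  - apply lifts_sh; try cok; auto using lifts_refl.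
Qed.
Lemma lifts_rw21r n : lifts cw (c_comp cx cy) n ->
  lifts (c_comp cw cr') (c_comp cx (c_comp cy cr'))
    (rw21r n (ch cx) (ch cy) (ch cr')).
Proof.
  intros Hn. unfold rw21r.
  apply (lifts_trans HX) with (d := c_comp (c_comp cx cy) cr'); try cok.
  - apply lifts_sym; try cok. now apply lifts_asc.
  - apply lifts_sh; try cok; auto using lifts_refl.
Qed.
End RewritingLifts.

(** * Companion-lifted actions and monoidal structures *)

Section LiftedAction.
Variables (X E : dbl_data) (HX : is_pseudodouble X) (HE : is_pseudodouble E).
Variables (M : monoidal_data X) (HM : is_monoidal M).
Variables (triO : ob X -> ob E -> ob E) (tri : @functor (dbl_prod X E) E (op2 triO)).
Variables (va : @vtrans (dbl_prod (dbl_prod X X) E) E (al_src (tenO M) triO) (al_tgt triO))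
          (vl : @vtrans E E (fun C => triO (I0 M) C) (fun C => C)).
Hypotheses (Htri : is_functor tri)
  (Hva : is_vtrans (triple_l (ten M) tri) (triple_r tri) va)
  (Hvl : is_vtrans (f_app2 tri (f_unit (un M) E) (f_id E)) (f_id E) vl)
  (va_inv : invertible va) (vl_inv : invertible vl).
Let va1 A B G := vt1 va (A, B, G).
Definition vas A A' B B' G G' (f : hor A A') (g : hor B B') (h : hor G G') :=
  @vts _ _ _ _ va (A, B, G) (A', B', G') (f, g, h).
Hypotheses
  (va_p : forall A B C G,
    va1 (tenO M A B) C G *v va1 A B (triO C G)
      = bv tri (al1 M A B C) (vid G) *v va1 A (tenO M B C) G *v bv tri (vid A) (va1 B C G))
  (va_ps : forall A A' B B' C C' G G'
      (f : hor A A') (g : hor B B') (h : hor C C') (k : hor G G'),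
    vas (bh (ten M) f g) h k // vas f g (bh tri h k)
      = bs tri (als M f g h) (sid k) // vas f (bh (ten M) g h) k
        // bs tri (sid f) (vas g h k))
  (va_m : forall A G,
    bv tri (vt1 (rh M) A) (vid G) = va1 A (I0 M) G *v bv tri (vid A) (vt1 vl G))
  (va_ms : forall A A' G G' (f : hor A A') (g : hor G G'),
    bs tri (vts (rh M) f) (sid g)
      = vas f (unit_h (un M)) g // bs tri (sid f) (vts vl g))
  (va_l : forall A G,
    va1 (I0 M) A G *v vt1 vl (triO A G) = bv tri (vt1 (la M) A) (vid G))
  (va_ls : forall A A' G G' (f : hor A A') (g : hor G G'),
    vas (unit_h (un M)) f g // vts vl (bh tri f g)
      = bs tri (vts (la M) f) (sid g)).
Variables (cal : forall x, companion (vt1 (al M) x))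
          (cla : forall A, companion (vt1 (la M) A))
          (crh : forall A, companion (vt1 (rh M) A))
          (cva : forall x, companion (vt1 va x))
          (cvl : forall G, companion (vt1 vl G)).
Hypotheses (Hal : forall x, is_companion (cal x)) (Hla : forall x, is_companion (cla x))
  (Hrh : forall x, is_companion (crh x)) (Hcva : forall x, is_companion (cva x))
  (Hcvl : forall x, is_companion (cvl x))
  (Eva : forall x, is_hequiv (ch (cva x))) (Evl : forall x, is_hequiv (ch (cvl x))).

Let T := lift_action cal cla crh tri cva cvl.
Let HT := ten_functor HM.

Section Transformations.
Variable W : dbl_data.
Local Notation "x ⊗f y" := (f_app2 (ten M) x y) (at level 35).
Local Notation "x ⊳f y" := (f_app2 tri x y) (at level 37, right associativity).
Variables (x0 y0 z0 : ob W -> ob X) (g0 h0 : ob W -> ob E).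
Variables (x : functor x0) (y : functor y0) (z : functor z0)
  (g : functor g0) (h : functor h0).
Hypotheses (HW : is_pseudodouble W) (Hx : is_functor x) (Hg : is_functor g).

Lemma lt_al : lifts_h ((x ⊗f y) ⊗f z) (x ⊗f (y ⊗f z))
  (v := vt_pre (f_pair (f_pair x y) z) (al M)) (fun w => cal (x0 w, y0 w, z0 w))
  (t_al (lift_monoidal cal cla crh) x y z).
Proof. exact (lt_pre (f_pair (f_pair x y) z) (lift_lifts_h HX Hal (al_vtrans HM))). Qed.
Lemma lt_be : lifts_h ((x ⊗f y) ⊳f g) (x ⊳f (y ⊳f g))
  (v := vt_pre (f_pair (f_pair x y) g) va) (fun w => cva (x0 w, y0 w, g0 w)) (t_be T x y g).
Proof. exact (lt_pre (f_pair (f_pair x y) g) (lift_lifts_h HE Hcva Hva)). Qed.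
Lemma lt_la : lifts_h (f_unit (un M) W ⊗f x) x
  (v := vt_pre x (la M)) (fun w => cla (x0 w)) (t_la (lift_monoidal cal cla crh) x).
Proof. exact (lt_pre x (lift_lifts_h HX Hla (la_vtrans HM))). Qed.
Lemma lt_rh : lifts_h (x ⊗f f_unit (un M) W) x
  (v := vt_pre x (rh M)) (fun w => crh (x0 w)) (t_rh (lift_monoidal cal cla crh) x).
Proof. exact (lt_pre x (lift_lifts_h HX Hrh (rh_vtrans HM))). Qed.
Lemma lt_la' : lifts_h (f_unit (un M) W ⊳f g) g
  (v := vt_pre g vl) (fun w => cvl (g0 w)) (t_la' T g).
Proof. exact (lt_pre g (lift_lifts_h HE Hcvl Hvl)). Qed.
Lemma lt_actR v (c : forall w, companion (vt1 v w)) (s : htrans x0 y0) :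
  lifts_h x y c s -> (forall w, is_companion (c w)) ->
  lifts_h (x ⊳f g) (y ⊳f g) (v := vt_post tri (vt_pair v (vt_id g)))
    (fun w => c_bifun tri (c w) (c_id (g0 w))) (t_actR T x y s g).
Proof.
  intros Hs Hc.
  refine (lt_post (prod_pseudodouble HX HE) HE _ (lt_pair Hs (lt_id HE Hg)) Htri).
  intros w. apply pair_ok; auto using c_id_ok.
Qed.
Lemma lt_actL v (c : forall w, companion (vt1 v w)) (s : htrans g0 h0) :
  lifts_h g h c s -> (forall w, is_companion (c w)) ->
  lifts_h (x ⊳f g) (x ⊳f h) (v := vt_post tri (vt_pair (vt_id x) v))
    (fun w => c_bifun tri (c_id (x0 w)) (c w)) (t_actL T x g h s).
Proof.
  intros Hs Hc.
  refine (lt_post (prod_pseudodouble HX HE) HE _ (lt_pair (lt_id HX Hx) Hs) Htri).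
  intros w. apply pair_ok; auto using c_id_ok.
Qed.
End Transformations.

Section Modifications.
Variable W : dbl_data.
Local Notation "x ⊗f y" := (f_app2 (ten M) x y) (at level 35).
Local Notation "x ⊳f y" := (f_app2 tri x y) (at level 37, right associativity).
Variables (x0 y0 z0 : ob W -> ob X) (g0 : ob W -> ob E).
Variables (x : functor x0) (y : functor y0) (z : functor z0) (g : functor g0).
Hypotheses (HW : is_pseudodouble W) (Hx : is_functor x) (Hg : is_functor g).

(** The closure lemmas present [p_src] and [p_tgt] as companion-lifts, which leaves the strict
    equality [va_ps] on 2-cells and [va_p] on 1v-cells. The other two modifications follow the same
    pattern. *)
Lemma lifted_p_mod :
  is_imod (((x ⊗f y) ⊗f z) ⊳f g) (x ⊳f (y ⊳f (z ⊳f g)))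
    (p_src T x y z g) (p_tgt T x y z g)
    (fun w => lift_p tri cal cva (x0 w) (y0 w) (z0 w) (g0 w)).
Proof.
  assert (H1 := lt_actR Hg (lt_al x y z) (fun w => Hal (x0 w, y0 w, z0 w))).
  assert (H2 := lt_be x (y ⊗f z) g).
  assert (H3 := lt_actL Hx (lt_be y z g) (fun w => Hcva (y0 w, z0 w, g0 w))).
  assert (H4 := lt_be (x ⊗f y) z g).
  assert (H5 := lt_be x y (z ⊳f g)).
  refine (lt_is_imod HE _ _ (lt_comp HE _ _ (lt_comp HE _ _ H1 H2) H3)
   (lt_comp HE _ _ H4 H5) _ _); try (intros; cbn; cok).
  - intros. symmetry. apply va_ps.
  - intros w. apply lift_eq_lifts; try cok.
    apply va_p.
Qed.
Lemma lifted_l_mod :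
  is_imod ((f_unit (un M) W ⊗f x) ⊳f g) (x ⊳f g)
    (l_src T x g) (l_tgt T x g) (fun w => lift_l tri cla cva cvl (x0 w) (g0 w)).
Proof.
  assert (H1 := lt_actR Hg (lt_la x) (fun w => Hla (x0 w))).
  assert (H2 := lt_be (f_unit (un M) W) x g).
  assert (H3 := lt_la' (x ⊳f g)).
  refine (lt_is_imod HE _ _ H1 (lt_comp HE _ _ H2 H3) _ _);
    try (intros; cbn; cok).
  - intros. symmetry. apply va_ls.
  - intros w. apply lift_eq_lifts; try cok.
    apply va_l.
Qed.
Lemma lifted_m_mod :
  is_imod ((x ⊗f f_unit (un M) W) ⊳f g) (x ⊳f g)
    (m_src T x g) (m_tgt T x g) (fun w => lift_m tri crh cva cvl (x0 w) (g0 w)).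
Proof.
  assert (H1 := lt_be x (f_unit (un M) W) g).
  assert (H2 := lt_actL Hx (lt_la' g) (fun w => Hcvl (g0 w))).
  assert (H3 := lt_actR Hg (lt_rh x) (fun w => Hrh (x0 w))).
  refine (lt_is_imod HE _ _ (lt_comp HE _ _ H1 H2) H3 _ _);
    try (intros; cbn; cok).
  - intros. symmetry. apply va_ms.
  - intros w. apply lift_eq_lifts; try cok.
Qed.
End Modifications.

Section Whiskering.
Variables (A B C : ob X) (G H K : ob E) (x : ver A B) (y : ver B C) (x' : ver G H) (y' : ver H K).
Variables (cx : companion x) (cy : companion y) (cx' : companion x') (cy' : companion y').
Hypotheses (Hx : is_companion cx) (Hy : is_companion cy)
  (Hx' : is_companion cx') (Hy' : is_companion cy').

Lemma lifts_cR : lifts (c_bifun tri (c_comp cx cy) (c_id G))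
  (c_comp (c_bifun tri cx (c_id G)) (c_bifun tri cy (c_id G))) (cR T (ch cx) (ch cy) G).
Proof.
  apply (lifts_trans HE) with (d := c_bifun tri (c_comp cx cy) (c_comp (c_id G) (c_id G)));
    try cok.
  - apply (lifts_bc HX HE HE Htri); cok.
  - apply (lifts_bs HX HE HE Htri); try cok.
    + apply (lifts_refl HX (c := c_comp cx cy)); cok.
    + apply (lifts_lun HE (c := c_id G)); cok.
Qed.
Lemma lifts_cL : lifts (c_bifun tri (c_id A) (c_comp cx' cy'))
  (c_comp (c_bifun tri (c_id A) cx') (c_bifun tri (c_id A) cy')) (cL T A (ch cx') (ch cy')).
Proof.
  apply (lifts_trans HE) with (d := c_bifun tri (c_comp (c_id A) (c_id A)) (c_comp cx' cy'));
    try cok.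
  - apply (lifts_bc HX HE HE Htri); cok.
  - apply (lifts_bs HX HE HE Htri); try cok.
    + apply (lifts_lun HX (c := c_id A)); cok.
    + apply (lifts_refl HE (c := c_comp cx' cy')); cok.
Qed.
End Whiskering.

Section ActionLifts.
Variables (A B C D U : ob X) (G H K L V : ob E).
Variables (x : ver A B) (y : ver B C) (z : ver C D) (u : ver A U) (v : ver U D)
  (x' : ver G H) (y' : ver H K) (z' : ver K L) (u' : ver G V) (v' : ver V L)
  (w : ver A C) (v2 : ver U C) (v2' : ver V K) (w' : ver G K).
Variables (cx : companion x) (cy : companion y) (cz : companion z)
  (cu : companion u) (cv : companion v) (cx' : companion x') (cy' : companion y')
  (cz' : companion z') (cu' : companion u') (cv' : companion v')
  (cw : companion w) (cv2 : companion v2) (cv2' : companion v2') (cw' : companion w').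
Hypotheses (Hx : is_companion cx) (Hy : is_companion cy) (Hz : is_companion cz)
  (Hu : is_companion cu) (Hv : is_companion cv) (Hx' : is_companion cx')
  (Hy' : is_companion cy') (Hz' : is_companion cz')
  (Hu' : is_companion cu') (Hv' : is_companion cv')
  (Hw : is_companion cw) (Hv2 : is_companion cv2) (Hv2' : is_companion cv2')
  (Hw' : is_companion cw').
Local Notation R c G := (c_bifun tri c (c_id G)).
Local Notation L' A c := (c_bifun tri (c_id A) c).

Lemma lifts_actR3 s : lifts (c_comp cu cv) (c_comp (c_comp cx cy) cz) s ->
  lifts (c_comp (R cu G) (R cv G)) (c_comp (c_comp (R cx G) (R cy G)) (R cz G))
    (actR3 T s (ch cx) (ch cy) (ch cz) (ch cu) (ch cv) G).
Proof.
  intros Hs. unfold actR3.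
  apply (lifts_trans HE) with (d := R (c_comp cu cv) G); try cok.
  2: { apply (lifts_sym HE); try cok. now apply lifts_cR. }
  apply (lifts_trans HE) with (d := R (c_comp (c_comp cx cy) cz) G); try cok.
  2: { apply (lifts_bs HX HE HE Htri); try cok. apply (lifts_refl HE (c := c_id G)); cok. }
  apply (lifts_trans HE) with (d := c_comp (R (c_comp cx cy) G) (R cz G)); try cok.
  2: { apply lifts_cR; cok. }
  apply (lifts_sh HE); try cok; [now apply lifts_cR | apply (lifts_refl HE (c := R cz G)); cok].
Qed.
Lemma lifts_actL3 s : lifts (c_comp cu' cv') (c_comp (c_comp cx' cy') cz') s ->
  lifts (c_comp (L' A cu') (L' A cv')) (c_comp (c_comp (L' A cx') (L' A cy')) (L' A cz'))
    (actL3 T A s (ch cx') (ch cy') (ch cz') (ch cu') (ch cv')).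
Proof.
  intros Hs. unfold actL3.
  apply (lifts_trans HE) with (d := L' A (c_comp cu' cv')); try cok.
  2: { apply (lifts_sym HE); try cok. now apply lifts_cL. }
  apply (lifts_trans HE) with (d := L' A (c_comp (c_comp cx' cy') cz')); try cok.
  2: { apply (lifts_bs HX HE HE Htri); try cok. apply (lifts_refl HX (c := c_id A)); cok. }
  apply (lifts_trans HE) with (d := c_comp (L' A (c_comp cx' cy')) (L' A cz')); try cok.
  2: { apply lifts_cL; cok. }
  apply (lifts_sh HE); try cok; [now apply lifts_cL | apply (lifts_refl HE (c := L' A cz')); cok].
Qed.
Lemma lifts_actR2 s : lifts cw (c_comp cx cy) s ->
  lifts (R cw G) (c_comp (R cx G) (R cy G)) (actR2 T s (ch cx) (ch cy) G).
Proof.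
  intros Hs. unfold actR2.
  apply (lifts_trans HE) with (d := R (c_comp cx cy) G); try cok.
  - now apply lifts_cR.
  - apply (lifts_bs HX HE HE Htri); try cok. apply (lifts_refl HE (c := c_id G)); cok.
Qed.
Lemma lifts_actL2 s : lifts cw' (c_comp cx' cy') s ->
  lifts (L' A cw') (c_comp (L' A cx') (L' A cy')) (actL2 T A s (ch cx') (ch cy')).
Proof.
  intros Hs. unfold actL2.
  apply (lifts_trans HE) with (d := L' A (c_comp cx' cy')); try cok.
  - now apply lifts_cL.
  - apply (lifts_bs HX HE HE Htri); try cok. apply (lifts_refl HX (c := c_id A)); cok.
Qed.
Lemma lifts_actR12 s : lifts (c_comp cu cv2) cw s ->
  lifts (c_comp (R cu G) (R cv2 G)) (R cw G) (actR12 T s (ch cu) (ch cv2) G).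
Proof.
  intros Hs. unfold actR12.
  apply (lifts_trans HE) with (d := R (c_comp cu cv2) G); try cok.
  - apply (lifts_bs HX HE HE Htri); try cok. apply (lifts_refl HE (c := c_id G)); cok.
  - apply (lifts_sym HE); try cok. now apply lifts_cR.
Qed.
Lemma lifts_actL12 s : lifts (c_comp cu' cv2') cw' s ->
  lifts (c_comp (L' A cu') (L' A cv2')) (L' A cw') (actL12 T A s (ch cu') (ch cv2')).
Proof.
  intros Hs. unfold actL12.
  apply (lifts_trans HE) with (d := L' A (c_comp cu' cv2')); try cok.
  - apply (lifts_bs HX HE HE Htri); try cok. apply (lifts_refl HX (c := c_id A)); cok.
  - apply (lifts_sym HE); try cok. now apply lifts_cL.
Qed.
End ActionLifts.

Section Naturality.
Variables (A A' B B' : ob X) (G G' : ob E) (u : ver A A') (v : ver B B') (w : ver G G').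
Variables (cu : companion u) (cv : companion v) (cw : companion w).
Hypotheses (Hu : is_companion cu) (Hv : is_companion cv) (Hw : is_companion cw).

(** The nested [c_bifun] presents its counit differently from [c_fun] of the composite functor. Its
    inverse units cancel against the unit of the composite, which is the condition in
    [image_companion]. *)
Lemma image_triple_r :
  image_companion (triple_r tri) (c_pair (c_pair cu cv) cw)
    (c_bifun tri cu (c_bifun tri cv cw)).
Proof.
  split; [cok | reflexivity |].
  change (bs tri (ceps cu) (bs tri (ceps cv) (ceps cw)) =
    (bs tri (ceps cu) (bs tri (ceps cv) (ceps cw) // ginv (bu tri B' G'))
      // ginv (bu tri A' (triO B' G')))
    // (bu tri A' (triO B' G') // bs tri (sid (hid A') // sid (hid A'))
      (bu tri B' G' // bs tri (sid (hid B') // sid (hid B')) (sid (hid G'))))).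
  rewrite !(sid_sv HX), (bs_sid Htri), (sv_sid HE (a := bu _ _ _)) by bd.
  asr. rewrite <- (sv_assoc HE (b := bu _ _ _)) by bd. erewrite giso_l by gi.
  rewrite (sid_sv HE), <- (bs_sv Htri), (sv_sid HX), (sv_assoc HE) by bd.
  erewrite giso_l by gi. now rewrite (sv_sid HE) by bd.
Qed.
Lemma image_triple_l :
  image_companion (triple_l (ten M) tri) (c_pair (c_pair cu cv) cw)
    (c_bifun tri (c_bifun (ten M) cu cv) cw).
Proof.
  split; [cok | reflexivity |].
  change (bs tri (bs (ten M) (ceps cu) (ceps cv)) (ceps cw) =
    (bs tri (bs (ten M) (ceps cu) (ceps cv) // ginv (bu (ten M) A' B')) (ceps cw)
      // ginv (bu tri (tenO M A' B') G'))
    // (bu tri (tenO M A' B') G' // bs tri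
      (bu (ten M) A' B' // bs (ten M) (sid (hid A') // sid (hid A')) (sid (hid B') // sid (hid B')))
      (sid (hid G')))).
  rewrite !(sid_sv HX), (bs_sid HT), (sv_sid HX) by bd.
  asr. rewrite <- (sv_assoc HE (b := bu _ _ _)) by bd. erewrite giso_l by gi.
  rewrite (sid_sv HE), <- (bs_sv Htri), (sv_sid HE), (sv_assoc HX) by bd.
  erewrite giso_l by gi. now rewrite (sv_sid HX) by bd.
Qed.
Lemma lifts_tah :
  lifts (c_comp (cva (A, B, G)) (c_bifun tri cu (c_bifun tri cv cw)))
    (c_comp (c_bifun tri (c_bifun (ten M) cu cv) cw) (cva (A', B', G')))
    (tah T (ch cu) (ch cv) (ch cw)).
Proof.
  refine (lt_lifts_hth (prod_pseudodouble (prod_pseudodouble HX HX) HE) HE _ _ Hva Hcva (lift_lifts_h HE Hcva Hva)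
    (d := c_pair (c_pair cu cv) cw) _ image_triple_l image_triple_r).
  - fok.
  - fok.
  - apply (pair_ok (prod_pseudodouble HX HX) HE (c := c_pair cu cv) (d := cw)); trivial.
    now apply pair_ok.
Qed.
End Naturality.

Section Naturality2.
Variables (A A' B B' : ob X) (G G' : ob E) (u : ver A A') (v : ver B B') (w : ver G G').
Variables (cu : companion u) (cv : companion v) (cw : companion w).
Hypotheses (Hu : is_companion cu) (Hv : is_companion cv) (Hw : is_companion cw).
Local Notation R c G := (c_bifun tri c (c_id G)).
Local Notation L' A c := (c_bifun tri (c_id A) c).

Lemma lifts_nat3 :
  lifts (c_comp (cva (A, B, G)) (L' A (L' B cw))) (c_comp (L' (tenO M A B) cw) (cva (A, B, G')))
    (nat3 T A B (ch cw)).
Proof.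
  apply (lifts_trans HE) with (d := c_comp (c_bifun tri (c_bifun (ten M) (c_id A) (c_id B)) cw)
    (cva (A, B, G'))); try cok.
  - apply (lifts_sh HE); try cok.
    + apply (lifts_bs HX HE HE Htri); try cok; [|now apply lifts_refl].
      apply (lifts_bu HX HT).
    + apply (lifts_refl HE (c := cva (A, B, G'))); cok.
  - apply (lifts_tah (cu := c_id A) (cv := c_id B)); cok.
Qed.
Lemma lifts_nat2 :
  lifts (c_comp (cva (A, B, G)) (L' A (R cv G))) (c_comp (R (c_bifun (ten M) (c_id A) cv) G) (cva (A, B', G)))
    (nat2 T A (ch cv) G).
Proof. apply (lifts_tah (cu := c_id A) (cw := c_id G)); cok. Qed.
Lemma lifts_nat1 :
  lifts (c_comp (cva (A, B, G)) (R cu (triO B G))) (c_comp (R (c_bifun (ten M) cu (c_id B)) G) (cva (A', B, G)))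
    (nat1 T (ch cu) B G).
Proof.
  apply (lifts_trans HE) with (d := c_comp (cva (A, B, G))
    (c_bifun tri cu (c_bifun tri (c_id B) (c_id G)))); try cok.
  - apply (lifts_tah (cv := c_id B) (cw := c_id G)); cok.
  - apply (lifts_sh HE); try cok.
    + apply (lifts_refl HE (c := cva (A, B, G))); cok.
    + apply (lifts_bs HX HE HE Htri); try cok; [now apply lifts_refl|].
      apply (lifts_sym HE); try cok. apply (lifts_bu HE Htri).
Qed.
End Naturality2.

Local Notation R c G := (c_bifun tri c (c_id G)).
Local Notation L' A c := (c_bifun tri (c_id A) c).
Local Notation "A ⊗ B" := (tenO M A B) (at level 35).
Local Notation "A ⊳ B" := (triO A B) (at level 37, right associativity).
Local Notation cb A B G := (cva (A, B, G)).
Local Notation ca A B C := (cal (A, B, C)).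

Lemma lifts_p A B C G :
  lifts (c_comp (cb (A ⊗ B) C G) (cb A B (C ⊳ G)))
    (c_comp (c_comp (R (ca A B C) G) (cb A (B ⊗ C) G)) (L' A (cb B C G)))
    (lift_p tri cal cva A B C G).
Proof. apply (lift_eq_lifts HE); first [cok | apply va_p]. Qed.
Lemma lifts_l A G : lifts (c_comp (cb (I0 M) A G) (cvl (A ⊳ G))) (R (cla A) G)
  (lift_l tri cla cva cvl A G).
Proof. apply (lift_eq_lifts HE); first [cok | apply va_l]. Qed.
Lemma lifts_m A G : lifts (R (crh A) G) (c_comp (cb A (I0 M) G) (L' A (cvl G)))
  (lift_m tri crh cva cvl A G).
Proof. apply (lift_eq_lifts HE); first [cok | apply va_m]. Qed.
Lemma lifts_mon_p A B C D :
  lifts (c_comp (ca (A ⊗ B) C D) (ca A B (C ⊗ D)))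
    (c_comp (c_comp (c_bifun (ten M) (ca A B C) (c_id D)) (ca A (B ⊗ C) D))
      (c_bifun (ten M) (c_id A) (ca B C D)))
    (lift_p (ten M) cal cal A B C D).
Proof. apply (lift_eq_lifts HX); first [cok | apply (mon_p HM)]. Qed.
Lemma lifts_mon_m A B :
  lifts (c_bifun (ten M) (crh A) (c_id B))
    (c_comp (ca A (I0 M) B) (c_bifun (ten M) (c_id A) (cla B)))
    (lift_m (ten M) crh cal cla A B).
Proof. apply (lift_eq_lifts HX); first [cok | apply (mon_m HM)]. Qed.

(** One rule for each kind of 2-cell in the action axioms; naturality cells that occur inverted are
    first turned round by [lifts_sym]. *)
Ltac clifts := first [apply (lifts_whl HE) | apply (lifts_whr HE) | apply (lifts_rw3r HE) | apply (lifts_rw3 HE)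
  | apply (lifts_rw2r HE) | apply (lifts_rw21r HE) | apply lifts_actR3 | apply lifts_actL3
  | apply lifts_actR2 | apply lifts_actL2 | apply lifts_actL12 | apply lifts_p
  | apply lifts_l | apply lifts_m
  | apply lifts_mon_p | apply lifts_mon_m
  | apply lifts_nat2 | apply lifts_nat1
  | apply (lifts_sym HE); [| | apply lifts_nat3] | apply (lifts_sym HE); [| | apply lifts_nat2]].
Ltac clifts_all := repeat first [cok | clifts].

Lemma lifted_TA1 A B C D G : TA1_lhs T A B C D G = TA1_rhs T A B C D G.
Proof.
  pose (c1 := R (ca (A ⊗ B) C D) G).
  pose (c2 := R (ca A B (C ⊗ D)) G).
  pose (c4 := cb A (B ⊗ (C ⊗ D)) G).
  pose (c5 := L' A (cb B (C ⊗ D) G)).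
  pose (c6 := L' A (L' B (cb C D G))).
  pose (d1 := R (c_bifun (ten M) (ca A B C) (c_id D)) G).
  pose (d2 := R (ca A (B ⊗ C) D) G).
  pose (d3 := R (c_bifun (ten M) (c_id A) (ca B C D)) G).
  pose (e1 := cb (A ⊗ B) (C ⊗ D) G).
  pose (e2 := cb A B ((C ⊗ D) ⊳ G)).
  pose (h1 := L' (A ⊗ B) (cb C D G)).
  pose (h2 := cb A B (C ⊳ (D ⊳ G))).
  pose (k1 := cb ((A ⊗ B) ⊗ C) D G).
  pose (k2 := cb (A ⊗ B) C (D ⊳ G)).
  pose (e4 := cb A ((B ⊗ C) ⊗ D) G).
  pose (m1 := L' A (R (ca B C D) G)).
  pose (q1 := L' A (cb (B ⊗ C) D G)).
  pose (q2 := L' A (cb B C (D ⊳ G))).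
  pose (s1 := cb (A ⊗ (B ⊗ C)) D G).
  pose (s2 := cb A (B ⊗ C) (D ⊳ G)).
  pose (n1 := R (ca A B C) (D ⊳ G)).
  (* [S0] is the companion of the common source of both sides, and [k1], [k2], [h2] give the common
     target. Each later [d] is the companion reached between two 2-cells; [lifts_trans] splits off
     the last 2-cell first because [//] associates to the left. *)
  pose (S0 := c_comp d1 (c_comp d2 (c_comp d3 (c_comp c4 (c_comp c5 c6))))).
  assert (Hf : is_companion (c_comp k1 (c_comp k2 h2))) by (unfold k1, k2, h2; cok).
  apply (lifts_unique HE (c := c_comp k1 (c_comp k2 h2)) (d := S0) Hf).
  - unfold TA1_lhs.
    apply (lifts_trans HE) with (d := c_comp c1 (c_comp e1 (c_comp h1 h2))); [exact Hf| |].
    2: { unfold c1, e1, h1, h2, k1, k2. clifts_all. }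
    apply (lifts_trans HE) with (d := c_comp c1 (c_comp e1 (c_comp e2 c6)));
      [unfold c1, e1, h1, h2; cok | |].
    2: { unfold c1, e1, h1, h2, e2, c6. clifts_all. }
    apply (lifts_trans HE) with (d := c_comp c1 (c_comp c2 (c_comp c4 (c_comp c5 c6))));
      [unfold c1, e1, e2, c6; cok | |].
    2: { unfold c1, c2, c4, c5, c6, e1, e2. clifts_all. }
    unfold S0, d1, d2, d3, c1, c2, c4, c5, c6. clifts_all.
  - unfold TA1_rhs. cbv zeta.
    apply (lifts_trans HE) with (d := c_comp k1 (c_comp n1 (c_comp s2 q2))); [exact Hf| |].
    2: { unfold n1, s2, q2, h2, k1, k2. clifts_all. }
    apply (lifts_trans HE) with (d := c_comp d1 (c_comp s1 (c_comp s2 q2)));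
      [unfold k1, n1, s2, q2; cok | |].
    2: { unfold d1, s1, s2, q2, k1, n1. clifts_all. }
    apply (lifts_trans HE) with (d := c_comp d1 (c_comp d2 (c_comp e4 (c_comp q1 q2))));
      [unfold d1, s1, s2, q2; cok | |].
    2: { unfold d1, d2, e4, q1, q2, s1, s2. clifts_all. }
    apply (lifts_trans HE) with (d := c_comp d1 (c_comp d2 (c_comp e4 (c_comp m1 (c_comp c5 c6)))));
      [unfold d1, d2, e4, q1, q2; cok | |].
    2: { unfold d1, d2, e4, q1, q2, m1, c5, c6. clifts_all. }
    unfold S0, d1, d2, d3, c4, c5, c6, e4, m1. clifts_all.
Qed.

Lemma lifted_TA2 A B G : TA2_lhs T A B G = TA2_rhs T A B G.
Proof.
  pose (I := I0 M).
  pose (a1 := R (ca A I B) G).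
  pose (a2 := cb A (I ⊗ B) G).
  pose (b1 := L' A (cb I B G)).
  pose (b2 := L' A (cvl (B ⊳ G))).
  pose (b0 := L' A (R (cla B) G)).
  pose (k1 := cb (A ⊗ I) B G).
  pose (k2 := R (crh A) (B ⊳ G)).
  pose (e2 := cb A I (B ⊳ G)).
  pose (d1 := R (c_bifun (ten M) (c_id A) (cla B)) G).
  pose (d2 := cb A B G).
  pose (d3 := R (c_bifun (ten M) (crh A) (c_id B)) G).
  assert (Hf : is_companion (c_comp k1 k2)) by (unfold k1, k2; cok).
  apply (lifts_unique HE (c := c_comp k1 k2) (d := c_comp a1 (c_comp a2 b0)) Hf).
  - unfold TA2_lhs. cbv zeta.
    apply (lifts_trans HE) with (d := c_comp k1 (c_comp e2 b2)); [exact Hf| |].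
    2: { unfold k1, k2, e2, b2. clifts_all. }
    apply (lifts_trans HE) with (d := c_comp a1 (c_comp a2 (c_comp b1 b2)));
      [unfold k1, e2, b2; cok | |].
    2: { unfold a1, a2, b1, b2, k1, e2. clifts_all. }
    unfold a1, a2, b0, b1, b2. clifts_all.
  - unfold TA2_rhs. cbv zeta.
    apply (lifts_trans HE) with (d := c_comp d3 d2); [exact Hf| |].
    2: { unfold k1, k2, d2, d3. clifts_all. }
    apply (lifts_trans HE) with (d := c_comp a1 (c_comp d1 d2));
      [unfold d3, d2; cok | |].
    2: { unfold a1, d1, d2, d3. clifts_all. }
    unfold a1, a2, b0, d1, d2. clifts_all.
Qed.

(** With [E] the base this gives the canonical action, with [E] the Kleisli double category the
    induced one. The second use is why [E] is only assumed to be a pseudodouble category. *)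
Theorem lifted_haction : is_haction T.
Proof.
  assert (HU := un_functor HM).
  split.
  - exact Htri.
  - split; [|exact Eva].
    refine (lt_is_htrans HE Hcva (lift_lifts_h HE Hcva Hva) _ _ Hva va_inv); [fok | fok].
  - split; [|exact Evl].
    refine (lt_is_htrans HE Hcvl (lift_lifts_h HE Hcvl Hvl) _ _ Hvl vl_inv); fok.
  - apply (lifted_p_mod (W := dbl_prod (dbl_prod (dbl_prod X X) X) E)
      (x := w1 X E) (w2 X E) (w3 X E) (g := w4 X E)); [unfold w1 | unfold w4]; fok.
  - apply (lifted_l_mod (W := dbl_prod X E) (f_fst X E) (g := f_snd X E)); fok.
  - apply (lifted_m_mod (W := dbl_prod X E) (x := f_fst X E) (g := f_snd X E)); fok.
  - exact lifted_TA1.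
  - exact lifted_TA2.
Qed.
End LiftedAction.

(** * Companion-lifted monoidal structures *)

Section LiftedMonoidal.
Variables (X : dbl_data) (HX : is_pseudodouble X).
Variables (M : monoidal_data X) (HM : is_monoidal M).
Variables (cal : forall x, companion (vt1 (al M) x))
          (cla : forall A, companion (vt1 (la M) A))
          (crh : forall A, companion (vt1 (rh M) A)).
Hypotheses (Hal : forall x, is_companion (cal x)) (Hla : forall x, is_companion (cla x))
  (Hrh : forall x, is_companion (crh x))
  (Eal : forall x, is_hequiv (ch (cal x))) (Ela : forall x, is_hequiv (ch (cla x)))
  (Erh : forall x, is_hequiv (ch (crh x))).
Let N := lift_monoidal cal cla crh.
Let T := lift_action cal cla crh (ten M) cal cla.
Let HT := ten_functor HM.
Local Notation R c G := (c_bifun (ten M) c (c_id G)).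
Local Notation L' A c := (c_bifun (ten M) (c_id A) c).
Local Notation "A ⊗ B" := (tenO M A B) (at level 35).
Local Notation ca A B C := (cal (A, B, C)).

Lemma self_haction : is_haction (self_action N).
Proof.
  exact (lifted_haction HX HX HM (ten_functor HM) (al_vtrans HM) (la_vtrans HM) (al_inv HM)
    (la_inv HM) (mon_p HM) (mon_ps HM) (mon_m HM) (mon_ms HM) (mon_l HM) (mon_ls HM)
    Hal Hla Hrh Hal Hla Eal Ela).
Qed.

(** This axiom involves [hr], which has no analogue in an action, so it is treated apart; the
    argument by uniqueness between fixed source and target companions is unchanged. *)
Lemma lifted_TA3 A B C : TA3_lhs N A B C = TA3_rhs N A B C.
Proof.
  pose (I := I0 M).
  pose (a1 := R (ca A B I) C).
  pose (a2 := ca A (B ⊗ I) C).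
  pose (a3 := L' A (ca B I C)).
  pose (a4 := L' A (L' B (cla C))).
  pose (b1 := ca (A ⊗ B) I C).
  pose (b2 := ca A B (I ⊗ C)).
  pose (b3 := L' (A ⊗ B) (cla C)).
  pose (k1 := R (crh (A ⊗ B)) C).
  pose (k2 := ca A B C).
  pose (d1 := L' A (R (crh B) C)).
  pose (d2 := R (L' A (crh B)) C).
  assert (Hf : is_companion (c_comp k1 k2)) by (unfold k1, k2; cok).
  apply (lifts_unique HX (c := c_comp k1 k2)
    (d := c_comp a1 (c_comp a2 (c_comp a3 a4))) Hf).
  - unfold TA3_lhs. cbv zeta.
    apply (lifts_trans HX) with (d := c_comp b1 (c_comp b3 k2)); [exact Hf| |].
    2: { unfold b1, b3, k1, k2. apply (lifts_rw21r HX); try cok. apply (lifts_mon_m HX HM); cok. }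
    apply (lifts_trans HX) with (d := c_comp b1 (c_comp b2 a4)); [unfold b1, b3, k2; cok | |].
    2: { unfold b1, b2, b3, k2, a4. apply (lifts_whl HX); try cok.
      apply (lifts_sym HX); try cok.
      apply (lifts_nat3 HX HX HM HT (al_vtrans HM)); cok. }
    unfold a1, a2, a3, a4, b1, b2. apply (lifts_rw3r HX); try cok.
    apply (lifts_mon_p HX HM); cok.
  - unfold TA3_rhs. cbv zeta.
    apply (lifts_trans HX) with (d := c_comp a1 (c_comp d2 k2)); [exact Hf| |].
    2: { unfold a1, d2, k1, k2. apply (lifts_rw21r HX); try cok.
      apply (lifts_sym HX); try cok. apply (lifts_actR12 HX HX HT); try cok.
      apply (lift_eq_lifts HX); try cok. apply (mon_r HM). }
    apply (lifts_trans HX) with (d := c_comp a1 (c_comp a2 d1)); [unfold a1, d2, k2; cok | |].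
    2: { unfold a1, a2, d1, d2, k2. apply (lifts_whl HX); try cok.
      apply (lifts_sym HX); try cok.
      apply (lifts_nat2 HX HX HM HT (al_vtrans HM)); cok. }
    unfold a1, a2, a3, a4, d1. apply (lifts_whl HX); try cok. apply (lifts_whl HX); try cok.
    apply (lifts_actL2 HX HX HT); try cok. apply (lifts_mon_m HX HM); cok.
Qed.

Lemma lifted_r_mod :
  is_imod (f_app2 (ten M) (f_app2 (ten M) (f_fst X X) (f_snd X X)) (f_unit (un M) _))
      (f_app2 (ten M) (f_fst X X) (f_snd X X))
      (r_src N) (r_tgt N) (fun w => hr N (fst w) (snd w)).
Proof.
  set (x := f_fst X X). set (y := f_snd X X).
  assert (H1 := lt_rh HX HM cal cla Hrh (f_app2 (ten M) x y)).
  assert (H2 := lt_al HX HM cla crh Hal x y (f_unit (un M) _)).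
  assert (Hx : is_functor x) by (unfold x; fok).
  assert (H3 := lt_actL HX HX HT cal cla crh cal cla Hx (lt_rh HX HM cal cla Hrh y)
    (fun w => Hrh (snd w))).
  refine (lt_is_imod HX _ _ H1 (lt_comp HX _ _ H2 H3) _ _);
    try (intros; cbn; cok).
  - intros. symmetry. apply (mon_rs HM).
  - intros w. apply (lift_eq_lifts HX); try cok. apply (mon_r HM).
Qed.

Theorem lifted_is_hmonoidal : is_hmonoidal N.
Proof.
  assert (HU := un_functor HM).
  split.
  - exact self_haction.
  - exact HU.
  - split; [|exact Erh].
    refine (lt_is_htrans HX Hrh (lift_lifts_h HX Hrh (rh_vtrans HM)) _ _ (rh_vtrans HM)
      (rh_inv HM)); fok.
  - exact lifted_r_mod.
  - exact lifted_TA3.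
Qed.
End LiftedMonoidal.

(** * Simplifications over a strict base *)

Section Strict.
Variables (X : dbl_data) (HX : is_pseudodouble X) (SX : is_strict X).

Lemma ginv_sid (A B : ob X) (f : hor A B) : ginv (sid f) = sid f.
Proof.
  apply (ginv_unique HX) with f f. repeat split; try bd; apply (sid_sv HX); bd.
Qed.
Lemma sh_assoc (A B C D A' B' C' D' : ob X)
    (a : sq A B A' B') (b : sq B C B' C') (c : sq C D C' D') :
  wf a -> wf b -> wf c -> rgt a = lft b -> rgt b = lft c ->
  (a || b) || c = a || (b || c).
Proof.
  intros Ha Hb Hc E E'. assert (H := asc_nat HX Ha Hb Hc E E').
  wfs. rewrite !(asc_id SX) in H. subst.
  rewrite (sid_sv HX), (sv_sid HX) in H by bd. exact H.
Qed.
Lemma sidv_sh (A B A' B' : ob X) (a : sq A B A' B') u :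
  wf a -> lft a = u -> sidv u || a = a.
Proof.
  intros Ha <-. assert (H := lun_nat HX Ha). wfs. rewrite !(lun_id SX) in H.
  rewrite (sid_sv HX), (sv_sid HX) in H by bd. exact H.
Qed.
Lemma sh_sidv (A B A' B' : ob X) (a : sq A B A' B') u :
  wf a -> rgt a = u -> a || sidv u = a.
Proof.
  intros Ha <-. assert (H := run_nat HX Ha). wfs. rewrite !(run_id SX) in H.
  rewrite (sid_sv HX), (sv_sid HX) in H by bd. exact H.
Qed.
Lemma hid_sh (A B B' : ob X) (a : sq A B A B') : wf a -> lft a = vid A -> sid (hid A) || a = a.
Proof. rewrite <- (sidv_id HX). apply sidv_sh. Qed.
Lemma sh_hid (A B A' : ob X) (a : sq A B A' B) : wf a -> rgt a = vid B -> a || sid (hid B) = a.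
Proof. rewrite <- (sidv_id HX). apply sh_sidv. Qed.

Section Assoc.
Variables (A B C D : ob X) (x : ver A B) (y : ver B C) (z : ver C D) (w : ver A D).
Variables (cx : companion x) (cy : companion y) (cz : companion z) (d : companion w).
Hypotheses (Hx : is_companion cx) (Hy : is_companion cy) (Hz : is_companion cz).
(** The associator lifts the rebracketing and is an identity square here, so the two bracketings of
    a composite companion share their counit. Hence [lifts] does not see the bracketing. *)
Lemma ceps_comp_assoc :
  ceps (c_comp cx (c_comp cy cz)) = ceps (c_comp (c_comp cx cy) cz).
Proof.
  destruct (lifts_asc HX Hx Hy Hz) as [_ E]. rewrite (asc_id SX) in E.
  assert (is_companion (c_comp cx (c_comp cy cz))) by cok.
  assert (H' := ceps_sq H).
  rewrite <- E. symmetry. apply (sid_sv HX); [bd|]. rewrite (top_of H'). cbn.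
  symmetry. apply (hc_assoc SX).
Qed.
Lemma lifts_assoc_l s :
  lifts (c_comp (c_comp cx cy) cz) d s <-> lifts (c_comp cx (c_comp cy cz)) d s.
Proof.
  unfold lifts. rewrite <- ceps_comp_assoc. cbn [ch c_comp]. now rewrite (hc_assoc SX).
Qed.
Lemma lifts_assoc_r s :
  lifts d (c_comp (c_comp cx cy) cz) s <-> lifts d (c_comp cx (c_comp cy cz)) s.
Proof.
  unfold lifts. rewrite <- ceps_comp_assoc. cbn [ch c_comp]. now rewrite (hc_assoc SX).
Qed.
End Assoc.
End Strict.

Lemma image_f_comp (X Y Z : dbl_data) (HX : is_pseudodouble X) (HY : is_pseudodouble Y)
    (HZ : is_pseudodouble Z) (F0 : ob X -> ob Y) (G0 : ob Y -> ob Z)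
    (F : functor F0) (G : functor G0) (HF : is_functor F) (HG : is_functor G)
    (A B : ob X) (u : ver A B) (d : companion u) :
  is_companion d -> image_companion (f_comp F G) d (c_fun G (c_fun F d)).
Proof.
  intros Hd. apply (image_comp HY HZ HF HG (image_c_fun HX HY HF Hd)).
  apply (image_c_fun HY HZ HG). cok.
Qed.

(** * The companion-lifted monad *)

Section LiftedMonad.
Variables (X : dbl_data) (HX : is_pseudodouble X) (SX : is_strict X).
Variables (T : vmonad_data X) (HT : is_vmonad T).
Variables (cmu : forall A, companion (vt1 (vmu T) A))
          (ceta : forall A, companion (vt1 (veta T) A)).
Hypotheses (Hmu : forall A, is_companion (cmu A)) (Heta : forall A, is_companion (ceta A)).
Hypotheses (mu_inv : invertible (vmu T)) (eta_inv : invertible (veta T)).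
Let S := lift_monad cmu ceta.
Let F := tf T.
Let HF : is_functor F := tf_functor HT.

Lemma lifts_hass A :
  lifts (c_comp (c_fun F (cmu A)) (cmu A)) (c_comp (cmu (tO T A)) (cmu A)) (hass S A).
Proof. apply (lift_eq_lifts HX); first [cok | symmetry; apply (vmu_assoc HT)]. Qed.
Lemma lifts_hlu A : lifts (c_id (tO T A)) (c_comp (ceta (tO T A)) (cmu A)) (hlu S A).
Proof. apply (lift_eq_lifts HX); first [cok | symmetry; apply (vmu_idl HT)]. Qed.
Lemma lifts_hru A : lifts (c_id (tO T A)) (c_comp (c_fun F (ceta A)) (cmu A)) (hru S A).
Proof. apply (lift_eq_lifts HX); first [cok | symmetry; apply (vmu_idr HT)]. Qed.
Lemma lifts_hth_mu A B (u : ver A B) (c : companion u) : is_companion c ->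
  lifts (c_comp (cmu A) (c_fun F c)) (c_comp (c_fun F (c_fun F c)) (cmu B)) (hth (hmu S) (ch c)).
Proof.
  intros Hc.
  apply (lt_lifts_hth HX HX (f_comp_ok HX HX HX HF HF) HF (vmu_vtrans HT) Hmu
    (lift_lifts_h HX Hmu (vmu_vtrans HT))); trivial.
  - now apply image_f_comp.
  - now apply image_c_fun.
Qed.

Theorem lifted_is_hmonad : is_hmonad S.
Proof.
  assert (Lmu := lift_lifts_h HX Hmu (vmu_vtrans HT)).
  assert (Leta := lift_lifts_h HX Heta (veta_vtrans HT)).
  split.
  - exact HF.
  - refine (lt_is_htrans HX Hmu Lmu _ _ (vmu_vtrans HT) mu_inv); fok.
  - refine (lt_is_htrans HX Heta Leta _ _ (veta_vtrans HT) eta_inv); fok.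
  - cbv zeta.
    refine (lt_is_imod HX (F := f_comp (f_comp F F) F) (G := F)
      (a := ht_comp (f_comp (f_comp F F) F) (f_comp F F) F (ht_pre F (hmu S)) (hmu S))
      (b := ht_comp (f_comp (f_comp F F) F) (f_comp F F) F
        (ht_post F (f_comp F F) F (hmu S)) (hmu S))
      _ _ (lt_comp HX _ _ (lt_pre F Lmu) Lmu)
      (lt_comp HX _ _ (lt_post HX HX _ Lmu HF) Lmu) _ lifts_hass);
      try (intros; cbn; cok).
    intros. apply (vmu_assoc_s HT).
  - cbv zeta.
    refine (lt_is_imod HX (F := F) (G := F)
      (a := ht_comp F (f_comp F F) F (ht_pre F (heta S)) (hmu S))
      _ _ (lt_comp HX _ _ (lt_pre F Leta) Lmu)
      (lt_id HX HF) _ lifts_hlu); try (intros; cbn; cok).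
    intros. apply (vmu_idl_s HT).
  - cbv zeta.
    refine (lt_is_imod HX (F := F) (G := F)
      (a := ht_comp F (f_comp F F) F (ht_post F (f_id X) F (heta S)) (hmu S))
      _ _ (lt_comp HX _ _ (lt_post HX HX _ Leta HF) Lmu)
      (lt_id HX HF) _ lifts_hru); try (intros; cbn; cok).
    intros. apply (vmu_idr_s HT).
  - intros A. cbv zeta.
    pose (m0 := cmu A). pose (m1 := cmu (tO T A)). pose (m2 := cmu (tO T (tO T A))).
    assert (H0 : is_companion m0) by (unfold m0; cok).
    assert (H1 : is_companion m1) by (unfold m1; cok).
    assert (H2 : is_companion m2) by (unfold m2; cok).
    assert (E0 := lifts_hass A). fold m0 m1 in E0.
    assert (E1 := lifts_hass (tO T A)). fold m1 m2 in E1.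
    assert (EF : lifts (c_fun F (c_comp (c_fun F m0) m0)) (c_fun F (c_comp m1 m0))
      (fs F (hass S A))) by (apply (lifts_fs HX HF); trivial; cok).
    (* Both sides of the pentagon run from [[μ_TT | μ_T | μ]] to [[TTμ | Tμ | μ]]. The lemmas on
       bracketing bring the pair of factors to be rewritten together. *)
    apply (lifts_unique HX (c := c_comp (c_fun F (c_fun F m0)) (c_comp (c_fun F m0) m0))
      (d := c_comp m2 (c_comp m1 m0))); [cok | |].
    + apply (lifts_trans HX) with (d := c_comp (c_fun F m1) (c_comp (c_fun F m0) m0)); [cok | |].
      2: { apply (lifts_assoc_l HX SX); try cok. apply (lifts_assoc_r HX SX); try cok.
        apply (lifts_whr HX); try cok.
        apply (lifts_trans HX) with (d := c_fun F (c_comp (c_fun F m0) m0)); try cok.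
        2: { apply (lifts_sym HX); try cok. apply (lifts_fc HX HX HF (c := c_fun F m0)); cok. }
        apply (lifts_trans HX) with (d := c_fun F (c_comp m1 m0)); try cok.
        apply (lifts_fc HX HX HF (c := m1)); cok. }
      apply (lifts_trans HX) with (d := c_comp (c_fun F m1) (c_comp m1 m0)); [cok | |].
      2: { apply (lifts_whl HX); trivial; cok. }
      apply (lifts_assoc_l HX SX); try cok. apply (lifts_assoc_r HX SX); try cok.
      apply (lifts_whr HX); trivial; cok.
    + apply (lifts_trans HX) with (d := c_comp (c_fun F (c_fun F m0)) (c_comp m1 m0)); [cok | |].
      2: { apply (lifts_whl HX (c := c_fun F (c_fun F m0))); trivial; cok. }
      apply (lifts_trans HX) with (d := c_comp m2 (c_comp (c_fun F m0) m0)); [cok | |].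
      2: { apply (lifts_assoc_l HX SX); try cok. apply (lifts_assoc_r HX SX); try cok.
        apply (lifts_whr HX); try cok. apply (lifts_sym HX); try cok.
        now apply lifts_hth_mu. }
      apply (lifts_whl HX); trivial; cok.
  - intros A. cbv zeta.
    pose (m0 := cmu A). pose (m1 := cmu (tO T A)).
    pose (e1 := ceta (tO T A)).
    assert (H0 : is_companion m0) by (unfold m0; cok).
    assert (H1 : is_companion m1) by (unfold m1; cok).
    assert (H3 : is_companion e1) by (unfold e1; cok).
    assert (E0 := lifts_hass A). fold m0 m1 in E0.
    assert (E1 := lifts_hlu A). fold m0 e1 in E1.
    assert (E2 := lifts_hru (tO T A)). fold m1 e1 in E2.
    assert (EF : lifts (c_fun F (c_id (tO T A))) (c_fun F (c_comp e1 m0))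
      (fs F (hlu S A))) by (apply (lifts_fs HX HF); trivial; cok).
    apply (lifts_unique HX (c := c_comp (c_id _) m0)
      (d := c_comp (c_comp (c_fun F e1) m1) m0)); [cok | |].
    + apply (lifts_whr HX); trivial; cok.
    + apply (lifts_trans HX) with (d := c_comp (c_comp (c_fun F e1) (c_fun F m0)) m0); [cok | |].
      * apply (lifts_assoc_l HX SX); try cok. apply (lifts_assoc_r HX SX); try cok.
        apply (lifts_whl HX (c := c_fun F e1)); trivial; cok.
      * apply (lifts_whr HX); try cok.
        apply (lifts_trans HX) with (d := c_fun F (c_id (tO T A))); try cok.
        2: { apply (lifts_sym HX); try cok. apply (lifts_fu HX HF). }
        apply (lifts_trans HX) with (d := c_fun F (c_comp e1 m0)); try cok.
        apply (lifts_fc HX HX HF (c := e1)); cok.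
Qed.
End LiftedMonad.

(** * Opcartesian squares and the Kleisli double category *)

(* The opcartesian square with top [p], right side [u] and bottom [p | û]. *)
Definition kap (X : dbl_data) (A B C : ob X) (p : hor A B) (u : ver B C)
    (c : companion u) : sq A B A C := sid p || ciot c.

Section Kap.
Variables (X : dbl_data) (HX : is_pseudodouble X) (SX : is_strict X).

Lemma kap_ty (A B C : ob X) (p : hor A B) (u : ver B C) (c : companion u) :
  is_companion c -> is_sq (kap p c) p (p *h ch c) (vid A) u.
Proof. intros Hc. unfold kap. bd. Qed.
Hint Resolve kap_ty : sqty.
(** Agreement of the bottoms is read off from the composites; only the right sides have to be known
    equal beforehand. *)
Lemma kap_epi (A B C D E : ob X) (p : hor A B) (u : ver B C) (c : companion u)
    (s s' : sq A C D E) g g' l l' r :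
  is_companion c -> is_sq s (p *h ch c) g l r -> is_sq s' (p *h ch c) g' l' r ->
  kap p c // s = kap p c // s' -> s = s'.
Proof.
  intros Hc Hs Hs' Eq.
  assert (g = g') as <-.
  { transitivity (bot (kap p c // s)); [symmetry; bd | rewrite Eq; bd]. }
  exact (ciot_epi_sh HX Hc Hs Hs' Eq).
Qed.
(** The condition on [b] is the one satisfied by a lifted square. Passing the opcartesian cell
    upwards past [a || b] then removes [b]. *)
Lemma kap_nat (A B C A' B' C' : ob X) (p : hor A B) (p' : hor A' B')
    (u : ver B C) (u' : ver B' C') (c : companion u) (c' : companion u')
    (a : sq A B A' B') (b : sq B C B' C') l w r :
  is_companion c -> is_companion c' ->
  is_sq a p p' l w -> is_sq b (ch c) (ch c') w r ->
  ciot c // b = sidv w // ciot c' -> kap p c // (a || b) = a // kap p' c'.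
Proof.
  intros Hc Hc' Ha Hb E. unfold kap.
  assert (E1 : w *v u' = u *v r).
  { transitivity (rgt (ciot c // b)); [rewrite E|]; [symmetry|]; bd. }
  rewrite (ich HX), E, (sid_sv HX) by bd.
  rewrite <- (sv_sid HX (a := a) (f := p')) at 1 by bd. rewrite <- (ich HX) by bd.
  rewrite (sh_sidv HX SX); bd.
Qed.
Lemma kap_nat_sid (A B C A' : ob X) (p : hor A B) (p' : hor A' B)
    (u : ver B C) (c : companion u) (a : sq A B A' B) l :
  is_companion c -> is_sq a p p' l (vid B) ->
  kap p c // (a || sid (ch c)) = a // kap p' c.
Proof.
  intros Hc Ha. eapply kap_nat; [eassumption | eassumption | eassumption | bd |].
  rewrite (sidv_id HX), (sid_sv HX), (sv_sid HX); bd.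
Qed.
Lemma kap_sh (A B C D : ob X) (x : hor D A) (p : hor A B) (u : ver B C) (c : companion u) :
  is_companion c -> sid x || kap p c = kap (x *h p) c.
Proof. intros Hc. unfold kap. rewrite (sid_hc HX). symmetry. apply (sh_assoc HX SX); bd. Qed.
Lemma kap_comp (A B C D : ob X) (p : hor A B) (u : ver B C) (v : ver C D)
    (c : companion u) (d : companion v) :
  is_companion c -> is_companion d ->
  kap p c // kap (p *h ch c) d = kap p (c_comp c d).
Proof.
  intros Hc Hd. unfold kap. cbn. rewrite (run_id SX), (ginv_sid HX), (sv_sid HX) by bd.
  rewrite (sid_hc HX), (sh_assoc HX SX (b := sid (ch c))) by bd.
  rewrite <- (sh_sidv HX SX (a := ciot c) (u := u)) at 1 by bd.
  rewrite (ich HX), (sid_sv HX) by bd. f_equal. f_equal. apply (sh_sidv HX SX); bd.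
Qed.
Lemma lifts_ciot (A B : ob X) (u v : ver A B) (c : companion u) (d : companion v) s :
  is_companion c -> is_companion d -> lifts c d s -> ciot d // s = ciot c.
Proof.
  intros Hc Hd H. assert (E := lifts_ver HX Hc Hd H). destruct H as [Hs Es].
  eapply ceps_mono; [exact HX | exact Hc | bd | bd |].
  rewrite (sv_assoc HX) by bd. rewrite Es, (ciot_ceps_v Hc), (ciot_ceps_v Hd). now subst.
Qed.
(** Lifted equalities become invisible behind an opcartesian cell: they merely replace one
    presentation of the companion by another. *)
Lemma kap_lifts (A B C : ob X) (p : hor A B) (u v : ver B C) (c : companion u)
    (d : companion v) s :
  is_companion c -> is_companion d -> lifts c d s -> kap p d // (sid p || s) = kap p c.
Proof.
  intros Hc Hd H. assert (Hs := lifts_glob H). unfold kap.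
  rewrite (ich HX), (sid_sv HX) by bd. now rewrite (lifts_ciot Hc Hd H).
Qed.
Lemma kap_id (A B : ob X) (p : hor A B) : kap p (c_id B) = sid p.
Proof. unfold kap. cbn. apply (sh_hid HX SX); bd. Qed.
End Kap.
#[global] Hint Resolve kap_ty : sqty.

(** A functor preserves opcartesian cells up to its compositor, by the right unit law [fc_run]. *)
Lemma kap_fun (X Y : dbl_data) (HX : is_pseudodouble X) (HY : is_pseudodouble Y)
    (SX : is_strict X) (SY : is_strict Y)
    (F0 : ob X -> ob Y) (F : functor F0) (HF : is_functor F)
    (A B C : ob X) (p : hor A B) (u : ver B C) (c : companion u) : is_companion c ->
  kap (fh F p) (c_fun F c) // fc F p (ch c) = fs F (kap p c).
Proof.
  intros Hc. unfold kap. cbn.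
  rewrite <- (sid_sv HY (a := sid (fh F p)) (f := fh F p)) by bd.
  rewrite <- (ich HY), <- (fs_sid HF) by bd. asr. vr (fc_sq HF).
  rewrite <- (sv_assoc HY) by bd.
  assert (E := fc_run HF p). rewrite !(run_id SX), !(run_id SY), (fs_sid HF) in E.
  rewrite (sv_sid HY) in E by bd. rewrite (fs_sid HF), E, (sid_sv HY); bd.
Qed.

Lemma prod_strict (X Y : dbl_data) : is_strict X -> is_strict Y -> is_strict (dbl_prod X Y).
Proof.
  intros HX HY. split; intros; cbn; try (destruct f; cbn);
   rewrite ?(asc_id HX), ?(asc_id HY), ?(lun_id HX), ?(lun_id HY), ?(run_id HX), ?(run_id HY),
     ?(hc_assoc HX), ?(hc_assoc HY), ?(hc_idl HX), ?(hc_idl HY), ?(hc_idr HX), ?(hc_idr HY);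
   trivial.
Qed.

Section KapLift.
Variables (X Y : dbl_data) (HX : is_pseudodouble X) (HY : is_pseudodouble Y) (SY : is_strict Y).
Variables (F0 G0 : ob X -> ob Y) (F : functor F0) (G : functor G0).
Variables (v : vtrans F0 G0) (c : forall A, companion (vt1 v A)) (a : htrans F0 G0).
Hypotheses (Hc : forall A, is_companion (c A)) (Ha : lifts_h F G c a).
Lemma lt_htv_ciot (A A' : ob X) (u : ver A A') : fv F u *v vt1 v A' = vt1 v A *v fv G u ->
  ciot (c A) // htv a u = sidv (fv F u) // ciot (c A').
Proof.
  intros E. assert (T0 := lt_htv_ty Ha u). assert (H1 := Hc A). assert (H2 := Hc A').
  eapply ceps_mono; [exact HY | apply Hc | bd | bd |]. asr.
  rewrite (lt_htv Ha), (ciot_ceps_v H2), <- (sv_assoc HY), (ciot_ceps_v H1) by bd.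
  now rewrite <- !(sidv_vc HY), E.
Qed.
Lemma lt_hth_ciot (A B : ob X) (f : hor A B) :
  kap (fh F f) (c B) // hth a f = ciot (c A) || vts v f.
Proof.
  assert (T1 := lt_vts_ty Ha f). assert (T2 := lt_hth_ty Ha f).
  assert (H1 := Hc A). assert (H2 := Hc B). assert (E := lt_hth Ha f).
  rewrite (lun_id SY), (run_id SY), !(sv_sid HY) in E by bd.
  eapply ceps_mono_sh; [exact HY | apply Hc | bd | bd |]. asr. rewrite E. unfold kap.
  rewrite !(ich HY), (ciot_ceps_v H1), (ciot_ceps_v H2), (sid_sv HY), (sv_sid HY) by bd.
  rewrite (sidv_sh HY SY), (sh_sidv HY SY); bd.
Qed.
End KapLift.

(** * Whiskering and vertical inverses *)

Lemma whl_sv (X : dbl_data) (HX : is_pseudodouble X) (A B C D E : ob X)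
    (f : hor A B) (a : sq B C B D) (b : sq B D B E) g g' g'' v v' :
  is_sq a g g' (vid B) v -> is_sq b g' g'' (vid B) v' ->
  sid f || (a // b) = (sid f || a) // (sid f || b).
Proof. intros Ha Hb. rewrite (ich HX) by bd. now rewrite (sid_sv HX) by bd. Qed.
Lemma sv_assoc4 (E : dbl_data) (HE : is_pseudodouble E) (A B A1 B1 A2 B2 A3 B3 A4 B4 : ob E)
    (a : sq A B A1 B1) (b : sq A1 B1 A2 B2) (c : sq A2 B2 A3 B3) (d : sq A3 B3 A4 B4)
    f f1 f2 f3 f4 u u1 u2 u3 v v1 v2 v3 :
  is_sq a f f1 u v -> is_sq b f1 f2 u1 v1 -> is_sq c f2 f3 u2 v2 -> is_sq d f3 f4 u3 v3 ->
  a // b // c // d = a // (b // c // d).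
Proof. intros Ha Hb Hc Hd. rewrite !(sv_assoc HE) by bd. reflexivity. Qed.
Lemma whl_sv_right (E : dbl_data) (HE : is_pseudodouble E) (A B C : ob E) (x : hor A B)
    (a : sq A C A C) (b c : sq B C B C) f g0 g1 g2 :
  is_glob a f (x *h g0) -> is_glob b g0 g1 -> is_glob c g1 g2 ->
  a // (sid x || b) // (sid x || c) = a // (sid x || (b // c)).
Proof.
  intros Ha Hb Hc. rewrite (sv_assoc HE), (ich HE), (sid_sv HE) by bd. reflexivity.
Qed.
(** [is_viso] prescribes only top and bottom of the inverse. Comparing the sides of both composites
    with those of identity squares shows that the sides are inverse 1v-cells. *)
Lemma viso_data (X : dbl_data) (HX : is_pseudodouble X) (A C D E : ob X) (a : sq A C D E) f g u v :
  is_viso a -> is_sq a f g u v ->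
  exists b u' v', is_sq b g f u' v' /\ a // b = sid f /\ b // a = sid g /\
    (u *v u' = vid A /\ u' *v u = vid D) /\ (v *v v' = vid C /\ v' *v v = vid E).
Proof.
  intros [_ (b & H1 & H2 & H3 & H4 & H5)] Ha.
  rewrite (top_of Ha), (bot_of Ha) in *.
  exists b, (lft b), (rgt b).
  assert (Hb : is_sq b g f (lft b) (rgt b)) by (repeat split; trivial).
  assert (L1 := f_equal (@lft _ _ _ _ _) H4). assert (L2 := f_equal (@lft _ _ _ _ _) H5).
  assert (R1 := f_equal (@rgt _ _ _ _ _) H4). assert (R2 := f_equal (@rgt _ _ _ _ _) H5).
  rewrite (lft_of (sv_ty HX Ha Hb)), (lft_of (sid_ty HX _)) in L1.
  rewrite (lft_of (sv_ty HX Hb Ha)), (lft_of (sid_ty HX _)) in L2.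
  rewrite (rgt_of (sv_ty HX Ha Hb)), (rgt_of (sid_ty HX _)) in R1.
  rewrite (rgt_of (sv_ty HX Hb Ha)), (rgt_of (sid_ty HX _)) in R2.
  repeat split; trivial.
Qed.
(** The inverse lifts the equality [w *v v' = v *v w'], obtained from the given one by cancelling
    [u] and [u']; monic counits show that the composites are identities. *)
Lemma lift_sq_inv (X : dbl_data) (HX : is_pseudodouble X) (A C D E : ob X) (u : ver A D) (v : ver D E) (v' : ver A C) (u' : ver C E)
    (w : ver D A) (w' : ver E C) (cv : companion v) (cv' : companion v') :
  is_companion cv -> is_companion cv' -> u *v v = v' *v u' ->
  u *v w = vid A -> w *v u = vid D -> u' *v w' = vid C -> w' *v u' = vid E ->
  is_sq (lift_sq w w' cv' cv) (ch cv) (ch cv') w w' /\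
  lift_sq u u' cv cv' // lift_sq w w' cv' cv = sid (ch cv') /\
  lift_sq w w' cv' cv // lift_sq u u' cv cv' = sid (ch cv).
Proof.
  intros H1 H2 E1 E2 E3 E4 E5.
  assert (E6 : w *v v' = v *v w').
  { rewrite <- (vc_idr HX v'), <- E4, <- (vc_assoc HX v'), <- E1.
    rewrite <- !(vc_assoc HX), E3, (vc_idl HX). reflexivity. }
  assert (T1 := lift_sq_ty HX H1 H2 E1). assert (T2 := lift_sq_ty HX H2 H1 E6).
  split; [exact T2 | split].
  - eapply (ceps_mono HX H2); [bd | bd |].
    rewrite (sv_assoc HX), (lift_sq_ceps HX H2 H1 E6), <- (sv_assoc HX) by bd.
    rewrite (lift_sq_ceps HX H1 H2 E1), (sv_assoc HX), <- (sidv_vc HX), E4, (sidv_id HX) by bd.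
    rewrite (sv_sid HX), (sid_sv HX); bd.
  - eapply (ceps_mono HX H1); [bd | bd |].
    rewrite (sv_assoc HX), (lift_sq_ceps HX H1 H2 E1), <- (sv_assoc HX) by bd.
    rewrite (lift_sq_ceps HX H2 H1 E6), (sv_assoc HX), <- (sidv_vc HX), E5, (sidv_id HX) by bd.
    rewrite (sv_sid HX), (sid_sv HX); bd.
Qed.

Section Kleisli.
Variables (X : dbl_data) (HX : is_pseudodouble X) (SX : is_strict X).
Variables (T : vmonad_data X) (HT : is_vmonad T).
Variables (cmu : forall A, companion (vt1 (vmu T) A))
          (ceta : forall A, companion (vt1 (veta T) A)).
Hypotheses (Hmu : forall A, is_companion (cmu A)) (Heta : forall A, is_companion (ceta A)).
Hypotheses (mu_inv : invertible (vmu T)) (eta_inv : invertible (veta T)).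
Let S := lift_monad cmu ceta.
Let F := tf T.
Let HF : is_functor F := tf_functor HT.
Let Lmu := lift_lifts_h HX Hmu (vmu_vtrans HT).
Let Leta := lift_lifts_h HX Heta (veta_vtrans HT).
Local Notation tT := (tO T).

(* Retyped copies of the structure cells, so that all objects are written with [tO T]. *)
Definition muv A : ver (tT (tT A)) (tT A) := vt1 (vmu T) A.
Definition etav A : ver A (tT A) := vt1 (veta T) A.
Definition mus A B (f : hor A B) : sq (tT (tT A)) (tT (tT B)) (tT A) (tT B) := vts (vmu T) f.
Definition etas A B (f : hor A B) : sq A B (tT A) (tT B) := vts (veta T) f.
Definition muh A : hor (tT (tT A)) (tT A) := ch (cmu A).
Definition etah A : hor A (tT A) := ch (ceta A).
Definition cmu' A : companion (muv A) := cmu A.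
Definition ceta' A : companion (etav A) := ceta A.
Definition mu_f A B (f : hor A B) : sq (tT (tT A)) (tT B) (tT (tT A)) (tT B) := hth (hmu S) f.
Definition eta_f A B (f : hor A B) : sq A (tT B) A (tT B) := hth (heta S) f.
Definition mu_u A B (u : ver A B) : sq (tT (tT A)) (tT A) (tT (tT B)) (tT B) := htv (hmu S) u.
Definition eta_u A B (u : ver A B) : sq A (tT A) B (tT B) := htv (heta S) u.
Definition ass A : sq (tT (tT (tT A))) (tT A) (tT (tT (tT A))) (tT A) := hass S A.
Definition lu A : sq (tT A) (tT A) (tT A) (tT A) := hlu S A.
Definition ru A : sq (tT A) (tT A) (tT A) (tT A) := hru S A.

Definition kh A B C (f : hor A (tT B)) (g : hor B (tT C)) : hor A (tT C) :=
  f *h fh F g *h muh C.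
Definition ks A B C A' B' C' (a : sq A (tT B) A' (tT B'))
    (b : sq B (tT C) B' (tT C')) (w : ver C C') : sq A (tT C) A' (tT C') :=
  a || fs F b || mu_u w.
(** The opcartesian cell that collapses [TT C] to [T C]. A cell out of a Kleisli composite, with a
    prescribed right side, is determined by its restriction along this one. *)
Definition kap_kl A B C (f : hor A (tT B)) (g : hor B (tT C)) : sq A (tT (tT C)) A (tT C) :=
  kap (f *h fh F g) (cmu' C).
Definition kasc A B C D (f : hor A (tT B)) (g : hor B (tT C)) (h : hor C (tT D))
    : sq A (tT D) A (tT D) :=
  fst (@asc (kl S) A B C D f g h).
Definition klun A B (f : hor A (tT B)) : sq A (tT B) A (tT B) := fst (@lun (kl S) A B f).
Definition krun A B (f : hor A (tT B)) : sq A (tT B) A (tT B) := fst (@run (kl S) A B f).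

Lemma mus_ty A B (f : hor A B) : is_sq (mus f) (fh F (fh F f)) (fh F f) (muv A) (muv B).
Proof. apply (vts_ty (vmu_vtrans HT)). Qed.
Lemma etas_ty A B (f : hor A B) : is_sq (etas f) f (fh F f) (etav A) (etav B).
Proof. apply (vts_ty (veta_vtrans HT)). Qed.
Lemma mu_u_ty A B (u : ver A B) :
  is_sq (mu_u u) (muh A) (muh B) (fv F (fv F u)) (fv F u).
Proof. apply (lt_htv_ty Lmu). Qed.
Lemma eta_u_ty A B (u : ver A B) : is_sq (eta_u u) (etah A) (etah B) u (fv F u).
Proof. apply (lt_htv_ty Leta). Qed.
Lemma cmu_ok A : is_companion (cmu' A). Proof. apply Hmu. Qed.
Lemma ceta_ok A : is_companion (ceta' A). Proof. apply Heta. Qed.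
Lemma imu_ty A : is_sq (ciot (cmu' A)) (hid _) (muh A) (vid _) (muv A).
Proof. exact (ciot_ty (Hmu A)). Qed.
Lemma ieta_ty A : is_sq (ciot (ceta' A)) (hid _) (etah A) (vid _) (etav A).
Proof. exact (ciot_ty (Heta A)). Qed.
Lemma kmu_ty A B (p : hor A (tT (tT B))) :
  is_sq (kap p (cmu' B)) p (p *h muh B) (vid A) (muv B).
Proof. exact (kap_ty HX SX p (Hmu B)). Qed.
Lemma keta_ty A B (p : hor A B) :
  is_sq (kap p (ceta' B)) p (p *h etah B) (vid A) (etav B).
Proof. exact (kap_ty HX SX p (Heta B)). Qed.
Lemma mu_f_ty A B (f : hor A B) :
  is_giso (mu_f f) (fh F (fh F f) *h muh B) (muh A *h fh F f).
Proof. exact (lt_hth_giso HX Hmu Lmu (mu_inv f)). Qed.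
Lemma eta_f_ty A B (f : hor A B) : is_giso (eta_f f) (f *h etah B) (etah A *h fh F f).
Proof. exact (lt_hth_giso HX Heta Leta (eta_inv f)). Qed.
Lemma mu_nat A B (u : ver A B) : fv F (fv F u) *v muv B = muv A *v fv F u.
Proof. apply (vt1_nat (vmu_vtrans HT)). Qed.
Lemma eta_nat A B (u : ver A B) : u *v etav B = etav A *v fv F u.
Proof. apply (vt1_nat (veta_vtrans HT)). Qed.
Lemma lifts_ass A :
  lifts (c_comp (c_fun F (cmu' A)) (cmu' A)) (c_comp (cmu' (tT A)) (cmu' A)) (ass A).
Proof. exact (lifts_hass HX HT ceta Hmu A). Qed.
Lemma lifts_lu A : lifts (c_id (tT A)) (c_comp (ceta' (tT A)) (cmu' A)) (lu A).
Proof. exact (lifts_hlu HX HT Hmu Heta A). Qed.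
Lemma lifts_ru A : lifts (c_id (tT A)) (c_comp (c_fun F (ceta' A)) (cmu' A)) (ru A).
Proof. exact (lifts_hru HX HT Hmu Heta A). Qed.
Hint Resolve mus_ty etas_ty mu_u_ty eta_u_ty imu_ty ieta_ty cmu_ok ceta_ok kmu_ty keta_ty : sqty.
Hint Resolve cmu_ok ceta_ok : psd.
Lemma ass_ty A : is_giso (ass A) (muh (tT A) *h muh A) (fh F (muh A) *h muh A).
Proof. refine (lifts_giso HX _ _ (lifts_ass A)); cok. Qed.
Lemma lu_ty A : is_giso (lu A) (etah (tT A) *h muh A) (hid (tT A)).
Proof. refine (lifts_giso HX _ _ (lifts_lu A)); cok. Qed.
Lemma ru_ty A : is_giso (ru A) (fh F (etah A) *h muh A) (hid (tT A)).
Proof. refine (lifts_giso HX _ _ (lifts_ru A)); cok. Qed.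
Hint Resolve mu_f_ty eta_f_ty ass_ty lu_ty ru_ty : giso.
Hint Extern 3 (is_sq (mu_f _) _ _ _ _) => eapply giso_glob; gi : sqty.
Hint Extern 3 (is_sq (eta_f _) _ _ _ _) => eapply giso_glob; gi : sqty.
Hint Extern 3 (is_sq (ass _) _ _ _ _) => eapply giso_glob; gi : sqty.
Hint Extern 3 (is_sq (lu _) _ _ _ _) => eapply giso_glob; gi : sqty.
Hint Extern 3 (is_sq (ru _) _ _ _ _) => eapply giso_glob; gi : sqty.

Lemma kascE A B C D (f : hor A (tT B)) (g : hor B (tT C)) (h : hor C (tT D)) :
  kasc f g h =
    (sid f || sid (fh F g) || ginv (mu_f h) || sid (muh D))
      // (sid f || sid (fh F g) || sid (fh F (fh F h)) || ass D)
      // (sid f || fc F g (fh F h) || sid (fh F (muh D)) || sid (muh D))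
      // (sid f || fc F (g *h fh F h) (muh D) || sid (muh D)).
Proof. reflexivity. Qed.
Lemma klunE A B (f : hor A (tT B)) :
  klun f = (ginv (eta_f f) || sid (muh B)) // (sid f || lu B).
Proof. reflexivity. Qed.
Lemma krunE A B (f : hor A (tT B)) : krun f = sid f || ru B.
Proof. reflexivity. Qed.

Lemma kasc_ty A B C D (f : hor A (tT B)) (g : hor B (tT C)) (h : hor C (tT D)) :
  is_giso (kasc f g h) (kh (kh f g) h) (kh f (kh g h)).
Proof. rewrite kascE. unfold kh. bd. Qed.
Lemma klun_ty A B (f : hor A (tT B)) : is_giso (klun f) (kh (etah A) f) f.
Proof. rewrite klunE. unfold kh. bd. Qed.
Lemma krun_ty A B (f : hor A (tT B)) : is_giso (krun f) (kh f (etah B)) f.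
Proof. rewrite krunE. unfold kh. bd. Qed.
Lemma kap_kl_ty A B C (f : hor A (tT B)) (g : hor B (tT C)) :
  is_sq (kap_kl f g) (f *h fh F g) (kh f g) (vid A) (muv C).
Proof. unfold kap_kl, kh. bd. Qed.
Lemma ks_ty A B C A' B' C' (a : sq A (tT B) A' (tT B'))
    (b : sq B (tT C) B' (tT C')) (w : ver C C') f g f' g' u v :
  is_sq a f f' u (fv F v) -> is_sq b g g' v (fv F w) ->
  is_sq (ks a b w) (kh f g) (kh f' g') u (fv F w).
Proof. intros Ha Hb. unfold ks, kh. bd. Qed.

Lemma kap_kl_nat A B C A' B' C' (a : sq A (tT B) A' (tT B'))
    (b : sq B (tT C) B' (tT C')) (w : ver C C') f g f' g' u v :
  is_sq a f f' u (fv F v) -> is_sq b g g' v (fv F w) ->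
  kap_kl f g // ks a b w = (a || fs F b) // kap_kl f' g'.
Proof.
  intros Ha Hb. eapply (kap_nat HX SX); [apply cmu_ok | apply cmu_ok | bd | exact (mu_u_ty w) |].
  exact (lt_htv_ciot HX Hmu Lmu (mu_nat w)).
Qed.
Lemma kap_kl_epi A B C D E (f : hor A (tT B)) (g : hor B (tT C))
    (s s' : sq A (tT C) D E) x x' l l' r :
  is_sq s (kh f g) x l r -> is_sq s' (kh f g) x' l' r ->
  kap_kl f g // s = kap_kl f g // s' -> s = s'.
Proof. intros Hs Hs'. apply (kap_epi HX SX (cmu_ok C) Hs Hs'). Qed.
Hint Resolve kap_kl_ty : sqty.
Hint Resolve kasc_ty klun_ty krun_ty : giso.
Hint Extern 3 (is_sq (kasc _ _ _) _ _ _ _) => eapply giso_glob; gi : sqty.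
Hint Extern 3 (is_sq (klun _) _ _ _ _) => eapply giso_glob; gi : sqty.
Hint Extern 3 (is_sq (krun _) _ _ _ _) => eapply giso_glob; gi : sqty.
Hint Extern 3 (is_sq (ks _ _ _) _ _ _ _) => eapply ks_ty; ty : sqty.

(** * Characterisation of the Kleisli associator and unitors *)

Lemma mus_f A B (h : hor A B) :
  kap (fh F (fh F h)) (cmu' B) // mu_f h = ciot (cmu' A) || mus h.
Proof. exact (lt_hth_ciot HX SX Hmu Lmu h). Qed.
Lemma etas_f A B (h : hor A B) :
  kap h (ceta' B) // eta_f h = ciot (ceta' A) || etas h.
Proof. exact (lt_hth_ciot HX SX Heta Leta h). Qed.
Lemma mus_f_inv A B (h : hor A B) :
  (ciot (cmu' A) || mus h) // ginv (mu_f h) = kap (fh F (fh F h)) (cmu' B).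
Proof.
  rewrite <- mus_f, (sv_assoc HX) by bd. erewrite giso_r by gi. now rewrite (sv_sid HX) by bd.
Qed.
Lemma etas_f_inv A B (h : hor A B) :
  (ciot (ceta' A) || etas h) // ginv (eta_f h) = kap h (ceta' B).
Proof.
  rewrite <- etas_f, (sv_assoc HX) by bd. erewrite giso_r by gi. now rewrite (sv_sid HX) by bd.
Qed.

Lemma kmu_sid A B A' p p' (a : sq A (tT (tT B)) A' (tT (tT B))) l :
  is_sq a p p' l (vid _) -> kap p (cmu' B) // (a || sid (muh B)) = a // kap p' (cmu' B).
Proof. intros Ha. exact (kap_nat_sid HX SX (cmu_ok B) Ha). Qed.
Lemma kFmu_sid A B A' p p' (a : sq A (tT (tT (tT B))) A' (tT (tT (tT B)))) l :
  is_sq a p p' l (vid _) ->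
  kap p (c_fun F (cmu' B)) // (a || sid (fh F (muh B))) = a // kap p' (c_fun F (cmu' B)).
Proof. intros Ha. refine (kap_nat_sid HX SX _ Ha). cok. Qed.
Lemma kmu_comp A B C (p : hor A B) (u : ver B (tT (tT C))) (c : companion u) x :
  is_companion c -> x = p *h ch c ->
  kap p c // kap x (cmu' C) = kap p (c_comp c (cmu' C)).
Proof. intros Hc ->. apply (kap_comp HX SX); [exact Hc | apply cmu_ok]. Qed.

Lemma kap_ass A B (p : hor B (tT (tT (tT A)))) :
  kap p (c_comp (cmu' (tT A)) (cmu' A)) // (sid p || ass A)
  = kap p (c_comp (c_fun F (cmu' A)) (cmu' A)).
Proof. refine (kap_lifts HX p _ _ (lifts_ass A)); cok. Qed.
Lemma kap_lu A B (p : hor B (tT A)) :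
  kap p (c_comp (ceta' (tT A)) (cmu' A)) // (sid p || lu A) = sid p.
Proof.
  transitivity (kap p (c_id (tT A))); [|apply (kap_id HX SX)]. refine (kap_lifts HX p _ _ (lifts_lu A)); cok.
Qed.
Lemma kap_ru A B (p : hor B (tT A)) :
  kap p (c_comp (c_fun F (ceta' A)) (cmu' A)) // (sid p || ru A) = sid p.
Proof.
  transitivity (kap p (c_id (tT A))); [|apply (kap_id HX SX)]. refine (kap_lifts HX p _ _ (lifts_ru A)); cok.
Qed.
Lemma kmus_inv A C D (p : hor A (tT (tT C))) (h : hor C (tT D)) :
  (kap p (cmu' C) || mus h) // (sid p || ginv (mu_f h)) = kap (p *h fh F (fh F h)) (cmu' (tT D)).
Proof.
  unfold kap at 1. rewrite (sh_assoc HX SX), (ich HX) by bd.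
  rewrite mus_f_inv, (sid_sv HX), (kap_sh HX SX); bd.
Qed.

Lemma kFmu_fc A B C (x : hor A (tT B)) (p : hor B (tT (tT C))) :
  kap (x *h fh F p) (c_fun F (cmu' C)) // (sid x || fc F p (muh C))
  = sid x || fs F (kap p (cmu' C)).
Proof.
  rewrite <- (kap_sh HX SX) by cok. rewrite (ich HX) by bd.
  rewrite (sid_sv HX) by bd. f_equal. exact (kap_fun HX HX SX SX HF p (cmu_ok C)).
Qed.

(** Two ways to collapse the string [[f | Tg | TTh]] to a triple Kleisli composite: along [μ_T] then
    [μ] here, along [Tμ] then [μ] in [kap_kl_r]. The monad law equates these right sides, and [kasc]
    is the comparison of the two collapses. *)
Definition kap_kl_l A B C D (f : hor A (tT B)) (g : hor B (tT C)) (h : hor C (tT D))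
    : sq A (tT (tT (tT D))) A (tT D) :=
  (kap_kl f g || mus h) // kap_kl (kh f g) h.
Definition kap_kl_r A B C D (f : hor A (tT B)) (g : hor B (tT C)) (h : hor C (tT D))
    : sq A (tT (tT (tT D))) A (tT D) :=
  (sid f || (fc F g (fh F h) // fs F (kap_kl g h))) // kap_kl f (kh g h).

(** The layers of the associator are consumed in turn: the inverse pseudonaturality cell cancels
    [mus h], the cell [ass] exchanges the two composites of multiplications, and the two compositors
    rebuild the image of [kap_kl g h] under [T]. *)
Lemma kasc_char A B C D (f : hor A (tT B)) (g : hor B (tT C)) (h : hor C (tT D)) :
  kap_kl_l f g h // kasc f g h = kap_kl_r f g h.
Proof.
  rewrite kascE. unfold kap_kl_l, kap_kl_r, kap_kl, kh. rewrite <- !(sid_hc HX). asr.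
  vr kmu_sid.
  vr kmus_inv. vr kmu_comp. vr kap_ass.
  erewrite <- kmu_comp; [| cok | reflexivity]. asr.
  vr kmu_sid. vr kFmu_sid. vr kmu_sid. vr kFmu_fc. vr (ich HX). now rewrite (sid_sv HX) by bd.
Qed.
Lemma klun_char A B (f : hor A (tT B)) :
  (ciot (ceta' A) || etas f) // (kap_kl (etah A) f // klun f) = sid f.
Proof.
  rewrite klunE. unfold kap_kl. asr. vr kmu_sid. vr etas_f_inv. vr kmu_comp. apply kap_lu.
Qed.
Lemma krun_char A B (f : hor A (tT B)) :
  (sid f || (fu F B // fs F (ciot (ceta' B)))) // (kap_kl f (etah B) // krun f) = sid f.
Proof.
  rewrite krunE. unfold kap_kl. change (sid f || (fu F B // fs F (ciot (ceta' B)))) with (kap f (c_fun F (ceta' B))).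
  vr kmu_comp. apply kap_ru.
Qed.
Lemma mus_nat A B A' B' (s : sq A B A' B') f g u v : is_sq s f g u v ->
  mus f // fs F s = fs F (fs F s) // mus g.
Proof.
  intros Hs. assert (E := vts_nat (vmu_vtrans HT) (wf_of Hs)).
  rewrite (top_of Hs), (bot_of Hs) in E. symmetry. exact E.
Qed.
Lemma etas_nat A B A' B' (s : sq A B A' B') f g u v : is_sq s f g u v ->
  etas f // fs F s = s // etas g.
Proof.
  intros Hs. assert (E := vts_nat (veta_vtrans HT) (wf_of Hs)).
  rewrite (top_of Hs), (bot_of Hs) in E. symmetry. exact E.
Qed.

Lemma kap_kl_l_ty A B C D (f : hor A (tT B)) (g : hor B (tT C)) (h : hor C (tT D)) :
  is_sq (kap_kl_l f g h) (f *h fh F g *h fh F (fh F h)) (kh (kh f g) h) (vid A) (muv (tT D) *v muv D).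
Proof. unfold kap_kl_l. bd. Qed.
Lemma kap_kl_r_ty A B C D (f : hor A (tT B)) (g : hor B (tT C)) (h : hor C (tT D)) :
  is_sq (kap_kl_r f g h) (f *h (fh F g *h fh F (fh F h))) (kh f (kh g h)) (vid A)
    (fv F (muv D) *v muv D).
Proof. unfold kap_kl_r. eapply is_sq_cast; [ty | cells ..]. Qed.
(** Trades the component [mus h] for an opcartesian cell followed by the invertible [mu_f h]. In
    this form the left collapse is seen to be epic. *)
Lemma kap_kl_mus A B C D (f : hor A (tT B)) (g : hor B (tT C)) (h : hor C (tT D)) :
  kap_kl f g || mus h = kap (f *h fh F g *h fh F (fh F h)) (cmu' (tT D))
    // (sid (f *h fh F g) || mu_f h).
Proof.
  rewrite <- kmus_inv, (sv_assoc HX) by (unfold kap_kl; bd). unfold kap_kl.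
  rewrite (ich HX) by bd. erewrite giso_l by gi. rewrite (sid_sv HX) by bd.
  rewrite <- (sid_hc HX), (sv_sid HX); bd.
Qed.
Lemma kap_kl_l_epi A B C D E E' (f : hor A (tT B)) (g : hor B (tT C)) (h : hor C (tT D))
    (s s' : sq A (tT D) E E') x x' l l' r :
  is_sq s (kh (kh f g) h) x l r -> is_sq s' (kh (kh f g) h) x' l' r ->
  kap_kl_l f g h // s = kap_kl_l f g h // s' -> s = s'.
Proof.
  intros Hs Hs' Eq. eapply kap_kl_epi; [exact Hs | exact Hs' |].
  assert (H1 := kap_kl_ty (kh f g) h).
  unfold kap_kl_l in Eq. rewrite kap_kl_mus in Eq.
  assert (T1 : is_sq (kap_kl (kh f g) h) (f *h fh F g *h (muh C *h fh F h)) (kh (kh f g) h) (vid A) (muv D)).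
  { eapply is_sq_cast; [exact H1 | unfold kh; cells | | |]; reflexivity. }
  rewrite !(sv_assoc HX) in Eq by bd.
  eapply (kap_epi HX SX) in Eq; [| apply cmu_ok | bd | bd].
  eapply (giso_epi HX (f := f *h fh F g *h (fh F (fh F h) *h muh (tT D)))) in Eq; [exact Eq | bd ..].
Qed.
Lemma kap_kl_l_nat A B C D A' B' C' D' (a : sq A (tT B) A' (tT B'))
    (b : sq B (tT C) B' (tT C')) (c : sq C (tT D) C' (tT D')) (v : ver C C') (w : ver D D')
    f g h f' g' h' t u :
  is_sq a f f' t (fv F u) -> is_sq b g g' u (fv F v) -> is_sq c h h' v (fv F w) ->
  kap_kl_l f g h // ks (ks a b v) c w = (a || (fs F b || fs F (fs F c))) // kap_kl_l f' g' h'.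
Proof.
  intros Ha Hb Hc. unfold kap_kl_l.
  assert (Hab := ks_ty Ha Hb).
  rewrite (sv_assoc HX) by bd. erewrite kap_kl_nat by eassumption.
  rewrite <- (sv_assoc HX) by bd. rewrite (ich HX) by bd.
  erewrite kap_kl_nat, mus_nat by eassumption.
  rewrite <- (ich HX), (sh_assoc HX SX) by bd. asr. reflexivity.
Qed.
Lemma kap_kl_r_nat A B C D A' B' C' D' (a : sq A (tT B) A' (tT B'))
    (b : sq B (tT C) B' (tT C')) (c : sq C (tT D) C' (tT D')) (v : ver C C') (w : ver D D')
    f g h f' g' h' t u :
  is_sq a f f' t (fv F u) -> is_sq b g g' u (fv F v) -> is_sq c h h' v (fv F w) ->
  kap_kl_r f g h // ks a (ks b c w) w = (a || (fs F b || fs F (fs F c))) // kap_kl_r f' g' h'.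
Proof.
  intros Ha Hb Hc. unfold kap_kl_r.
  assert (Hbc := ks_ty Hb Hc).
  rewrite (sv_assoc HX) by bd. erewrite kap_kl_nat by eassumption.
  rewrite <- !(sv_assoc HX), !(ich HX) by bd.
  rewrite (sid_sv HX), (sv_sid HX) by bd. f_equal. f_equal. asr.
  rewrite <- (fs_sv HF) by bd. erewrite kap_kl_nat by eassumption.
  rewrite (fs_sv HF) by bd. vrl (fc_sq HF). reflexivity.
Qed.
(** Both collapses are natural and the left one is epic, hence their comparison is natural. *)
Lemma kasc_nat A B C D A' B' C' D' (a : sq A (tT B) A' (tT B'))
    (b : sq B (tT C) B' (tT C')) (c : sq C (tT D) C' (tT D')) (v : ver C C') (w : ver D D')
    f g h f' g' h' t u :
  is_sq a f f' t (fv F u) -> is_sq b g g' u (fv F v) -> is_sq c h h' v (fv F w) ->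
  ks (ks a b v) c w // kasc f' g' h' = kasc f g h // ks a (ks b c w) w.
Proof.
  intros Ha Hb Hc. assert (Hab := ks_ty Ha Hb). assert (Habc := ks_ty Hab Hc).
  assert (Hbc := ks_ty Hb Hc). assert (Habc' := ks_ty Ha Hbc).
  assert (TL := kap_kl_l_ty f g h). assert (TL' := kap_kl_l_ty f' g' h').
  eapply kap_kl_l_epi; [bd | bd |].
  rewrite <- !(sv_assoc HX) by bd. rewrite kasc_char.
  erewrite kap_kl_l_nat, kap_kl_r_nat by eassumption.
  rewrite (sv_assoc HX), kasc_char by bd. reflexivity.
Qed.
Lemma eta_mu A : etav (tT A) *v muv A = vid (tT A).
Proof. exact (vmu_idl HT A). Qed.
Lemma Feta_mu A : fv F (etav A) *v muv A = vid (tT A).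
Proof. exact (vmu_idr HT A). Qed.
(** [lL] and [rL] are the inverse unitors, written without [ginv]; their right sides are identities
    by the unit laws of the monad. Naturality of the unitors is proved for these cells and then
    inverted. *)
Definition lL A B (f : hor A (tT B)) : sq A (tT B) A (tT B) :=
  (ciot (ceta' A) || etas f) // kap_kl (etah A) f.
Definition rL A B (f : hor A (tT B)) : sq A (tT B) A (tT B) :=
  (sid f || (fu F B // fs F (ciot (ceta' B)))) // kap_kl f (etah B).
Lemma lL_ty A B (f : hor A (tT B)) : is_sq (lL f) f (kh (etah A) f) (vid A) (vid (tT B)).
Proof. eapply is_sq_cast; [unfold lL; ty | cells | reflexivity | cells |apply eta_mu]. Qed.
Lemma rL_ty A B (f : hor A (tT B)) : is_sq (rL f) f (kh f (etah B)) (vid A) (vid (tT B)).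
Proof. eapply is_sq_cast; [unfold rL; ty | cells | reflexivity | cells |].
  rewrite (vc_idl HX). apply Feta_mu. Qed.
Lemma lLE A B (f : hor A (tT B)) : lL f = ginv (klun f).
Proof.
  eapply (ginv_of_l HX); [apply klun_ty | apply lL_ty |].
  unfold lL. rewrite (sv_assoc HX) by bd. apply klun_char.
Qed.
Lemma rLE A B (f : hor A (tT B)) : rL f = ginv (krun f).
Proof.
  eapply (ginv_of_l HX); [apply krun_ty | apply rL_ty |].
  unfold rL. rewrite (sv_assoc HX) by bd. apply krun_char.
Qed.
Lemma ieta_u A B (u : ver A B) : ciot (ceta' A) // eta_u u = sidv u // ciot (ceta' B).
Proof. exact (lt_htv_ciot HX Heta Leta (eta_nat u)). Qed.
Lemma lL_nat A B A' B' (a : sq A (tT B) A' (tT B')) u v f g : is_sq a f g u (fv F v) ->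
  lL f // ks (eta_u u) a v = a // lL g.
Proof.
  intros Ha. assert (H1 := eta_u_ty u). unfold lL.
  rewrite (sv_assoc HX) by bd. erewrite kap_kl_nat by eassumption.
  rewrite <- (sv_assoc HX) by bd. rewrite (ich HX), ieta_u by bd.
  erewrite etas_nat by eassumption. rewrite <- (ich HX) by bd.
  rewrite (sidv_sh HX SX) by bd. apply (sv_assoc HX); bd.
Qed.
Lemma rL_nat A B A' B' (a : sq A (tT B) A' (tT B')) u v f g : is_sq a f g u (fv F v) ->
  rL f // ks a (eta_u v) v = a // rL g.
Proof.
  intros Ha. assert (H1 := eta_u_ty v). unfold rL.
  rewrite (sv_assoc HX) by bd. erewrite kap_kl_nat by eassumption.
  rewrite <- (sv_assoc HX) by bd. rewrite (ich HX), (sid_sv HX), (sv_assoc HX) by bd.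
  rewrite <- (fs_sv HF), ieta_u, (fs_sv HF) by bd. vrl (fu_nat HF).
  rewrite <- (sv_sid HX (a := a) (f := g)) at 1 by bd. rewrite <- (ich HX) by bd.
  rewrite (sh_sidv HX SX) by bd. apply (sv_assoc HX); bd.
Qed.
Lemma klun_nat A B A' B' (a : sq A (tT B) A' (tT B')) u v f g : is_sq a f g u (fv F v) ->
  ks (eta_u u) a v // klun g = klun f // a.
Proof.
  intros Ha. assert (E := lL_nat Ha). rewrite !lLE in E.
  assert (H1 := klun_ty f). assert (H2 := klun_ty g).
  assert (Hk := ks_ty (eta_u_ty u) Ha).
  symmetry in E. apply (ginv_nat HX (giso_inv H1) (giso_inv H2) Ha Hk) in E.
  now rewrite (ginv_ginv HX H1), (ginv_ginv HX H2) in E.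
Qed.
Lemma krun_nat A B A' B' (a : sq A (tT B) A' (tT B')) u v f g : is_sq a f g u (fv F v) ->
  ks a (eta_u v) v // krun g = krun f // a.
Proof.
  intros Ha. assert (E := rL_nat Ha). rewrite !rLE in E.
  assert (H1 := krun_ty f). assert (H2 := krun_ty g).
  assert (Hk := ks_ty Ha (eta_u_ty v)).
  symmetry in E. apply (ginv_nat HX (giso_inv H1) (giso_inv H2) Ha Hk) in E.
  now rewrite (ginv_ginv HX H1), (ginv_ginv HX H2) in E.
Qed.

Lemma kap_kl_nat_sid A B C (f : hor A (tT B)) g g' (b : sq B (tT C) B (tT C)) :
  is_sq b g g' (vid B) (fv F (vid C)) ->
  kap_kl f g // ks (sid f) b (vid C) = (sid f || fs F b) // kap_kl f g'.
Proof. intros Hb. eapply kap_kl_nat; [|eassumption]. bd. Qed.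

Lemma Feta_mus A B (g : hor A (tT B)) : fs F (etas g) // mus g = sid (fh F g).
Proof. exact (vmu_idr_s HT g). Qed.
Lemma kFeta_fc A B C (x : hor A (tT B)) (p : hor B C) :
  kap (x *h fh F p) (c_fun F (ceta' C)) // (sid x || fc F p (etah C))
  = sid x || fs F (kap p (ceta' C)).
Proof.
  rewrite <- (kap_sh HX SX) by cok. rewrite (ich HX) by bd.
  rewrite (sid_sv HX) by bd. f_equal. exact (kap_fun HX HX SX SX HF p (ceta_ok C)).
Qed.

(** Inserts [Tη] into [[f | Tg]], since the triangle axiom has to be tested on the string
    [[f | Tη | TTg]]. Under [mus] the inserted component vanishes by a unit law of the monad. *)
Definition Peta A B C (f : hor A (tT B)) (g : hor B C) : sq A (tT C) A (tT (tT C)) :=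
  sid f || ((fu F B // fs F (ciot (ceta' B))) || fs F (etas g)).
Lemma Peta_ty A B C (f : hor A (tT B)) (g : hor B C) :
  is_sq (Peta f g) (f *h fh F g) (f *h (fh F (etah B) *h fh F (fh F g))) (vid A) (fv F (etav C)).
Proof. unfold Peta. bd. Qed.
Lemma Peta_fc A B C (f : hor A (tT B)) (g : hor B C) :
  Peta f g // (sid f || fc F (etah B) (fh F g))
  = sid f || fs F (ciot (ceta' B) || etas g).
Proof.
  unfold Peta. rewrite (ich HX), (sid_sv HX) by bd. f_equal.
  rewrite <- (sid_sv HX (a := fs F (etas g)) (f := fh F g)) by bd.
  rewrite <- (ich HX) by bd. asr. erewrite (fc_sq HF) by bd.
  assert (E := fc_lun HF g). rewrite !(lun_id SX), (fs_sid HF), (sv_sid HX) in E by bd.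
  rewrite <- (sv_assoc HX), E, (sid_sv HX); bd.
Qed.
Lemma Peta_epi A B C E E' (f : hor A (tT B)) (g : hor B C)
    (s s' : sq A (tT (tT C)) E E') x x' l l' r :
  is_sq s (f *h (fh F (etah B) *h fh F (fh F g))) x l r ->
  is_sq s' (f *h (fh F (etah B) *h fh F (fh F g))) x' l' r ->
  Peta f g // s = Peta f g // s' -> s = s'.
Proof.
  intros Hs Hs' Eq. assert (HP := Peta_ty f g).
  (* Up to compositors and the invertible image of [eta_f g], this is the opcartesian cell of
     [Tη_C], which is why it is epic. *)
  assert (E0 : Peta f g = kap (f *h fh F g) (c_fun F (ceta' C)) // ((sid f || fc F g (etah C))
    // ((sid f || fs F (eta_f g)) // (sid f || ginv (fc F (etah B) (fh F g)))))).
  { rewrite <- (sv_assoc HX), kFeta_fc by bd. rewrite <- (sv_assoc HX) by bd.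
    rewrite (ich HX), (sid_sv HX), <- (fs_sv HF), etas_f, <- Peta_fc by bd.
    rewrite (sv_assoc HX), (ich HX) by bd. erewrite giso_r by gi.
    rewrite (sid_sv HX), <- (sid_hc HX), (sv_sid HX); bd. }
  rewrite E0 in Eq. rewrite !(sv_assoc HX) in Eq by bd.
  eapply (kap_epi HX SX) in Eq; [| cok | bd | bd].
  eapply (giso_epi HX (f := f *h (fh F g *h fh F (etah C)))) in Eq; [| bd ..].
  eapply (giso_epi HX (f := f *h fh F (g *h etah C))) in Eq; [| bd ..].
  eapply (giso_epi HX (f := f *h fh F (etah B *h fh F g))) in Eq; [exact Eq | bd ..].
Qed.

Lemma ktriangle A B C (f : hor A (tT B)) (g : hor B (tT C)) :
  kasc f (etah B) g // ks (sid f) (klun g) (vid C) = ks (krun f) (sid g) (vid C).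
Proof.
  assert (H1 : is_sq (klun g) (kh (etah B) g) g (vid B) (fv F (vid C))) by bd.
  assert (H2 : is_sq (krun f) (kh f (etah B)) f (vid A) (fv F (vid B))) by bd.
  assert (H3 : is_sq (sid g) g g (vid B) (fv F (vid C))) by bd.
  assert (H4 : is_sq (sid f) f f (vid A) (fv F (vid B))) by bd.
  assert (T1 := ks_ty H4 H1). assert (T2 := ks_ty H2 H3).
  assert (TL := kap_kl_l_ty f (etah B) g).
  eapply kap_kl_l_epi; [bd | bd |].
  eapply Peta_epi; [bd | bd |].
  rewrite <- (sv_assoc HX (b := kasc _ _ _)), kasc_char by bd.
  assert (HP := Peta_ty f g).
  (* Both sides reduce to the collapse of [[f | Tg]]: the unitor on [g] cancels by [klun_char] under
     [T], the one on [f] by [krun_char]. *)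
  transitivity (kap_kl f g).
  - unfold kap_kl_r. asr. rewrite kap_kl_nat_sid with (1 := H1). 
    rewrite <- (sid_sv HX (a := sid f) (f := f)) at 1 by bd.
    rewrite <- (ich HX) by bd. asr. vr Peta_fc.
    rewrite <- !(sv_assoc HX) by bd. rewrite !(ich HX), !(sid_sv HX), <- !(fs_sv HF) by bd.
    assert (El : (ciot (ceta' B) || etas g) // kap_kl (etah B) g // klun g = sid g).
    { rewrite (sv_assoc HX) by bd. apply klun_char. }
    rewrite El, (fs_sid HF), <- (sid_hc HX). apply (sid_sv HX); bd.
  - unfold kap_kl_l. asr. rewrite kap_kl_nat with (1 := H2) (2 := H3), (fs_sid HF).
    unfold Peta. rewrite <- (sh_assoc HX SX) by bd. rewrite <- !(sv_assoc HX) by bd.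
    rewrite !(ich HX), Feta_mus, (sv_sid HX) by bd.
    assert (Er : (sid f || (fu F B // fs F (ciot (ceta' B)))) // kap_kl f (etah B) // krun f = sid f).
    { rewrite (sv_assoc HX) by bd. apply krun_char. }
    rewrite Er, <- (sid_hc HX). symmetry. apply (sid_sv HX); bd.
Qed.

Lemma mu_assoc A : muv (tT A) *v muv A = fv F (muv A) *v muv A.
Proof. exact (vmu_assoc HT A). Qed.
Hint Resolve mu_assoc : cells.
Lemma mus_hc A B C (f : hor A B) (g : hor B C) :
  fc F (fh F f) (fh F g) // (fs F (fc F f g) // mus (f *h g)) = (mus f || mus g) // fc F f g.
Proof.
  rewrite <- (sv_assoc HX) by bd. exact (vts_hc (vmu_vtrans HT) f g).
Qed.
(** Collapses the first two factors of [[f | Tg | TTh | TTTk]]; the components [mus] carry the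
    multiplication past [h] and [k], so that [kap_kl_l] for the remaining three factors can
    follow. *)
Definition kQ A B C D E (f : hor A (tT B)) (g : hor B (tT C)) (h : hor C (tT D))
    (k : hor D (tT E)) : sq A (tT (tT (tT (tT E)))) A (tT (tT (tT E))) :=
  kap_kl f g || (mus h || mus (fh F k)).
Lemma kQ_ty A B C D E (f : hor A (tT B)) (g : hor B (tT C)) (h : hor C (tT D))
    (k : hor D (tT E)) :
  is_sq (kQ f g h k) (f *h fh F g *h (fh F (fh F h) *h fh F (fh F (fh F k))))
    (kh f g *h (fh F h *h fh F (fh F k))) (vid A) (muv (tT (tT E))).
Proof. unfold kQ. bd. Qed.
Lemma kQ_fc A B C D E (f : hor A (tT B)) (g : hor B (tT C)) (h : hor C (tT D))
    (k : hor D (tT E)) :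
  kQ f g h k // (sid (kh f g) || fc F h (fh F k))
  = (sid (f *h fh F g) || (fc F (fh F h) (fh F (fh F k)) // fs F (fc F h (fh F k))))
    // (kap_kl f g || mus (h *h fh F k)).
Proof.
  unfold kQ. rewrite !(ich HX), (sid_sv HX), (sv_sid HX) by bd. f_equal.
  rewrite (sv_assoc HX) by bd. symmetry. apply mus_hc.
Qed.
Lemma kQ_epi A B C D E E1 E2 (f : hor A (tT B)) (g : hor B (tT C)) (h : hor C (tT D))
    (k : hor D (tT E)) (s s' : sq A (tT (tT (tT E))) E1 E2) x x' l l' r :
  is_sq s (kh f g *h (fh F h *h fh F (fh F k))) x l r ->
  is_sq s' (kh f g *h (fh F h *h fh F (fh F k))) x' l' r ->
  kQ f g h k // s = kQ f g h k // s' -> s = s'.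
Proof.
  intros Hs Hs' Eq. assert (HQ := kQ_ty f g h k).
  (* Compatibility of [mus] with compositors merges its two occurrences into one at [h *h fh F k].
     That one is an opcartesian cell followed by a pseudonaturality cell, so [kQ] is epic. *)
  assert (E0 : kQ f g h k =
    (sid (f *h fh F g) || (fc F (fh F h) (fh F (fh F k)) // fs F (fc F h (fh F k))))
    // (kap (f *h fh F g *h fh F (fh F (h *h fh F k))) (cmu' (tT (tT E)))
    // ((sid (f *h fh F g) || mu_f (h *h fh F k))
    // (sid (kh f g) || ginv (fc F h (fh F k)))))).
  { assert (E0 : kap_kl f g || mus (h *h fh F k) =
      kap (f *h fh F g *h fh F (fh F (h *h fh F k))) (cmu' (tT (tT E)))
      // (sid (f *h fh F g) || mu_f (h *h fh F k))).
    { rewrite <- kmus_inv, (sv_assoc HX) by (unfold kap_kl; bd). unfold kap_kl.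
      rewrite (ich HX) by bd. erewrite giso_l by gi.
      rewrite (sid_sv HX), <- (sid_hc HX), (sv_sid HX); bd. }
    rewrite <- (sv_assoc HX (c := sid _ || ginv _)), <- E0 by (unfold kh; bd).
    rewrite <- (sv_assoc HX), <- kQ_fc by (unfold kh; bd).
    rewrite (sv_assoc HX), (ich HX) by bd. erewrite giso_r by gi.
    rewrite (sid_sv HX), <- (sid_hc HX), (sv_sid HX); bd. }
  rewrite E0 in Eq. unfold kh in *. rewrite !(sv_assoc HX) in Eq by bd.
  eapply (giso_epi HX (f := f *h fh F g *h (fh F (fh F h) *h fh F (fh F (fh F k))))) in Eq; [| bd ..].
  eapply (kap_epi HX SX) in Eq; [| cok | bd | bd].
  eapply (giso_epi HX (f := f *h fh F g *h (fh F (fh F (h *h fh F k)) *h muh (tT (tT E))))) in Eq; [| bd ..].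
  eapply (giso_epi HX (f := f *h fh F g *h muh C *h fh F (h *h fh F k))) in Eq; [exact Eq | bd ..].
Qed.

Lemma kpentagon A B C D E (f : hor A (tT B)) (g : hor B (tT C)) (h : hor C (tT D))
    (k : hor D (tT E)) :
  kasc (kh f g) h k // kasc f g (kh h k)
  = ks (kasc f g h) (sid k) (vid E) // kasc f (kh g h) k // ks (sid f) (kasc g h k) (vid E).
Proof.
  assert (H1 : is_sq (kasc f g h) (kh (kh f g) h) (kh f (kh g h)) (vid A) (fv F (vid D))) by bd.
  assert (H2 : is_sq (kasc g h k) (kh (kh g h) k) (kh g (kh h k)) (vid B) (fv F (vid E))) by bd.
  assert (H3 : is_sq (sid k) k k (vid D) (fv F (vid E))) by bd.
  assert (H4 : is_sq (sid f) f f (vid A) (fv F (vid B))) by bd.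
  assert (T1 := ks_ty H1 H3). assert (T2 := ks_ty H4 H2).
  assert (TL := kap_kl_l_ty (kh f g) h k). assert (TQ := kQ_ty f g h k).
  eapply kap_kl_l_epi; [bd | bd |].
  eapply kQ_epi; [bd | bd |].
  (* The common value: compositors regroup the string, then [kap_kl_r] collapses [g], [h], [k] under
     [T], and a last collapse takes in [f]. *)
  transitivity ((sid f || ((sid (fh F g) || fc F (fh F h) (fh F (fh F k)))
     // (fc F g (fh F h *h fh F (fh F k)) // fs F (kap_kl_r g h k)))) // kap_kl f (kh g (kh h k))).
  - rewrite <- (sv_assoc HX (b := kasc _ _ _)), kasc_char by bd.
    unfold kap_kl_r at 1. asr.
    assert (EQ : kQ f g h k // (sid (kh f g) || (fc F h (fh F k) // fs F (kap_kl h k)))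
      = (sid (f *h fh F g) || (fc F (fh F h) (fh F (fh F k)) // (fs F (fc F h (fh F k))
        // fs F (fs F (kap_kl h k))))) // (kap_kl f g || mus (kh h k))).
    { rewrite <- (sid_sv HX (a := sid (kh f g)) (f := kh f g)) by bd.
      rewrite <- (ich HX), <- (sv_assoc HX), kQ_fc by bd. asr.
      rewrite !(ich HX), !(sid_sv HX), (sv_sid HX) by bd.
      erewrite mus_nat by bd. asr. reflexivity. }
    rewrite <- (sv_assoc HX), EQ by bd. asr.
    rewrite <- (sv_assoc HX (b := kap_kl _ _)) by bd. fold (kap_kl_l f g (kh h k)).
    assert (TL' := kap_kl_l_ty f g (kh h k)).
    rewrite kasc_char. unfold kap_kl_r at 1. rewrite <- (sv_assoc HX) by bd. f_equal.
    rewrite (sid_hc HX), (sh_assoc HX SX), (ich HX), (sid_sv HX) by bd. f_equal.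
    unfold kap_kl_r. rewrite (fs_sv HF) by bd. asr.
    rewrite <- (sv_assoc HX (c := fs F (kap_kl g (kh h k)))) by bd.
    rewrite <- (sv_assoc HX (c := fs F (kap_kl g (kh h k)))) by bd.
    rewrite <- (sv_assoc HX (c := fs F (kap_kl g (kh h k)))) by bd. f_equal. asr.
    rewrite <- (fs_sv HF) by bd. vrl (fc_sq HF). rewrite (fs_sid HF). vr (ich HX).
    rewrite (sid_sv HX) by bd. reflexivity.
  - asr. unfold kap_kl_l.
    rewrite (sv_assoc HX), <- (sv_assoc HX (a := kap_kl (kh (kh f g) h) k)) by bd.
    rewrite kap_kl_nat with (1 := H1) (2 := H3), (fs_sid HF).
    assert (E1 : kQ f g h k // (kap_kl (kh f g) h || mus k)
      = kap_kl_l f g h || (fs F (mus k) // mus k)).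
    { unfold kQ. rewrite <- (sh_assoc HX SX) by bd. rewrite (ich HX) by bd.
      f_equal. exact (vmu_assoc_s HT k). }
    assert (TL1 := kap_kl_l_ty f g h).
    assert (E2 : kQ f g h k // ((kap_kl (kh f g) h || mus k) // (kasc f g h || sid (fh F k)))
      = ((sid f || (fc F g (fh F h) // fs F (kap_kl g h))) || fs F (mus k))
        // (kap_kl f (kh g h) || mus k)).
    { rewrite <- (sv_assoc HX), E1 by bd. rewrite (ich HX), kasc_char, (sv_sid HX) by bd.
      unfold kap_kl_r. now rewrite (ich HX) by bd. }
    rewrite (sv_assoc HX (a := kasc f g h || _)) by bd.
    rewrite (sv_rew3 HX E2), (sv_assoc HX (a := _ || fs F (mus k))) by bd.
    rewrite <- (sv_assoc HX (a := _ || mus k)) by bd. fold (kap_kl_l f (kh g h) k).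
    assert (TL2 := kap_kl_l_ty f (kh g h) k).
    asr. rewrite <- (sv_assoc HX (b := kasc _ _ _)), kasc_char by bd.
    unfold kap_kl_r at 2. asr. rewrite kap_kl_nat_sid with (1 := H2).
    rewrite <- (sv_assoc HX (b := sid f || fs F (kasc g h k))) by bd.
    rewrite <- (sv_assoc HX (a := _ || fs F (mus k))) by bd. f_equal.
    rewrite (sh_assoc HX SX), !(ich HX), !(sid_sv HX) by bd. f_equal.
    rewrite <- (sid_sv HX (a := fs F (mus k)) (f := fh F (fh F (fh F k)))) by bd.
    rewrite <- (ich HX) by bd. asr. vr (fc_sq HF).
    rewrite <- !(fs_sv HF) by bd.
    assert (E3 : (kap_kl g h || mus k) // (kap_kl (kh g h) k // kasc g h k) = kap_kl_r g h k).
    { rewrite <- (sv_assoc HX) by bd. apply kasc_char. }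
    assert (TR := kap_kl_r_ty g h k).
    rewrite E3. rewrite <- !(sv_assoc HX) by bd. f_equal.
    assert (E4 := fc_asc HF g (fh F h) (fh F (fh F k))).
    rewrite !(asc_id SX), (fs_sid HF), (sv_sid HX), (sid_sv HX) in E4 by bd.
    symmetry. exact E4.
Qed.

(** * The Kleisli pseudodouble category *)

Let HS : is_hmonad S := lifted_is_hmonad HX SX HT Hmu Heta mu_inv eta_inv.
Lemma mu_u_vid A : mu_u (vid A) = sid (muh A).
Proof. exact (htv_vid (hmu_htrans HS) A). Qed.
Lemma mu_u_vc A B C (u : ver A B) (v : ver B C) : mu_u (u *v v) = mu_u u // mu_u v.
Proof. exact (htv_vc (hmu_htrans HS) u v). Qed.
Lemma eta_u_vid A : eta_u (vid A) = sid (etah A).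
Proof. exact (htv_vid (heta_htrans HS) A). Qed.
Lemma eta_u_vc A B C (u : ver A B) (v : ver B C) : eta_u (u *v v) = eta_u u // eta_u v.
Proof. exact (htv_vc (heta_htrans HS) u v). Qed.

Lemma ks_sv A B C D E G H K L (a : sq A (tT B) D (tT E)) (b : sq B (tT C) E (tT G))
    (c : sq D (tT E) H (tT K)) (d : sq E (tT G) K (tT L)) (v : ver C G) (v' : ver G L)
    u u' f g f' g' f'' g'' t t' :
  is_sq a f f' t (fv F u) -> is_sq b g g' u (fv F v) ->
  is_sq c f' f'' t' (fv F u') -> is_sq d g' g'' u' (fv F v') ->
  ks a b v // ks c d v' = ks (a // c) (b // d) (v *v v').
Proof.
  intros Ha Hb Hc Hd. assert (H1 := mu_u_ty v). assert (H2 := mu_u_ty v').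
  unfold ks. rewrite !(ich HX), mu_u_vc, (fs_sv HF); bd.
Qed.
Lemma ks_sid A B C (f : hor A (tT B)) (g : hor B (tT C)) :
  ks (sid f) (sid g) (vid C) = sid (kh f g).
Proof. unfold ks, kh. now rewrite mu_u_vid, (fs_sid HF), !(sid_hc HX). Qed.

Lemma kl_sq A B C D (s : @sq (kl S) A B C D) f g u v :
  is_sq (fst s) f g u (fv F v) -> snd s = v -> @is_sq (kl S) A B C D s f g u v.
Proof. intros (H1 & H2 & H3 & H4 & H5) <-. repeat split; trivial. Qed.
Lemma kl_sq_inv A B C D (s : @sq (kl S) A B C D) f g u v :
  @is_sq (kl S) A B C D s f g u v -> is_sq (fst s) f g u (fv F v) /\ snd s = v.
Proof. intros ((H1 & H1') & H2 & H3 & H4 & <-). repeat split; trivial. Qed.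
Lemma kl_inv_glob A B (a b : sq A (tT B) A (tT B)) f g : inv_glob a b f g ->
  @inv_glob (kl S) A B (a, vid B) (b, vid B) f g.
Proof.
  intros (H1 & H2 & H3 & H4). split; [|split; [|split]].
  - apply kl_sq; cbn; bd.
  - apply kl_sq; cbn; bd.
  - cbn. rewrite H3. f_equal. cells.
  - cbn. rewrite H4. f_equal. cells.
Qed.
Lemma kl_giso A B (a : sq A (tT B) A (tT B)) f g : is_giso a f g ->
  @is_giso (kl S) A B (a, vid B) f g.
Proof. intros [b Hb]. exists (b, vid B). now apply kl_inv_glob. Qed.

Theorem kl_pseudodouble : is_pseudodouble (kl S).
Proof.
  split.
  - intros. apply (vc_assoc HX).
  - intros. apply (vc_idl HX).
  - intros. apply (vc_idr HX).
  - intros. apply kl_sq; cbn; bd.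
  - intros. apply kl_sq; [|reflexivity]. exact (eta_u_ty u).
  - intros. apply kl_sq_inv in H as [H <-]. apply kl_sq_inv in H0 as [H0 <-].
    apply kl_sq; [|reflexivity]. exact (ks_ty H H0).
  - intros. apply kl_sq_inv in H as [H <-]. apply kl_sq_inv in H0 as [H0 <-].
    apply kl_sq; [|reflexivity]. cbn. rewrite (fv_vc HF). exact (sv_ty HX H H0).
  - intros A B C D E G K L a b c [H1 _] [H2 _] [H3 _] E1 E2. cbn in *.
    f_equal; [apply (sv_assoc HX) | apply (vc_assoc HX)]; trivial.
  - intros A B C D [a v] [H1 _]. cbn in *. f_equal; [now apply (sv_idl HX) | apply (vc_idl HX)].
  - intros A B C D [a v] [H1 _]. cbn in *. f_equal; [now apply (sv_idr HX) | apply (vc_idr HX)].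
  - intros A B C D E G H K L [a u] [b v] [c u'] [d v'] [H1 R1] [H2 R2] [H3 R3] [H4 R4] E1 E2 E3 E4.
    cbn in *. wfs. f_equal. eapply ks_sv; eassumption.
  - intros. cbn. f_equal. symmetry. apply ks_sid.
  - intros. cbn. f_equal. apply eta_u_vc.
  - intros. cbn. f_equal. apply eta_u_vid.
  - intros. exact (kl_giso (kasc_ty f g h)).
  - intros. exact (kl_giso (klun_ty f)).
  - intros. exact (kl_giso (krun_ty f)).
  - intros A B C D A' B' C' D' [a u] [b v] [c w] [H1 R1] [H2 R2] [H3 R3] E1 E2.
    cbn in *. wfs. f_equal; [|cells]. eapply kasc_nat; eassumption.
  - intros A B A' B' [a u] [H1 R1]. cbn in *. wfs. f_equal; [|cells]. eapply klun_nat; eassumption.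
  - intros A B A' B' [a u] [H1 R1]. cbn in *. wfs. f_equal; [|cells]. eapply krun_nat; eassumption.
  - intros. cbn. f_equal; [exact (kpentagon f g h k) | cells].
  - intros. cbn. f_equal; [exact (ktriangle f g) | cells].
Qed.

(** * The functor from the base to its Kleisli double category *)

Let K := kl_K S.
Definition Kf A B (f : hor A B) : hor A (tT B) := f *h etah B.
Definition Ks A B C D (a : sq A B C D) (w : ver B D) : sq A (tT B) C (tT D) := a || eta_u w.
(** The compositor of [K] is a whiskered left unitor of the Kleisli double category. The functor
    laws of [K] thereby reduce to naturality and coherence of unitors in [kl]. *)
Definition kfc A B C (f : hor A B) (g : hor B C) : sq A (tT C) A (tT C) :=
  sid f || klun (Kf g).

Lemma fc_K A B C (f : hor A B) (g : hor B C) : fc K f g = (kfc f g, vid C).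
Proof.
  cbn. f_equal. unfold kfc. rewrite klunE. unfold Kf.
  change ((sid f || ginv (eta_f (g *h etah C)) || sid (muh C))
    // (sid f || sid g || sid (etah C) || lu C) =
    sid f || ((ginv (eta_f (g *h etah C)) || sid (muh C)) // (sid (g *h etah C) || lu C))).
  rewrite <- (sid_sv HX (a := sid f) (f := f)) at 3 by bd.
  rewrite <- (ich HX) by bd. rewrite (sid_hc HX).
  rewrite !(sh_assoc HX SX); bd.
Qed.
Lemma Ks_ty A B C D (a : sq A B C D) f g u w :
  is_sq a f g u w -> is_sq (Ks a w) (Kf f) (Kf g) u (fv F w).
Proof. intros Ha. assert (H := eta_u_ty w). unfold Ks, Kf. bd. Qed.
Lemma kfc_ty A B C (f : hor A B) (g : hor B C) :
  is_giso (kfc f g) (kh (Kf f) (Kf g)) (Kf (f *h g)).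
Proof.
  eapply giso_cast; [unfold kfc; gi | unfold kh, Kf; cells | unfold Kf; cells].
Qed.
Lemma ks_whisker A A' B C D A1 B1 C1 (a : sq A A' A1 B1) (b : sq A' (tT B) B1 (tT C1))
    (c : sq B (tT C) C1 (tT D)) w f f' g g' h h' u v t :
  is_sq a f f' u v -> is_sq b g g' v (fv F t) -> is_sq c h h' t (fv F w) ->
  ks (a || b) c w = a || ks b c w.
Proof.
  intros Ha Hb Hc. assert (H := mu_u_ty w). unfold ks.
  now rewrite !(sh_assoc HX SX) by bd.
Qed.
Lemma kasc_whisker A A' B C D (f : hor A A') (g : hor A' (tT B)) (h : hor B (tT C)) (k : hor C (tT D)) :
  kasc (f *h g) h k = sid f || kasc g h k.
Proof.
  rewrite !kascE. erewrite !(whl_sv HX) by (first [bd | eapply is_sq_cast; [ty | cells ..]]).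
  rewrite (sid_hc HX f g), !(sh_assoc HX SX) by bd. reflexivity.
Qed.
Lemma krun_whisker A A' B (f : hor A A') (g : hor A' (tT B)) :
  krun (f *h g) = sid f || krun g.
Proof. rewrite !krunE, (sid_hc HX). apply (sh_assoc HX SX); bd. Qed.
(** This equation and the next are the derived unit laws of a general pseudodouble category, read in
    [kl]. *)
Lemma klun_eta A : klun (etah A) = krun (etah A).
Proof. exact (f_equal fst (lun_hid_run kl_pseudodouble A)). Qed.
Lemma klun_kelly A B C (f : hor A (tT B)) (g : hor B (tT C)) :
  kasc (etah A) f g // klun (kh f g) = ks (klun f) (sid g) (vid C).
Proof. exact (f_equal fst (asc_hid_lun kl_pseudodouble f g)). Qed.

Lemma fs_K A B C D (a : sq A B C D) w : rgt a = w -> fs K a = (Ks a w, w).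
Proof. now intros <-. Qed.
Lemma Ks_sid A B (f : hor A B) : Ks (sid f) (vid B) = sid (Kf f).
Proof. unfold Ks, Kf. rewrite eta_u_vid. symmetry. apply (sid_hc HX). Qed.
Lemma Ks_sv A B C D E G (a : sq A B C D) (b : sq C D E G) f g h u v w t :
  is_sq a f g u v -> is_sq b g h w t -> Ks (a // b) (v *v t) = Ks a v // Ks b t.
Proof.
  intros Ha Hb. assert (H1 := eta_u_ty v). assert (H2 := eta_u_ty t).
  unfold Ks. rewrite eta_u_vc. symmetry. apply (ich HX); bd.
Qed.
Lemma kfc_nat A B C A' B' C' (a : sq A B A' B') (b : sq B C B' C') f f' g g' u v w :
  is_sq a f f' u v -> is_sq b g g' v w ->
  ks (Ks a v) (Ks b w) w // kfc f' g' = kfc f g // Ks (a || b) w.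
Proof.
  intros Ha Hb. assert (H1 := eta_u_ty v). assert (H2 := eta_u_ty w).
  assert (Hb' := Ks_ty Hb). unfold kfc.
  unfold Ks at 1. erewrite ks_whisker by bd.
  rewrite (ich HX) by bd.
  erewrite klun_nat by bd. rewrite (sv_sid HX) by bd.
  unfold Ks at 2. rewrite (sh_assoc HX SX) by bd. fold (Ks b w).
  rewrite (ich HX), (sid_sv HX); bd.
Qed.
Lemma ks_whl A A' B C (f : hor A A') (b : sq A' (tT B) A' (tT B)) (c : sq B (tT C) B (tT C))
    g g' h h' :
  is_sq b g g' (vid A') (vid (tT B)) -> is_sq c h h' (vid B) (vid (tT C)) ->
  ks (sid f || b) c (vid C) = sid f || ks b c (vid C).
Proof.
  intros Hb Hc. eapply (ks_whisker (t := vid B) (w := vid C)); bd.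
Qed.
Lemma ks_glob A B C (b : sq A (tT B) A (tT B)) (c : sq B (tT C) B (tT C))
    g g' h h' :
  is_sq b g g' (vid A) (vid (tT B)) -> is_sq c h h' (vid B) (vid (tT C)) ->
  is_sq (ks b c (vid C)) (kh g h) (kh g' h') (vid A) (vid (tT C)).
Proof.
  intros Hb Hc. eapply is_sq_cast; [eapply (ks_ty (v := vid B) (w := vid C)); bd | cells ..].
Qed.
Lemma kfc_sq A B C (f : hor A B) (g : hor B C) :
  is_sq (kfc f g) (kh (Kf f) (Kf g)) (Kf (f *h g)) (vid A) (vid (tT C)).
Proof. exact (giso_glob (kfc_ty f g)). Qed.
Lemma kfc_asc A B C D (f : hor A B) (g : hor B C) (h : hor C D) :
  ks (kfc f g) (sid (Kf h)) (vid D) // kfc (f *h g) h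
  = kasc (Kf f) (Kf g) (Kf h) // ks (sid (Kf f)) (kfc g h) (vid D) // kfc f (g *h h).
Proof.
  assert (T1 := kfc_sq f g). assert (T2 := kfc_sq g h).
  unfold kfc at 1. erewrite ks_whl by bd.
  assert (T3 := ks_glob (b := klun (Kf g)) (c := sid (Kf h)) ltac:(bd) ltac:(bd)).
  assert (T4 := ks_glob (b := sid (etah B)) (c := kfc g h) ltac:(bd) ltac:(bd)).
  unfold kfc at 1. rewrite (sid_hc HX), (sh_assoc HX SX) by bd.
  fold (kfc g h).
  change (kasc (Kf f) (Kf g) (Kf h)) with (kasc (f *h etah B) (Kf g) (Kf h)).
  rewrite kasc_whisker.
  change (sid (Kf f)) with (sid (f *h etah B)). rewrite (sid_hc HX). erewrite ks_whl by bd.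
  unfold kfc at 3.
  rewrite (sv_assoc HX) by (first [bd | unfold kh, Kf; bd]).
  assert (E : kasc (etah B) (Kf g) (Kf h) // (ks (sid (etah B)) (kfc g h) (vid D)
     // klun (Kf (g *h h))) = ks (klun (Kf g)) (sid (Kf h)) (vid D) // kfc g h).
  { rewrite <- eta_u_vid. erewrite klun_nat by bd.
    rewrite <- (sv_assoc HX) by bd. now rewrite klun_kelly. }
  erewrite <- !(whl_sv HX) by bd.
  rewrite <- E. reflexivity.
Qed.
Theorem K_functor : is_functor K.
Proof.
  split.
  - reflexivity.
  - reflexivity.
  - intros A B C D a f g u v Ha. apply kl_sq; [|exact (rgt_of Ha)]. cbn.
    rewrite (rgt_of Ha). exact (Ks_ty Ha).
  - intros A B f. 
    rewrite (fs_K (w := vid B)) by bd. now rewrite Ks_sid.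
  - intros A B C D E G a b Ha Hb E1.
    destruct (wf_sq Ha) as (f & g & u & v & Ta), (wf_sq Hb) as (g' & h & w & t & Tb).
    rewrite (bot_of Ta), (top_of Tb) in E1. subst g'.
    rewrite (fs_K (w := v *v t)), (fs_K (w := v) (a := a)), (fs_K (w := t)) by bd.
    cbn. f_equal. eapply Ks_sv; eassumption.
  - intros A B C f g. rewrite fc_K. exact (kl_giso (kfc_ty f g)).
  - intros A. apply kl_giso. cbn. rewrite (hc_idl SX). apply (giso_sid HX).
  - intros A B C A' B' C' a b Ha Hb E. rewrite !fc_K.
    destruct (wf_sq Ha) as (f & f' & u & v & Ta), (wf_sq Hb) as (g & g' & v' & w & Tb).
    rewrite (rgt_of Ta), (lft_of Tb) in E. subst v'.
    rewrite (top_of Ta), (bot_of Ta), (top_of Tb), (bot_of Tb).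
    rewrite (fs_K (w := v)), (fs_K (w := w) (a := b)), (fs_K (w := w)) by bd.
    cbn. f_equal; [|cells ..]. eapply kfc_nat; eassumption.
  - intros A B u. rewrite (fs_K (w := u)) by bd. cbn. f_equal; [|cells ..].
    assert (H := eta_u_ty u). change (eta_u u // sid (etah B) = sid (etah A) // Ks (sidv u) u).
    rewrite (sv_sid HX) by bd. unfold Ks. rewrite (sidv_sh HX SX), (sid_sv HX); bd.
  - intros A B C D f g h. rewrite !fc_K, (asc_id SX), (fs_K (w := vid D)) by bd.
    rewrite Ks_sid. cbn. f_equal; [|cells ..].
    assert (T1 := kfc_sq f g). assert (T2 := kfc_sq (f *h g) h).
    change (ks (kfc f g) (sid (Kf h)) (vid D) // kfc (f *h g) h // sid (Kf (f *h g *h h))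
      = kasc (Kf f) (Kf g) (Kf h) // ks (sid (Kf f)) (kfc g h) (vid D) // kfc f (g *h h)).
    rewrite <- kfc_asc.
    assert (T3 := ks_glob (b := kfc f g) (c := sid (Kf h)) ltac:(bd) ltac:(bd)).
    assert (T4 := sv_ty HX T3 T2). apply (sv_sid HX (wf_of T4)). exact (bot_of T4).
  - intros A B f. rewrite fc_K, (lun_id SX), (fs_K (w := vid B)) by bd. rewrite Ks_sid.
    cbn. f_equal; [|cells ..].
    change (ks (sid (etah A)) (sid (Kf f)) (vid B) // kfc (hid A) f // sid (Kf f) = klun (Kf f)).
    rewrite ks_sid. unfold kfc. rewrite (hid_sh HX SX), (sid_sv HX), (sv_sid HX); bd.
  - intros A B f. rewrite fc_K, (run_id SX), (fs_K (w := vid B)) by bd. rewrite Ks_sid.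
    cbn. f_equal; [|cells ..].
    change (ks (sid (Kf f)) (sid (etah B)) (vid B) // kfc f (hid B) // sid (Kf f) = krun (Kf f)).
    assert (E : kfc f (hid B) = krun (Kf f)).
    { change (krun (Kf f)) with (krun (f *h etah B)). unfold kfc.
      rewrite krun_whisker, <- klun_eta. unfold Kf. now rewrite (hc_idl SX). }
    rewrite ks_sid, E, (sid_sv HX), (sv_sid HX); bd.
Qed.

Variables (M : monoidal_data X) (HM : is_monoidal M).
Variables (t : str_data M T) (Ht : is_strength t).
Variable (ct : forall x, companion (vt1 t x)).
Hypotheses (Hct : forall x, is_companion (ct x)) (t_inv : invertible t).
Local Notation B := (ten M).
Local Notation "A ⊗ B" := (tenO M A B) (at level 35).
Let HB : is_functor B := ten_functor HM.
Let HTS : is_functor (f_str_src M T) := ltac:(unfold f_str_src; fok).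
Let HTT : is_functor (f_str_tgt M T) := ltac:(unfold f_str_tgt; fok).
Let Lt := lift_lifts_h HX Hct (str_vtrans Ht).

(** * The action on the Kleisli double category *)

Definition tv1 A C : ver (A ⊗ tT C) (tT (A ⊗ C)) := vt1 t (A, C).
Definition th1 A C : hor (A ⊗ tT C) (tT (A ⊗ C)) := ch (ct (A, C)).
Definition ct' A C : companion (tv1 A C) := ct (A, C).
Definition tss A A' C C' (f : hor A A') (g : hor C C')
    : sq (A ⊗ tT C) (A' ⊗ tT C') (tT (A ⊗ C)) (tT (A' ⊗ C')) := sts t f g.
Definition t_f A A' C C' (f : hor A A') (g : hor C C')
    : sq (A ⊗ tT C) (tT (A' ⊗ C')) (A ⊗ tT C) (tT (A' ⊗ C')) := th ct f g.
Definition t_u A A' C C' (u : ver A A') (v : ver C C')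
    : sq (A ⊗ tT C) (tT (A ⊗ C)) (A' ⊗ tT C') (tT (A' ⊗ C')) := tv ct u v.
Definition wh A C : sq (A ⊗ tT (tT C)) (tT (A ⊗ C)) (A ⊗ tT (tT C)) (tT (A ⊗ C)) :=
  w_hat cmu ct A C.
Definition zh A C : sq (A ⊗ C) (tT (A ⊗ C)) (A ⊗ C) (tT (A ⊗ C)) := z_hat ceta ct A C.
Local Notation trih f g := (bh B f g *h th1 _ _).
Definition tris A1 A2 A3 A4 C1 C2 C3 C4 (s : sq A1 A2 A3 A4)
    (d : sq C1 (tT C2) C3 (tT C4)) (u : ver A2 A4) (v : ver C2 C4)
    : sq (A1 ⊗ C1) (tT (A2 ⊗ C2)) (A3 ⊗ C3) (tT (A4 ⊗ C4)) :=
  bs B s d || t_u u v.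
Definition tric A A' A'' C C' C'' (f : hor A A') (g : hor C (tT C'))
    (f' : hor A' A'') (g' : hor C' (tT C''))
    : sq (A ⊗ C) (tT (A'' ⊗ C'')) (A ⊗ C) (tT (A'' ⊗ C'')) := tri_c cmu ct f g f' g'.
Definition kap_str A A' C C' (f : hor A A') (g : hor C (tT C'))
    : sq (A ⊗ C) (A' ⊗ tT C') (A ⊗ C) (tT (A' ⊗ C')) := kap (bh B f g) (ct' A' C').

Lemma tss_ty A A' C C' (f : hor A A') (g : hor C C') :
  is_sq (tss f g) (bh B f (fh F g)) (fh F (bh B f g)) (tv1 A C) (tv1 A' C').
Proof. exact (vts_ty (str_vtrans Ht) (A := (A, C)) (B := (A', C')) (f, g)). Qed.
Lemma t_u_ty A A' C C' (u : ver A A') (v : ver C C') :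
  is_sq (t_u u v) (th1 A C) (th1 A' C') (bv B u (fv F v)) (fv F (bv B u v)).
Proof. exact (lt_htv_ty Lt (A := (A, C)) (A' := (A', C')) (u, v)). Qed.
Lemma t_f_ty A A' C C' (f : hor A A') (g : hor C C') :
  is_giso (t_f f g) (bh B f (fh F g) *h th1 A' C') (th1 A C *h fh F (bh B f g)).
Proof.
  exact (lt_hth_giso HX Hct Lt (A := (A, C)) (B := (A', C')) (f := (f, g)) (@t_inv (A, C) (A', C') (f, g))).
Qed.
Lemma ct_ok A C : is_companion (ct' A C).
Proof. exact (Hct (A, C)). Qed.
Lemma ict_ty A C : is_sq (ciot (ct' A C)) (hid _) (th1 A C) (vid _) (tv1 A C).
Proof. exact (ciot_ty (Hct (A, C))). Qed.
Lemma t_nat A A' C C' (u : ver A A') (v : ver C C') :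
  bv B u (fv F v) *v tv1 A' C' = tv1 A C *v fv F (bv B u v).
Proof. exact (vt1_nat (str_vtrans Ht) (A := (A, C)) (B := (A', C')) (u, v)). Qed.
Lemma kct_ty A A' C (p : hor A (A' ⊗ tT C)) :
  is_sq (kap p (ct' A' C)) p (p *h th1 A' C) (vid A) (tv1 A' C).
Proof. exact (kap_ty HX SX p (ct_ok A' C)). Qed.
Lemma kap_str_ty A A' C C' (f : hor A A') (g : hor C (tT C')) :
  is_sq (kap_str f g) (bh B f g) (trih f g) (vid (A ⊗ C)) (tv1 A' C').
Proof. apply kct_ty. Qed.
Hint Resolve tss_ty t_u_ty ict_ty ct_ok kct_ty kap_str_ty : sqty.
Hint Resolve ct_ok : psd comp.
Hint Resolve t_f_ty : giso.
Hint Extern 3 (is_sq (t_f _ _) _ _ _ _) => eapply giso_glob; gi : sqty.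

Lemma str_ver_w A C : bv B (vid A) (muv C) *v tv1 A C
  = tv1 A (tT C) *v fv F (tv1 A C) *v muv (A ⊗ C).
Proof. exact (str_w Ht A C). Qed.
Lemma str_ver_z A C : etav (A ⊗ C) = bv B (vid A) (etav C) *v tv1 A C.
Proof. exact (str_z Ht A C). Qed.

Lemma str_ver_w' A C : bv B (vid A) (muv C) *v tv1 A C
  = tv1 A (tT C) *v (fv F (tv1 A C) *v muv (A ⊗ C)).
Proof. rewrite str_ver_w. apply (vc_assoc HX). Qed.
Hint Resolve str_ver_z str_ver_w' : cells.
Hint Extern 2 (_ = _ :> ver _ _) =>
  symmetry; solve [apply str_ver_z | apply str_ver_w'] : cells.
Lemma lifts_wh A C :
  lifts (c_comp (c_bifun B (c_id A) (cmu' C)) (ct' A C))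
    (c_comp (c_comp (ct' A (tT C)) (c_fun F (ct' A C))) (cmu' (A ⊗ C))) (wh A C).
Proof. apply (lift_eq_lifts HX); [cok | cok |]. apply str_ver_w. Qed.
Lemma lifts_zh A C :
  lifts (ceta' (A ⊗ C)) (c_comp (c_bifun B (c_id A) (ceta' C)) (ct' A C)) (zh A C).
Proof. apply (lift_eq_lifts HX); [cok | cok |]. apply str_ver_z. Qed.
Lemma wh_ty A C : is_giso (wh A C) (th1 A (tT C) *h fh F (th1 A C) *h muh (A ⊗ C))
  (bh B (hid A) (muh C) *h th1 A C).
Proof. refine (lifts_giso HX _ _ (lifts_wh A C)); cok. Qed.
Lemma zh_ty A C : is_giso (zh A C) (bh B (hid A) (etah C) *h th1 A C) (etah (A ⊗ C)).
Proof. refine (lifts_giso HX _ _ (lifts_zh A C)); cok. Qed.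
Hint Resolve wh_ty zh_ty : giso.
Hint Extern 3 (is_sq (wh _ _) _ _ _ _) => eapply giso_glob; gi : sqty.
Hint Extern 3 (is_sq (zh _ _) _ _ _ _) => eapply giso_glob; gi : sqty.
Lemma tss_nat A A' C C' A1 A1' C1 C1' (a : sq A A' A1 A1') (c : sq C C' C1 C1') f f' g g' u v w x :
  is_sq a f f' u v -> is_sq c g g' w x ->
  bs B a (fs F c) // tss f' g' = tss f g // fs F (bs B a c).
Proof.
  intros Ha Hc.
  assert (E := vts_nat (str_vtrans Ht) (wf_of (sq_pair Ha Hc))).
  rewrite (top_of (sq_pair Ha Hc)), (bot_of (sq_pair Ha Hc)) in E. exact E.
Qed.
Lemma ict_u A A' C C' (u : ver A A') (v : ver C C') :
  ciot (ct' A C) // t_u u v = sidv (bv B u (fv F v)) // ciot (ct' A' C').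
Proof.
  exact (@lt_htv_ciot _ _ HX _ _ _ _ _ _ _ Hct Lt (A, C) (A', C') (u, v) (t_nat u v)).
Qed.
Lemma tss_f A A' C C' (f : hor A A') (g : hor C C') :
  kap (bh B f (fh F g)) (ct' A' C') // t_f f g = ciot (ct' A C) || tss f g.
Proof. exact (@lt_hth_ciot _ _ HX SX _ _ _ _ _ _ _ Hct Lt (A, C) (A', C') (f, g)). Qed.
Lemma tss_f_inv A A' C C' (f : hor A A') (g : hor C C') :
  (ciot (ct' A C) || tss f g) // ginv (t_f f g) = kap (bh B f (fh F g)) (ct' A' C').
Proof.
  rewrite <- tss_f, (sv_assoc HX) by bd. erewrite giso_r by gi. now rewrite (sv_sid HX) by bd.
Qed.
Lemma tss_w A A' C C' (f : hor A A') (g : hor C C') :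
  bs B (sid f) (mus g) // tss f g = tss f (fh F g) // fs F (tss f g) // mus (bh B f g).
Proof. exact (str_ws Ht f g). Qed.
Lemma tss_z A A' C C' (f : hor A A') (g : hor C C') :
  etas (bh B f g) = bs B (sid f) (etas g) // tss f g.
Proof. exact (str_zs Ht f g). Qed.
Lemma tss_hc A A' A'' C C' C'' (f : hor A A') (g : hor C C') (f' : hor A' A'') (g' : hor C' C'') :
  (tss f g || tss f' g') // (fc F (bh B f g) (bh B f' g') // fs F (bc B f g f' g'))
  = bc B f (fh F g) f' (fh F g') // bs B (sid (f *h f')) (fc F g g') // tss (f *h f') (g *h g').
Proof.
  assert (E := vts_hc (str_vtrans Ht) (A := (A, C)) (B := (A', C')) (C := (A'', C'')) (f, g) (f', g')).
  cbn in E.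
  (* [f_str_src] and [f_str_tgt] are built from projections, whose compositors are identity squares.
     They are displayed here in order to be erased. *)
  change ((bc B f (fh F g) f' (fh F g')
      // bs B (sid (f *h f')) (fc F g g' // fs F (sid (g *h g')))) // tss (f *h f') (g *h g')
    = (tss f g || tss f' g') // (fc F (bh B f g) (bh B f' g')
      // fs F (bc B f g f' g' // bs B (sid (f *h f')) (sid (g *h g'))))) in E.
  rewrite (fs_sid HF), (bs_sid HB), !(sv_sid HX) in E by bd. symmetry. exact E.
Qed.
Lemma tss_hid A C :
  sidv (tv1 A C) // (fu F (A ⊗ C) // fs F (bu B A C))
  = bu B A (tT C) // bs B (sid (hid A)) (fu F C) // tss (hid A) (hid C).
Proof.
  assert (E := vts_hid (str_vtrans Ht) (A, C)). cbn in E.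
  change (bu B A (tT C) // bs B (sid (hid A)) (fu F C // fs F (sid (hid C))) // tss (hid A) (hid C)
    = sidv (tv1 A C) // (fu F (A ⊗ C) // fs F (bu B A C // bs B (sid (hid A)) (sid (hid C))))) in E.
  rewrite (fs_sid HF), (bs_sid HB), !(sv_sid HX) in E by bd. symmetry. exact E.
Qed.
Lemma kap_bifun A A' A'' C C' C'' (p : hor A A') (q : hor C C') (u : ver A' A'') (v : ver C' C'')
    (c : companion u) (d : companion v) : is_companion c -> is_companion d ->
  kap (bh B p q) (c_bifun B c d) // bc B p q (ch c) (ch d) = bs B (kap p c) (kap q d).
Proof.
  intros Hc Hd.
  exact (kap_fun (prod_pseudodouble HX HX) HX (prod_strict SX SX) SX HB (A := (A, C)) (B := (A', C'))
    (C := (A'', C'')) (p, q) (pair_ok HX HX Hc Hd)).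
Qed.
Lemma kap_str_nat A1 A2 A3 A4 C1 C2 C3 C4 (s : sq A1 A2 A3 A4)
    (d : sq C1 (tT C2) C3 (tT C4)) (u : ver A2 A4) (v : ver C2 C4) f f' g g' w w' :
  is_sq s f f' w u -> is_sq d g g' w' (fv F v) ->
  kap_str f g // tris s d u v = bs B s d // kap_str f' g'.
Proof.
  intros Hs Hd. eapply (kap_nat HX SX); [apply ct_ok | apply ct_ok | bd | exact (t_u_ty u v) |].
  apply ict_u.
Qed.

Hint Extern 3 (is_sq (tris _ _ _ _) _ _ _ _) => unfold tris; ty : sqty.

(* The opcartesian cell underlying [tri_h f g] Kleisli-followed by [tri_h f' g']. *)
Definition kap_tri A A' A'' C C' C'' (f : hor A A') (g : hor C (tT C'))
    (f' : hor A' A'') (g' : hor C' (tT C''))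
    : sq (A ⊗ C) (A'' ⊗ tT (tT C'')) (A ⊗ C) (tT (A'' ⊗ C'')) :=
  (kap_str f g || (tss f' g' // fs F (kap_str f' g'))) // kap_kl (trih f g) (trih f' g').
(** Companion of [t], then [T t], then [μ]: the long side of the strength law [str_w]. *)
Definition t3 A C := c_comp (c_comp (ct' A (tT C)) (c_fun F (ct' A C))) (cmu' (A ⊗ C)).
Lemma kap_tri_ty A A' A'' C C' C'' (f : hor A A') (g : hor C (tT C'))
    (f' : hor A' A'') (g' : hor C' (tT C'')) :
  is_sq (kap_tri f g f' g') (bh B f g *h bh B f' (fh F g')) (kh (trih f g) (trih f' g'))
    (vid _) (bv B (vid A'') (muv C'') *v tv1 A'' C'').
Proof.
  eapply is_sq_cast; [unfold kap_tri; ty | cells | cells | cells |].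
  rewrite str_ver_w. cells.
Qed.
Lemma kct_sid A A' C A1 p p' (a : sq A (A' ⊗ tT C) A1 (A' ⊗ tT C)) l :
  is_sq a p p' l (vid _) -> kap p (ct' A' C) // (a || sid (th1 A' C)) = a // kap p' (ct' A' C).
Proof. intros Ha. exact (kap_nat_sid HX SX (ct_ok A' C) Ha). Qed.
Lemma kFct_ty A A' C (p : hor A (tT (A' ⊗ tT C))) :
  is_sq (kap p (c_fun F (ct' A' C))) p (p *h fh F (th1 A' C)) (vid A) (fv F (tv1 A' C)).
Proof. refine (kap_ty HX SX p (c := c_fun F (ct' A' C)) _). cok. Qed.
Hint Resolve kFct_ty : sqty.
Lemma kFct_sid A A' C A1 p p' (a : sq A (tT (A' ⊗ tT C)) A1 (tT (A' ⊗ tT C))) l :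
  is_sq a p p' l (vid _) ->
  kap p (c_fun F (ct' A' C)) // (a || sid (fh F (th1 A' C))) = a // kap p' (c_fun F (ct' A' C)).
Proof. intros Ha. refine (kap_nat_sid HX SX _ Ha). cok. Qed.
Lemma ktss_inv A A' A'' C C' C'' (f : hor A A') (g : hor C (tT C'))
    (f' : hor A' A'') (g' : hor C' C'') :
  (kap_str f g || tss f' g') // (sid (bh B f g) || ginv (t_f f' g'))
  = kap (bh B f g *h bh B f' (fh F g')) (ct' A'' C'').
Proof.
  unfold kap_str, kap at 1. rewrite (sh_assoc HX SX), (ich HX) by bd.
  rewrite tss_f_inv, (sid_sv HX), (kap_sh HX SX); bd.
Qed.
Lemma FkT A A' C C' (f : hor A A') (g : hor C (tT C')) :
  kap (fh F (bh B f g)) (c_fun F (ct' A' C')) // fc F (bh B f g) (th1 A' C') = fs F (kap_str f g).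
Proof. exact (kap_fun HX HX SX SX HF (bh B f g) (ct_ok A' C')). Qed.
(** The first two layers of [tri_c], before the law [str_w] enters. They take [f'⊗g'] out from under
    [T] and move it in front of the strength. *)
Definition triiso A A' A'' C C' C'' (f : hor A A') (g : hor C (tT C'))
    (f' : hor A' A'') (g' : hor C' (tT C'')) :=
  (sid (bh B f g) || sid (th1 A' C') || ginv (fc F (bh B f' g') (th1 A'' C'')) || sid (muh (A'' ⊗ C'')))
  // (sid (bh B f g) || ginv (t_f f' g') || sid (fh F (th1 A'' C'')) || sid (muh (A'' ⊗ C''))).
Lemma FkT_inv A A' C C' (f : hor A A') (g : hor C (tT C')) :
  fs F (kap_str f g) // ginv (fc F (bh B f g) (th1 A' C')) = kap (fh F (bh B f g)) (c_fun F (ct' A' C')).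
Proof.
  rewrite <- FkT, (sv_assoc HX) by bd. erewrite giso_r by gi. apply (sv_sid HX); bd.
Qed.
Lemma triiso_char A A' A'' C C' C'' (f : hor A A') (g : hor C (tT C'))
    (f' : hor A' A'') (g' : hor C' (tT C'')) :
  kap_tri f g f' g' // triiso f g f' g' = kap (bh B f g *h bh B f' (fh F g')) (t3 A'' C'').
Proof.
  unfold kap_tri, triiso, kap_kl, t3. asr. vr kmu_sid. vr kmu_sid. rewrite <- !(sid_hc HX).
  assert (E1 : (kap_str f g || (tss f' g' // fs F (kap_str f' g')))
      // (sid (bh B f g *h th1 A' C') || ginv (fc F (bh B f' g') (th1 A'' C'')))
    = (kap_str f g || tss f' g') // kap (bh B f g *h th1 A' C' *h fh F (bh B f' g')) (c_fun F (ct' A'' C''))).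
  { rewrite (ich HX) by bd. rewrite (sv_assoc HX), FkT_inv by bd.
    rewrite <- (ich HX) by bd. now rewrite (kap_sh HX SX) by cok. }
  rewrite (sv_rew2 HX E1) by bd. asr. vr kFct_sid.
  rewrite (sv_rew2 HX (ktss_inv f g f' g')) by bd.
  rewrite <- (kap_comp HX SX) by cok. rewrite <- (kap_comp HX SX) by cok. cbn [ch c_fun c_comp].
  rewrite (sv_assoc HX) by bd. rewrite !(hc_assoc SX). reflexivity.
Qed.
Lemma triiso_ty A A' A'' C C' C'' (f : hor A A') (g : hor C (tT C'))
    (f' : hor A' A'') (g' : hor C' (tT C'')) :
  is_giso (triiso f g f' g') (kh (trih f g) (trih f' g'))
    (bh B f g *h bh B f' (fh F g') *h ch (t3 A'' C'')).
Proof.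
  unfold triiso, kh, t3. cbn [ch c_fun c_comp].
  eapply giso_cast; [gi | cells | cells].
Qed.
(** By [triiso_char], [kap_tri] is an opcartesian cell for [t3] followed by an invertible cell. *)
Lemma kap_tri_epi A A' A'' C C' C'' E E' (f : hor A A') (g : hor C (tT C'))
    (f' : hor A' A'') (g' : hor C' (tT C'')) (s s' : sq (A ⊗ C) (tT (A'' ⊗ C'')) E E') x x' l l' r :
  is_sq s (kh (trih f g) (trih f' g')) x l r -> is_sq s' (kh (trih f g) (trih f' g')) x' l' r ->
  kap_tri f g f' g' // s = kap_tri f g f' g' // s' -> s = s'.
Proof.
  intros Hs Hs' Eq. assert (HI := triiso_ty f g f' g'). assert (HP := kap_tri_ty f g f' g').
  assert (E0 : kap_tri f g f' g' = kap (bh B f g *h bh B f' (fh F g')) (t3 A'' C'')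
    // ginv (triiso f g f' g')).
  { rewrite <- triiso_char, (sv_assoc HX) by bd. erewrite giso_r by gi. symmetry. apply (sv_sid HX); bd. }
  assert (Hk : is_companion (t3 A'' C'')) by (unfold t3; cok).
  assert (Hkt := kap_ty HX SX (bh B f g *h bh B f' (fh F g')) Hk).
  rewrite E0, !(sv_assoc HX) in Eq by bd.
  eapply (kap_epi HX SX Hk) in Eq; [| bd | bd].
  eapply (giso_epi HX (giso_inv HI)); [bd .. | exact Eq].
Qed.
Definition cBmu A C : companion (bv B (vid A) (muv C)) := c_bifun B (c_id A) (cmu' C).
Lemma cBmu_ok A C : is_companion (cBmu A C). Proof. unfold cBmu. cok. Qed.
Lemma kBmu_ty A A' C (p : hor A (A' ⊗ tT (tT C))) :
  is_sq (kap p (cBmu A' C)) p (p *h bh B (hid A') (muh C)) (vid A) (bv B (vid A') (muv C)).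
Proof. exact (kap_ty HX SX p (cBmu_ok A' C)). Qed.
Hint Resolve cBmu_ok : comp.
Hint Resolve kBmu_ty : sqty.
Lemma kBmu_sid A A' C A1 p p' (a : sq A (A' ⊗ tT (tT C)) A1 (A' ⊗ tT (tT C))) l :
  is_sq a p p' l (vid _) ->
  kap p (cBmu A' C) // (a || sid (bh B (hid A') (muh C))) = a // kap p' (cBmu A' C).
Proof. intros Ha. exact (kap_nat_sid HX SX (cBmu_ok A' C) Ha). Qed.
Lemma kap_wh A A' C (p : hor A (A' ⊗ tT (tT C))) :
  kap p (t3 A' C) // (sid p || wh A' C)
  = kap p (cBmu A' C) // kap (p *h bh B (hid A') (muh C)) (ct' A' C).
Proof.
  transitivity (kap p (c_comp (cBmu A' C) (ct' A' C))).
  - refine (kap_lifts HX p _ _ (lifts_wh A' C)); unfold t3; cok.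
  - symmetry. apply (kap_comp HX SX); cok.
Qed.
Lemma kBmu_bc A A' C C' (f : hor A A') (g : hor C (tT (tT C'))) :
  kap (bh B f g) (cBmu A' C') // bc B f g (hid A') (muh C') = bs B (sid f) (kap g (cmu' C')).
Proof.
  rewrite <- (kap_id HX SX f). apply kap_bifun; cok.
Qed.
Lemma kt3_ty A A' C (p : hor A (A' ⊗ tT (tT C))) :
  is_sq (kap p (t3 A' C)) p (p *h th1 A' (tT C) *h fh F (th1 A' C) *h muh (A' ⊗ C)) (vid A)
    (tv1 A' (tT C) *v fv F (tv1 A' C) *v muv (A' ⊗ C)).
Proof.
  assert (Hk : is_companion (t3 A' C)) by (unfold t3; cok).
  eapply is_sq_cast; [exact (kap_ty HX SX p Hk) | reflexivity | | reflexivity | reflexivity].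
  unfold t3. cbn [ch c_comp c_fun]. rewrite !(hc_assoc SX). reflexivity.
Qed.
Hint Resolve kt3_ty : sqty.
(** [kap_wh] trades [t3] for [A⊗μ] followed by [t]; the compositors of [⊗] then gather [μ] into the
    Kleisli composite of [g] and [g']. The laws of the compositor of the action are read off from
    this equation. *)
Lemma tric_char A A' A'' C C' C'' (f : hor A A') (g : hor C (tT C'))
    (f' : hor A' A'') (g' : hor C' (tT C'')) :
  kap_tri f g f' g' // tric f g f' g'
  = bc B f g f' (fh F g') // (bs B (sid (f *h f')) (kap_kl g g') // kap_str (f *h f') (kh g g')).
Proof.
  change (tric f g f' g') with (triiso f g f' g'
    // (sid (bh B f g) || sid (bh B f' (fh F g')) || wh A'' C'')
    // (bc B f g f' (fh F g') || sid (bh B (hid A'') (muh C'')) || sid (th1 A'' C''))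
    // (bc B (f *h f') (g *h fh F g') (hid A'') (muh C'') || sid (th1 A'' C''))).
  assert (HI := triiso_ty f g f' g'). assert (HP := kap_tri_ty f g f' g').
  change (ch (t3 A'' C'')) with (th1 A'' (tT C'') *h fh F (th1 A'' C'') *h muh (A'' ⊗ C'')) in HI.
  asr. rewrite (sv_rew2 HX (triiso_char f g f' g')) by bd.
  rewrite <- !(sid_hc HX).
  rewrite (sv_rew2 HX (kap_wh _)) by bd. asr. vr kct_sid. vr kct_sid. vr kBmu_sid.
  unfold kap_kl. vr kBmu_bc. rewrite (hc_idr SX). reflexivity.
Qed.

Lemma tric_giso A A' A'' C C' C'' (f : hor A A') (g : hor C (tT C'))
    (f' : hor A' A'') (g' : hor C' (tT C'')) :
  is_giso (tric f g f' g') (kh (trih f g) (trih f' g')) (trih (f *h f') (kh g g')).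
Proof.
  change (tric f g f' g') with (triiso f g f' g'
    // (sid (bh B f g) || sid (bh B f' (fh F g')) || wh A'' C'')
    // (bc B f g f' (fh F g') || sid (bh B (hid A'') (muh C'')) || sid (th1 A'' C''))
    // (bc B (f *h f') (g *h fh F g') (hid A'') (muh C'') || sid (th1 A'' C''))).
  assert (HI := triiso_ty f g f' g').
  change (ch (t3 A'' C'')) with (th1 A'' (tT C'') *h fh F (th1 A'' C'') *h muh (A'' ⊗ C'')) in HI.
  eapply giso_cast; [gi | cells | unfold kh; cells].
Qed.
Hint Resolve tric_giso : giso.
Hint Extern 3 (is_sq (tric _ _ _ _) _ _ _ _) => eapply giso_glob; gi : sqty.
Hint Resolve kap_tri_ty : sqty.
Lemma tris_ty A1 A2 A3 A4 C1 C2 C3 C4 (s : sq A1 A2 A3 A4)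
    (d : sq C1 (tT C2) C3 (tT C4)) (u : ver A2 A4) (v : ver C2 C4) f f' g g' w w' :
  is_sq s f f' w u -> is_sq d g g' w' (fv F v) ->
  is_sq (tris s d u v) (trih f g) (trih f' g') (bv B w w') (fv F (bv B u v)).
Proof. intros Hs Hd. unfold tris. bd. Qed.
Lemma kap_tri_nat A1 A2 A3 A1' A2' A3' C1 C2 C3 C1' C2' C3' (s : sq A1 A2 A1' A2')
    (d : sq C1 (tT C2) C1' (tT C2')) (s1 : sq A2 A3 A2' A3') (d1 : sq C2 (tT C3) C2' (tT C3'))
    (u : ver A2 A2') (v : ver C2 C2') (u1 : ver A3 A3') (v1 : ver C3 C3')
    f f' g g' f1 f1' g1 g1' w w' :
  is_sq s f f' w u -> is_sq d g g' w' (fv F v) ->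
  is_sq s1 f1 f1' u u1 -> is_sq d1 g1 g1' v (fv F v1) ->
  kap_tri f g f1 g1 // ks (tris s d u v) (tris s1 d1 u1 v1) (bv B u1 v1)
  = (bs B s d || bs B s1 (fs F d1)) // kap_tri f' g' f1' g1'.
Proof.
  intros Hs Hd Hs1 Hd1. assert (T1 := tris_ty Hs Hd). assert (T2 := tris_ty Hs1 Hd1).
  unfold kap_tri. asr. erewrite kap_kl_nat by eassumption.
  rewrite <- (sv_assoc HX) by bd. rewrite (ich HX) by bd.
  rewrite (sv_assoc HX), <- (fs_sv HF) by bd.
  rewrite (kap_str_nat Hs Hd), (kap_str_nat Hs1 Hd1).
  rewrite (fs_sv HF), <- (sv_assoc HX) by bd. erewrite <- tss_nat by eassumption.
  rewrite (sv_assoc HX), <- (ich HX) by bd. apply (sv_assoc HX); bd.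
Qed.
Lemma tric_nat A1 A2 A3 A1' A2' A3' C1 C2 C3 C1' C2' C3' (s : sq A1 A2 A1' A2')
    (d : sq C1 (tT C2) C1' (tT C2')) (s1 : sq A2 A3 A2' A3') (d1 : sq C2 (tT C3) C2' (tT C3'))
    (u : ver A2 A2') (v : ver C2 C2') (u1 : ver A3 A3') (v1 : ver C3 C3')
    f f' g g' f1 f1' g1 g1' w w' :
  is_sq s f f' w u -> is_sq d g g' w' (fv F v) ->
  is_sq s1 f1 f1' u u1 -> is_sq d1 g1 g1' v (fv F v1) ->
  ks (tris s d u v) (tris s1 d1 u1 v1) (bv B u1 v1) // tric f' g' f1' g1'
  = tric f g f1 g1 // tris (s || s1) (ks d d1 v1) u1 v1.
Proof.
  intros Hs Hd Hs1 Hd1. assert (T1 := tris_ty Hs Hd). assert (T2 := tris_ty Hs1 Hd1).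
  assert (T3 := ks_ty T1 T2). assert (T4 := ks_ty Hd Hd1).
  assert (T5 := sh_ty HX Hs Hs1). assert (T6 := tris_ty T5 T4).
  assert (HP := kap_tri_ty f g f1 g1). assert (HP' := kap_tri_ty f' g' f1' g1').
  eapply kap_tri_epi; [bd | bd |].
  rewrite <- !(sv_assoc HX) by bd. erewrite kap_tri_nat by eassumption.
  rewrite tric_char. rewrite (sv_assoc HX) by bd. rewrite tric_char.
  asr. rewrite (kap_str_nat T5 T4).
  rewrite <- (sv_assoc HX) by bd. erewrite bc_sq by bd. asr. f_equal.
  rewrite <- !(sv_assoc HX (c := kap_str _ _)) by bd. f_equal.
  rewrite <- !(bs_sv HB) by bd. f_equal.
  - rewrite (sid_sv HX), (sv_sid HX) by bd. reflexivity.
  - symmetry. eapply kap_kl_nat; eassumption.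
Qed.

(** * Unit laws of the action *)

Lemma zh_char A C :
  ciot (ceta' (A ⊗ C)) // ginv (zh A C)
  = bu B A C // (bs B (sid (hid A)) (ciot (ceta' C)) // kap_str (hid A) (etah C)).
Proof.
  (* The right-hand side is the unit cell of the composite companion in the law [str_z]; [zh] lifts
     that law, so its inverse carries the unit cell of [η] to this one. *)
  assert (H1 : ciot (c_comp (c_bifun B (c_id A) (ceta' C)) (ct' A C))
    = bu B A C // (bs B (sid (hid A)) (ciot (ceta' C)) // kap_str (hid A) (etah C))).
  { cbn. rewrite (run_id SX), (ginv_sid HX). unfold kap_str, kap.
    change (bu B A C // bs B (sid (hid A)) (ciot (ceta' C)) // sid (bh B (hid A) (etah C))
     // (sid (bh B (hid A) (etah C)) || ciot (ct' A C)) =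
     bu B A C // (bs B (sid (hid A)) (ciot (ceta' C)) // (sid (bh B (hid A) (etah C)) || ciot (ct' A C)))).
    rewrite (sv_sid HX) by bd. apply (sv_assoc HX); bd. }
  rewrite <- H1.
  assert (E : ciot (c_comp (c_bifun B (c_id A) (ceta' C)) (ct' A C)) // zh A C = ciot (ceta' (A ⊗ C))).
  { refine (lifts_ciot HX _ _ (lifts_zh A C)); cok. }
  rewrite H1 in E. rewrite H1, <- E. asr. erewrite giso_r by gi.
  rewrite (sv_sid HX) by bd. reflexivity.
Qed.
Lemma ieta_epi A D E (s s' : sq A (tT A) D E) g g' l l' r :
  is_sq s (etah A) g l r -> is_sq s' (etah A) g' l' r ->
  ciot (ceta' A) // s = ciot (ceta' A) // s' -> s = s'.
Proof.
  intros Hs Hs' Eq. eapply (kap_epi HX SX (p := hid A) (ceta_ok A)); [bd | bd |].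
  unfold kap. now rewrite (hid_sh HX SX) by bd.
Qed.
Lemma zh_nat A A' C C' (u : ver A A') (v : ver C C') :
  eta_u (bv B u v) // ginv (zh A' C') = ginv (zh A C) // tris (sidv u) (eta_u v) u v.
Proof.
  assert (H1 := eta_u_ty v). assert (H2 := eta_u_ty (bv B u v)).
  assert (H3 := tris_ty (sidv_ty HX u) H1).
  assert (Ev : etav (A ⊗ C) *v fv F (bv B u v) = bv B u v *v etav (A' ⊗ C')) by (symmetry; apply eta_nat).
  eapply ieta_epi; [bd | bd |].
  rewrite <- !(sv_assoc HX), ieta_u, zh_char by bd.
  rewrite (sv_assoc HX), zh_char by bd. asr.
  rewrite (kap_str_nat (sidv_ty HX u) H1).
  rewrite <- (sv_assoc HX (b := bs B _ (eta_u v))) by bd.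
  rewrite <- (bs_sv HB), ieta_u, (sid_sv HX) by bd.
  rewrite <- (sv_sid HX (a := sidv u) (f := hid A')) by bd.
  rewrite (bs_sv HB) by bd. asr.
  rewrite <- !(sv_assoc HX (b := bs B (sidv u) (sidv v))) by bd.
  rewrite <- (bu_nat HB). symmetry. apply (sv_assoc HX); bd.
Qed.

Lemma kap_str_etas A A' C C' (f : hor A A') (g : hor C (tT C')) :
  kap_str f g // (ciot (ceta' (A ⊗ C)) || etas (trih f g))
  = ciot (ceta' (A ⊗ C)) || (bs B (sid f) (etas g) // (tss f g // fs F (kap_str f g))).
Proof.
  assert (HK := kap_str_ty f g).
  rewrite <- (hid_sh HX SX (a := kap_str f g)) at 1 by bd.
  rewrite (ich HX), (sid_sv HX) by bd. f_equal.
  rewrite <- (etas_nat HK), tss_z. apply (sv_assoc HX); bd.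
Qed.
Lemma tric_lun A A' C C' (f : hor A A') (g : hor C (tT C')) :
  ks (ginv (zh A C)) (sid (trih f g)) (vid _) // tric (hid A) (etah C) f g
    // tris (sid f) (klun g) (vid _) (vid _) = klun (trih f g).
Proof.
  assert (HK := kap_str_ty f g). assert (HK1 := kap_str_ty (hid A) (etah C)).
  assert (HP := kap_tri_ty (hid A) (etah C) f g).
  assert (T1 : is_sq (ginv (zh A C)) (etah (A ⊗ C)) (trih (hid A) (etah C)) (vid _) (fv F (vid _))) by bd.
  assert (T2 : is_sq (sid (trih f g)) (trih f g) (trih f g) (vid _) (fv F (vid _))) by bd.
  assert (T3 := ks_ty T1 T2).
  assert (T4 : is_sq (klun g) (kh (etah C) g) g (vid _) (fv F (vid _))) by bd.
  assert (T5 := tris_ty (sid_ty HX f) T4).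
  assert (T6 : is_sq (lL (trih f g)) (trih f g) (kh (etah (A ⊗ C)) (trih f g)) (vid _) (vid _)) by apply lL_ty.
  assert (T7 : is_sq (tric (hid A) (etah C) f g) (kh (trih (hid A) (etah C)) (trih f g)) (trih f (kh (etah C) g)) (vid _) (vid _)).
  { eapply is_sq_cast; [exact (giso_glob (tric_giso (hid A) (etah C) f g)) | reflexivity | | reflexivity | reflexivity].
    now rewrite (hc_idl SX). }
  set (L := _ // tris _ _ _ _).
  assert (TL : is_sq L (kh (etah (A ⊗ C)) (trih f g)) (trih f g) (vid _) (vid _))  by (unfold L; bd).
  (* [lL] inverts [klun], so it is enough that [lL] followed by the left-hand side is an identity.
     This is checked behind the opcartesian cell of the strength, where [str_zs] splits the
     component of [η] at a tensor. *)
  assert (E : lL (trih f g) // L = sid (trih f g)).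
  { eapply (kap_epi HX SX (ct_ok A' C') (p := bh B f g)); [bd | bd |].
    fold (kap_str f g). rewrite (sv_sid HX) by bd.
    unfold L. rewrite <- !(sv_assoc HX) by bd.
    unfold lL. rewrite <- (sv_assoc HX (b := _ || etas _)), kap_str_etas by bd.
    asr. rewrite (sv_rew2 HX (kap_kl_nat T1 T2)) by bd. asr.
    rewrite (fs_sid HF). vr (ich HX). rewrite zh_char. rewrite (sv_sid HX) by bd.
    rewrite <- (sid_sv HX (a := bs B (sid f) (etas g) // _) (f := bh B f g)) by bd.
    rewrite <- (ich HX) by bd. rewrite <- (ich HX) by bd. asr.
    rewrite <- (sv_assoc HX (a := kap_str _ _ || _)) by bd. fold (kap_tri (hid A) (etah C) f g).
    rewrite (sv_rew2 HX (tric_char (hid A) (etah C) f g)) by bd. asr.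
    rewrite (hc_idl SX). rewrite (kap_str_nat (sid_ty HX f) T4).
    rewrite <- (sv_assoc HX (a := bs B _ _ || _)) by bd.
    erewrite (bc_sq HB) by bd. asr. rewrite <- !(sv_assoc HX (c := kap_str _ _)) by bd.
    rewrite <- !(bs_sv HB) by bd.
    rewrite klun_char, (hid_sh HX SX), !(sid_sv HX) by bd.
    assert (E := bc_lun HB f g). rewrite !(lun_id SX), (sv_assoc HX) in E by bd.
    rewrite E. apply (sid_sv HX); bd. }
  rewrite lLE in E, T6.
  assert (Hl := klun_ty (trih f g)).
  rewrite <- (sid_sv HX (a := L) (f := kh (etah (A ⊗ C)) (trih f g))) by bd.
  rewrite <- (giso_r Hl), (sv_assoc HX), E by bd. apply (sv_sid HX); bd.
Qed.
Lemma kap_str_tss_hid A A' C C' (f : hor A A') (g : hor C (tT C')) :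
  kap_str f g // (sid (trih f g) || (fu F (A' ⊗ C') // fs F (bu B A' C')))
  = kap_str f g || (bu B A' (tT C') // (bs B (sid (hid A')) (fu F C') // tss (hid A') (hid C'))).
Proof.
  assert (HK := kap_str_ty f g).
  rewrite <- (sh_sidv HX SX (a := kap_str f g) (u := tv1 A' C')) at 1 by bd.
  rewrite (ich HX), (sv_sid HX), tss_hid by bd. f_equal. apply (sv_assoc HX); bd.
Qed.
(** Same scheme with [rL]. The unit now sits at the end of the string, and compatibility of the
    strength with units, [tss_hid], takes the place of [str_zs]. *)
Lemma tric_run A A' C C' (f : hor A A') (g : hor C (tT C')) :
  ks (sid (trih f g)) (ginv (zh A' C')) (vid _) // tric f g (hid A') (etah C')
    // tris (sid f) (krun g) (vid _) (vid _) = krun (trih f g).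
Proof.
  assert (HK := kap_str_ty f g). assert (HK1 := kap_str_ty (hid A') (etah C')).
  assert (HP := kap_tri_ty f g (hid A') (etah C')).
  assert (T1 : is_sq (ginv (zh A' C')) (etah (A' ⊗ C')) (trih (hid A') (etah C')) (vid _) (fv F (vid _))) by bd.
  assert (T2 : is_sq (sid (trih f g)) (trih f g) (trih f g) (vid _) (fv F (vid _))) by bd.
  assert (T3 := ks_ty T2 T1).
  assert (T4 : is_sq (krun g) (kh g (etah C')) g (vid _) (fv F (vid _))) by bd.
  assert (T5 := tris_ty (sid_ty HX f) T4).
  assert (T6 := rL_ty (trih f g)).
  assert (T7 : is_sq (tric f g (hid A') (etah C')) (kh (trih f g) (trih (hid A') (etah C'))) (trih f (kh g (etah C'))) (vid _) (vid _)).
  { eapply is_sq_cast; [exact (giso_glob (tric_giso f g (hid A') (etah C'))) | reflexivity | | reflexivity | reflexivity].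
    now rewrite (hc_idr SX). }
  set (L := _ // tris _ _ _ _).
  assert (TL : is_sq L (kh (trih f g) (etah (A' ⊗ C'))) (trih f g) (vid _) (vid _)) by (unfold L; bd).
  assert (E : rL (trih f g) // L = sid (trih f g)).
  { eapply (kap_epi HX SX (ct_ok A' C') (p := bh B f g)); [bd | bd |].
    fold (kap_str f g). rewrite (sv_sid HX) by bd.
    unfold L, rL. asr. rewrite (sv_rew2 HX (kap_kl_nat T2 T1)) by bd. asr.
    rewrite <- (sv_assoc HX (b := sid _ || fs F (ginv _))), (ich HX), (sid_sv HX) by bd.
    rewrite (sv_assoc HX (a := fu F _)), <- (fs_sv HF), zh_char, (fs_sv HF) by bd.
    rewrite (fs_sv HF), <- (sv_assoc HX (a := fu F _)) by bd.
    rewrite <- (sid_sv HX (a := sid (trih f g)) (f := trih f g)) by bd.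
    rewrite <- (ich HX) by bd. asr.
    rewrite (sv_rew2 HX (kap_str_tss_hid f g)) by bd. asr. vr (ich HX). rewrite (sv_sid HX) by bd.
    assert (E1 : tss (hid A') (hid C') // fs F (bs B (sid (hid A')) (ciot (ceta' C')))
      = bs B (sid (hid A')) (fs F (ciot (ceta' C'))) // tss (hid A') (etah C')).
    { symmetry. eapply tss_nat; bd. }
    rewrite (sv_rew2 HX E1) by bd. asr.
    assert (E2 : bs B (sid (hid A')) (fu F C') // bs B (sid (hid A')) (fs F (ciot (ceta' C')))
      = bs B (sid (hid A')) (fu F C' // fs F (ciot (ceta' C')))).
    { rewrite <- (bs_sv HB), (sid_sv HX); bd. }
    rewrite (sv_rew2 HX E2) by bd.
    rewrite <- (sid_sv HX (a := kap_str f g) (f := bh B f g)) at 1 by bd.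
    rewrite <- (ich HX) by bd.
    rewrite <- (sid_sv HX (a := kap_str f g) (f := bh B f g)) at 1 by bd.
    rewrite <- (ich HX) by bd. asr.
    rewrite <- (sv_assoc HX (a := kap_str _ _ || _)) by bd. fold (kap_tri f g (hid A') (etah C')).
    rewrite (sv_rew2 HX (tric_char f g (hid A') (etah C'))) by bd. asr.
    rewrite (hc_idr SX). rewrite (kap_str_nat (sid_ty HX f) T4).
    rewrite <- (bs_sid HB).
    rewrite <- (sv_assoc HX (a := _ || bs B _ _)) by bd.
    erewrite (bc_sq HB) by bd. asr. rewrite <- !(sv_assoc HX (c := kap_str _ _)) by bd.
    rewrite <- !(bs_sv HB) by bd.
    rewrite krun_char, (sh_hid HX SX), !(sid_sv HX) by bd.
    assert (E := bc_run HB f g). rewrite !(run_id SX), (sv_assoc HX) in E by bd.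
    rewrite (bs_sid HB) in *. rewrite E. apply (sid_sv HX); bd. }
  rewrite rLE in E, T6.
  assert (Hl := krun_ty (trih f g)).
  rewrite <- (sid_sv HX (a := L) (f := kh (trih f g) (etah (A' ⊗ C')))) by bd.
  rewrite <- (giso_r Hl), (sv_assoc HX), E by bd. apply (sv_sid HX); bd.
Qed.

(** * Associativity of the compositor of the action *)

Lemma bs_sidl_sv A A' C C' D D' E E' (f : hor A A') (a : sq C C' D D') (b : sq D D' E E') :
  wf a -> wf b -> bot a = top b ->
  bs B (sid f) (a // b) = bs B (sid f) a // bs B (sid f) b.
Proof. intros. rewrite <- (bs_sv HB) by first [assumption | bd]. now rewrite (sid_sv HX) by bd. Qed.
(** Tensoring keeps the cell epic because, by [kBmu_bc], the result is an opcartesian cell for [A⊗μ]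
    followed by a compositor. *)
Lemma bs_kmu_epi A A' C C' E E' (f : hor A A') (g : hor C (tT (tT C')))
    (s s' : sq (A ⊗ C) (A' ⊗ tT C') E E') x x' l l' r :
  is_sq s (bh B f (g *h muh C')) x l r -> is_sq s' (bh B f (g *h muh C')) x' l' r ->
  bs B (sid f) (kap g (cmu' C')) // s = bs B (sid f) (kap g (cmu' C')) // s' -> s = s'.
Proof.
  intros Hs Hs' Eq. rewrite <- kBmu_bc, !(sv_assoc HX) in Eq by bd.
  eapply (kap_epi HX SX (cBmu_ok _ _)) in Eq; [| bd | bd].
  eapply (giso_epi HX (bc_ty HB f g (hid A') (muh C'))); [bd .. | exact Eq].
Qed.
Lemma bs_kL_ty A A' C1 C2 C3 C4 (f : hor A A') (g : hor C1 (tT C2))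
    (h : hor C2 (tT C3)) (k : hor C3 (tT C4)) :
  is_sq (bs B (sid f) (kap_kl_l g h k)) (bh B f (g *h fh F h *h fh F (fh F k))) (bh B f (kh (kh g h) k))
    (vid _) (bv B (vid A') (muv (tT C4) *v muv C4)).
Proof.
  assert (TL := kap_kl_l_ty g h k).
  eapply is_sq_cast; [eapply (bs_ty HB); [exact (sid_ty HX f) | exact TL] | reflexivity | reflexivity | cells | reflexivity].
Qed.
Lemma bs_kL_epi A A' C1 C2 C3 C4 E E' (f : hor A A') (g : hor C1 (tT C2))
    (h : hor C2 (tT C3)) (k : hor C3 (tT C4)) (s s' : sq (A ⊗ C1) (A' ⊗ tT C4) E E') x x' l l' r :
  is_sq s (bh B f (kh (kh g h) k)) x l r -> is_sq s' (bh B f (kh (kh g h) k)) x' l' r ->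
  bs B (sid f) (kap_kl_l g h k) // s = bs B (sid f) (kap_kl_l g h k) // s' -> s = s'.
Proof.
  intros Hs Hs' Eq. unfold kap_kl_l in Eq. rewrite kap_kl_mus in Eq.
  assert (HK := kap_kl_ty (kh g h) k).
  unfold kh in *. rewrite !bs_sidl_sv, !(sv_assoc HX) in Eq by bd.
  eapply bs_kmu_epi in Eq; [| bd | bd].
  eapply (giso_epi HX (f := bh B f (g *h fh F h *h (fh F (fh F k) *h muh (tT C4))))) in Eq; [| bd ..].
  eapply bs_kmu_epi in Eq; [exact Eq | bd ..].
Qed.
(** The shape in which a factor after the first occurs: the strength component, followed by the
    opcartesian cell of the factor under [T]. *)
Definition kap_strT A A' C C' (f : hor A A') (g : hor C (tT C')) :
  sq (A ⊗ tT C) (A' ⊗ tT (tT C')) (tT (A ⊗ C)) (tT (tT (A' ⊗ C'))) :=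
  tss f g // fs F (kap_str f g).
Lemma kap_strT_ty A A' C C' (f : hor A A') (g : hor C (tT C')) :
  is_sq (kap_strT f g) (bh B f (fh F g)) (fh F (trih f g)) (tv1 A C) (tv1 A' (tT C') *v fv F (tv1 A' C')).
Proof. unfold kap_strT. bd. Qed.
(** The 2-cell form of [str_w] replaces two strengths followed by [μ] with [μ] followed by one
    strength. *)
Lemma kap_strT_mus A A' C C' (f : hor A A') (g : hor C (tT C')) :
  tss f (fh F g) // (fs F (kap_strT f g) // mus (trih f g)) = bs B (sid f) (mus g) // kap_strT f g.
Proof.
  assert (HK := kap_str_ty f g). unfold kap_strT. rewrite (fs_sv HF) by bd. asr.
  rewrite <- (mus_nat HK), <- !(sv_assoc HX), tss_w by bd. reflexivity.
Qed.
(** Three-factor analogue of [kap_tri]: it starts from [[f1⊗g1 | f2⊗Tg2 | f3⊗TTg3]]. *)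
Definition kap_tri3 A1 A2 A3 A4 C1 C2 C3 C4 (f1 : hor A1 A2) (g1 : hor C1 (tT C2))
    (f2 : hor A2 A3) (g2 : hor C2 (tT C3)) (f3 : hor A3 A4) (g3 : hor C3 (tT C4)) :=
  (kap_str f1 g1 || (kap_strT f2 g2 || (tss f3 (fh F g3) // fs F (kap_strT f3 g3))))
  // kap_kl_l (trih f1 g1) (trih f2 g2) (trih f3 g3).
Hint Resolve kap_strT_ty : sqty.
Lemma kap_strT_tric A A' A'' C C' C'' (f : hor A A') (g : hor C (tT C'))
    (f' : hor A' A'') (g' : hor C' (tT C'')) :
  (kap_str f g || kap_strT f' g') // (kap_kl (trih f g) (trih f' g') // tric f g f' g')
  = bc B f g f' (fh F g') // (bs B (sid (f *h f')) (kap_kl g g') // kap_str (f *h f') (kh g g')).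
Proof. rewrite <- (sv_assoc HX) by bd. apply tric_char. Qed.
Lemma kap_tri3_l A1 A2 A3 A4 C1 C2 C3 C4 (f1 : hor A1 A2) (g1 : hor C1 (tT C2))
    (f2 : hor A2 A3) (g2 : hor C2 (tT C3)) (f3 : hor A3 A4) (g3 : hor C3 (tT C4)) :
  kap_tri3 f1 g1 f2 g2 f3 g3
    // (ks (tric f1 g1 f2 g2) (sid (trih f3 g3)) (vid _) // tric (f1 *h f2) (kh g1 g2) f3 g3)
  = (bc B f1 g1 f2 (fh F g2) || sid (bh B f3 (fh F (fh F g3))))
    // (bc B (f1 *h f2) (g1 *h fh F g2) f3 (fh F (fh F g3))
    // (bs B (sid (f1 *h f2 *h f3)) (kap_kl_l g1 g2 g3) // kap_str (f1 *h f2 *h f3) (kh (kh g1 g2) g3))).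
Proof.
  assert (HT1 : is_sq (tric f1 g1 f2 g2) (kh (trih f1 g1) (trih f2 g2)) (trih (f1 *h f2) (kh g1 g2)) (vid _) (fv F (vid _))) by bd.
  assert (HT2 : is_sq (sid (trih f3 g3)) (trih f3 g3) (trih f3 g3) (vid _) (fv F (vid _))) by bd.
  assert (HT3 := ks_ty HT1 HT2).
  assert (HP := kap_tri_ty f1 g1 f2 g2). assert (HP' := kap_tri_ty (f1 *h f2) (kh g1 g2) f3 g3).
  unfold kap_tri3, kap_kl_l. rewrite <- (sh_assoc HX SX) by bd. asr.
  rewrite (sv_rew2 HX (kap_kl_nat HT1 HT2)) by bd. asr. rewrite (fs_sid HF).
  vr (ich HX). vr (ich HX). rewrite (sv_sid HX) by bd. rewrite kap_strT_mus.
  rewrite <- (sv_assoc HX (b := kap_kl _ _)) by bd. 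
  rewrite kap_strT_tric. rewrite <- (sid_sv HX (a := bs B (sid f3) (mus g3) // _) (f := bh B f3 (fh F (fh F g3)))) by bd.
  rewrite <- !(ich HX) by bd. asr.
  rewrite kap_strT_tric. rewrite <- (sv_assoc HX (a := bs B _ _ || _)) by bd.
  erewrite (bc_sq HB) by bd. asr. rewrite <- (sid_hc HX).
  do 2 f_equal. rewrite <- (sv_assoc HX) by bd. f_equal. now rewrite <- bs_sidl_sv by bd.
Qed.
Lemma kap_strT_fc A2 A3 A4 C2 C3 C4
    (f2 : hor A2 A3) (g2 : hor C2 (tT C3)) (f3 : hor A3 A4) (g3 : hor C3 (tT C4)) :
  (kap_strT f2 g2 || (tss f3 (fh F g3) // fs F (kap_strT f3 g3)))
    // (fc F (trih f2 g2) (fh F (trih f3 g3))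
    // (fs F (kap_kl (trih f2 g2) (trih f3 g3)) // fs F (tric f2 g2 f3 g3)))
  = bc B f2 (fh F g2) f3 (fh F (fh F g3))
    // (bs B (sid (f2 *h f3)) (fc F g2 (fh F g3) // fs F (kap_kl g2 g3))
    // kap_strT (f2 *h f3) (kh g2 g3)).
Proof.
  unfold kap_strT at 1. rewrite <- (ich HX) by bd. asr. vr (fc_sq HF).
  rewrite <- !(fs_sv HF), kap_strT_tric by bd. rewrite !(fs_sv HF) by bd.
  rewrite bs_sidl_sv by bd. asr.
  rewrite <- (sv_assoc HX (a := fc F _ _)) by bd.
  rewrite <- (sv_assoc HX (a := tss _ _ || _)), tss_hc by bd. asr.
  do 2 f_equal. unfold kap_strT. rewrite <- !(sv_assoc HX (c := fs F (kap_str _ _))) by bd. f_equal.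
  symmetry. eapply tss_nat; bd.
Qed.
Lemma kap_tri3_r A1 A2 A3 A4 C1 C2 C3 C4 (f1 : hor A1 A2) (g1 : hor C1 (tT C2))
    (f2 : hor A2 A3) (g2 : hor C2 (tT C3)) (f3 : hor A3 A4) (g3 : hor C3 (tT C4)) :
  kap_tri3 f1 g1 f2 g2 f3 g3
    // (kasc (trih f1 g1) (trih f2 g2) (trih f3 g3)
    // (ks (sid (trih f1 g1)) (tric f2 g2 f3 g3) (vid _) // tric f1 g1 (f2 *h f3) (kh g2 g3)))
  = (sid (bh B f1 g1) || bc B f2 (fh F g2) f3 (fh F (fh F g3)))
    // (bc B f1 g1 (f2 *h f3) (fh F g2 *h fh F (fh F g3))
    // (bs B (sid (f1 *h (f2 *h f3))) (kap_kl_r g1 g2 g3) // kap_str (f1 *h (f2 *h f3)) (kh g1 (kh g2 g3)))).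
Proof.
  assert (HT1 : is_sq (tric f2 g2 f3 g3) (kh (trih f2 g2) (trih f3 g3)) (trih (f2 *h f3) (kh g2 g3)) (vid _) (fv F (vid _))) by bd.
  assert (HT2 : is_sq (sid (trih f1 g1)) (trih f1 g1) (trih f1 g1) (vid _) (fv F (vid _))) by bd.
  assert (HT3 := ks_ty HT2 HT1). assert (HL := kap_kl_l_ty (trih f1 g1) (trih f2 g2) (trih f3 g3)).
  unfold kap_tri3. asr. 
  rewrite <- (sv_assoc HX (a := kap_kl_l _ _ _)), kasc_char by bd. unfold kap_kl_r at 1. asr.
  rewrite (sv_rew2 HX (kap_kl_nat HT2 HT1)) by bd. asr.
  vr (ich HX). vr (ich HX). rewrite (sid_sv HX), !(sv_sid HX) by bd.
  rewrite kap_strT_fc.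
  rewrite <- (sid_sv HX (a := kap_str f1 g1) (f := bh B f1 g1)) at 1 by bd.
  rewrite <- (ich HX) by bd.
  rewrite <- (sid_sv HX (a := kap_str f1 g1) (f := bh B f1 g1)) at 1 by bd.
  rewrite <- (ich HX) by bd. asr. rewrite kap_strT_tric. rewrite <- (bs_sid HB).
  rewrite <- (sv_assoc HX (a := _ || bs B _ (fc F _ _ // _))) by bd.
  erewrite (bc_sq HB) by bd. asr. rewrite <- (sid_hc HX).
  do 2 f_equal. rewrite <- (sv_assoc HX) by bd. f_equal. now rewrite <- bs_sidl_sv by bd.
Qed.
Lemma bc_asc_id A1 A2 A3 A4 C1 C2 C3 C4 (f1 : hor A1 A2) (g1 : hor C1 C2)
    (f2 : hor A2 A3) (g2 : hor C2 C3) (f3 : hor A3 A4) (g3 : hor C3 C4) :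
  (bc B f1 g1 f2 g2 || sid (bh B f3 g3)) // bc B (f1 *h f2) (g1 *h g2) f3 g3
  = (sid (bh B f1 g1) || bc B f2 g2 f3 g3) // bc B f1 g1 (f2 *h f3) (g2 *h g3).
Proof.
  assert (E := bc_asc HB f1 f2 f3 g1 g2 g3).
  rewrite !(asc_id SX), (bs_sid HB), (sv_sid HX), (sid_sv HX) in E by bd. exact E.
Qed.
Lemma ks_giso A C D (a : sq A (tT C) A (tT C)) (b : sq C (tT D) C (tT D)) f f' g g' :
  is_giso a f f' -> is_giso b g g' -> is_giso (ks a b (vid D)) (kh f g) (kh f' g').
Proof.
  intros Ha Hb. assert (H := fs_giso HF Hb). unfold ks, kh. rewrite mu_u_vid.
  repeat apply (giso_sh HX); trivial. apply (giso_sid HX).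
Qed.
Lemma kap_tri3_ty A1 A2 A3 A4 C1 C2 C3 C4 (f1 : hor A1 A2) (g1 : hor C1 (tT C2))
    (f2 : hor A2 A3) (g2 : hor C2 (tT C3)) (f3 : hor A3 A4) (g3 : hor C3 (tT C4)) :
  exists x r, is_sq (kap_tri3 f1 g1 f2 g2 f3 g3) x (kh (kh (trih f1 g1) (trih f2 g2)) (trih f3 g3)) (vid _) r.
Proof.
  assert (HL := kap_kl_l_ty (trih f1 g1) (trih f2 g2) (trih f3 g3)).
  do 2 eexists. unfold kap_tri3. bd.
Qed.
Lemma kap_tri3_epi A1 A2 A3 A4 C1 C2 C3 C4 E E' (f1 : hor A1 A2) (g1 : hor C1 (tT C2))
    (f2 : hor A2 A3) (g2 : hor C2 (tT C3)) (f3 : hor A3 A4) (g3 : hor C3 (tT C4))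
    (s s' : sq (A1 ⊗ C1) (tT (A4 ⊗ C4)) E E') x x' l l' r :
  is_sq s (kh (kh (trih f1 g1) (trih f2 g2)) (trih f3 g3)) x l r ->
  is_sq s' (kh (kh (trih f1 g1) (trih f2 g2)) (trih f3 g3)) x' l' r ->
  kap_tri3 f1 g1 f2 g2 f3 g3 // s = kap_tri3 f1 g1 f2 g2 f3 g3 // s' -> s = s'.
Proof.
  intros Hs Hs' Eq.
  assert (G1 := ks_giso (tric_giso f1 g1 f2 g2) (giso_sid HX (trih f3 g3))).
  assert (G2 := giso_sv HX G1 (tric_giso (f1 *h f2) (kh g1 g2) f3 g3)).
  assert (EW := kap_tri3_l f1 g1 f2 g2 f3 g3).
  destruct (kap_tri3_ty f1 g1 f2 g2 f3 g3) as (y & z & HW).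
  (* [i] combines two compositors of the action and is invertible. By [kap_tri3_l], [kap_tri3 // i]
     is a composite of invertible and epic cells, so [kap_tri3] is epic as well. *)
  set (i := ks _ _ _ // _) in *.
  assert (HkL := bs_kL_ty (f1 *h f2 *h f3) g1 g2 g3).
  assert (HK := kap_str_ty (f1 *h f2 *h f3) (kh (kh g1 g2) g3)).
  assert (Ei : forall (s : sq (A1 ⊗ C1) (tT (A4 ⊗ C4)) E E') x l,
    is_sq s (kh (kh (trih f1 g1) (trih f2 g2)) (trih f3 g3)) x l r -> i // (ginv i // s) = s).
  { intros. rewrite <- (sv_assoc HX) by bd. erewrite giso_r by gi. apply (sid_sv HX); bd. }
  rewrite <- (Ei s _ _ Hs), <- (Ei s' _ _ Hs') in Eq.
  rewrite <- !(sv_assoc HX (b := i)), EW, !(sv_assoc HX) in Eq by bd.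
  eapply (giso_epi HX (giso_sh HX (bc_ty HB f1 g1 f2 (fh F g2)) (giso_sid HX (bh B f3 (fh F (fh F g3)))))) in Eq; [| bd ..].
  eapply (giso_epi HX (bc_ty HB (f1 *h f2) (g1 *h fh F g2) f3 (fh F (fh F g3)))) in Eq; [| bd ..].
  eapply bs_kL_epi in Eq; [| bd | bd].
  eapply (kap_epi HX SX (ct_ok A4 C4) (p := bh B (f1 *h f2 *h f3) (kh (kh g1 g2) g3))) in Eq; [| bd | bd].
  now rewrite <- (Ei s _ _ Hs), Eq, (Ei s' _ _ Hs').
Qed.
(** Behind [kap_tri3] the two sides are computed by [kap_tri3_l] and [kap_tri3_r]; their difference
    is settled by associativity of the compositor of [⊗] and by [kasc_char] in the second
    variable. *)
Lemma tric_asc A1 A2 A3 A4 C1 C2 C3 C4 (f1 : hor A1 A2) (g1 : hor C1 (tT C2))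
    (f2 : hor A2 A3) (g2 : hor C2 (tT C3)) (f3 : hor A3 A4) (g3 : hor C3 (tT C4)) :
  ks (tric f1 g1 f2 g2) (sid (trih f3 g3)) (vid _) // tric (f1 *h f2) (kh g1 g2) f3 g3
    // tris (sid (f1 *h f2 *h f3)) (kasc g1 g2 g3) (vid _) (vid _)
  = kasc (trih f1 g1) (trih f2 g2) (trih f3 g3)
    // ks (sid (trih f1 g1)) (tric f2 g2 f3 g3) (vid _) // tric f1 g1 (f2 *h f3) (kh g2 g3).
Proof.
  assert (HT1 : is_sq (tric f2 g2 f3 g3) (kh (trih f2 g2) (trih f3 g3)) (trih (f2 *h f3) (kh g2 g3)) (vid _) (fv F (vid _))) by bd.
  assert (HT2 : is_sq (sid (trih f1 g1)) (trih f1 g1) (trih f1 g1) (vid _) (fv F (vid _))) by bd.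
  assert (HT3 := ks_ty HT2 HT1).
  assert (HU1 : is_sq (tric f1 g1 f2 g2) (kh (trih f1 g1) (trih f2 g2)) (trih (f1 *h f2) (kh g1 g2)) (vid _) (fv F (vid _))) by bd.
  assert (HU2 : is_sq (sid (trih f3 g3)) (trih f3 g3) (trih f3 g3) (vid _) (fv F (vid _))) by bd.
  assert (HU3 := ks_ty HU1 HU2).
  assert (T4 : is_sq (kasc g1 g2 g3) (kh (kh g1 g2) g3) (kh g1 (kh g2 g3)) (vid _) (fv F (vid _))) by bd.
  assert (T5 := tris_ty (sid_ty HX (f1 *h f2 *h f3)) T4).
  destruct (kap_tri3_ty f1 g1 f2 g2 f3 g3) as (y & z & HW).
  eapply kap_tri3_epi; [bd | bd |]. asr. rewrite kap_tri3_r.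
  rewrite <- (sv_assoc HX (b := tric _ _ _ _)) by bd.
  rewrite (sv_rew2 HX (kap_tri3_l f1 g1 f2 g2 f3 g3)) by bd.
  assert (HL0 := kap_kl_l_ty g1 g2 g3). assert (HR0 := kap_kl_r_ty g1 g2 g3).
  assert (HkL := bs_kL_ty (f1 *h f2 *h f3) g1 g2 g3).
  asr. rewrite (kap_str_nat (sid_ty HX (f1 *h f2 *h f3)) T4).
  rewrite <- (sv_assoc HX (a := bs B _ (kap_kl_l _ _ _))), <- bs_sidl_sv, kasc_char by (first [assumption | bd]).
  rewrite <- !(sv_assoc HX (a := _ || _)) by bd.
  rewrite bc_asc_id, (hc_assoc SX f1). reflexivity.
Qed.

(** * The action as a pseudodouble functor *)

Let Hth : is_htrans (f_str_src M T) (f_str_tgt M T) (str_hat ct) :=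
  lt_is_htrans HX Hct Lt HTS HTT (str_vtrans Ht) t_inv.
Lemma t_u_vid A C : t_u (vid A) (vid C) = sid (th1 A C).
Proof. exact (htv_vid Hth (A, C)). Qed.
Lemma t_u_vc A A' A'' C C' C'' (u : ver A A') (v : ver C C') (u' : ver A' A'') (v' : ver C' C'') :
  t_u (u *v u') (v *v v') = t_u u v // t_u u' v'.
Proof. exact (htv_vc Hth (A := (A, C)) (B := (A', C')) (C := (A'', C'')) (u, v) (u', v')). Qed.
Lemma tris_sid A A' C C' (f : hor A A') (g : hor C (tT C')) :
  tris (sid f) (sid g) (vid A') (vid C') = sid (trih f g).
Proof. unfold tris. now rewrite t_u_vid, (bs_sid HB), (sid_hc HX). Qed.
Lemma tris_sv A1 A2 A3 A4 A5 A6 C1 C2 C3 C4 C5 C6 (s : sq A1 A2 A3 A4) (d : sq C1 (tT C2) C3 (tT C4))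
    (s' : sq A3 A4 A5 A6) (d' : sq C3 (tT C4) C5 (tT C6)) u v u' v' f f' f'' g g' g'' w x w' x' :
  is_sq s f f' w u -> is_sq d g g' x (fv F v) -> is_sq s' f' f'' w' u' -> is_sq d' g' g'' x' (fv F v') ->
  tris (s // s') (d // d') (u *v u') (v *v v') = tris s d u v // tris s' d' u' v'.
Proof.
  intros H1 H2 H3 H4. unfold tris. rewrite t_u_vc, (bs_sv HB), (ich HX); bd.
Qed.
Let Tri := act_tri cmu ceta ct.
Lemma kl_sq_wf A C D E (s : @sq (kl S) A C D E) : wf s ->
  exists f g u, is_sq (fst s) f g u (fv F (snd s)).
Proof.
  intros [H1 H2]. exists (top (fst s)), (bot (fst s)), (lft (fst s)).
  change (rgt (fst s) = fv F (snd s)) in H2. rewrite <- H2. repeat split; trivial.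
Qed.
Lemma fs_tri A1 A2 A3 A4 C1 C2 C3 C4 (s : sq A1 A2 A3 A4) (d : sq C1 (tT C2) C3 (tT C4)) u v :
  rgt s = u -> @bs X (kl S) (kl S) _ Tri A1 A2 A3 A4 C1 C2 C3 C4 s (d, v) = (tris s d u v, bv B u v).
Proof. intros <-. reflexivity. Qed.
Lemma fs_tri_pair A1 A2 A3 A4 C1 C2 C3 C4 (s : sq A1 A2 A3 A4) (d : sq C1 (tT C2) C3 (tT C4)) u v :
  rgt s = u -> @fs (dbl_prod X (kl S)) (kl S) _ Tri (A1, C1) (A2, C2) (A3, C3) (A4, C4) (s, (d, v))
    = (tris s d u v, bv B u v).
Proof. intros <-. reflexivity. Qed.
Theorem tri_functor_ok : is_functor Tri.
Proof.
  split.
  - intros [A C]. exact (bv_vid HB A C).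
  - intros [A1 C1] [A2 C2] [A3 C3] [u v] [u' v']. exact (bv_vc HB u u' v v').
  - intros [A1 C1] [A2 C2] [A3 C3] [A4 C4] [s [d v0]] [f f'] [g g'] [u u'] [w w'] H.
    assert (H1 := is_sq_fst H). assert (H2 := kl_sq_inv (is_sq_snd H)). cbn in H1, H2.
    destruct H2 as [H2 <-]. 
    refine (eq_ind_r (fun z => is_sq z _ _ _ _) _ (fs_tri_pair d v0 (rgt_of H1))).
    exact (kl_sq (s := (_, _)) (tris_ty H1 H2) eq_refl).
  - intros [A C] [A' C'] [f g]. refine (eq_trans (fs_tri _ _ (rgt_of (sid_ty HX f))) _).
    cbn. now rewrite tris_sid, (bv_vid HB).
  - intros [A1 C1] [A2 C2] [A3 C3] [A4 C4] [A5 C5] [A6 C6] [s [d v]] [s' [d' v']] [H1 H2] [H1' H2'] E.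
    destruct (wf_sq H1) as (f & f' & u & w & Hs), (wf_sq H1') as (f1 & f'' & u' & w' & Hs').
    destruct (kl_sq_wf H2) as (g & g' & x & Hd), (kl_sq_wf H2') as (g1 & g'' & x' & Hd').
    injection E as E1 E2. cbn in *. 
    rewrite (bot_of Hs), (top_of Hs') in E1. rewrite (bot_of Hd), (top_of Hd') in E2. subst f1 g1.
    change ((tris (s // s') (d // d') (rgt (s // s')) (v *v v'), bv B (rgt (s // s')) (v *v v'))
      = (tris s d (rgt s) v // tris s' d' (rgt s') v', bv B (rgt s) v *v bv B (rgt s') v')).
    assert (R : rgt (s // s') = w *v w') by bd. rewrite R, (rgt_of Hs), (rgt_of Hs').
    erewrite tris_sv by eassumption. now rewrite (bv_vc HB).
  - intros [A1 C1] [A2 C2] [A3 C3] [f f'] [g g']. exact (kl_giso (tric_giso f f' g g')).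
  - intros [A C]. refine (kl_giso (a := ginv (zh A C)) _). exact (giso_inv (zh_ty A C)).
  - intros [A1 C1] [A2 C2] [A3 C3] [A4 C4] [A5 C5] [A6 C6] [s [d v]] [s' [d' v']] [H1 H2] [H1' H2'] E.
    destruct (wf_sq H1) as (f & f' & u & w & Hs), (wf_sq H1') as (f1 & f1' & u' & w' & Hs').
    destruct (kl_sq_wf H2) as (g & g' & x & Hd), (kl_sq_wf H2') as (g1 & g1' & x' & Hd').
    injection E as E1 E2. cbn in *.
    rewrite (rgt_of Hs), (lft_of Hs') in E1. rewrite (lft_of Hd') in E2. subst u' x'.
    change ((ks (tris s d (rgt s) v) (tris s' d' (rgt s') v') (bv B (rgt s') v')
        // tric (bot s) (bot d) (bot s') (bot d'), bv B (rgt s') v' *v vid _)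
      = (tric (top s) (top d) (top s') (top d') // tris (s || s') (ks d d' v') (rgt (s || s')) v',
        vid _ *v bv B (rgt (s || s')) v')).
    rewrite (top_of Hs), (top_of Hs'), (bot_of Hs), (bot_of Hs'), (rgt_of Hs), (rgt_of Hs').
    rewrite (top_of Hd), (top_of Hd'), (bot_of Hd), (bot_of Hd').
    assert (R : rgt (s || s') = w') by bd. rewrite R.
    f_equal; [|cells ..]. exact (tric_nat Hs Hd Hs' Hd').
  - intros [A C] [A' C'] [u v].
    change ((eta_u (bv B u v) // ginv (zh A' C'), bv B u v *v vid _)
      = (ginv (zh A C) // tris (sidv u) (eta_u v) (rgt (sidv u)) v, vid _ *v bv B (rgt (sidv u)) v)).
    rewrite (rgt_of (sidv_ty HX u)). f_equal; [|cells ..]. exact (zh_nat u v).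
  - intros [A1 C1] [A2 C2] [A3 C3] [A4 C4] [f1 g1] [f2 g2] [f3 g3].
    change ((ks (tric f1 g1 f2 g2) (sid (trih f3 g3)) (vid _) // tric (f1 *h f2) (kh g1 g2) f3 g3
        // tris (asc f1 f2 f3) (kasc g1 g2 g3) (rgt (asc f1 f2 f3)) (vid _),
        vid _ *v vid _ *v bv B (rgt (asc f1 f2 f3)) (vid _))
      = (kasc (trih f1 g1) (trih f2 g2) (trih f3 g3)
        // ks (sid (trih f1 g1)) (tric f2 g2 f3 g3) (vid _) // tric f1 g1 (f2 *h f3) (kh g2 g3),
        vid (A4 ⊗ C4) *v vid _ *v vid _)).
    rewrite (asc_id SX), (rgt_of (sid_ty HX _)). f_equal; [|cells ..]. apply tric_asc.
  - intros [A1 C1] [A2 C2] [f g].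
    change ((ks (ginv (zh A1 C1)) (sid (trih f g)) (vid _) // tric (hid A1) (etah C1) f g
        // tris (lun f) (klun g) (rgt (lun f)) (vid _),
        vid _ *v vid _ *v bv B (rgt (lun f)) (vid _)) = (klun (trih f g), vid (A2 ⊗ C2))).
    rewrite (lun_id SX), (rgt_of (sid_ty HX _)). f_equal; [|cells ..]. apply tric_lun.
  - intros [A1 C1] [A2 C2] [f g].
    change ((ks (sid (trih f g)) (ginv (zh A2 C2)) (vid _) // tric f g (hid A2) (etah C2)
        // tris (run f) (krun g) (rgt (run f)) (vid _),
        vid _ *v vid _ *v bv B (rgt (run f)) (vid _)) = (krun (trih f g), vid (A2 ⊗ C2))).
    rewrite (run_id SX), (rgt_of (sid_ty HX _)). f_equal; [|cells ..]. apply tric_run.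
Qed.

(** * The associator of the action *)

Definition alv A C D : ver ((A ⊗ C) ⊗ D) (A ⊗ (C ⊗ D)) := vt1 (al M) (A, C, D).
Definition alss A A' C C' D D' (f : hor A A') (g : hor C C') (h : hor D D')
    : sq ((A ⊗ C) ⊗ D) ((A' ⊗ C') ⊗ D') (A ⊗ (C ⊗ D)) (A' ⊗ (C' ⊗ D')) := als M f g h.
Definition ys A C D : sq ((A ⊗ C) ⊗ tT D) (tT ((A ⊗ C) ⊗ D)) (A ⊗ (C ⊗ tT D)) (tT (A ⊗ (C ⊗ D))) :=
  y_star ct A C D.
Definition tri_al A A' C C' D D' (f : hor A A') (g : hor C C') (h : hor D (tT D'))
    : sq ((A ⊗ C) ⊗ D) (tT ((A' ⊗ C') ⊗ D')) (A ⊗ (C ⊗ D)) (tT (A' ⊗ (C' ⊗ D'))) :=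
  act_als ct f g h.
Lemma alss_ty A A' C C' D D' (f : hor A A') (g : hor C C') (h : hor D D') :
  is_sq (alss f g h) (bh B (bh B f g) h) (bh B f (bh B g h)) (alv A C D) (alv A' C' D').
Proof. exact (vts_ty (al_vtrans HM) (A := (A, C, D)) (B := (A', C', D')) (f, g, h)). Qed.
Hint Resolve alss_ty : sqty.
Lemma ver_y A C D : alv A C (tT D) *v (bv B (vid A) (tv1 C D) *v tv1 A (C ⊗ D))
  = tv1 (A ⊗ C) D *v fv F (alv A C D).
Proof. rewrite <- (vc_assoc HX). exact (str_y Ht A C D). Qed.
Hint Resolve ver_y : cells.
Hint Extern 2 (_ = _ :> ver _ _) => symmetry; apply ver_y : cells.
Definition cBt A C D : companion (bv B (vid A) (tv1 C D)) := c_bifun B (c_id A) (ct' C D).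
Lemma cBt_ok A C D : is_companion (cBt A C D). Proof. unfold cBt. cok. Qed.
Hint Resolve cBt_ok : comp.
Definition cy A C D := c_comp (cBt A C D) (ct' A (C ⊗ D)).
Lemma cy_ok A C D : is_companion (cy A C D). Proof. unfold cy. cok. Qed.
Hint Resolve cy_ok : comp.
Lemma ys_ty A C D : is_sq (ys A C D) (th1 (A ⊗ C) D) (bh B (hid A) (th1 C D) *h th1 A (C ⊗ D))
  (alv A C (tT D)) (fv F (alv A C D)).
Proof. exact (lift_sq_ty HX (cy_ok A C D) (ct_ok (A ⊗ C) D) (ver_y A C D)). Qed.
Hint Resolve ys_ty : sqty.
Lemma ys_ciot A C D :
  ciot (ct' (A ⊗ C) D) // ys A C D = sidv (alv A C (tT D)) // ciot (cy A C D).
Proof. exact (lift_sq_ciot HX (cy_ok A C D) (ct_ok (A ⊗ C) D) (ver_y A C D)). Qed.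
Lemma kBt_bc A A' C C' D (f : hor A A') (g : hor C (C' ⊗ tT D)) :
  kap (bh B f g) (cBt A' C' D) // bc B f g (hid A') (th1 C' D) = bs B (sid f) (kap g (ct' C' D)).
Proof. rewrite <- (kap_id HX SX f). apply kap_bifun; cok. Qed.
Lemma kBt_ty A A' C D (p : hor A (A' ⊗ (C ⊗ tT D))) :
  is_sq (kap p (cBt A' C D)) p (p *h bh B (hid A') (th1 C D)) (vid A) (bv B (vid A') (tv1 C D)).
Proof. exact (kap_ty HX SX p (cBt_ok A' C D)). Qed.
Hint Resolve kBt_ty : sqty.
Lemma tri_al_ty A A' C C' D D' (f : hor A A') (g : hor C C') (h : hor D (tT D')) :
  is_sq (tri_al f g h) (trih (bh B f g) h) (trih f (trih g h)) (alv A C D) (fv F (alv A' C' D')).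
Proof.
  change (tri_al f g h) with ((alss f g h || ys A' C' D')
    // (bc B f (bh B g h) (hid A') (th1 C' D') || sid (th1 A' (C' ⊗ D')))). bd.
Qed.
Hint Resolve tri_al_ty : sqty.
(** The square [ys] lifts [str_y], so it disappears behind the opcartesian cell and leaves the cell
    of a composite companion. The compositor closing [act_als] turns the inner half of it into
    [f ⊗ kap_str g h]. *)
Lemma tri_al_char A A' C C' D D' (f : hor A A') (g : hor C C') (h : hor D (tT D')) :
  kap_str (bh B f g) h // tri_al f g h = alss f g h // (bs B (sid f) (kap_str g h) // kap_str f (trih g h)).
Proof.
  change (tri_al f g h) with ((alss f g h || ys A' C' D')
    // (bc B f (bh B g h) (hid A') (th1 C' D') || sid (th1 A' (C' ⊗ D')))).
  assert (E : kap_str (bh B f g) h // (alss f g h || ys A' C' D')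
    = alss f g h // kap (bh B f (bh B g h)) (cy A' C' D')).
  { eapply (kap_nat HX SX); [cok | cok | bd | exact (ys_ty A' C' D') | apply ys_ciot]. }
  rewrite (sv_rew2 HX E) by bd.
  unfold cy. rewrite <- (kap_comp HX SX) by cok. change (ch (cBt A' C' D')) with (bh B (hid A') (th1 C' D')).
  asr. vr kct_sid. vr kBt_bc. rewrite (hc_idr SX). reflexivity.
Qed.
Lemma alss_nat A A' C C' D D' A1 A1' C1 C1' D1 D1' (a : sq A A' A1 A1') (c : sq C C' C1 C1')
    (d : sq D D' D1 D1') f f' g g' h h' u u' v v' w w' :
  is_sq a f f' u u' -> is_sq c g g' v v' -> is_sq d h h' w w' ->
  bs B (bs B a c) d // alss f' g' h' = alss f g h // bs B a (bs B c d).
Proof.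
  intros Ha Hc Hd.
  assert (H := sq_pair (sq_pair Ha Hc) Hd).
  assert (E := vts_nat (al_vtrans HM) (wf_of H)). rewrite (top_of H), (bot_of H) in E. exact E.
Qed.

Lemma al_nat A A' C C' D D' (u : ver A A') (v : ver C C') (w : ver D D') :
  bv B (bv B u v) w *v alv A' C' D' = alv A C D *v bv B u (bv B v w).
Proof. exact (vt1_nat (al_vtrans HM) (A := (A, C, D)) (B := (A', C', D')) (u, v, w)). Qed.
Lemma Fal_nat A A' C C' D D' (u : ver A A') (v : ver C C') (w : ver D D') :
  fv F (bv B (bv B u v) w) *v fv F (alv A' C' D') = fv F (alv A C D) *v fv F (bv B u (bv B v w)).
Proof. rewrite <- !(fv_vc HF). now rewrite al_nat. Qed.
Hint Resolve al_nat Fal_nat : cells.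
Hint Extern 2 (_ = _ :> ver _ _) => symmetry; solve [apply al_nat | apply Fal_nat] : cells.
Lemma tri_al_nat A A' C C' D D' A1 A1' C1 C1' D1 D1' (a : sq A A' A1 A1') (c : sq C C' C1 C1')
    (d : sq D (tT D') D1 (tT D1')) f f' g g' h h' u u' v v' w w' :
  is_sq a f f' u u' -> is_sq c g g' v v' -> is_sq d h h' w (fv F w') ->
  tris (bs B a c) d (bv B u' v') w' // tri_al f' g' h' = tri_al f g h // tris a (tris c d v' w') u' (bv B v' w').
Proof.
  intros Ha Hc Hd. assert (T1 := bs_ty HB Ha Hc). assert (T2 := tris_ty T1 Hd).
  assert (T3 := tris_ty Hc Hd). assert (T4 := tris_ty Ha T3).
  eapply (kap_epi HX SX (ct_ok (A' ⊗ C') D') (p := bh B (bh B f g) h)); [bd | bd |].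
  fold (kap_str (bh B f g) h). rewrite <- !(sv_assoc HX) by bd. rewrite (kap_str_nat T1 Hd), tri_al_char.
  asr. rewrite tri_al_char. rewrite (kap_str_nat Ha T3).
  rewrite <- !(sv_assoc HX (c := kap_str _ _)) by bd. f_equal.
  rewrite <- (sv_assoc HX), (alss_nat Ha Hc Hd) by bd. asr. f_equal.
  rewrite <- !(bs_sv HB), (kap_str_nat Hc Hd) by bd.
  rewrite (sid_sv HX), (sv_sid HX) by bd. reflexivity.
Qed.
Lemma alss_hc A A' A'' C C' C'' D D' D'' (f : hor A A') (g : hor C C') (h : hor D D')
    (f' : hor A' A'') (g' : hor C' C'') (h' : hor D' D'') :
  bc B (bh B f g) h (bh B f' g') h' // (bs B (bc B f g f' g') (sid (h *h h'))
    // alss (f *h f') (g *h g') (h *h h'))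
  = (alss f g h || alss f' g' h') // (bc B f (bh B g h) f' (bh B g' h')
    // bs B (sid (f *h f')) (bc B g h g' h')).
Proof.
  assert (E := vts_hc (al_vtrans HM) (A := (A, C, D)) (B := (A', C', D')) (C := (A'', C'', D''))
    (f, g, h) (f', g', h')).
  change ((bc B (bh B f g) h (bh B f' g') h' // bs B (bc B f g f' g'
      // bs B (sid (f *h f') // sid (f *h f')) (sid (g *h g') // sid (g *h g'))) (sid (h *h h')))
      // alss (f *h f') (g *h g') (h *h h')
    = (alss f g h || alss f' g' h') // (bc B f (bh B g h) f' (bh B g' h')
    // bs B (sid (f *h f') // sid (f *h f')) (bc B g h g' h'
      // bs B (sid (g *h g') // sid (g *h g')) (sid (h *h h'))))) in E.
  rewrite !(sv_sid HX (a := sid _)) in E by bd.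
  rewrite !(bs_sid HB), !(sv_sid HX), (sv_assoc HX) in E by bd. exact E.
Qed.
Lemma alss_hid A C D :
  sidv (alv A C D) // (bu B A (C ⊗ D) // bs B (sid (hid A)) (bu B C D))
  = bu B (A ⊗ C) D // (bs B (bu B A C) (sid (hid D)) // alss (hid A) (hid C) (hid D)).
Proof.
  assert (E := vts_hid (al_vtrans HM) (A, C, D)).
  change ((bu B (A ⊗ C) D // bs B (bu B A C
      // bs B (sid (hid A) // sid (hid A)) (sid (hid C) // sid (hid C))) (sid (hid D)))
     // alss (hid A) (hid C) (hid D)
    = sidv (alv A C D) // (bu B A (C ⊗ D) // bs B (sid (hid A) // sid (hid A))
       (bu B C D // bs B (sid (hid C) // sid (hid C)) (sid (hid D))))) in E.
  rewrite !(sv_sid HX (a := sid _)) in E by bd.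
  rewrite !(bs_sid HB), !(sv_sid HX), (sv_assoc HX) in E by bd. symmetry. exact E.
Qed.
Lemma tss_y A A' C C' D D' (f : hor A A') (g : hor C C') (h : hor D D') :
  alss f g (fh F h) // (bs B (sid f) (tss g h) // tss f (bh B g h))
  = tss (bh B f g) h // fs F (alss f g h).
Proof. rewrite <- (sv_assoc HX) by bd. exact (str_ys Ht f g h). Qed.
Lemma kap_strT_tri_al A A' C C' D D' (f : hor A A') (g : hor C C') (h : hor D (tT D')) :
  kap_strT (bh B f g) h // fs F (tri_al f g h)
  = alss f g (fh F h) // (bs B (sid f) (kap_strT g h) // kap_strT f (trih g h)).
Proof.
  unfold kap_strT. asr. rewrite <- (fs_sv HF), tri_al_char, !(fs_sv HF) by bd.
  rewrite <- (sv_assoc HX (a := tss _ _)), <- tss_y by bd. asr.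
  rewrite bs_sidl_sv by bd. asr. do 2 f_equal.
  rewrite <- !(sv_assoc HX) by bd. f_equal. symmetry. eapply tss_nat; bd.
Qed.
Lemma tri_al_hc A A' A'' C C' C'' D D' D'' (f : hor A A') (g : hor C C') (h : hor D (tT D'))
    (f' : hor A' A'') (g' : hor C' C'') (h' : hor D' (tT D'')) :
  tric (bh B f g) h (bh B f' g') h' // (tris (bc B f g f' g') (sid (kh h h')) (vid _) (vid _)
    // tri_al (f *h f') (g *h g') (kh h h'))
  = ks (tri_al f g h) (tri_al f' g' h') (alv A'' C'' D'') // (tric f (trih g h) f' (trih g' h')
    // tris (sid (f *h f')) (tric g h g' h') (vid _) (vid _)).
Proof.
  assert (T1 := tri_al_ty f g h). assert (T2 := tri_al_ty f' g' h'). assert (T3 := ks_ty T1 T2).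
  assert (T4 : is_sq (sid (kh h h')) (kh h h') (kh h h') (vid D) (fv F (vid D''))) by bd.
  assert (T4' : is_sq (bc B f g f' g') (bh B f g *h bh B f' g') (bh B (f *h f') (g *h g')) (vid _) (vid _)) by bd.
  assert (T5 := tris_ty T4' T4).
  assert (T6 : is_sq (tric g h g' h') (kh (trih g h) (trih g' h')) (trih (g *h g') (kh h h')) (vid _) (fv F (vid _))) by bd.
  assert (T7 := tris_ty (sid_ty HX (f *h f')) T6).
  assert (HP := kap_tri_ty (bh B f g) h (bh B f' g') h').
  eapply kap_tri_epi; [bd | bd |].
  (* The common value: associators first, then compositors of [⊗] at both levels, then the collapse
     of [h] and [h'] under two tensors, followed by the strengths. *)
  transitivity ((alss f g h || alss f' g' (fh F h')) // (bc B f (bh B g h) f' (bh B g' (fh F h'))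
    // (bs B (sid (f *h f')) (bc B g h g' (fh F h') // (bs B (sid (g *h g')) (kap_kl h h')
       // kap_str (g *h g') (kh h h'))) // kap_str (f *h f') (trih (g *h g') (kh h h'))))).
  - rewrite <- (sv_assoc HX), tric_char by bd. asr.
    rewrite <- (sv_assoc HX (a := kap_str _ _)), (kap_str_nat T4' T4) by bd. asr. rewrite tri_al_char.
    assert (E1 : bs B (sid (bh B f g *h bh B f' g')) (kap_kl h h')
        // (bs B (bc B f g f' g') (sid (kh h h')) // alss (f *h f') (g *h g') (kh h h'))
      = bs B (bc B f g f' g') (sid (h *h fh F h')) // (alss (f *h f') (g *h g') (h *h fh F h')
        // bs B (sid (f *h f')) (bs B (sid (g *h g')) (kap_kl h h')))).
    { assert (HK := kap_kl_ty h h').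
      rewrite <- (alss_nat (sid_ty HX (f *h f')) (sid_ty HX (g *h g')) HK).
      rewrite <- !(sv_assoc HX), <- !(bs_sv HB), (bs_sid HB) by bd.
      now rewrite !(sid_sv HX), !(sv_sid HX) by bd. }
    rewrite (sv_rew3 HX E1) by bd. asr.
    rewrite (sv_rew3 HX (alss_hc f g h f' g' (fh F h'))) by bd. asr. do 2 f_equal.
    rewrite !bs_sidl_sv by bd. asr. reflexivity.
  - unfold kap_tri. fold (kap_strT (bh B f' g') h'). asr. rewrite (sv_rew2 HX (kap_kl_nat T1 T2)) by bd. asr.
    vr (ich HX). rewrite tri_al_char, kap_strT_tri_al.
    rewrite <- (ich HX) by bd. rewrite <- (ich HX) by bd. asr.
    rewrite <- (sv_assoc HX (b := tric _ _ _ _)) by bd.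
    rewrite <- (sv_assoc HX (b := kap_kl _ _ // tric _ _ _ _)), kap_strT_tric by bd. asr.
    rewrite (kap_str_nat (sid_ty HX (f *h f')) T6).
    rewrite <- (sv_assoc HX (a := bs B _ _ || _)) by bd. erewrite (bc_sq HB) by bd. asr.
    rewrite <- (sid_hc HX). do 2 f_equal.
    rewrite <- !(sv_assoc HX (c := kap_str _ _)) by bd. f_equal.
    rewrite <- !bs_sidl_sv by bd. f_equal. asr. now rewrite kap_strT_tric.
Qed.

Lemma tri_al_hid A C D :
  ginv (zh (A ⊗ C) D) // (tris (bu B A C) (sid (etah D)) (vid _) (vid _) // tri_al (hid A) (hid C) (etah D))
  = eta_u (alv A C D) // (ginv (zh A (C ⊗ D)) // tris (sid (hid A)) (ginv (zh C D)) (vid _) (vid _)).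
Proof.
  assert (H1 := eta_u_ty (alv A C D)).
  assert (T1 : is_sq (bu B A C) (hid _) (bh B (hid A) (hid C)) (vid _) (vid _)) by bd.
  assert (T2 : is_sq (sid (etah D)) (etah D) (etah D) (vid _) (fv F (vid D))) by bd.
  assert (T3 := tris_ty T1 T2).
  assert (T4 : is_sq (ginv (zh C D)) (etah (C ⊗ D)) (trih (hid C) (etah D)) (vid _) (fv F (vid _))) by bd.
  assert (T5 := tris_ty (sid_ty HX (hid A)) T4).
  eapply ieta_epi; [bd | bd |].
  rewrite <- !(sv_assoc HX (a := ciot _)) by bd. rewrite ieta_u, zh_char. asr.
  rewrite (sv_rew2 HX (zh_char A (C ⊗ D))) by bd. asr.
  rewrite <- (sv_assoc HX (a := kap_str _ _) (c := tri_al _ _ _)), (kap_str_nat T1 T2) by bd. asr. rewrite tri_al_char.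
  rewrite (kap_str_nat (sid_ty HX (hid A)) T4).
  rewrite <- (sv_assoc HX (a := bs B _ _) (c := kap_str (hid A) _)), <- bs_sidl_sv, zh_char by bd.
  assert (E1 : bs B (sid (hid (A ⊗ C))) (ciot (ceta' D)) // (bs B (bu B A C) (sid (etah D))
      // alss (hid A) (hid C) (etah D))
    = bs B (bu B A C) (sid (hid D)) // (alss (hid A) (hid C) (hid D)
      // bs B (sid (hid A)) (bs B (sid (hid C)) (ciot (ceta' D))))).
  { assert (HK := ieta_ty D).
    rewrite <- (alss_nat (sid_ty HX (hid A)) (sid_ty HX (hid C)) HK).
    rewrite <- !(sv_assoc HX), <- !(bs_sv HB), (bs_sid HB) by bd.
    now rewrite !(sid_sv HX), !(sv_sid HX) by bd. }
  rewrite (sv_rew3 HX E1) by bd. asr.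
  rewrite (sv_rew3 HX (eq_sym (alss_hid A C D))) by bd. asr. do 2 f_equal.
  rewrite !bs_sidl_sv by bd. asr. reflexivity.
Qed.
Lemma al_p A C D E : alv (A ⊗ C) D E *v alv A C (D ⊗ E)
  = bv B (alv A C D) (vid E) *v (alv A (C ⊗ D) E *v bv B (vid A) (alv C D E)).
Proof. rewrite <- (vc_assoc HX). exact (mon_p HM A C D E). Qed.
Lemma Fal_p A C D E : fv F (alv (A ⊗ C) D E) *v fv F (alv A C (D ⊗ E))
  = fv F (bv B (alv A C D) (vid E)) *v (fv F (alv A (C ⊗ D) E) *v fv F (bv B (vid A) (alv C D E))).
Proof. rewrite <- !(fv_vc HF). now rewrite al_p. Qed.
Hint Resolve al_p Fal_p : cells.
Hint Extern 2 (_ = _ :> ver _ _) => symmetry; solve [apply al_p | apply Fal_p] : cells.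
Lemma alss_p A A' C C' D D' E E' (f : hor A A') (g : hor C C') (h : hor D D') (k : hor E E') :
  alss (bh B f g) h k // alss f g (bh B h k)
  = bs B (alss f g h) (sid k) // (alss f (bh B g h) k // bs B (sid f) (alss g h k)).
Proof. rewrite <- (sv_assoc HX) by bd. exact (mon_ps HM f g h k). Qed.
(** Behind the opcartesian cell every [tri_al] becomes a component of the base associator, and the
    strict pentagon [alss_p] of 2-cells remains. *)
Lemma tri_al_p A A' C C' D D' E E' (f : hor A A') (g : hor C C') (h : hor D D') (k : hor E (tT E')) :
  tri_al (bh B f g) h k // tri_al f g (trih h k)
  = tris (alss f g h) (sid k) (alv A' C' D') (vid E') // (tri_al f (bh B g h) k
    // tris (sid f) (tri_al g h k) (vid _) (alv C' D' E')).
Proof.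
  assert (T0 : is_sq (sid k) k k (vid E) (fv F (vid E'))) by bd.
  assert (T1 := tris_ty (alss_ty f g h) T0).
  assert (T2 := tris_ty (sid_ty HX f) (tri_al_ty g h k)).
  eapply (kap_epi HX SX (ct_ok _ _) (p := bh B (bh B (bh B f g) h) k)); [bd | bd |].

  fold (kap_str (bh B (bh B f g) h) k).
  rewrite <- !(sv_assoc HX (a := kap_str _ _)) by bd. rewrite tri_al_char, (kap_str_nat (alss_ty f g h) T0). asr.
  rewrite tri_al_char. rewrite <- (sv_assoc HX (a := kap_str _ _) (b := tri_al _ _ _)) by bd.
  rewrite tri_al_char. asr. rewrite (kap_str_nat (sid_ty HX f) (tri_al_ty g h k)).
  rewrite <- (sv_assoc HX (a := bs B (sid f) (kap_str _ _))), <- bs_sidl_sv, tri_al_char by bd.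
  assert (E1 : bs B (sid (bh B f g)) (kap_str h k) // alss f g (trih h k)
    = alss f g (bh B h k) // bs B (sid f) (bs B (sid g) (kap_str h k))).
  { rewrite <- (bs_sid HB). exact (alss_nat (sid_ty HX f) (sid_ty HX g) (kap_str_ty h k)). }
  rewrite (sv_rew2 HX E1) by bd. asr. rewrite (sv_rew2 HX (alss_p f g h k)) by bd. asr.
  rewrite !bs_sidl_sv by bd. asr. reflexivity.
Qed.

(** * The left unitor of the action *)

Local Notation I := (I0 M).
Local Notation u1 := (unit_h (un M)).
Let HU := un_functor HM.
Definition lav A : ver (I ⊗ A) A := vt1 (la M) A.
Definition lass A A' (f : hor A A') : sq (I ⊗ A) (I ⊗ A') A A' := vts (la M) f.
Definition xs A : sq (I ⊗ tT A) (tT (I ⊗ A)) (tT A) (tT A) := x_star ct A.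
Definition tri_la A A' (h : hor A (tT A')) : sq (I ⊗ A) (tT (I ⊗ A')) A (tT A') := lass h || xs A'.
Lemma lass_ty A A' (f : hor A A') : is_sq (lass f) (bh B u1 f) f (lav A) (lav A').
Proof. exact (vts_ty (la_vtrans HM) f). Qed.
Hint Resolve lass_ty : sqty.
Lemma ver_x A : lav (tT A) *v vid (tT A) = tv1 I A *v fv F (lav A).
Proof. rewrite (vc_idr HX). exact (str_x Ht A). Qed.
Lemma ver_x' A : tv1 I A *v fv F (lav A) = lav (tT A).
Proof. symmetry. exact (str_x Ht A). Qed.
Hint Resolve ver_x' : cells.
Hint Extern 2 (_ = _ :> ver _ _) => symmetry; apply ver_x' : cells.
Lemma cid_ok A : is_companion (c_id (tT A)). Proof. cok. Qed.
Lemma xs_ty A : is_sq (xs A) (th1 I A) (hid (tT A)) (lav (tT A)) (fv F (lav A)).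
Proof. exact (lift_sq_ty HX (cid_ok A) (ct_ok I A) (ver_x A)). Qed.
Hint Resolve xs_ty : sqty.
Lemma xs_ciot A : ciot (ct' I A) // xs A = sidv (lav (tT A)) // ciot (c_id (tT A)).
Proof. exact (lift_sq_ciot HX (cid_ok A) (ct_ok I A) (ver_x A)). Qed.
Lemma tri_la_ty A A' (h : hor A (tT A')) : is_sq (tri_la h) (trih u1 h) h (lav A) (fv F (lav A')).
Proof. unfold tri_la. bd. Qed.
Hint Resolve tri_la_ty : sqty.
Lemma tri_la_char A A' (h : hor A (tT A')) : kap_str u1 h // tri_la h = lass h.
Proof.
  transitivity (lass h // kap h (c_id (tT A'))).
  - eapply (kap_nat HX SX); [cok | cok | bd | exact (xs_ty A') | apply xs_ciot].
  - rewrite (kap_id HX SX). apply (sv_sid HX); bd.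
Qed.
Lemma lass_nat A A' A1 A1' (a : sq A A' A1 A1') f f' u v : is_sq a f f' u v ->
  bs B (sid u1) a // lass f' = lass f // a.
Proof.
  intros Ha. assert (E := vts_nat (la_vtrans HM) (wf_of Ha)). rewrite (top_of Ha), (bot_of Ha) in E.
  change (bs B (@fs _ _ _ (un M) tt tt tt tt tt) a // lass f' = lass f // a) in E.
  assert (E1 : @fs _ _ _ (un M) tt tt tt tt tt = sid u1) by exact (fs_sid HU (A := tt) (B := tt) tt).
  now rewrite E1 in E.
Qed.
(** The unit object is a pseudodouble functor from the terminal double category, so [u1] is only
    isomorphic to [hid I]. [fcu] and [fuu] are its compositor and unit. *)
Definition fcu : sq I I I I := @fc _ _ _ (un M) tt tt tt tt tt.
Definition fuu : sq I I I I := @fu _ _ _ (un M) tt.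
Lemma fcu_ty : is_giso fcu (u1 *h u1) u1.
Proof. exact (fc_ty HU (A := tt) (B := tt) (C := tt) tt tt). Qed.
Lemma fuu_ty : is_giso fuu (hid I) u1.
Proof. exact (fu_ty HU tt). Qed.
Hint Resolve fcu_ty fuu_ty : giso.
Hint Extern 3 (is_sq fcu _ _ _ _) => eapply giso_glob; gi : sqty.
Hint Extern 3 (is_sq fuu _ _ _ _) => eapply giso_glob; gi : sqty.
Lemma lass_hc A A' A'' (f : hor A A') (g : hor A' A'') :
  bc B u1 f u1 g // (bs B fcu (sid (f *h g)) // lass (f *h g)) = lass f || lass g.
Proof.
  assert (E := vts_hc (la_vtrans HM) f g).
  change ((bc B u1 f u1 g // bs B (fcu // @fs _ _ _ (un M) tt tt tt tt tt) (sid (f *h g))) // lass (f *h g)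
    = (lass f || lass g) // sid (f *h g)) in E.
  assert (E1 : @fs _ _ _ (un M) tt tt tt tt tt = sid u1) by exact (fs_sid HU (A := tt) (B := tt) tt).
  rewrite E1, !(sv_sid HX), (sv_assoc HX) in E by bd. exact E.
Qed.
Lemma lass_hid A :
  bu B I A // (bs B fuu (sid (hid A)) // lass (hid A)) = sidv (lav A).
Proof.
  assert (E := vts_hid (la_vtrans HM) A).
  change ((bu B I A // bs B (fuu // @fs _ _ _ (un M) tt tt tt tt tt) (sid (hid A))) // lass (hid A)
    = sidv (lav A) // sid (hid A)) in E.
  assert (E1 : @fs _ _ _ (un M) tt tt tt tt tt = sid u1) by exact (fs_sid HU (A := tt) (B := tt) tt).
  rewrite E1, !(sv_sid HX), (sv_assoc HX) in E by bd. exact E.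
Qed.
Lemma la_nat A A' (v : ver A A') : bv B (vid I) v *v lav A' = lav A *v v.
Proof.
  assert (E := vt1_nat (la_vtrans HM) v).
  change (bv B (@fv _ _ _ (un M) tt tt tt) v *v lav A' = lav A *v v) in E.
  assert (E1 : @fv _ _ _ (un M) tt tt tt = vid I) by exact (fv_vid HU tt).
  now rewrite E1 in E.
Qed.
Lemma Fla_nat A A' (v : ver A A') : fv F (bv B (vid I) v) *v fv F (lav A') = fv F (lav A) *v fv F v.
Proof. rewrite <- !(fv_vc HF). now rewrite la_nat. Qed.
Hint Resolve la_nat Fla_nat : cells.
Lemma tri_la_nat A A' A1 A1' (a : sq A (tT A') A1 (tT A1')) f f' u v : is_sq a f f' u (fv F v) ->
  tris (sid u1) a (vid I) v // tri_la f' = tri_la f // a.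
Proof.
  intros Ha. assert (T1 := tris_ty (sid_ty HX u1) Ha).
  eapply (kap_epi HX SX (ct_ok _ _) (p := bh B u1 f)); [bd | bd |]. fold (kap_str u1 f).
  rewrite <- !(sv_assoc HX), tri_la_char, (kap_str_nat (sid_ty HX u1) Ha) by bd.
  rewrite (sv_assoc HX), tri_la_char by bd. apply (lass_nat Ha).
Qed.
Lemma tss_x A A' (f : hor A A') : lass (fh F f) = tss u1 f // fs F (lass f).
Proof. exact (str_xs Ht f). Qed.
Lemma kap_strT_tri_la A A' (f : hor A (tT A')) : kap_strT u1 f // fs F (tri_la f) = lass (fh F f).
Proof.
  unfold kap_strT. asr. now rewrite <- (fs_sv HF), tri_la_char, tss_x by bd.
Qed.
Lemma tri_la_hc A A' A'' (f : hor A (tT A')) (g : hor A' (tT A'')) :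
  tric u1 f u1 g // (tris fcu (sid (kh f g)) (vid _) (vid _) // tri_la (kh f g))
  = ks (tri_la f) (tri_la g) (lav A'').
Proof.
  assert (T1 := tri_la_ty f). assert (T2 := tri_la_ty g). assert (T3 := ks_ty T1 T2).
  assert (T4 : is_sq (sid (kh f g)) (kh f g) (kh f g) (vid _) (fv F (vid A''))) by bd.
  assert (T4' : is_sq fcu (u1 *h u1) u1 (vid _) (vid _)) by bd.
  assert (T5 := tris_ty T4' T4).
  assert (HP := kap_tri_ty u1 f u1 g).
  eapply kap_tri_epi; [bd | bd |].
  rewrite <- (sv_assoc HX), tric_char by bd. asr.
  rewrite <- (sv_assoc HX (a := kap_str _ _)), (kap_str_nat T4' T4) by bd. asr. rewrite tri_la_char.
  unfold kap_tri. fold (kap_strT u1 g). asr. rewrite (kap_kl_nat T1 T2).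
  rewrite <- (sv_assoc HX (a := kap_str _ _ || _)), (ich HX), tri_la_char, kap_strT_tri_la by bd.
  rewrite <- lass_hc. asr. f_equal.
  assert (E : lass (f *h fh F g) // kap_kl f g = bs B (sid u1) (kap_kl f g) // lass (kh f g)).
  { symmetry. exact (lass_nat (kap_kl_ty f g)). }
  rewrite E. rewrite <- !(sv_assoc HX) by bd. f_equal.
  rewrite <- !(bs_sv HB), !(sid_sv HX), !(sv_sid HX) by bd. reflexivity.
Qed.
Lemma tri_la_hid A :
  ginv (zh I A) // (tris fuu (sid (etah A)) (vid _) (vid _) // tri_la (etah A)) = eta_u (lav A).
Proof.
  assert (H1 := eta_u_ty (lav A)).
  assert (T1 : is_sq fuu (hid I) u1 (vid _) (vid _)) by bd.
  assert (T2 : is_sq (sid (etah A)) (etah A) (etah A) (vid _) (fv F (vid A))) by bd.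
  assert (T3 := tris_ty T1 T2).
  eapply ieta_epi; [bd | bd |].
  rewrite <- !(sv_assoc HX (a := ciot _)) by bd. rewrite ieta_u, zh_char. asr.
  rewrite <- (sv_assoc HX (a := kap_str _ _)), (kap_str_nat T1 T2) by bd. asr. rewrite tri_la_char.
  rewrite <- lass_hid. asr. f_equal.
  assert (HK := ieta_ty A). rewrite <- (lass_nat HK). rewrite <- !(sv_assoc HX) by bd. f_equal.
  rewrite <- !(bs_sv HB), !(sid_sv HX), !(sv_sid HX) by bd. reflexivity.
Qed.
Definition rhv A : ver (A ⊗ I) A := vt1 (rh M) A.
Definition rhss A A' (f : hor A A') : sq (A ⊗ I) (A' ⊗ I) A A' := vts (rh M) f.
Lemma rhss_ty A A' (f : hor A A') : is_sq (rhss f) (bh B f u1) f (rhv A) (rhv A').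
Proof. exact (vts_ty (rh_vtrans HM) f). Qed.
Hint Resolve rhss_ty : sqty.
Lemma al_m A C : alv A I C *v bv B (vid A) (lav C) = bv B (rhv A) (vid C).
Proof. symmetry. exact (mon_m HM A C). Qed.
Lemma Fal_m A C : fv F (alv A I C) *v fv F (bv B (vid A) (lav C)) = fv F (bv B (rhv A) (vid C)).
Proof. rewrite <- !(fv_vc HF). now rewrite al_m. Qed.
Lemma al_l A C : alv I A C *v lav (A ⊗ C) = bv B (lav A) (vid C).
Proof. exact (mon_l HM A C). Qed.
Lemma Fal_l A C : fv F (alv I A C) *v fv F (lav (A ⊗ C)) = fv F (bv B (lav A) (vid C)).
Proof. rewrite <- !(fv_vc HF). now rewrite al_l. Qed.
Hint Resolve al_m Fal_m al_l Fal_l : cells.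
Lemma tri_al_m A A' C C' (f : hor A A') (g : hor C (tT C')) :
  tris (rhss f) (sid g) (rhv A') (vid C') = tri_al f u1 g // tris (sid f) (tri_la g) (vid _) (lav C').
Proof.
  assert (T0 : is_sq (sid g) g g (vid C) (fv F (vid C'))) by bd.
  assert (T1 := tris_ty (rhss_ty f) T0).
  assert (T2 := tris_ty (sid_ty HX f) (tri_la_ty g)).
  eapply (kap_epi HX SX (ct_ok _ _) (p := bh B (bh B f u1) g)); [bd | bd |]. fold (kap_str (bh B f u1) g).
  rewrite (kap_str_nat (rhss_ty f) T0). rewrite <- (sv_assoc HX), tri_al_char by bd. asr.
  rewrite (kap_str_nat (sid_ty HX f) (tri_la_ty g)).
  rewrite <- !(sv_assoc HX) by bd. f_equal. rewrite (sv_assoc HX), <- bs_sidl_sv, tri_la_char by bd.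
  exact (mon_ms HM f g).
Qed.
Lemma tri_al_l A A' C C' (f : hor A A') (g : hor C (tT C')) :
  tri_al u1 f g // tri_la (trih f g) = tris (lass f) (sid g) (lav A') (vid C').
Proof.
  assert (T0 : is_sq (sid g) g g (vid C) (fv F (vid C'))) by bd.
  assert (T1 := tris_ty (lass_ty f) T0).
  eapply (kap_epi HX SX (ct_ok _ _) (p := bh B (bh B u1 f) g)); [bd | bd |]. fold (kap_str (bh B u1 f) g).
  rewrite (kap_str_nat (lass_ty f) T0). rewrite <- (sv_assoc HX), tri_al_char by bd. asr. rewrite tri_la_char.
  rewrite (lass_nat (kap_str_ty f g)), <- (sv_assoc HX) by bd. f_equal. exact (mon_ls HM f g).
Qed.

(** * The vertical transformations on the Kleisli double category *)

Let VA := act_al cmu ceta ct.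
Let VL := act_la cmu ceta ct.
Let EK := kl_pseudodouble.
Lemma VA_vtrans : is_vtrans (triple_l B Tri) (triple_r Tri) VA.
Proof.
  split.
  - intros [[A C] D] [[A' C'] D'] [[u v] w]. exact (al_nat u v w).
  - intros [[A C] D] [[A' C'] D'] [[f g] h]. exact (kl_sq (s := (_, _)) (tri_al_ty f g h) eq_refl).
  - intros [[A C] D] [[A' C'] D'] [[A1 C1] D1] [[A1' C1'] D1'] [[s s'] [d w]] [[H1 H2] H3].
    cbn in *.
    destruct (wf_sq H1) as (f & f' & u & u' & Hs), (wf_sq H2) as (g & g' & v & v' & Hs').
    destruct (kl_sq_wf (s := (d, w)) H3) as (h & h' & x & Hd). cbn in Hd.
    change ((tris (bs B s s') d (rgt (bs B s s')) w // tri_al (bot s) (bot s') (bot d),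
        bv B (rgt (bs B s s')) w *v alv A1' C1' D1')
      = (tri_al (top s) (top s') (top d) // tris s (tris s' d (rgt s') w) (rgt s) (bv B (rgt s') w),
        alv A' C' D' *v bv B (rgt s) (bv B (rgt s') w))).
    assert (R : rgt (bs B s s') = bv B u' v') by bd. rewrite R.
    rewrite (top_of Hs), (top_of Hs'), (top_of Hd), (bot_of Hs),
      (bot_of Hs'), (bot_of Hd), (rgt_of Hs), (rgt_of Hs').
    f_equal; [|cells ..]. exact (tri_al_nat Hs Hs' Hd).
  - intros [[A C] D] [[A' C'] D'] [[A2 C2] D2] [[f g] h] [[f' g'] h'].
    (* [Q1] and [Q2] are identity compositors of projections inside the triple functors, and [P] is
       the compositor of [⊗] with them attached. All three are simplified once the statement is
       unfolded. *)
    set (Q1 := sid (f *h f') // sid (f *h f')). set (Q2 := sid (g *h g') // sid (g *h g')).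
    set (P := bc B f g f' g' // bs B Q1 Q2).
    change ((tric (bh B f g) h (bh B f' g') h' // tris P (sid (kh h h')) (rgt P) (@vid X D2)
        // tri_al (f *h f') (g *h g') (kh h h'), vid _ *v bv B (rgt P) (@vid X D2) *v alv A2 C2 D2)
      = (ks (tri_al f g h) (tri_al f' g' h') (alv A2 C2 D2) // (tric f (trih g h) f' (trih g' h')
        // tris Q1 (tric g h g' h' // tris Q2 (sid (kh h h')) (rgt Q2) (@vid X D2)) (rgt Q1)
             (vid _ *v bv B (rgt Q2) (@vid X D2))),
        alv A2 C2 D2 *v (vid _ *v bv B (rgt Q1) (vid _ *v bv B (rgt Q2) (@vid X D2))))).
    assert (E1 : Q1 = sid (f *h f')) by (apply (sv_sid HX); bd).
    assert (E2 : Q2 = sid (g *h g')) by (apply (sv_sid HX); bd).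
    assert (E3 : P = bc B f g f' g').
    { unfold P. rewrite E1, E2, (bs_sid HB). apply (sv_sid HX); bd. }
    rewrite E1, E2, E3, !(rgt_of (sid_ty HX _)).
    assert (R : rgt (bc B f g f' g') = vid (A2 ⊗ C2)) by bd. rewrite R.
    cbn [fst snd]. rewrite (bv_vid HB C2 D2), !(vc_idl HX), tris_sid. f_equal; [|cells ..].
    rewrite (sv_sid HX (a := tric g h g' h')) by bd.
    refine (eq_trans _ (tri_al_hc f g h f' g' h')). apply (sv_assoc HX); bd.
  - intros [[A C] D].
    set (Q1 := sid (hid A) // sid (hid A)). set (Q2 := sid (hid C) // sid (hid C)).
    set (P := bu B A C // bs B Q1 Q2).
    change ((ginv (zh (A ⊗ C) D) // tris P (sid (etah D)) (rgt P) (@vid X D) // tri_al (hid A) (hid C) (etah D),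
        vid _ *v bv B (rgt P) (@vid X D) *v alv A C D)
      = (eta_u (alv A C D) // (ginv (zh A (C ⊗ D))
        // tris Q1 (ginv (zh C D) // tris Q2 (sid (etah D)) (rgt Q2) (@vid X D)) (rgt Q1)
             (vid _ *v bv B (rgt Q2) (@vid X D))),
        alv A C D *v (vid _ *v bv B (rgt Q1) (vid _ *v bv B (rgt Q2) (@vid X D))))).
    assert (E1 : Q1 = sid (hid A)) by (apply (sv_sid HX); bd).
    assert (E2 : Q2 = sid (hid C)) by (apply (sv_sid HX); bd).
    assert (E3 : P = bu B A C).
    { unfold P. rewrite E1, E2, (bs_sid HB). apply (sv_sid HX); bd. }
    rewrite E1, E2, E3, !(rgt_of (sid_ty HX _)).
    assert (R : rgt (bu B A C) = vid (A ⊗ C)) by bd. rewrite R.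
    cbn [fst snd]. rewrite (bv_vid HB C D), !(vc_idl HX), tris_sid. f_equal; [|cells ..].
    rewrite (sv_sid HX (a := ginv (zh C D))) by bd.
    refine (eq_trans _ (tri_al_hid A C D)). apply (sv_assoc HX); bd.
Qed.
Lemma VL_vtrans : is_vtrans (f_app2 Tri (f_unit (un M) (kl S)) (f_id (kl S))) (f_id (kl S)) VL.
Proof.
  assert (E1 : @fs _ _ _ (un M) tt tt tt tt tt = sid u1) by exact (fs_sid HU (A := tt) (B := tt) tt).
  assert (E2 : @fv _ _ _ (un M) tt tt tt = vid I) by exact (fv_vid HU tt).
  split.
  - intros A A' v. change (bv B (@fv _ _ _ (un M) tt tt tt) v *v lav A' = lav A *v v).
    rewrite E2. exact (la_nat v).
  - intros A A' h. assert (H := kl_sq (s := (tri_la h, lav A')) (tri_la_ty h) eq_refl). exact H.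
  - intros A A' A1 A1' [d w] H. cbn in *. destruct (kl_sq_wf (s := (d, w)) H) as (h & h' & x & Hd). cbn in Hd.
    change ((tris (@fs _ _ _ (un M) tt tt tt tt tt) d (rgt (@fs _ _ _ (un M) tt tt tt tt tt)) w // tri_la (bot d),
        bv B (rgt (@fs _ _ _ (un M) tt tt tt tt tt)) w *v lav A1') = (tri_la (top d) // d, lav A' *v w)).
    rewrite E1, (rgt_of (sid_ty HX _)), (top_of Hd), (bot_of Hd).
    f_equal; [|cells ..]. exact (tri_la_nat Hd).
  - intros A A' A'' f g.
    set (P := fcu // @fs _ _ _ (un M) tt tt tt tt tt).
    change ((tric u1 f u1 g // tris P (sid (kh f g)) (rgt P) (@vid X A'') // tri_la (kh f g),
      vid _ *v bv B (rgt P) (@vid X A'') *v lav A'')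
      = (ks (tri_la f) (tri_la g) (lav A'') // sid (kh f g), lav A'' *v @vid X A'')).
    assert (E3 : P = fcu) by (unfold P; rewrite E1; apply (sv_sid HX); bd).
    assert (R : rgt fcu = vid I) by bd. rewrite E3, R.
    assert (T3 := ks_ty (tri_la_ty f) (tri_la_ty g)).
    f_equal; [|cells ..]. rewrite (sv_sid HX), <- tri_la_hc by bd. apply (sv_assoc HX); bd.
  - intros A. set (P := fuu // @fs _ _ _ (un M) tt tt tt tt tt).
    change ((ginv (zh I A) // tris P (sid (etah A)) (rgt P) (@vid X A) // tri_la (etah A),
      vid _ *v bv B (rgt P) (@vid X A) *v lav A) = (eta_u (lav A) // sid (etah A), lav A *v @vid X A)).
    assert (E3 : P = fuu) by (unfold P; rewrite E1; apply (sv_sid HX); bd).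
    assert (R : rgt fuu = vid I) by bd. rewrite E3, R. assert (H1 := eta_u_ty (lav A)).
    f_equal; [|cells ..]. rewrite (sv_sid HX), <- tri_la_hid by bd. apply (sv_assoc HX); bd.
Qed.


(* A square of [Kl] is vertically invertible when it is so in [X], with an inverse whose
   right side is in the image of [T]. *)
Lemma kl_viso (A C D E : ob X) (a : sq A (tT C) D (tT E)) (b : sq D (tT E) A (tT C)) f g u v u' v' :
  is_sq a f g u (fv F v) -> is_sq b g f u' (fv F v') -> a // b = sid f -> b // a = sid g ->
  v *v v' = vid C -> v' *v v = vid E -> @is_viso (kl S) A C D E (a, v).
Proof.
  intros Ha Hb E1 E2 E3 E4. split; [exact (wf_of (kl_sq (s := (a, v)) Ha eq_refl))|].
  exists (b, v'). split; [exact (wf_of (kl_sq (s := (b, v')) Hb eq_refl))|].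
  change (top b = bot a /\ bot b = top a /\ (a // b, v *v v') = (sid (top a), vid C)
    /\ (b // a, v' *v v) = (sid (bot a), vid E)).
  rewrite (top_of Ha), (bot_of Ha), (top_of Hb), (bot_of Hb), E1, E2, E3, E4. repeat split.
Qed.
Lemma alss_inv A A' C C' D D' (f : hor A A') (g : hor C C') (h : hor D D') :
  is_viso (alss f g h).
Proof. exact (al_inv HM (A := (A, C, D)) (B := (A', C', D')) (f, g, h)). Qed.
(** Invertibility is assumed for 2-cell components. The left side of the inverse to the component at
    identity 1h-cells is the required 1v-cell. *)
Lemma alv_inv A C D : exists w, alv A C D *v w = vid _ /\ w *v alv A C D = vid _.
Proof.
  destruct (viso_data HX (alss_inv (hid A) (hid C) (hid D)) (alss_ty _ _ _))
    as (b & w & w' & _ & _ & _ & H & _). now exists w.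
Qed.
Lemma lav_inv A : exists w, lav A *v w = vid _ /\ w *v lav A = vid _.
Proof.
  destruct (viso_data HX (la_inv HM (hid A)) (lass_ty (hid A)))
    as (b & w & w' & _ & _ & _ & H & _). now exists w.
Qed.
Lemma tri_al_inv A A' C C' D D' (f : hor A A') (g : hor C C') (h : hor D (tT D')) :
  @is_viso (kl S) ((A ⊗ C) ⊗ D) ((A' ⊗ C') ⊗ D') (A ⊗ (C ⊗ D)) (A' ⊗ (C' ⊗ D')) (tri_al f g h, alv A' C' D').
Proof.
  destruct (viso_data HX (alss_inv f g h) (alss_ty f g h))
    as (i & w & w1 & Hi & I1 & I2 & _ & [W1 W2]).
  (* The inverse of [alss f g h] has as right side an inverse of the associator at [T D']. A square
     of [kl] has its right side recorded at [D'], so the inverse there is obtained separately and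
     its image under [T] used for the strength part. *)
  destruct (alv_inv A' C' D') as (w2 & W3 & W4).
  assert (W5 : fv F (alv A' C' D') *v fv F w2 = vid _) by now rewrite <- (fv_vc HF), W3, (fv_vid HF).
  assert (W6 : fv F w2 *v fv F (alv A' C' D') = vid _) by now rewrite <- (fv_vc HF), W4, (fv_vid HF).
  destruct (lift_sq_inv HX (cy_ok A' C' D') (ct_ok (A' ⊗ C') D') (ver_y A' C' D') W1 W2 W5 W6)
    as (Hj & J1 & J2).
  set (j := lift_sq w1 (fv F w2) (ct' (A' ⊗ C') D') (cy A' C' D')) in *.
  change (lift_sq (alv A' C' (tT D')) (fv F (alv A' C' D')) (cy A' C' D') (ct' (A' ⊗ C') D'))
    with (ys A' C' D') in J1, J2.
  change (ch (ct' (A' ⊗ C') D')) with (th1 (A' ⊗ C') D') in *.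
  change (ch (cy A' C' D')) with (bh B (hid A') (th1 C' D') *h th1 A' (C' ⊗ D')) in *.
  set (q := bc B f (bh B g h) (hid A') (th1 C' D') || sid (th1 A' (C' ⊗ D'))).
  assert (Hq : is_giso q (bh B f (bh B g h) *h (bh B (hid A') (th1 C' D') *h th1 A' (C' ⊗ D')))
     (trih f (trih g h))).
  { eapply giso_cast; [unfold q; gi | cells | cells]. }
  eapply (kl_viso (b := ginv q // (i || j)) (v' := w2) (tri_al_ty f g h)).
  - bd.
  - change (tri_al f g h) with ((alss f g h || ys A' C' D') // q).
    asr. rewrite <- (sv_assoc HX (a := q)) by bd. rewrite (giso_r Hq), (sid_sv HX) by bd.
    rewrite (ich HX), I1, J1, <- (sid_hc HX) by bd. reflexivity.
  - change (tri_al f g h) with ((alss f g h || ys A' C' D') // q).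
    asr. rewrite <- (sv_assoc HX (a := i || j)), (ich HX), I2, J2, <- (sid_hc HX), (sid_sv HX) by bd.
    exact (giso_l Hq).
  - exact W3.
  - exact W4.
Qed.
Lemma VA_inv : invertible VA.
Proof. intros [[A C] D] [[A' C'] D'] [[f g] h]. exact (tri_al_inv f g h). Qed.
Lemma tri_la_inv A A' (h : hor A (tT A')) :
  @is_viso (kl S) (I ⊗ A) (I ⊗ A') A A' (tri_la h, lav A').
Proof.
  destruct (viso_data HX (la_inv HM h) (lass_ty h)) as (i & w & w1 & Hi & I1 & I2 & _ & [W1 W2]).
  destruct (lav_inv A') as (w2 & W3 & W4).
  assert (W5 : fv F (lav A') *v fv F w2 = vid _) by now rewrite <- (fv_vc HF), W3, (fv_vid HF).
  assert (W6 : fv F w2 *v fv F (lav A') = vid _) by now rewrite <- (fv_vc HF), W4, (fv_vid HF).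
  destruct (lift_sq_inv HX (cid_ok A') (ct_ok I A') (ver_x A') W1 W2 W5 W6) as (Hj & J1 & J2).
  set (j := lift_sq w1 (fv F w2) (ct' I A') (c_id (tT A'))) in *.
  change (lift_sq (lav (tT A')) (fv F (lav A')) (c_id (tT A')) (ct' I A')) with (xs A') in J1, J2.
  change (ch (ct' I A')) with (th1 I A') in *. change (ch (c_id (tT A'))) with (hid (tT A')) in *.
  eapply (kl_viso (b := i || j) (v' := w2) (tri_la_ty h)).
  - bd.
  - unfold tri_la. rewrite (ich HX) by bd. change (lass h // i = sid (bh B u1 h)) in I1.
    rewrite I1, J1, <- (sid_hc HX). reflexivity.
  - unfold tri_la. rewrite (ich HX) by bd. change (i // lass h = sid h) in I2.
    rewrite I2, J2, <- (sid_hc HX), (hc_idr SX). reflexivity.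
  - exact W3.
  - exact W4.
Qed.
Lemma VL_inv : invertible VL.
Proof. intros A A' h. exact (tri_la_inv h). Qed.

(** * The induced horizontal action *)

Variables (cal : forall x, companion (vt1 (al M) x))
          (cla : forall A, companion (vt1 (la M) A))
          (crh : forall A, companion (vt1 (rh M) A)).
Hypotheses (Hal : forall x, is_companion (cal x)) (Hla : forall x, is_companion (cla x))
  (Hrh : forall x, is_companion (crh x))
  (Eal : forall x, is_hequiv (ch (cal x))) (Ela : forall x, is_hequiv (ch (cla x)))
  (Erh : forall x, is_hequiv (ch (crh x))).
(** What [lifted_haction] still asks for are strict equations between vertical 2-cells of [kl]. The
    companions there are images under [K], which as a functor preserves companions and
    equivalences. *)
Lemma induced_haction : is_haction (induced_action cal cla crh cmu ceta ct).
Proof.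
  refine (lifted_haction HX EK HM tri_functor_ok VA_vtrans VL_vtrans VA_inv VL_inv
    _ _ _ _ _ _ Hal Hla Hrh _ _ _ _).
  - intros A C D E. exact (mon_p HM A C D E).
  - intros A A' C C' D D' E E' f g h k. change (ob X) in E, E'. change (@hor X E (tT E')) in k.
    assert (R : rgt (alss f g h) = alv A' C' D') by bd.
    change ((tri_al (bh B f g) h k // tri_al f g (trih h k), alv (A' ⊗ C') D' E' *v alv A' C' (D' ⊗ E'))
      = (tris (alss f g h) (sid k) (rgt (alss f g h)) (vid E') // tri_al f (bh B g h) k
          // tris (sid f) (tri_al g h k) (rgt (sid f)) (alv C' D' E'),
        bv B (rgt (alss f g h)) (vid E') *v alv A' (C' ⊗ D') E' *v bv B (rgt (sid f)) (alv C' D' E'))).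
    rewrite R, (rgt_of (sid_ty HX f)). f_equal; [|cells ..].
    rewrite (sv_assoc HX) by bd. apply tri_al_p.
  - intros A C. exact (mon_m HM A C).
  - intros A A' C C' f g. change (ob X) in C, C'. change (@hor X C (tT C')) in g.
    assert (R : rgt (rhss f) = rhv A') by bd.
    change ((tris (rhss f) (sid g) (rgt (rhss f)) (vid C'), bv B (rgt (rhss f)) (vid C'))
      = (tri_al f u1 g // tris (sid f) (tri_la g) (rgt (sid f)) (lav C'),
         alv A' I C' *v bv B (rgt (sid f)) (lav C'))).
    rewrite R, (rgt_of (sid_ty HX f)). f_equal; [|cells ..]. apply tri_al_m.
  - intros A C. exact (mon_l HM A C).
  - intros A A' C C' f g. change (ob X) in C, C'. change (@hor X C (tT C')) in g.
    assert (R : rgt (lass f) = lav A') by bd.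
    change ((tri_al u1 f g // tri_la (trih f g), alv I A' C' *v lav (A' ⊗ C'))
      = (tris (lass f) (sid g) (rgt (lass f)) (vid C'), bv B (rgt (lass f)) (vid C'))).
    rewrite R. f_equal; [|cells ..]. apply tri_al_l.
  - intros [[A C] D]. exact (c_fun_ok HX EK K_functor (Hal (A, C, D))).
  - intros x. exact (c_fun_ok HX EK K_functor (Hla _)).
  - intros [[A C] D]. exact (functor_hequiv HX EK K_functor (Eal (A, C, D))).
  - intros x. exact (functor_hequiv HX EK K_functor (Ela _)).
Qed.

(** * The icon and the extension axioms *)

Definition theta A A' C C' (f : hor A A') (g : hor C C') : sq (A ⊗ C) (tT (A' ⊗ C')) (A ⊗ C) (tT (A' ⊗ C')) :=
  ind_th ceta ct f g.
Definition cBe A C : companion (bv B (vid A) (etav C)) := c_bifun B (c_id A) (ceta' C).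
Lemma cBe_ok A C : is_companion (cBe A C). Proof. unfold cBe. cok. Qed.
Hint Resolve cBe_ok : comp.
Lemma kBe_ty A A' C (p : hor A (A' ⊗ C)) :
  is_sq (kap p (cBe A' C)) p (p *h bh B (hid A') (etah C)) (vid A) (bv B (vid A') (etav C)).
Proof. exact (kap_ty HX SX p (cBe_ok A' C)). Qed.
Hint Resolve kBe_ty : sqty.
Lemma kBe_bc A A' C C' (f : hor A A') (g : hor C C') :
  kap (bh B f g) (cBe A' C') // bc B f g (hid A') (etah C') = bs B (sid f) (kap g (ceta' C')).
Proof. rewrite <- (kap_id HX SX f). apply kap_bifun; cok. Qed.
Lemma theta_ty A A' C C' (f : hor A A') (g : hor C C') :
  is_giso (theta f g) (trih f (Kf g)) (Kf (bh B f g)).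
Proof.
  change (theta f g) with ((ginv (bc B f g (hid A') (etah C')) || sid (th1 A' C'))
    // (sid (bh B f g) || zh A' C')).
  eapply giso_cast; [gi | unfold Kf; cells | reflexivity].
Qed.
Hint Resolve theta_ty : giso.
Hint Extern 3 (is_sq (theta _ _) _ _ _ _) => eapply giso_glob; gi : sqty.
Lemma kap_zh A A' C (p : hor A (A' ⊗ C)) :
  kap p (cBe A' C) // (kap (p *h bh B (hid A') (etah C)) (ct' A' C) // (sid p || zh A' C))
  = kap p (ceta' (A' ⊗ C)).
Proof.
  rewrite <- (sv_assoc HX) by bd. rewrite (kap_comp HX SX) by cok.
  refine (kap_lifts HX p _ _ (lifts_zh A' C)); cok.
Qed.
(** Reaches [f ⊳ K g] by inserting [η] in the second variable and then the strength. [theta]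
    compares this with the opcartesian cell of [η] at the tensor. *)
Definition kap_theta A A' C C' (f : hor A A') (g : hor C C') : sq (A ⊗ C) (A' ⊗ C') (A ⊗ C) (tT (A' ⊗ C')) :=
  bs B (sid f) (kap g (ceta' C')) // kap_str f (Kf g).
Lemma kap_theta_ty A A' C C' (f : hor A A') (g : hor C C') :
  is_sq (kap_theta f g) (bh B f g) (trih f (Kf g)) (vid _) (etav (A' ⊗ C')).
Proof.
  assert (H := keta_ty g). change (g *h etah C') with (Kf g) in H.
  unfold kap_theta. bd.
Qed.
Hint Resolve kap_theta_ty : sqty.
Lemma theta_char A A' C C' (f : hor A A') (g : hor C C') :
  kap_theta f g // theta f g = kap (bh B f g) (ceta' (A' ⊗ C')).
Proof.
  assert (H := keta_ty g). 
  change (theta f g) with ((ginv (bc B f g (hid A') (etah C')) || sid (th1 A' C'))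
    // (sid (bh B f g) || zh A' C')).
  unfold kap_theta, Kf. rewrite <- kBe_bc.
  asr. assert (E1 : kap_str f (g *h etah C') // (ginv (bc B f g (hid A') (etah C')) || sid (th1 A' C'))
    = ginv (bc B f g (hid A') (etah C')) // kap (bh B f g *h bh B (hid A') (etah C')) (ct' A' C')).
  { unfold kap_str. eapply kct_sid. bd. }
  rewrite (sv_rew2 HX E1) by bd. asr.
  assert (E2 : bc B f g (hid A') (etah C') // ginv (bc B f g (hid A') (etah C'))
    = sid (bh B f g *h bh B (hid A') (etah C'))).
  { erewrite giso_r by gi. reflexivity. }
  rewrite (sv_rew2 HX E2) by bd. rewrite (sid_sv HX) by bd. apply kap_zh.
Qed.
Lemma kap_theta_epi A A' C C' D E (f : hor A A') (g : hor C C') (s s' : sq (A ⊗ C) (tT (A' ⊗ C')) D E) x x' l l' r :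
  is_sq s (trih f (Kf g)) x l r -> is_sq s' (trih f (Kf g)) x' l' r ->
  kap_theta f g // s = kap_theta f g // s' -> s = s'.
Proof.
  intros Hs Hs' Eq. assert (HT1 := giso_glob (theta_ty f g)). assert (Hk := keta_ty (bh B f g)).
  assert (E0 : kap_theta f g = kap (bh B f g) (ceta' (A' ⊗ C')) // ginv (theta f g)).
  { rewrite <- theta_char, (sv_assoc HX) by bd. erewrite giso_r by gi. symmetry. apply (sv_sid HX); bd. }
  rewrite E0, !(sv_assoc HX) in Eq by (unfold Kf; bd).
  eapply (kap_epi HX SX (ceta_ok _)) in Eq; [| unfold Kf; bd | unfold Kf; bd].
  eapply (giso_epi HX (giso_inv (theta_ty f g))); [bd .. | exact Eq].
Qed.
Lemma keta_Ks A A' A1 A1' (a : sq A A' A1 A1') f f' u w : is_sq a f f' u w ->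
  kap f (ceta' A') // Ks a w = a // kap f' (ceta' A1').
Proof.
  intros Ha. eapply (kap_nat HX SX); [cok | cok | bd | exact (eta_u_ty w) | apply ieta_u].
Qed.
Lemma kap_theta_nat A A' C C' A1 A1' C1 C1' (a : sq A A' A1 A1') (c : sq C C' C1 C1') f f' g g' u u' v v' :
  is_sq a f f' u u' -> is_sq c g g' v v' ->
  kap_theta f g // tris a (Ks c v') u' v' = bs B a c // kap_theta f' g'.
Proof.
  intros Ha Hc. assert (H1 := Ks_ty Hc). assert (H2 := tris_ty Ha H1).
  assert (H3 := keta_ty g). assert (H4 := keta_ty g'). change (g *h etah C') with (Kf g) in H3.
  change (g' *h etah C1') with (Kf g') in H4.
  unfold kap_theta. asr. rewrite (kap_str_nat Ha H1), <- !(sv_assoc HX), <- !(bs_sv HB) by bd.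
  rewrite (keta_Ks Hc), (sid_sv HX), (sv_sid HX) by bd. reflexivity.
Qed.
Lemma theta_nat A A' C C' A1 A1' C1 C1' (a : sq A A' A1 A1') (c : sq C C' C1 C1') f f' g g' u u' v v' :
  is_sq a f f' u u' -> is_sq c g g' v v' ->
  tris a (Ks c v') u' v' // theta f' g' = theta f g // Ks (bs B a c) (bv B u' v').
Proof.
  intros Ha Hc. assert (H1 := Ks_ty Hc). assert (H2 := tris_ty Ha H1).
  assert (H3 := bs_ty HB Ha Hc). assert (H4 := Ks_ty H3).
  eapply kap_theta_epi; [bd | bd |].
  rewrite <- !(sv_assoc HX), (kap_theta_nat Ha Hc), theta_char by bd.
  rewrite (sv_assoc HX), theta_char, (keta_Ks H3) by bd. reflexivity.
Qed.
Lemma theta_hid A C : ginv (zh A C) // theta (hid A) (hid C) = Ks (bu B A C) (vid _).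
Proof.
  assert (H1 : is_sq (bu B A C) (hid _) (bh B (hid A) (hid C)) (vid _) (vid _)) by bd.
  assert (H2 := Ks_ty H1). unfold Kf in H2. rewrite (hc_idl SX) in H2.
  assert (H3 := giso_glob (theta_ty (hid A) (hid C))). unfold Kf in H3. rewrite (hc_idl SX) in H3.
  eapply ieta_epi; [bd | bd |].
  rewrite <- (sv_assoc HX), zh_char by bd.
  assert (E1 : kap (hid (A ⊗ C)) (ceta' (A ⊗ C)) = ciot (ceta' (A ⊗ C))) by (apply (hid_sh HX SX); bd).
  assert (E2 : kap (hid C) (ceta' C) = ciot (ceta' C)) by (apply (hid_sh HX SX); bd).
  rewrite <- E1, (keta_Ks H1), <- theta_char. unfold kap_theta. rewrite E2. unfold Kf.
  rewrite (hc_idl SX). asr. reflexivity.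
Qed.
Lemma theta_la A A' (f : hor A A') : theta u1 f // Ks (lass f) (lav A') = tri_la (Kf f).
Proof.
  assert (H := Ks_ty (lass_ty f)). assert (H3 := keta_ty f). change (f *h etah A') with (Kf f) in H3.
  eapply kap_theta_epi; [bd | bd |].
  rewrite <- (sv_assoc HX), theta_char, (keta_Ks (lass_ty f)) by bd.
  unfold kap_theta. rewrite (sv_assoc HX), tri_la_char by bd. symmetry. apply (lass_nat H3).
Qed.
Lemma theta_al A A' C C' D D' (f : hor A A') (g : hor C C') (h : hor D D') :
  theta (bh B f g) h // Ks (alss f g h) (alv A' C' D')
  = tri_al f g (Kf h) // (tris (sid f) (theta g h) (vid _) (vid _) // theta f (bh B g h)).
Proof.
  assert (H := Ks_ty (alss_ty f g h)). assert (H3 := keta_ty h). change (h *h etah D') with (Kf h) in H3.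
  assert (H4 : is_sq (theta g h) (trih g (Kf h)) (Kf (bh B g h)) (vid _) (fv F (vid _))) by bd.
  assert (H5 := tris_ty (sid_ty HX f) H4).
  eapply kap_theta_epi; [bd | bd |].
  rewrite <- (sv_assoc HX), theta_char, (keta_Ks (alss_ty f g h)) by bd.
  unfold kap_theta at 1. rewrite (sv_assoc HX), <- (sv_assoc HX (a := kap_str _ _)), tri_al_char by bd. asr.
  rewrite <- (sv_assoc HX (a := kap_str _ _)), (kap_str_nat (sid_ty HX f) H4) by bd. asr.
  rewrite <- (sv_assoc HX (a := bs B (sid f) (kap_str _ _))), <- bs_sidl_sv by bd.
  rewrite <- (sv_assoc HX (a := bs B _ _) (b := alss _ _ _)) by bd. rewrite <- (bs_sid HB).
  rewrite (alss_nat (sid_ty HX f) (sid_ty HX g) H3). asr. f_equal.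
  rewrite <- (sv_assoc HX (a := bs B (sid f) _) (b := bs B (sid f) _)), <- bs_sidl_sv by bd.
  rewrite <- (sv_assoc HX (a := bs B _ _) (b := kap_str _ _)) by bd.
  rewrite <- (sv_assoc HX (b := kap_str g _)) by bd. fold (kap_theta g h). rewrite theta_char.
  symmetry. apply theta_char.
Qed.

(** Units inserted at both factors and then collapsed by [μ] amount to the single unit of the
    composite. *)
Lemma kfc_char A C D (f : hor A C) (g : hor C D) :
  (kap f (ceta' C) || (etas g // fs F (kap g (ceta' D)))) // (kap_kl (Kf f) (Kf g) // kfc f g)
  = kap (f *h g) (ceta' D).
Proof.
  assert (Hk := keta_ty g). change (g *h etah D) with (Kf g) in Hk.
  assert (E1 : kap_kl (Kf f) (Kf g) = sid f || kap_kl (etah C) (Kf g)).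
  { unfold kap_kl, Kf at 1. rewrite (kap_sh HX SX) by cok. now rewrite !(hc_assoc SX). }
  rewrite E1. unfold kfc.
  assert (E2 : kap f (ceta' C) || (etas g // fs F (kap g (ceta' D)))
    = sid f || (kap g (ceta' D) // (ciot (ceta' C) || etas (Kf g)))).
  { unfold kap at 1. rewrite (sh_assoc HX SX) by bd. f_equal. rewrite (etas_nat Hk).
    rewrite <- (hid_sh HX SX (a := kap g (ceta' D))) at 2 by bd. rewrite (ich HX), (sid_sv HX); bd. }
  rewrite E2. assert (HL : is_sq (klun (Kf g)) (kh (etah C) (Kf g)) (Kf g) (vid _) (vid _)) by bd.
  erewrite <- !(whl_sv HX) by bd.
  asr. rewrite klun_char, (sv_sid HX) by bd. apply (kap_sh HX SX). cok.
Qed.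
Definition kap_theta2 A A' A'' C C' C'' (f : hor A A') (g : hor C C') (f' : hor A' A'') (g' : hor C' C'') :=
  (kap_theta f g || (etas (bh B f' g') // fs F (kap_theta f' g'))) // kap_kl (trih f (Kf g)) (trih f' (Kf g')).
Lemma kap_theta2_ty A A' A'' C C' C'' (f : hor A A') (g : hor C C') (f' : hor A' A'') (g' : hor C' C'') :
  exists r, is_sq (kap_theta2 f g f' g') (bh B f g *h bh B f' g')
    (kh (trih f (Kf g)) (trih f' (Kf g'))) (vid _) r.
Proof. eexists. unfold kap_theta2. bd. Qed.
Lemma kap_theta2_theta A A' A'' C C' C'' (f : hor A A') (g : hor C C') (f' : hor A' A'') (g' : hor C' C'') :
  kap_theta2 f g f' g' // (ks (theta f g) (theta f' g') (vid _) // kfc (bh B f g) (bh B f' g'))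
  = kap (bh B f g *h bh B f' g') (ceta' (A'' ⊗ C'')).
Proof.
  assert (T1 : is_sq (theta f g) (trih f (Kf g)) (Kf (bh B f g)) (vid _) (fv F (vid _))) by bd.
  assert (T2 : is_sq (theta f' g') (trih f' (Kf g')) (Kf (bh B f' g')) (vid _) (fv F (vid _))) by bd.
  assert (T3 := ks_ty T1 T2). assert (T4 := kfc_sq (bh B f g) (bh B f' g')).
  unfold kap_theta2. rewrite (sv_assoc HX), <- (sv_assoc HX (a := kap_kl _ _)), (kap_kl_nat T1 T2) by bd. asr.
  rewrite <- (sv_assoc HX (a := _ || _) (b := theta f g || _)), (ich HX) by bd.
  rewrite (sv_assoc HX), <- (fs_sv HF), !theta_char by bd. apply kfc_char.
Qed.
Lemma kap_theta2_epi A A' A'' C C' C'' D E (f : hor A A') (g : hor C C') (f' : hor A' A'') (g' : hor C' C'')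
    (s s' : sq (A ⊗ C) (tT (A'' ⊗ C'')) D E) x x' l l' r :
  is_sq s (kh (trih f (Kf g)) (trih f' (Kf g'))) x l r ->
  is_sq s' (kh (trih f (Kf g)) (trih f' (Kf g'))) x' l' r ->
  kap_theta2 f g f' g' // s = kap_theta2 f g f' g' // s' -> s = s'.
Proof.
  intros Hs Hs' Eq. destruct (kap_theta2_ty f g f' g') as [r' HZ].
  assert (HI := giso_sv HX (ks_giso (theta_ty f g) (theta_ty f' g')) (kfc_ty (bh B f g) (bh B f' g'))).
  set (i := ks _ _ _ // _) in HI. assert (EZ := kap_theta2_theta f g f' g'). fold i in EZ.
  assert (Hk := keta_ty (bh B f g *h bh B f' g')).
  assert (E0 : kap_theta2 f g f' g' = kap (bh B f g *h bh B f' g') (ceta' (A'' ⊗ C'')) // ginv i).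
  { rewrite <- EZ, (sv_assoc HX) by bd. erewrite giso_r by gi. symmetry. apply (sv_sid HX); bd. }
  rewrite E0, !(sv_assoc HX) in Eq by (unfold Kf; bd).
  eapply (kap_epi HX SX (ceta_ok _)) in Eq; [| unfold Kf in *; bd | unfold Kf in *; bd].
  eapply (giso_epi HX (giso_inv HI)); [bd .. | exact Eq].
Qed.
(** Rewrites the test cell for two icon components through [kap_tri], so that [tric_char] evaluates
    the compositor of the action behind it. The step relies on the law [str_zs] and naturality of
    the strength. *)
Lemma kap_theta2_tri A A' A'' C C' C'' (f : hor A A') (g : hor C C') (f' : hor A' A'') (g' : hor C' C'') :
  kap_theta2 f g f' g' = (bs B (sid f) (kap g (ceta' C'))
    || bs B (sid f') (etas g' // fs F (kap g' (ceta' C'')))) // kap_tri f (Kf g) f' (Kf g').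
Proof.
  assert (Hk := keta_ty g). change (g *h etah C') with (Kf g) in Hk.
  assert (Hk' := keta_ty g'). change (g' *h etah C'') with (Kf g') in Hk'.
  unfold kap_tri. fold (kap_strT f' (Kf g')). rewrite <- (sv_assoc HX), (ich HX) by bd. unfold kap_theta2. do 2 f_equal.
  unfold kap_theta. rewrite (fs_sv HF), tss_z by bd. unfold kap_strT. asr.
  assert (E1 : tss f' g' // fs F (bs B (sid f') (kap g' (ceta' C'')))
    = bs B (sid f') (fs F (kap g' (ceta' C''))) // tss f' (Kf g')).
  { symmetry. eapply tss_nat; [bd | exact Hk']. }
  rewrite (sv_rew2 HX E1) by bd. rewrite bs_sidl_sv by bd. asr. reflexivity.
Qed.
Lemma theta_hc A A' A'' C C' C'' (f : hor A A') (g : hor C C') (f' : hor A' A'') (g' : hor C' C'') :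
  tric f (Kf g) f' (Kf g') // (tris (sid (f *h f')) (kfc g g') (vid _) (vid _) // theta (f *h f') (g *h g'))
  = ks (theta f g) (theta f' g') (vid _) // (kfc (bh B f g) (bh B f' g') // Ks (bc B f g f' g') (vid _)).
Proof.
  assert (T1 : is_sq (theta f g) (trih f (Kf g)) (Kf (bh B f g)) (vid _) (fv F (vid _))) by bd.
  assert (T2 : is_sq (theta f' g') (trih f' (Kf g')) (Kf (bh B f' g')) (vid _) (fv F (vid _))) by bd.
  assert (T3 := ks_ty T1 T2). assert (T4 := kfc_sq (bh B f g) (bh B f' g')).
  assert (T5 : is_sq (bc B f g f' g') (bh B f g *h bh B f' g') (bh B (f *h f') (g *h g')) (vid _) (vid _)) by bd.
  assert (T6 := Ks_ty T5).
  assert (T7 : is_sq (kfc g g') (kh (Kf g) (Kf g')) (Kf (g *h g')) (vid _) (fv F (vid _))).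
  { eapply is_sq_cast; [exact (kfc_sq g g') | cells ..]. }
  assert (T8 := tris_ty (sid_ty HX (f *h f')) T7).
  destruct (kap_theta2_ty f g f' g') as [r HZ].
  assert (Hk := keta_ty g). change (g *h etah C') with (Kf g) in Hk.
  assert (Hk' := keta_ty g'). change (g' *h etah C'') with (Kf g') in Hk'.
  eapply kap_theta2_epi; [bd | bd |].
  rewrite <- (sv_assoc HX (a := ks _ _ _)) by bd.
  rewrite <- (sv_assoc HX (a := kap_theta2 _ _ _ _) (c := Ks _ _)), kap_theta2_theta, (keta_Ks T5) by bd.
  assert (HP := kap_tri_ty f (Kf g) f' (Kf g')).
  rewrite kap_theta2_tri, (sv_assoc HX), <- (sv_assoc HX (a := kap_tri _ _ _ _)), tric_char by bd. asr.
  rewrite <- (sv_assoc HX (a := kap_str _ _)), (kap_str_nat (sid_ty HX (f *h f')) T7) by bd. asr.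
  rewrite <- (sv_assoc HX (a := _ || _) (b := bc B _ _ _ _)) by bd.
  erewrite (bc_sq HB) by bd. asr. f_equal. rewrite <- (sid_hc HX).
  rewrite <- (sv_assoc HX (a := bs B _ _) (b := bs B _ (kap_kl _ _))), <- bs_sidl_sv by bd.
  rewrite <- (sv_assoc HX (a := bs B _ _) (b := bs B _ (kfc _ _))), <- bs_sidl_sv by bd.
  rewrite (sv_assoc HX (c := kfc g g')), kfc_char by bd.
  rewrite <- theta_char. unfold kap_theta. symmetry.
  assert (Hk'' := keta_ty (g *h g')). change (g *h g' *h etah C'') with (Kf (g *h g')) in Hk''.
  apply (sv_assoc HX); bd.
Qed.

(** * Verification of the icon and of the extension axioms *)

Let N := lift_monoidal cal cla crh.
Let ACT := induced_action cal cla crh cmu ceta ct.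
Let ICO := induced_icon cmu ceta ct.
Let SRC := ext_src ACT.
Let TGT := @ext_tgt X N S.
Let HXX := prod_pseudodouble HX HX.
Let HSRC : is_functor SRC := f_app2_ok HXX HX EK EK tri_functor_ok (f_fst_ok X HX)
  (f_comp_ok HXX HX EK (f_snd_ok X HX) K_functor).
Let HTGT : is_functor TGT := f_comp_ok HXX HX EK
  (f_app2_ok HXX HX HX HX HB (f_fst_ok X HX) (f_snd_ok X HX)) K_functor.
Lemma ico_ty A B (f : @hor (dbl_prod X X) A B) : is_giso (Defs.ich ICO f) (fh SRC f) (fh TGT f).
Proof. destruct A as [A C], B as [A' C'], f as [f g]. exact (kl_giso (theta_ty f g)). Qed.
Lemma ico_nat A B A' B' (s : @sq (dbl_prod X X) A B A' B') : wf s ->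
  fs SRC s // Defs.ich ICO (bot s) = Defs.ich ICO (top s) // fs TGT s.
Proof.
  destruct A as [A1 C1], B as [A2 C2], A' as [A3 C3], B' as [A4 C4], s as [a c].
  intros [H1 H2]. cbn in *.
  destruct (wf_sq H1) as (f & f' & u & u' & Ha), (wf_sq H2) as (g & g' & v & v' & Hc).
  change ((tris a (Ks c (rgt c)) (rgt a) (rgt c) // theta (bot a) (bot c), bv (ten M) (rgt a) (rgt c) *v vid _)
    = (theta (top a) (top c) // Ks (bs (ten M) a c) (rgt (bs (ten M) a c)), vid _ *v rgt (bs (ten M) a c))).
  assert (R : rgt (bs (ten M) a c) = bv (ten M) u' v') by bd. rewrite R.
  rewrite (rgt_of Ha), (rgt_of Hc), (top_of Ha), (top_of Hc), (bot_of Ha), (bot_of Hc).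
  f_equal; [|cells ..]. exact (theta_nat Ha Hc).
Qed.
Lemma ico_hc A1 A2 A3 (p : @hor (dbl_prod X X) A1 A2) (q : hor A2 A3) :
  fc SRC p q // Defs.ich ICO (p *h q) = (Defs.ich ICO p || Defs.ich ICO q) // fc TGT p q.
Proof.
  destruct A1 as [A C], A2 as [A' C'], A3 as [A'' C''], p as [f g], q as [f' g'].
  set (P := sid (f *h f')). set (Q := sid (g *h g')). set (R := bc (ten M) f g f' g' // bs (ten M) P Q).
  set (k1 := fst (@fc _ _ _ K C C' C'' g g')).
  set (k2 := fst (@fc _ _ _ K _ _ _ (bh (ten M) f g) (bh (ten M) f' g'))).
  change ((tric f (Kf g) f' (Kf g') // tris P (k1 // Ks Q (rgt Q)) (rgt P) (vid C'' *v rgt Q)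
      // theta (f *h f') (g *h g'), vid _ *v bv (ten M) (rgt P) (vid C'' *v rgt Q) *v vid _)
    = (ks (theta f g) (theta f' g') (vid _) // (k2 // Ks R (rgt R)), vid _ *v (vid _ *v rgt R))).
  assert (E1 : k1 = kfc g g') by (unfold k1; now rewrite fc_K).
  assert (E2 : k2 = kfc (bh (ten M) f g) (bh (ten M) f' g')) by (unfold k2; now rewrite fc_K).
  assert (E3 : R = bc (ten M) f g f' g').
  { unfold R, P, Q. rewrite (bs_sid HB). apply (sv_sid HX); bd. }
  assert (E4 : rgt (bc (ten M) f g f' g') = vid (A'' ⊗ C'')) by bd.
  unfold P, Q. rewrite E1, E2, E3, E4, !(rgt_of (sid_ty HX _)), Ks_sid.
  assert (T1 := kfc_sq g g'). cbn [fst snd]. apply (f_equal2 pair). all: swap 1 2. { cbn [vc vid kl]. cells. }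
  rewrite (sv_sid HX (a := kfc g g')), (vc_idl HX) by bd.
  refine (eq_trans _ (theta_hc f g f' g')).
  assert (T7 : is_sq (kfc g g') (kh (Kf g) (Kf g')) (Kf (g *h g')) (vid _) (fv F (vid _))).
  { eapply is_sq_cast; [exact (kfc_sq g g') | cells ..]. }
  assert (T8 := tris_ty (sid_ty HX (f *h f')) T7).
  apply (sv_assoc HX); bd.
Qed.
Lemma ico_hid A0 : fu SRC A0 // Defs.ich ICO (hid A0) = fu TGT A0.
Proof.
  destruct A0 as [A C].
  set (P := sid (hid A)). set (Q := sid (hid C)). set (R := bu (ten M) A C // bs (ten M) P Q).
  change ((ginv (zh A C) // tris P (sid (etah C) // Ks Q (rgt Q)) (rgt P) (vid C *v rgt Q)
      // theta (hid A) (hid C), vid _ *v bv (ten M) (rgt P) (vid C *v rgt Q) *v vid _)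
    = (sid (etah (A ⊗ C)) // Ks R (rgt R), vid _ *v rgt R)).
  assert (E3 : R = bu (ten M) A C).
  { unfold R, P, Q. rewrite (bs_sid HB). apply (sv_sid HX); bd. }
  assert (E4 : rgt (bu (ten M) A C) = vid (A ⊗ C)) by bd.
  assert (E5 : Kf (hid C) = etah C) by apply (hc_idl SX).
  unfold P, Q. rewrite E3, E4, !(rgt_of (sid_ty HX _)), Ks_sid, E5.
  assert (T1 : is_sq (bu (ten M) A C) (hid _) (bh (ten M) (hid A) (hid C)) (vid _) (vid _)) by bd.
  assert (T2 := Ks_ty T1). assert (E6 : Kf (hid (A ⊗ C)) = etah (A ⊗ C)) by apply (hc_idl SX).
  rewrite E6 in T2.
  cbn [fst snd]. apply (f_equal2 pair). all: swap 1 2. { cbn [vc vid kl]. cells. }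
  rewrite (sv_sid HX (a := sid (etah C))), (vc_idl HX), tris_sid by bd.
  rewrite (sid_sv HX (a := Ks _ _)), <- theta_hid by bd. rewrite (sv_sid HX (a := ginv _)) by bd. reflexivity.
Qed.
Lemma ico_ok : is_icon SRC TGT ICO.
Proof.
  refine (is_icon_of EK HSRC HTGT ico_ty _ _ ico_nat ico_hc ico_hid).
  - intros A A' u. reflexivity.
  - intros A A' u. reflexivity.
Qed.

Local Notation KC c := (c_fun K c).
Local Notation TC c d := (c_bifun Tri c d).
Lemma image_K A C (u : ver A C) (c : companion u) : is_companion c -> image_companion K c (KC c).
Proof. exact (image_c_fun HX EK K_functor (d := c)). Qed.
Lemma image_K_id A : image_companion K (c_id A) (@c_id (kl S) A).
Proof.
  split.
  - cok.
  - exact (eq_sym (hc_idl SX (etah A))).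
  - change ((sid (hid A) || eta_u (rgt (sid (hid A))), rgt (sid (hid A)))
      = (sid (etah A) // sid (etah A), vid A *v vid A)).
    rewrite (rgt_of (sid_ty HX _)), eta_u_vid, (hid_sh HX SX), (sid_sv HX), (vc_idl HX) by bd.
    reflexivity.
Qed.
Lemma image_ten (A A' C C' : ob X) (u : ver A A') (v : ver C C') (c : companion u) (d : companion v) :
  is_companion c -> is_companion d ->
  image_companion (f_app2 (ten M) (f_fst X X) (f_snd X X)) (c_pair c d) (c_bifun (ten M) c d).
Proof.
  intros Hc Hd. split.
  - cok.
  - reflexivity.
  - assert (T1 := ceps_ty Hc). assert (T2 := ceps_ty Hd).
    change (bs (ten M) (ceps c) (ceps d) = bs (ten M) (ceps c) (ceps d) // ginv (bu (ten M) A' C')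
      // (bu (ten M) A' C' // bs (ten M) (sid (hid A')) (sid (hid C')))).
    rewrite (bs_sid HB). asr. rewrite <- (sv_assoc HX (a := ginv _)) by bd. erewrite giso_l by gi.
    rewrite (sid_sv HX), (sv_sid HX); bd.
Qed.
Lemma image_tgt (A A' C C' : ob X) (u : ver A A') (v : ver C C') (c : companion u) (d : companion v) :
  is_companion c -> is_companion d ->
  image_companion TGT (c_pair c d) (KC (c_bifun (ten M) c d)).
Proof.
  intros Hc Hd. refine (image_comp HX EK _ K_functor (image_ten Hc Hd) (image_K _)); [fok | cok].
Qed.
(** Brings the components of the icon at companions under uniqueness, so that the axioms for [l],
    [m] and [p] become comparisons of lifts. *)
Lemma lifts_ico (A A' C C' : ob X) (u : ver A A') (v : ver C C') (c : companion u) (d : companion v)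
    (d' : @companion (kl S) C C' v) :
  is_companion c -> is_companion d -> image_companion K d d' ->
  lifts (KC (c_bifun (ten M) c d)) (TC c d') (thh (M := N) ICO (ch c) (ch d)).
Proof.
  intros Hc Hd Hi.
  refine (lifts_icon EK HSRC HTGT ico_ty ico_nat ico_hid (d := c_pair c d) _ _ _).
  - exact (pair_ok HX HX Hc Hd).
  - exact (image_app2_snd HX EK EK tri_functor_ok K_functor Hc Hd eq_refl Hi).
  - exact (image_tgt Hc Hd).
Qed.

Local Notation kal A C D := (cal (A, C, D)).
Lemma ok_K A C (u : ver A C) (c : companion u) : is_companion c -> is_companion (KC c).
Proof. exact (c_fun_ok HX EK K_functor (c := c)). Qed.
Lemma ok_T (A A' C C' : ob X) (u : ver A A') (v : ver C C') (c : companion u)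
    (d' : @companion (kl S) C C' v) : is_companion c -> is_companion d' -> is_companion (TC c d').
Proof. exact (c_bifun_ok HX EK EK tri_functor_ok (c := c) (d := d')). Qed.
Lemma kid_ok (A : ob X) : is_companion (@c_id (kl S) A). Proof. exact (c_id_ok EK A). Qed.
Lemma lifts_Kc A C D (u : ver A C) (v : ver C D) (c : companion u) (d : companion v) :
  is_companion c -> is_companion d ->
  lifts (KC (c_comp c d)) (c_comp (KC c) (KC d)) (fc K (ch c) (ch d)).
Proof. exact (lifts_fc HX EK K_functor (c := c) (d := d)). Qed.
Lemma lifts_Kc_inv A C D (u : ver A C) (v : ver C D) (c : companion u) (d : companion v) :
  is_companion c -> is_companion d ->
  lifts (c_comp (KC c) (KC d)) (KC (c_comp c d)) (ginv (fc K (ch c) (ch d))).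
Proof.
  intros Hc Hd. apply (lifts_sym EK).
  - apply ok_K. cok.
  - apply (c_comp_ok EK); now apply ok_K.
  - now apply lifts_Kc.
Qed.
Lemma lifts_Ks A C (u v : ver A C) (c : companion u) (d : companion v) s :
  is_companion c -> is_companion d -> lifts c d s -> lifts (KC c) (KC d) (fs K s).
Proof. exact (lifts_fs EK K_functor (c := c) (d := d) (s := s)). Qed.
Lemma ext_l_ok A C :
  thh (M := N) ICO (ch (cla A)) (hid C) // fs K (hl N A C)
    // ginv (fc K (ch (kal I A C)) (ch (cla (A ⊗ C)))) = tll ACT A C.
Proof.
  assert (H1 : is_companion (c_comp (KC (kal I A C)) (KC (cla (A ⊗ C))))).
  { apply (c_comp_ok EK); apply ok_K; auto. }
  assert (H2 : is_companion (TC (cla A) (@c_id (kl S) C))) by (apply ok_T; [auto | apply kid_ok]).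
  refine (lifts_unique EK (c := c_comp (KC (kal I A C)) (KC (cla (A ⊗ C))))
    (d := TC (cla A) (@c_id (kl S) C)) H1 _ _).
  - eapply (lifts_trans EK H1); [|apply lifts_Kc_inv; auto].
    eapply (lifts_trans EK (d := KC (c_bifun (ten M) (cla A) (c_id C)))).
    + apply ok_K. cok.
    + exact (lifts_ico (Hla A) (c_id_ok HX C) (image_K_id C)).
    + apply lifts_Ks; [cok | cok |]. apply (lift_eq_lifts HX); [cok | cok | apply al_l].
  - apply (lift_eq_lifts EK H1 H2). apply al_l.
Qed.
Lemma ext_m_ok A C :
  (sid (fh K (ch (kal A I C))) || thh (M := N) ICO (hid A) (ch (cla C)))
    // fc K (ch (kal A I C)) (tenL N A (ch (cla C))) // fs K (hm N A C)
    // ginv (thh (M := N) ICO (ch (crh A)) (hid C)) = tm ACT A C.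
Proof.
  set (Y := c_comp (KC (kal A I C)) (TC (c_id A) (KC (cla C)))).
  set (Z := TC (crh A) (@c_id (kl S) C)).
  assert (H1 : is_companion Z) by (apply ok_T; [auto | apply kid_ok]).
  assert (H3 : is_companion (c_bifun (ten M) (c_id A) (cla C))) by cok.
  assert (H2 : is_companion Y).
  { apply (c_comp_ok EK); [now apply ok_K | apply ok_T; [cok | now apply ok_K]]. }
  refine (lifts_unique EK (c := Z) (d := Y) H1 _ _).
  - eapply (lifts_trans EK H1 (d := KC (c_bifun (ten M) (crh A) (c_id C)))).
    2:{ apply (lifts_sym EK); [apply ok_K; cok | exact H1 |].
        exact (lifts_ico (Hrh A) (c_id_ok HX C) (image_K_id C)). }
    assert (H4 : is_companion (KC (c_bifun (ten M) (crh A) (c_id C)))) by (apply ok_K; cok).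
    eapply (lifts_trans EK H4 (d := KC (c_comp (kal A I C) (c_bifun (ten M) (c_id A) (cla C))))).
    2:{ apply lifts_Ks; [cok | cok |]. apply (lift_eq_lifts HX); [cok | cok | symmetry; apply al_m]. }
    refine (lifts_trans EK _ (d := c_comp (KC (kal A I C)) (KC (c_bifun (ten M) (c_id A) (cla C)))) _ _).
    + apply ok_K. cok.
    + refine (lifts_whl EK (c := KC (kal A I C)) _ _ _ _).
      * now apply ok_K.
      * now apply ok_K.
      * apply ok_T; [cok | now apply ok_K].
      * exact (lifts_ico (c_id_ok HX A) (Hla C) (image_K (Hla C))).
    + exact (lifts_Kc (Hal (A, I, C)) H3).
  - apply (lift_eq_lifts EK H1 H2). symmetry. apply al_m.
Qed.
Lemma ext_p_ok A C D E :
  (thh (M := N) ICO (ch (kal A C D)) (hid E) || sid (fh K (ch (kal A (C ⊗ D) E)))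
     || thh (M := N) ICO (hid A) (ch (kal C D E)))
    // (fc K (tenR N (ch (kal A C D)) E) (ch (kal A (C ⊗ D) E))
        || sid (fh K (tenL N A (ch (kal C D E)))))
    // fc K (tenR N (ch (kal A C D)) E *h ch (kal A (C ⊗ D) E)) (tenL N A (ch (kal C D E)))
    // fs K (hp N A C D E) // ginv (fc K (ch (kal (A ⊗ C) D E)) (ch (kal A C (D ⊗ E))))
  = tp ACT A C D E.
Proof.
  set (r := c_bifun (ten M) (kal A C D) (c_id E)). set (m := kal A (C ⊗ D) E).
  set (l := c_bifun (ten M) (c_id A) (kal C D E)).
  set (r' := TC (kal A C D) (@c_id (kl S) E)). set (l' := TC (c_id A) (KC (kal C D E))).
  set (x := kal (A ⊗ C) D E). set (y := kal A C (D ⊗ E)).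
  assert (Hr : is_companion r) by (unfold r; cok). assert (Hm : is_companion m) by apply Hal.
  assert (Hl : is_companion l) by (unfold l; cok).
  assert (Hx : is_companion x) by apply Hal. assert (Hy : is_companion y) by apply Hal.
  assert (Hr' : is_companion r') by (apply ok_T; [auto | apply kid_ok]).
  assert (Hl' : is_companion l') by (apply ok_T; [cok | apply ok_K; auto]).
  assert (Kr := ok_K Hr). assert (Km := ok_K Hm). assert (Kl := ok_K Hl).
  assert (Kx := ok_K Hx). assert (Ky := ok_K Hy).
  assert (Hrm : is_companion (c_comp r m)) by cok.
  assert (Krm := ok_K Hrm).
  assert (H1 : is_companion (c_comp (KC x) (KC y))) by now apply (c_comp_ok EK).
  assert (H2 : is_companion (c_comp (c_comp r' (KC m)) l')) by now repeat apply (c_comp_ok EK).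
  refine (lifts_unique EK (c := c_comp (KC x) (KC y)) (d := c_comp (c_comp r' (KC m)) l') H1 _ _).
  - eapply (lifts_trans EK H1); [|exact (lifts_Kc_inv Hx Hy)].
    eapply (lifts_trans EK (d := KC (c_comp (c_comp r m) l))).
    + apply ok_K. cok.
    + refine (lifts_trans EK _ (d := c_comp (KC (c_comp r m)) (KC l)) _ _).
      * apply ok_K. cok.
      * refine (lifts_trans EK _ (d := c_comp (c_comp (KC r) (KC m)) (KC l)) _ _).
        -- now apply (c_comp_ok EK).
        -- refine (lifts_sh EK _ _ _ _ _ _); [now apply (c_comp_ok EK) .. | exact Kl | exact Hl' | |].
           ++ refine (lifts_whr EK (c' := KC m) Kr Hr' Km _).
              exact (lifts_ico (Hal (A, C, D)) (c_id_ok HX E) (image_K_id E)).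
           ++ exact (lifts_ico (c_id_ok HX A) (Hal (C, D, E)) (image_K (Hal (C, D, E)))).
        -- refine (lifts_whr EK (c' := KC l) Krm _ Kl (lifts_Kc Hr Hm)). now apply (c_comp_ok EK).
      * exact (lifts_Kc Hrm Hl).
    + apply lifts_Ks; [cok | cok |]. apply (lift_eq_lifts HX); [cok | cok |].
      exact (mon_p HM A C D E).
  - apply (lift_eq_lifts EK H1 H2). exact (mon_p HM A C D E).
Qed.
Lemma ext_lam_ok A A' (f : hor A A') :
  (thh (M := N) ICO (unit_h (un M)) f || sid (fh K (ch (cla A'))))
    // fc K (bh (ten M) (unit_h (un M)) f) (ch (cla A'))
    // fs K (hth (hla N) f) // ginv (fc K (ch (cla A)) f)
  = hth (tl ACT) (fh K f).
Proof.
  assert (L1 := lift_lifts_h EK (c := act_cla cla ct) (fun C => ok_K (Hla C)) VL_vtrans).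
  assert (L2 := lt_post HX EK Hla (lift_lifts_h HX Hla (la_vtrans HM)) K_functor).
  assert (E1 := lt_hth L1 (fh K f)). assert (E2 := lt_hth L2 f).
  assert (T1 := lt_hth_ty L1 (fh K f)). assert (T2 := lt_hth_ty L2 f).
  assert (U1 := lt_vts_ty L1 (fh K f)). assert (U2 := lt_vts_ty L2 f).
  assert (Tth : is_glob (thh (M := N) ICO (unit_h (un M)) f) (trih u1 (Kf f)) (Kf (bh (ten M) u1 f)))
    by exact (giso_glob (kl_giso (theta_ty u1 f))).
  assert (Eq : thh (M := N) ICO (unit_h (un M)) f // fs K (vts (la M) f) = vts VL (fh K f) // sid (fh K f)).
  { assert (R : rgt (lass f) = lav A') by bd.
    change ((theta u1 f // Ks (lass f) (rgt (lass f)), vid _ *v rgt (lass f))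
      = (tri_la (Kf f) // sid (Kf f), lav A' *v vid A')).
    rewrite R, theta_la, (sv_sid HX) by bd. apply (f_equal2 pair); [reflexivity | cells]. }
  assert (Res := lifted_hth_transfer EK (ok_K (Hla A)) (ok_K (Hla A')) Tth
    (sid_ty EK (fh K f)) U1 U2 T1 T2 E1 E2 Eq).
  refine (eq_trans _ (eq_trans Res _)).
  - refine (sv_assoc4 EK (sh_ty EK Tth (sid_ty EK (fh K (ch (cla A')))))
      (giso_glob (fc_ty K_functor (bh (ten M) u1 f) (ch (cla A')))) (fs_ty K_functor (lt_hth_ty (lift_lifts_h HX Hla (la_vtrans HM)) f))
      (ginv_glob (fc_ty K_functor (ch (cla A)) f))).
  - refine (eq_trans (f_equal (sv _) (eq_sym (sid_hc EK _ _))) _).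
    exact (sv_sid EK (wf_of T1) (bot_of T1)).
Qed.
Lemma ext_al_ok A A' C C' D D' (f : hor A A') (g : hor C C') (h : hor D D') :
  (thh (M := N) ICO (bh (ten M) f g) h || sid (fh K (ch (kal A' C' D'))))
    // fc K (bh (ten M) (bh (ten M) f g) h) (ch (kal A' C' D'))
    // fs K (halh N f g h) // ginv (fc K (ch (kal A C D)) (bh (ten M) f (bh (ten M) g h)))
  = tah ACT f g (fh K h)
    // (sid (ta1 ACT A C D) || bs Tri (sid f) (thh (M := N) ICO g h))
    // (sid (ta1 ACT A C D) || thh (M := N) ICO f (bh (ten M) g h)).
Proof.
  assert (OK : forall x, is_companion (act_cal cal (cmu := cmu) (ceta := ceta) ct x))
    by (intros [[A1 A2] A3]; exact (ok_K (Hal (A1, A2, A3)))).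
  assert (L1 := lift_lifts_h EK OK VA_vtrans).
  assert (L0 := lift_lifts_h HX Hal (al_vtrans HM)).
  assert (L2 := lt_post HX EK Hal L0 K_functor).
  pose (x := (A, C, D)). pose (y := (A', C', D')).
  pose (p1 := (f, g, fh K h) : @hor (dbl_prod (dbl_prod X X) (kl S)) x y).
  pose (p2 := (f, g, h) : @hor (dbl_prod (dbl_prod X X) X) x y).
  assert (E1 := lt_hth L1 p1). assert (E2 := lt_hth L2 p2).
  assert (T1 := lt_hth_ty L1 p1). assert (T2 := lt_hth_ty L2 p2).
  assert (U1 := lt_vts_ty L1 p1). assert (U2 := lt_vts_ty L2 p2).
  assert (Tth : is_glob (thh (M := N) ICO (bh (ten M) f g) h) (trih (bh (ten M) f g) (Kf h))
    (Kf (bh (ten M) (bh (ten M) f g) h))) by exact (giso_glob (kl_giso (theta_ty (bh (ten M) f g) h))).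
  assert (Tgh : @is_glob (kl S) _ _ (thh (M := N) ICO g h) (trih g (Kf h)) (Kf (bh (ten M) g h)))
    by exact (giso_glob (kl_giso (theta_ty g h))).
  assert (Tw1 : is_glob (bs Tri (sid f) (thh (M := N) ICO g h)) (trih f (trih g (Kf h)))
    (trih f (Kf (bh (ten M) g h)))).
  { assert (H := bs_ty tri_functor_ok (sid_ty HX f) Tgh). rewrite !(bv_vid tri_functor_ok) in H. exact H. }
  assert (Tw2 : is_glob (thh (M := N) ICO f (bh (ten M) g h)) (trih f (Kf (bh (ten M) g h)))
    (Kf (bh (ten M) f (bh (ten M) g h)))) by exact (giso_glob (kl_giso (theta_ty f (bh (ten M) g h)))).
  (* The two icon cells on the right-hand side are merged into one globular cell, as
     [lifted_hth_transfer] has room for a single cell there; [theta_al] is the vertical equation it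
     needs. *)
  pose (w := bs Tri (sid f) (thh (M := N) ICO g h) // thh (M := N) ICO f (bh (ten M) g h)).
  assert (Tw : is_glob w (trih f (trih g (Kf h))) (Kf (bh (ten M) f (bh (ten M) g h)))).
  { assert (H := sv_ty EK Tw1 Tw2). rewrite !(vc_idl EK) in H. exact H. }
  assert (Eq : thh (M := N) ICO (bh (ten M) f g) h // fs K (vts (al M) p2) = vts VA p1 // w).
  { assert (R : rgt (alss f g h) = alv A' C' D') by bd.
    change ((theta (bh (ten M) f g) h // Ks (alss f g h) (rgt (alss f g h)), vid _ *v rgt (alss f g h))
      = (tri_al f g (Kf h) // (tris (sid f) (theta g h) (rgt (sid f)) (vid (C' ⊗ D')) // theta f (bh (ten M) g h)),
         alv A' C' D' *v (bv (ten M) (rgt (sid f)) (vid (C' ⊗ D')) *v vid _))).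
    rewrite R, (rgt_of (sid_ty HX f)), theta_al. apply (f_equal2 pair); [reflexivity | cells]. }
  assert (Res := lifted_hth_transfer EK (OK x) (OK y) Tth Tw U1 U2 T1 T2 E1 E2 Eq).
  refine (eq_trans _ (eq_trans Res _)).
  - exact (sv_assoc4 EK (sh_ty EK Tth (sid_ty EK (fh K (ch (kal A' C' D')))))
      (giso_glob (fc_ty K_functor (bh (ten M) (bh (ten M) f g) h) (ch (kal A' C' D'))))
      (fs_ty K_functor (lt_hth_ty L0 p2))
      (ginv_glob (fc_ty K_functor (ch (kal A C D)) (bh (ten M) f (bh (ten M) g h))))).
  - symmetry. exact (whl_sv_right EK T1 Tw1 Tw2).
Qed.
Theorem induced_extension : @is_horizontal_extension X N S ACT ICO.
Proof.
  split.
  - exact (lifted_is_hmonoidal HX HM Hal Hla Hrh Eal Ela Erh).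
  - exact HS.
  - exact EK.
  - exact induced_haction.
  - exact ico_ok.
  - reflexivity.
  - reflexivity.
  - intros A C.
    assert (R : rgt (bu (ten M) A C) = vid (A ⊗ C)) by bd.
    change ((ginv (zh A C) // theta (hid A) (hid C), vid _ *v vid _)
      = (Ks (bu (ten M) A C) (rgt (bu (ten M) A C)), rgt (bu (ten M) A C))).
    rewrite R. apply (f_equal2 pair); [apply theta_hid | cells].
  - intros A C. exact (ext_l_ok A C).
  - intros A C. exact (ext_m_ok A C).
  - intros A C D E. exact (ext_p_ok A C D E).
  - intros A A' f. exact (ext_lam_ok f).
  - intros A A' C C' D D' f g h. exact (ext_al_ok f g h).
Qed.

End Kleisli.

Theorem theorem10p26 (X : double_category) (M : monoidal_double_category X)
    (T : vertical_double_monad X)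
    (Lal : liftable (al M)) (Lla : liftable (la M)) (Lrh : liftable (rh M))
    (Lal_inv : inverse_liftable (al M)) (Lla_inv : inverse_liftable (la M))
    (Lrh_inv : inverse_liftable (rh M))
    (Lmu : liftable (vmu T)) (Leta : liftable (veta T))
    (mu_inv : invertible (vmu T)) (eta_inv : invertible (veta T))
    (t : left_vertical_strength M T) (Lt : liftable (lvs_data t))
    (t_inv : invertible (lvs_data t)) :
  @is_horizontal_extension X
    (lift_monoidal Lal Lla Lrh)
    (lift_monad Lmu Leta)
    (induced_action Lal Lla Lrh Lmu Leta Lt)
    (induced_icon Lmu Leta Lt).

Proof.
  assert (HX := dc_pseudo X). assert (SX := dc_strict X).
  refine (induced_extension HX SX (vdm_laws T) (lift_ok Lmu) (lift_ok Leta) mu_inv eta_inv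
    (mdc_laws M) (lvs_laws t) (lift_ok Lt) t_inv (lift_ok Lal) (lift_ok Lla) (lift_ok Lrh) _ _ _).
  (* The companions of the inverse 1v-cells make the lifted constraints equivalences, as the
     definition of a horizontal action demands. *)
  - exact (liftable_hequiv HX Lal Lal_inv).
  - exact (liftable_hequiv HX Lla Lla_inv).
  - exact (liftable_hequiv HX Lrh Lrh_inv).
Qed.
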